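(* Let $L/K$ be a finite, separable, and purely wild extension. Then the motivic Zeta function $Z_{\mathrm{Res}_{L/K}\mathbf{G}_m}(z)$ is a rational function. More precisely, it is contained in the subring $$K_0(\mathrm{Var}_k)\Big[z, \frac{1}{1-\mathbf{L}^az^b}\Big]_{(a,b)\in \mathbf{Z}\times\mathbf{Z}_{>0}\colon a/b=c_{tame}(\mathrm{Res}_{L/K}\mathbf{G}_m)}\subseteq K_0(\mathrm{Var}_k)[\![z]\!].$$ The function $Z_{\mathrm{Res}_{L/K}\mathbf{G}_m}(\mathbf{L}^{-s})$ has a unique pole at $s=c_{tame}(\mathrm{Res}_{L/K}\mathbf{G}_m)$, of order $1$.
   Context: $K$ is a complete discretely valued field whose ring of integers $\mathcal{O}_K$ is strictly Henselian, with algebraically closed residue field $k$ of characteristic $p>0$. A finite extension of $K$ is purely wild if its degree is a power of $p$. For a positive integer $d$ prime to $p$, $K(d)$ denotes the unique extension of $K$ of degree $d$, $\mathcal{O}_{K(d)}$ its ring of integers and $\mathfrak{m}_d$ the maximal ideal of $\mathcal{O}_{K(d)}$. A Néron lft-model is a smooth separated model, locally of finite type, satisfying the Néron mapping property. Let $B$ be a semiabelian variety over $K$ of dimension $g$ (tori are included), $\mathscr{B}$ its Néron lft-model over $\mathcal{O}_K$, and $\mathscr{B}(d)$ the Néron lft-model of $B\times_K \mathrm{Spec}\, K(d)$ over $\mathcal{O}_{K(d)}$. The canonical base change morphism induces $\psi_d\colon \mathrm{Lie}(\mathscr{B})\otimes_{\mathcal{O}_K}\mathcal{O}_{K(d)}\to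 \mathrm{Lie}(\mathscr{B}(d))$, and $\mathrm{coker}\,\psi_d\cong\bigoplus_{i=1}^g \mathcal{O}_{K(d)}/\mathfrak{m}_d^{j_{d,i}}$ with integers $0\le j_{d,1}\leq\dots\leq j_{d,g}$. Put $\mathrm{ord}_B(d):=\sum_{i=1}^g j_{d,i}$. Choose a tower $K\subseteq K(d_1)\subseteq K(d_2)\subseteq\cdots$ cofinal in the set of all finite tame extensions of $K$; the jumps of $B$ are $j_i:=\lim_{n\to\infty} j_{d_n,i}/d_n$ (the limits exist and are independent of the tower), and $c_{tame}(B):=\sum_{i=1}^g j_i$. $K_0(\mathrm{Var}_k)$ is the Grothendieck ring of varieties over $k$, $[X]$ the class of $X$, and $\mathbf{L}=[\mathbf{A}^1_k]$. Let $\mathscr{B}(d)^{\mathrm{qc}}$ be the maximal quasi-compact open subgroup scheme of $\mathscr{B}(d)$ and $\mathscr{B}(d)^{\mathrm{qc}}_k$ its special fibre. The motivic Zeta function of $B$ is $$Z_B(z):=\sum_{d\geq 1,\ p\nmid d} [\mathscr{B}(d)_k^{\mathrm{qc}}]\,\mathbf{L}^{\mathrm{ord}_B(d)}z^d\in K_0(\mathrm{Var}_k)[\![z]\!].$$ Poles: $Z(\mathbf{L}^{-s})$ means $Z(z)$ with $z=\mathbf{L}^{-s}$ as a formal variable, so that $1-\mathbf{L}^az^b$ corresponds to $s=a/b$. For a rational number $s_0$ and integer $m\ge 0$, $Z(\mathbf{L}^{-s})$ has a pole of order at most $m$ at $s_0$ if $Z(z)$ is a $K_0(\mathrm{Var}_k)[z]$-linear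 combination of finitely many terms $\prod_{(a,b)\in M}(1-\mathbf{L}^az^b)^{-1}$, with each $M$ a finite multiset of pairs in $\mathbf{Z}_{\geq 0}\times\mathbf{Z}_{>0}$ containing at most $m$ elements (counted with multiplicity) with $a/b=s_0$. The pole has order $m\geq 1$ if it has order at most $m$ but not at most $m-1$; $s_0$ is a pole if it is not of order at most $0$. *)

(* Defs.v *)
From HB Require Import structures.
From mathcomp Require Import all_boot all_order all_algebra all_field.
From mathcomp Require Import boolp classical_sets functions reals.
From mathcomp Require Import topology normedtype sequences.

Set Implicit Arguments.
Unset Strict Implicit.
Unset Printing Implicit Defensive.

Import Order.TTheory GRing.Theory Num.Theory.
Import numFieldNormedType.Exports.

Local Open Scope ring_scope.

(* Schemes over [R] are treated by their functors of points on commutative  *)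
(* [R]-algebras (Demazure-Gabriel): a scheme is a Zariski sheaf with an     *)
(* open cover by affine schemes.  Test algebras may be the zero ring, hence *)
(* [comPzRingType] and not [comAlgType].                                    *)

Record algebra (R : comPzRingType) := Algebra {
  alg_sort :> comPzRingType;
  alg_in : {rmorphism R -> alg_sort} }.

Record alghom (R : comPzRingType) (A B : algebra R) := AlgHom {
  hom_fun :> {rmorphism A -> B};
  hom_in : forall r, hom_fun (alg_in A r) = alg_in B r }.

Definition self_alg (R : comPzRingType) : algebra R :=
  @Algebra R R (idfun : {rmorphism R -> R}).

Definition restr (R S : comPzRingType) (phi : {rmorphism R -> S})
    (A : algebra S) : algebra R :=
  @Algebra R A (alg_in A \o phi : {rmorphism R -> A}).

Fact restr_hom_in (R S : comPzRingType) (phi : {rmorphism R -> S})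
    (A B : algebra S) (f : alghom A B) (r : R) :
  f (alg_in (restr phi A) r) = alg_in (restr phi B) r.
Proof. exact: hom_in. Qed.

Definition restr_hom (R S : comPzRingType) (phi : {rmorphism R -> S})
    (A B : algebra S) (f : alghom A B) : alghom (restr phi A) (restr phi B) :=
  @AlgHom R (restr phi A) (restr phi B) f (restr_hom_in phi f).

Record presheaf (R : comPzRingType) := Presheaf {
  pt :> algebra R -> Type;
  pmap : forall A B : algebra R, alghom A B -> pt A -> pt B;
  pmap_id : forall (A : algebra R) (f : alghom A A) (x : pt A),
    f =1 id -> pmap f x = x;
  pmap_comp : forall (A B C : algebra R) (f : alghom A B) (g : alghom B C)
      (h : alghom A C) (x : pt A),
    h =1 g \o f -> pmap h x = pmap g (pmap f x) }.

Record morphism (R : comPzRingType) (X Y : presheaf R) := Morphism {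
  mor :> forall A, X A -> Y A;
  mor_map : forall (A B : algebra R) (f : alghom A B) (x : X A),
    mor (pmap f x) = pmap f (mor x) }.
Arguments mor {R X Y} _ A _.

Definition isomorphic (R : comPzRingType) (X Y : presheaf R) : Prop :=
  exists f : morphism X Y, forall A, bijective (f A).

Definition base_change (R S : comPzRingType) (phi : {rmorphism R -> S})
    (X : presheaf R) : presheaf S :=
  @Presheaf S (fun A => X (restr phi A))
    (fun A B f => pmap (restr_hom phi f))
    (fun A f => @pmap_id R X (restr phi A) (restr_hom phi f))
    (fun A B C f g h => @pmap_comp R X (restr phi A) (restr phi B)
       (restr phi C) (restr_hom phi f) (restr_hom phi g) (restr_hom phi h)).

Definition point (R : comPzRingType) : presheaf R :=
  @Presheaf R (fun=> unit) (fun _ _ _ => id) (fun _ _ _ _ => erefl)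
    (fun _ _ _ _ _ _ _ _ => erefl).

Definition affine_line (R : comPzRingType) : presheaf R :=
  @Presheaf R (fun A => A) (fun A B f => f) (fun _ _ x e => e x)
    (fun _ _ _ _ _ _ x e => e x).

Section Product.
Variables (R : comPzRingType) (X Y : presheaf R).
Definition prod_map (A B : algebra R) (f : alghom A B) (x : X A * Y A) :=
  (pmap f x.1, pmap f x.2).
Fact prod_map_id (A : algebra R) (f : alghom A A) (x : X A * Y A) :
  f =1 id -> prod_map f x = x.
Proof. by case: x => x y e; rewrite /prod_map !pmap_id. Qed.
Fact prod_map_comp (A B C : algebra R) (f : alghom A B) (g : alghom B C)
    (h : alghom A C) (x : X A * Y A) :
  h =1 g \o f -> prod_map h x = prod_map g (prod_map f x).
Proof. by move=> e; rewrite /prod_map /= !(pmap_comp _ e). Qed.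
Definition prod_presheaf : presheaf R := Presheaf prod_map_id prod_map_comp.
End Product.

Record subfunctor (R : comPzRingType) (X : presheaf R) := Subfunctor {
  sf :> forall A, X A -> Prop;
  sf_map : forall (A B : algebra R) (f : alghom A B) (x : X A),
    sf x -> sf (pmap f x) }.
Arguments sf {R X} _ A _.

Section SubPresheaf.
Variables (R : comPzRingType) (X : presheaf R) (U : subfunctor X).
Definition sub_map (A B : algebra R) (f : alghom A B) (x : {x | U A x}) :
  {x | U B x} := exist _ (pmap f (sval x)) (sf_map f (svalP x)).
Fact sub_map_id (A : algebra R) (f : alghom A A) (x : {x | U A x}) :
  f =1 id -> sub_map f x = x.
Proof. by case: x => x xU e; apply: eq_exist; rewrite /= pmap_id. Qed.
Fact sub_map_comp (A B C : algebra R) (f : alghom A B) (g : alghom B C)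
    (h : alghom A C) (x : {x | U A x}) :
  h =1 g \o f -> sub_map h x = sub_map g (sub_map f x).
Proof. by case: x => x xU e; apply: eq_exist; rewrite /= (pmap_comp _ e). Qed.
Definition sub_presheaf : presheaf R := Presheaf sub_map_id sub_map_comp.
End SubPresheaf.

(* [f(S)] generates the unit ideal of [B] *)
Definition gen_unit_ideal (R : comPzRingType) (A B : algebra R)
    (f : alghom A B) (S : A -> Prop) : Prop :=
  exists n (b : 'I_n -> B) (s : 'I_n -> A),
    (forall i, S (s i)) /\ \sum_(i < n) b i * f (s i) = 1.

(* The pullback of [U] along every [x : Spec A -> X] is the open subscheme  *)
(* of [Spec A] where some element of [S] does not vanish.                   *)
Definition is_open (R : comPzRingType) (X : presheaf R) (U : subfunctor X) :=
  forall (A : algebra R) (x : X A), exists S : A -> Prop,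
    forall (B : algebra R) (f : alghom A B),
      U B (pmap f x) <-> gen_unit_ideal f S.

(* [Z] is a closed subscheme of [X], and [U] its open complement *)
Definition complementary (R : comPzRingType) (X : presheaf R)
    (Z U : subfunctor X) :=
  forall (A : algebra R) (x : X A), exists S : A -> Prop,
    forall (B : algebra R) (f : alghom A B),
      (Z B (pmap f x) <-> forall s, S s -> f s = 0) /\
      (U B (pmap f x) <-> gen_unit_ideal f S).

(* [U] is isomorphic to [Spec A], with universal point [u] *)
Definition represented (R : comPzRingType) (X : presheaf R)
    (U : subfunctor X) (A : algebra R) :=
  exists u : X A, forall (B : algebra R),
    (forall y : X B, U B y <-> exists f : alghom A B, pmap f u = y) /\
    (forall f g : alghom A B, pmap f u = pmap g u -> f =1 g).

(* By Demazure-Gabriel, a family of open subschemes covers if it does so on *)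
(* field-valued points.                                                     *)
Definition affine_cover (R : comPzRingType) (X : presheaf R) (I : Type)
    (P : algebra R -> Prop) :=
  exists U : I -> subfunctor X,
    (forall i, is_open (U i) /\ exists2 A, P A & represented (U i) A) /\
    (forall (F : fieldType) (s : {rmorphism R -> F}) (x : X (Algebra s)),
       exists i, U i _ x).

Definition is_localization (R : comPzRingType) (A B : algebra R)
    (l : alghom A B) (f : A) :=
  [/\ exists y, l f * y = 1,
      forall a, l a = 0 -> exists m, f ^+ m * a = 0 &
      forall b, exists m a, l f ^+ m * b = l a].

Definition zariski_sheaf (R : comPzRingType) (X : presheaf R) :=
  forall (A : algebra R) (n : nat) (f c : 'I_n -> A),
    \sum_(i < n) c i * f i = 1 ->
  forall (B : 'I_n -> algebra R) (l : forall i, alghom A (B i)),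
    (forall i, is_localization (l i) (f i)) ->
  forall x : forall i, X (B i),
    (* agreement on [A_(f i * f j)], which is the pushout of [B i], [B j] *)
    (forall i j (C : algebra R) (g : alghom (B i) C) (h : alghom (B j) C),
       g \o l i =1 h \o l j -> pmap g (x i) = pmap h (x j)) ->
  exists! y : X A, forall i, pmap (l i) y = x i.

Definition separated (R : comPzRingType) (X : presheaf R) :=
  forall (A : algebra R) (x y : X A), exists S : A -> Prop,
    forall (B : algebra R) (f : alghom A B),
      pmap f x = pmap f y <-> forall s, S s -> f s = 0.

(* polynomials in [n] variables, as expressions *)
Inductive pexpr (R : Type) (n : nat) : Type :=
  | PConst of R | PVar of 'I_n
  | PAdd of pexpr R n & pexpr R n | PMul of pexpr R n & pexpr R n.

Fixpoint peval (R : comPzRingType) (n : nat) (A : algebra R) (a : 'I_n -> A)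
    (e : pexpr R n) : A :=
  match e with
  | PConst r => alg_in A r
  | PVar i => a i
  | PAdd e1 e2 => peval a e1 + peval a e2
  | PMul e1 e2 => peval a e1 * peval a e2
  end.

(* [A = R[x_1, ..., x_n] / (rels)], the class of [x_i] being [a i] *)
Definition presents (R : comPzRingType) (n : nat) (A : algebra R)
    (a : 'I_n -> A) (rels : pexpr R n -> Prop) :=
  (forall e, rels e -> peval a e = 0) /\
  forall (B : algebra R) (b : 'I_n -> B), (forall e, rels e -> peval b e = 0) ->
    (exists f : alghom A B, forall i, f (a i) = b i) /\
    (forall f g : alghom A B, (forall i, f (a i) = g (a i)) -> f =1 g).

Definition finite_type (R : comPzRingType) (A : algebra R) :=
  exists n (a : 'I_n -> A) (rels : pexpr R n -> Prop), presents a rels.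

Definition finitely_presented (R : comPzRingType) (A : algebra R) :=
  exists n (a : 'I_n -> A) m (rels : 'I_m -> pexpr R n),
    presents a (fun e => exists i, rels i = e).

Definition quasi_compact (R : comPzRingType) (X : presheaf R) :=
  exists n, affine_cover X 'I_n (fun=> True).

Definition formally_smooth (R : comPzRingType) (X : presheaf R) :=
  forall (A B : algebra R) (f : alghom A B),
    (forall b, exists a, f a = b) ->
    (exists n, forall a : 'I_n -> A,
       (forall i, f (a i) = 0) -> \prod_(i < n) a i = 0) ->
  forall y : X B, exists x : X A, pmap f x = y.

Definition smooth_scheme (R : comPzRingType) (X : presheaf R) :=
  [/\ zariski_sheaf X,
      exists I : Type, affine_cover X I (@finitely_presented R) &
      formally_smooth X].

(* separated schemes of finite type *)
Definition variety (k : comPzRingType) (X : presheaf k) :=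
  [/\ zariski_sheaf X, separated X &
      exists n, affine_cover X 'I_n (@finite_type k)].

Definition additive_invariant (k : comPzRingType) (M : zmodType)
    (mu : presheaf k -> M) :=
  (forall X Y, variety X -> variety Y -> isomorphic X Y -> mu X = mu Y) /\
  (forall X (Z U : subfunctor X), variety X -> complementary Z U ->
     mu X = mu (sub_presheaf Z) + mu (sub_presheaf U)).

(* [K0] is the abelian group generated by the [cl X], [X] a variety, with   *)
(* the isomorphism and scissor relations, multiplied through products.      *)
(* It is specified and not constructed: presheaves form a type too large to *)
(* carry a [zmodType].  The values of [cl] outside varieties are irrelevant.*)
Record grothendieck_ring (k K0 : comPzRingType) (cl : presheaf k -> K0) :
    Prop := GrothendieckRing {
  gr_inv : additive_invariant cl;
  gr_univ : forall (M : zmodType) (mu : presheaf k -> M),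
    additive_invariant mu ->
    (exists phi : {additive K0 -> M},
       forall X, variety X -> phi (cl X) = mu X) /\
    (forall phi phi' : {additive K0 -> M},
       (forall X, variety X -> phi (cl X) = phi' (cl X)) -> phi =1 phi');
  gr_one : cl (point k) = 1;
  gr_mul : forall X Y, variety X -> variety Y ->
    cl (prod_presheaf X Y) = cl X * cl Y }.

Record group_functor (R : comPzRingType) := GroupFunctor {
  gsp :> presheaf R;
  gone : forall A, gsp A;
  gmul : forall A, gsp A -> gsp A -> gsp A;
  ginv : forall A, gsp A -> gsp A;
  gmulA : forall A, associative (@gmul A);
  gmul1 : forall A, left_id (gone A) (@gmul A);
  gmulV : forall A, left_inverse (gone A) (@ginv A) (@gmul A);
  gmul_map : forall (A B : algebra R) (f : alghom A B) (x y : gsp A),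
    pmap f (gmul x y) = gmul (pmap f x) (pmap f y) }.
Arguments gone {R} _ A.

Definition gbase_change (R S : comPzRingType) (phi : {rmorphism R -> S})
    (G : group_functor R) : group_functor S :=
  @GroupFunctor S (base_change phi G) (fun A => gone G (restr phi A))
    (fun A => @gmul R G (restr phi A)) (fun A => @ginv R G (restr phi A))
    (fun A => @gmulA R G (restr phi A)) (fun A => @gmul1 R G (restr phi A))
    (fun A => @gmulV R G (restr phi A))
    (fun A B f => @gmul_map R G _ _ (restr_hom phi f)).

Definition open_subgroup (R : comPzRingType) (G : group_functor R)
    (U : subfunctor G) :=
  [/\ is_open U, forall A, U A (gone G A),
      forall A x y, U A x -> U A y -> U A (gmul x y) &
      forall A x, U A x -> U A (ginv x)].

Definition max_qc_subgroup (R : comPzRingType) (G : group_functor R)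
    (U : subfunctor G) :=
  [/\ open_subgroup U, quasi_compact (sub_presheaf U) &
      forall V : subfunctor G, open_subgroup V ->
        quasi_compact (sub_presheaf V) -> forall A x, V A x -> U A x].

Section Gm.
Variable R : comPzRingType.
Definition unit_pair (A : algebra R) := {u : A * A | u.1 * u.2 == 1}.

Fact unit_pair_inj (A : algebra R) (u w : unit_pair A) :
  sval u = sval w -> u = w.
Proof. exact: val_inj. Qed.

Fact gm_map_subproof (A B : algebra R) (f : alghom A B) (u : unit_pair A) :
  f (sval u).1 * f (sval u).2 == 1.
Proof. by rewrite -rmorphM (eqP (svalP u)) rmorph1. Qed.
Definition gm_map (A B : algebra R) (f : alghom A B) (u : unit_pair A) :
    unit_pair B :=
  exist (fun u : B * B => u.1 * u.2 == 1) (f (sval u).1, f (sval u).2)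
    (gm_map_subproof f u).

Fact gm_map_id (A : algebra R) (f : alghom A A) (u : unit_pair A) :
  f =1 id -> gm_map f u = u.
Proof. by move=> e; apply: unit_pair_inj; rewrite /= !e; case: (sval u). Qed.
Fact gm_map_comp (A B C : algebra R) (f : alghom A B) (g : alghom B C)
    (h : alghom A C) (u : unit_pair A) :
  h =1 g \o f -> gm_map h u = gm_map g (gm_map f u).
Proof. by move=> e; apply: unit_pair_inj; rewrite /= !e. Qed.
Definition Gm_presheaf : presheaf R := Presheaf gm_map_id gm_map_comp.

Fact gm_one_subproof (A : algebra R) : 1 * 1 == 1 :> A.
Proof. by rewrite mulr1. Qed.
Definition gm_one (A : algebra R) : unit_pair A :=
  exist (fun u : A * A => u.1 * u.2 == 1) (1, 1) (gm_one_subproof A).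

Fact gm_mul_subproof (A : algebra R) (u w : unit_pair A) :
  (sval u).1 * (sval w).1 * ((sval u).2 * (sval w).2) == 1.
Proof. by rewrite mulrACA (eqP (svalP u)) (eqP (svalP w)) mulr1. Qed.
Definition gm_mul (A : algebra R) (u w : unit_pair A) : unit_pair A :=
  exist (fun u : A * A => u.1 * u.2 == 1)
    ((sval u).1 * (sval w).1, (sval u).2 * (sval w).2) (gm_mul_subproof u w).

Fact gm_inv_subproof (A : algebra R) (u : unit_pair A) :
  (sval u).2 * (sval u).1 == 1.
Proof. by rewrite mulrC; exact: (svalP u). Qed.
Definition gm_inv (A : algebra R) (u : unit_pair A) : unit_pair A :=
  exist (fun u : A * A => u.1 * u.2 == 1) ((sval u).2, (sval u).1)
    (gm_inv_subproof u).

Fact gm_mulA (A : algebra R) : associative (@gm_mul A).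
Proof. by move=> u w t; apply: unit_pair_inj; rewrite /= !mulrA. Qed.
Fact gm_mul1 (A : algebra R) : left_id (gm_one A) (@gm_mul A).
Proof. by move=> u; apply: unit_pair_inj; rewrite /= !mul1r; case: (sval u). Qed.
Fact gm_mulV (A : algebra R) : left_inverse (gm_one A) (@gm_inv A) (@gm_mul A).
Proof.
move=> [[a b] /= ab]; apply: unit_pair_inj; rewrite /= [b * a]mulrC.
by rewrite (eqP ab).
Qed.
Fact gm_mul_map (A B : algebra R) (f : alghom A B) (u w : unit_pair A) :
  gm_map f (gm_mul u w) = gm_mul (gm_map f u) (gm_map f w).
Proof. by apply: unit_pair_inj; rewrite /= !rmorphM. Qed.

Definition Gm : group_functor R :=
  @GroupFunctor R Gm_presheaf gm_one gm_mul gm_inv gm_mulA gm_mul1 gm_mulV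
    gm_mul_map.
End Gm.

(* [A (x)_K L] for a finite extension [L / K]: coordinate vectors in the    *)
(* [A]-basis [1 (x) (vbasis {:L})`_i], multiplied by structure constants.   *)
Section Tensor.
Variables (K : fieldType) (L : fieldExtType K) (A : algebra K).
Local Notation n := (\dim {:L}).
Local Notation b := (vbasis {:L}).

Definition tensor_sort : Type := 'rV[A]_n.
HB.instance Definition _ := GRing.Zmodule.on tensor_sort.

Definition struct_const (i j l : 'I_n) : K := coord b l (b`_i * b`_j).
Local Notation c i j l := (alg_in A (struct_const i j l)).

Definition tensor_in (x : L) : tensor_sort :=
  \row_l alg_in A (coord b l x).
Definition tensor_mul (x y : tensor_sort) : tensor_sort :=
  \row_l \sum_i \sum_j x 0 i * y 0 j * c i j l.

Lemma coord_mul (x y : L) (l : 'I_n) :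
  coord b l (x * y) =
    \sum_i \sum_j coord b i x * coord b j y * struct_const i j l.
Proof.
rewrite [x in LHS](coord_vbasis (memvf x)) [y in LHS](coord_vbasis (memvf y)).
rewrite mulr_suml linear_sum /=; apply: eq_bigr => i _.
rewrite mulr_sumr linear_sum /=; apply: eq_bigr => j _.
by rewrite -scalerAl -scalerAr scalerA linearZ.
Qed.

Lemma struct_constA (i j k l : 'I_n) :
  \sum_m struct_const i j m * struct_const m k l =
  \sum_m struct_const j k m * struct_const i m l.
Proof.
transitivity (coord b l (b`_i * b`_j * b`_k)).
  rewrite [X in X * b`_k](coord_vbasis (memvf _)) mulr_suml linear_sum /=.
  by apply: eq_bigr => m _; rewrite -scalerAl linearZ.
rewrite -mulrA [X in b`_i * X](coord_vbasis (memvf _)) mulr_sumr linear_sum /=.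
by apply: eq_bigr => m _; rewrite -scalerAr linearZ.
Qed.

Fact tensor_mulC : commutative tensor_mul.
Proof.
move=> x y; apply/rowP => l; rewrite !mxE exchange_big /=.
apply: eq_bigr => i _; apply: eq_bigr => j _.
by rewrite /struct_const [x _ _ * _]mulrC [b`_j * _]mulrC.
Qed.

Fact tensor_mulDl : left_distributive tensor_mul +%R.
Proof.
move=> x y z; apply/rowP => l; rewrite !mxE -big_split /=.
apply: eq_bigr => i _; rewrite -big_split /=; apply: eq_bigr => j _.
by rewrite !mxE !mulrDl.
Qed.

Fact tensor_mulA : associative tensor_mul.
Proof.
move=> x y z; apply/rowP => l.
transitivity (\sum_i \sum_j \sum_k x 0 i * y 0 j * z 0 k *
   alg_in A (\sum_m struct_const j k m * struct_const i m l)); last first.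
  rewrite mxE; under [RHS]eq_bigr => m _ do under eq_bigr => k _ do
    (rewrite mxE !mulr_suml; under eq_bigr => i _ do rewrite !mulr_suml).
  under [RHS]eq_bigr => m _ do rewrite exchange_big /=.
  rewrite [RHS]exchange_big /=; apply: eq_bigr => i _.
  under [RHS]eq_bigr => m _ do rewrite exchange_big /=.
  rewrite [RHS]exchange_big /=; apply: eq_bigr => j _.
  rewrite [RHS]exchange_big /=; apply: eq_bigr => k _.
  rewrite -struct_constA rmorph_sum mulr_sumr; apply: eq_bigr => m _.
  by rewrite rmorphM /= -!mulrA; congr (_ * (_ * _)); rewrite mulrCA.
rewrite mxE; apply: eq_bigr => i _.
under eq_bigr => m _ do
  (rewrite mxE mulr_sumr mulr_suml; under eq_bigr => j _ do
     rewrite mulr_sumr mulr_suml).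
rewrite exchange_big /=; apply: eq_bigr => j _.
rewrite exchange_big /=; apply: eq_bigr => k _.
rewrite rmorph_sum mulr_sumr; apply: eq_bigr => m _.
by rewrite rmorphM /= -!mulrA.
Qed.

Fact tensor_mul1 : left_id (tensor_in 1) tensor_mul.
Proof.
move=> x; apply/rowP => l; rewrite mxE exchange_big /=.
transitivity (\sum_j x 0 j * alg_in A (coord b l (1 * b`_j))).
  apply: eq_bigr => j _.
  rewrite [X in X * b`_j](coord_vbasis (memvf _)) mulr_suml linear_sum /=.
  rewrite rmorph_sum mulr_sumr; apply: eq_bigr => i _.
  rewrite -scalerAl linearZ /= mxE rmorphM /= mulrA.
  by congr (_ * _); rewrite mulrC.
rewrite (bigD1 l) //= mul1r coord_free ?(basis_free (vbasisP _)) // eqxx.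
rewrite rmorph1 mulr1 big1 ?addr0 // => j /negPf jl.
rewrite mul1r coord_free ?(basis_free (vbasisP _)) // jl.
by rewrite rmorph0 mulr0.
Qed.

HB.instance Definition _ := GRing.Zmodule_isComPzRing.Build tensor_sort
  tensor_mulA tensor_mulC tensor_mul1 tensor_mulDl.

Fact tensor_in_additive : nmod_morphism tensor_in.
Proof.
split; first by apply/rowP => l; rewrite !mxE linear0 rmorph0.
by move=> x y; apply/rowP => l; rewrite !mxE linearD rmorphD.
Qed.
Fact tensor_in_multiplicative : monoid_morphism tensor_in.
Proof.
split=> // x y; apply/rowP => l; rewrite !mxE coord_mul rmorph_sum.
apply: eq_bigr => i _; rewrite rmorph_sum; apply: eq_bigr => j _.
by rewrite !mxE !rmorphM.
Qed.
HB.instance Definition _ :=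
  GRing.isNmodMorphism.Build L tensor_sort tensor_in tensor_in_additive.
HB.instance Definition _ :=
  GRing.isMonoidMorphism.Build L tensor_sort tensor_in tensor_in_multiplicative.

Definition tensor : algebra L :=
  @Algebra L tensor_sort (tensor_in : {rmorphism L -> tensor_sort}).
End Tensor.

Section TensorMap.
Variables (K : fieldType) (L : fieldExtType K) (A B : algebra K).
Variable f : alghom A B.

Definition tensor_fun (x : tensor_sort L A) : tensor_sort L B :=
  \row_l f ((x : 'rV_(\dim {:L})) 0 l).
Fact tensor_fun_additive : nmod_morphism tensor_fun.
Proof.
split; first by apply/rowP => l; rewrite !mxE rmorph0.
by move=> x y; apply/rowP => l; rewrite !mxE rmorphD.
Qed.
Fact tensor_fun_in (x : L) : tensor_fun (tensor_in A x) = tensor_in B x.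
Proof. by apply/rowP => l; rewrite !mxE hom_in. Qed.
Fact tensor_fun_multiplicative : monoid_morphism tensor_fun.
Proof.
split; first exact: tensor_fun_in.
move=> x y; apply/rowP => l; rewrite !mxE rmorph_sum.
apply: eq_bigr => i _; rewrite rmorph_sum; apply: eq_bigr => j _.
by rewrite !mxE !rmorphM hom_in.
Qed.
HB.instance Definition _ := GRing.isNmodMorphism.Build
  (tensor_sort L A) (tensor_sort L B) tensor_fun tensor_fun_additive.
HB.instance Definition _ := GRing.isMonoidMorphism.Build
  (tensor_sort L A) (tensor_sort L B) tensor_fun tensor_fun_multiplicative.
Definition tensor_map : alghom (tensor L A) (tensor L B) :=
  @AlgHom L (tensor L A) (tensor L B)
    (tensor_fun : {rmorphism tensor_sort L A -> tensor_sort L B}) tensor_fun_in.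
End TensorMap.

Section WeilRestriction.
Variables (K : fieldType) (L : fieldExtType K) (G : group_functor L).
Definition weil_map (A B : algebra K) (f : alghom A B) :
  G (tensor L A) -> G (tensor L B) := pmap (tensor_map L f).
Fact weil_map_id (A : algebra K) (f : alghom A A) (x : G (tensor L A)) :
  f =1 id -> weil_map f x = x.
Proof. by move=> e; apply: pmap_id => y; apply/rowP => l; rewrite mxE e. Qed.
Fact weil_map_comp (A B C : algebra K) (f : alghom A B) (g : alghom B C)
    (h : alghom A C) (x : G (tensor L A)) :
  h =1 g \o f -> weil_map h x = weil_map g (weil_map f x).
Proof.
by move=> e; apply: pmap_comp => y; apply/rowP => l; rewrite !mxE e.
Qed.
Definition weil_restriction : group_functor K :=
  @GroupFunctor K (Presheaf weil_map_id weil_map_comp)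
    (fun A => gone G (tensor L A)) (fun A => @gmul L G (tensor L A))
    (fun A => @ginv L G (tensor L A)) (fun A => @gmulA L G (tensor L A))
    (fun A => @gmul1 L G (tensor L A)) (fun A => @gmulV L G (tensor L A))
    (fun A B f => gmul_map (tensor_map L f)).
End WeilRestriction.

Definition res_Gm (K : fieldType) (L : fieldExtType K) : group_functor K :=
  weil_restriction (Gm L).

(* normalized discrete valuations; the value at [0] is irrelevant *)
Record valuation (K : fieldType) := Valuation {
  vmap :> K -> int;
  vmapM : forall x y, x != 0 -> y != 0 -> vmap (x * y) = vmap x + vmap y;
  vmapD : forall x y, x != 0 -> y != 0 -> x + y != 0 ->
    Num.min (vmap x) (vmap y) <= vmap (x + y);
  vmap_unif : exists2 x, x != 0 & vmap x = 1 }.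

Definition vge (K : fieldType) (v : valuation K) (m : int) (x : K) : bool :=
  (x == 0) || (m <= v x).

Definition complete_field (K : fieldType) (v : valuation K) :=
  forall u : nat -> K,
    (forall N : nat, exists n0, forall m n,
       (n0 <= m)%N -> (n0 <= n)%N -> vge v N%:Z (u m - u n)) ->
  exists l, forall N : nat, exists n0, forall n,
    (n0 <= n)%N -> vge v N%:Z (u n - l).

Section Integers.
Variables (K : fieldType) (v : valuation K).

Definition integer : {pred K} := fun x => vge v 0 x.

Lemma vmap1 : v 1 = 0.
Proof.
have := vmapM v (oner_neq0 K) (oner_neq0 K); rewrite mulr1 => e.
by apply: (@addrI _ (v 1)); rewrite addr0 -e.
Qed.

Lemma vmapN1 : v (-1) = 0.
Proof.
have n1 : (-1 : K) != 0 by rewrite oppr_eq0 oner_eq0.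
have := vmapM v n1 n1; rewrite mulrNN mulr1 vmap1 => /esym/eqP.
by rewrite -mulr2n mulrn_eq0 /= => /eqP.
Qed.

Fact integer_subring : subring_closed integer.
Proof.
have intM : {in integer &, forall x y, x * y \in integer}.
  move=> x y; rewrite !unfold_in.
  case: (eqVneq x 0) => [->|x0] /=; first by rewrite mul0r /vge eqxx.
  case: (eqVneq y 0) => [->|y0] /=; first by rewrite mulr0 /vge eqxx.
  rewrite /vge (negPf x0) (negPf y0) /= => hx hy.
  by rewrite vmapM // addr_ge0 ?orbT.
have int1 : 1 \in integer by rewrite unfold_in /vge vmap1 lexx orbT.
have intN1 : -1 \in integer by rewrite unfold_in /vge vmapN1 lexx orbT.
have intD : {in integer &, forall x y, x + y \in integer}.
  move=> x y; rewrite !unfold_in.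
  case: (eqVneq x 0) => [->|x0]; first by rewrite add0r.
  case: (eqVneq y 0) => [->|y0]; first by rewrite addr0.
  rewrite /vge (negPf x0) (negPf y0) /= => hx hy.
  case: eqVneq => //= xy0.
  by apply: le_trans (vmapD v x0 y0 xy0); rewrite le_min hx.
split=> // x y hx hy; apply: intD => //.
by rewrite -mulN1r; apply: intM.
Qed.

HB.instance Definition _ := GRing.isSubringClosed.Build K integer
  integer_subring.

Record integers := Integers { int_val : K; _ : int_val \in integer }.
HB.instance Definition _ := [isSub for int_val].
HB.instance Definition _ := [Choice of integers by <:].
HB.instance Definition _ := [SubChoice_isSubComNzRing of integers by <:].

Definition int_incl : {rmorphism integers -> K} := \val.

(* With an algebraically closed residue field this is strict henselianity.  *)
Definition henselian :=
  forall (f : {poly integers}) (a : integers), f \is monic ->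
    vge v 1 (int_val f.[a]) -> ~~ vge v 1 (int_val f^`().[a]) ->
  exists2 a' : integers, f.[a'] = 0 & vge v 1 (int_val (a' - a)).

(* [red] identifies [k] with the residue field *)
Definition residue_map (k : fieldType) (red : {rmorphism integers -> k}) :=
  (forall y, exists x, red x = y) /\
  (forall x, red x = 0 <-> vge v 1 (int_val x)).
End Integers.

(* A finite extension of [K] with the extension of the valuation of [K],    *)
(* renormalized, and with the same residue field [k] (automatic when [k] is *)
(* algebraically closed).                                                   *)
Record val_ext (K : fieldType) (v : valuation K) (k : fieldType)
    (red : {rmorphism integers v -> k}) := ValExt {
  ve_field :> fieldExtType K;
  ve_val : valuation ve_field;
  ve_inc : {rmorphism integers v -> integers ve_val};
  ve_incE : forall x, int_val (ve_inc x) = (int_val x)%:A;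
  ve_red : {rmorphism integers ve_val -> k};
  ve_redP : residue_map ve_red;
  ve_red_inc : forall x, ve_red (ve_inc x) = red x }.

(* The group law of a Neron lft-model is determined by that of [B] through  *)
(* the mapping property; it is made part of the data.                       *)
Record neron_lft (K : fieldType) (v : valuation K) (B : group_functor K) :=
    NeronLft {
  nm :> group_functor (integers v);
  nm_generic : morphism (base_change (int_incl v) nm) B;
  nm_generic_bij : forall A, bijective (nm_generic A);
  nm_generic_hom : forall A (x y : nm (restr (int_incl v) A)),
    nm_generic A (gmul x y) = gmul (nm_generic A x) (nm_generic A y);
  nm_smooth : smooth_scheme nm;
  nm_separated : separated nm;
  nm_mapping : forall Y : presheaf (integers v), smooth_scheme Y ->
    forall u : morphism (base_change (int_incl v) Y) B,
    (exists w : morphism Y nm, forall A y,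
       nm_generic A (w (restr (int_incl v) A) y) = u A y) /\
    (forall w w' : morphism Y nm,
       (forall A y, nm_generic A (w (restr (int_incl v) A) y) = u A y) ->
       (forall A y, nm_generic A (w' (restr (int_incl v) A) y) = u A y) ->
       forall A y, w A y = w' A y) }.

Section BaseChangeMorphism.
Variables (K : fieldType) (v : valuation K) (k : fieldType).
Variables (red : {rmorphism integers v -> k}) (E : val_ext red).
Variable B : group_functor K.
Local Notation inE := (GRing.in_alg E : {rmorphism K -> E}).
Local Notation iK := (int_incl v).
Local Notation iE := (int_incl (ve_val E)).
Variable N : neron_lft v B.
Variable NE : neron_lft (ve_val E) (gbase_change inE B).

(* The morphism extending the identity of [B_E].  The two [O_K]-algebra     *)
(* structures on an [E]-algebra [A], through [K] and through [O_E], are     *)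
(* equal but not convertible: [e] is the identity between them.             *)
Record bc_morphism := BcMorphism {
  bc :> morphism (base_change (ve_inc E) N) NE;
  bc_generic : forall (A : algebra E)
      (e : alghom (restr iK (restr inE A)) (restr (ve_inc E) (restr iE A))),
    (forall a : A, e a = a) ->
    forall x : N (restr iK (restr inE A)),
      nm_generic NE A (bc (restr iE A) (pmap e x)) =
      nm_generic N (restr inE A) x }.
End BaseChangeMorphism.

Section DualNumbers.
Variable A : comPzRingType.
Definition dual : Type := (A * A)%type.
HB.instance Definition _ := GRing.Zmodule.on dual.

(* [(a, b)] stands for [a + b epsilon] *)
Definition dual_mul (x y : dual) : dual := (x.1 * y.1, x.1 * y.2 + x.2 * y.1).
Fact dual_mulA : associative dual_mul.
Proof.
move=> [a a'] [b b'] [c c']; rewrite /dual_mul /= !mulrDr !mulrDl !mulrA.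
by rewrite addrA.
Qed.
Fact dual_mulC : commutative dual_mul.
Proof.
move=> [a a'] [b b']; rewrite /dual_mul /= [b * a]mulrC.
by rewrite [b * a']mulrC [b' * a]mulrC [a' * b + _]addrC.
Qed.
Fact dual_mul1 : left_id (1, 0) dual_mul.
Proof. by move=> [a a']; rewrite /dual_mul /= !mul1r mul0r addr0. Qed.
Fact dual_mulDl : left_distributive dual_mul +%R.
Proof.
move=> [a a'] [b b'] [c c']; rewrite /dual_mul /= -[RHS]/(_, _) /=.
by congr (_, _); rewrite !mulrDl // addrACA.
Qed.
HB.instance Definition _ := GRing.Zmodule_isComPzRing.Build dual
  dual_mulA dual_mulC dual_mul1 dual_mulDl.
End DualNumbers.

(* [a + b epsilon |-> f a + c * f b epsilon] *)
Section DualMap.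
Variables (A B : comPzRingType) (f : {rmorphism A -> B}) (c : B).
Definition dual_fun (x : dual A) : dual B := (f x.1, c * f x.2).
Fact dual_fun_additive : nmod_morphism dual_fun.
Proof.
split; first by rewrite /dual_fun !rmorph0 mulr0.
by move=> [a a'] [b b']; rewrite /dual_fun /= !rmorphD mulrDr.
Qed.
Fact dual_fun_multiplicative : monoid_morphism dual_fun.
Proof.
split; first by rewrite /dual_fun /= rmorph0 mulr0 rmorph1.
move=> [a a'] [b b']; rewrite /dual_fun /= rmorphM -[RHS]/(_, _) /=.
by congr (_, _); rewrite rmorphD !rmorphM mulrDr [c * (f a * _)]mulrCA [c * (f a' * _)]mulrA.
Qed.
HB.instance Definition _ := GRing.isNmodMorphism.Build
  (dual A) (dual B) dual_fun dual_fun_additive.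
HB.instance Definition _ := GRing.isMonoidMorphism.Build
  (dual A) (dual B) dual_fun dual_fun_multiplicative.
End DualMap.

Section DualIn.
Variable R : comPzRingType.
Definition dual_in (r : R) : dual R := (r, 0).
Fact dual_in_additive : nmod_morphism dual_in.
Proof. by split=> // x y; rewrite /dual_in -[RHS]/(_, _) /= addr0. Qed.
Fact dual_in_multiplicative : monoid_morphism dual_in.
Proof.
by split=> // x y; rewrite /dual_in -[RHS]/(_, _) /= mulr0 mul0r addr0.
Qed.
HB.instance Definition _ := GRing.isNmodMorphism.Build
  R (dual R) dual_in dual_in_additive.
HB.instance Definition _ := GRing.isMonoidMorphism.Build
  R (dual R) dual_in dual_in_multiplicative.
Definition dual_alg : algebra R :=
  @Algebra R (dual R) (dual_in : {rmorphism R -> dual R}).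

Definition dual_proj (x : dual R) : R := x.1.
Fact dual_proj_additive : nmod_morphism dual_proj.
Proof. by []. Qed.
Fact dual_proj_multiplicative : monoid_morphism dual_proj.
Proof. by []. Qed.
HB.instance Definition _ := GRing.isNmodMorphism.Build
  (dual R) R dual_proj dual_proj_additive.
HB.instance Definition _ := GRing.isMonoidMorphism.Build
  (dual R) R dual_proj dual_proj_multiplicative.
Definition dual_proj_hom : alghom dual_alg (self_alg R) :=
  @AlgHom R dual_alg (self_alg R) (dual_proj : {rmorphism dual R -> R})
    (fun=> erefl).

Fact dual_scale_in (c r : R) :
  dual_fun (idfun : {rmorphism R -> R}) c (alg_in dual_alg r) =
  alg_in dual_alg r.
Proof. by rewrite /dual_fun /= mulr0. Qed.
Definition dual_scale (c : R) : alghom dual_alg dual_alg :=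
  @AlgHom R dual_alg dual_alg
    (dual_fun (idfun : {rmorphism R -> R}) c : {rmorphism dual R -> dual R})
    (dual_scale_in c).
End DualIn.

Section DualChange.
Variables (R S : comPzRingType) (phi : {rmorphism R -> S}).
Fact dual_change_in (r : R) :
  dual_fun phi 1 (alg_in (dual_alg R) r) = alg_in (restr phi (dual_alg S)) r.
Proof. by rewrite /dual_fun /= rmorph0 mulr0. Qed.
Definition dual_change : alghom (dual_alg R) (restr phi (dual_alg S)) :=
  @AlgHom R (dual_alg R) (restr phi (dual_alg S))
    (dual_fun phi 1 : {rmorphism dual R -> dual S}) dual_change_in.
End DualChange.

(* [Lie G] is the kernel of [G(R[epsilon]) -> G(R)], with addition [gmul]   *)
(* and scalars acting through [epsilon |-> c epsilon].                      *)
Section Lie.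
Variables (R : comPzRingType) (G : group_functor R).
Definition in_lie (x : G (dual_alg R)) : Prop :=
  pmap (dual_proj_hom R) x = gone G (self_alg R).
Definition lie_scale (c : R) (x : G (dual_alg R)) : G (dual_alg R) :=
  pmap (dual_scale c) x.
Definition lie_comb (n : nat) (c : 'I_n -> R) (e : 'I_n -> G (dual_alg R)) :=
  \big[(@gmul R G (dual_alg R))/(gone G (dual_alg R))]_(i < n)
    lie_scale (c i) (e i).
End Lie.

Section Cokernel.
Variables (K : fieldType) (v : valuation K) (k : fieldType).
Variables (red : {rmorphism integers v -> k}) (E : val_ext red).
Variable B : group_functor K.
Variable N : neron_lft v B.
Variable NE : neron_lft (ve_val E)
  (gbase_change (GRing.in_alg E : {rmorphism K -> E}) B).
Variable h : bc_morphism N NE.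
Local Notation OE := (integers (ve_val E)).

(* image of [Lie(N) (x)_(O_K) O_E -> Lie(NE)]: the [O_E]-submodule          *)
(* generated by the image of [Lie(N)]                                       *)
Inductive im_psi : NE (dual_alg OE) -> Prop :=
  | ImGen (t : N (dual_alg (integers v))) : in_lie t ->
      im_psi (h (dual_alg OE) (pmap (dual_change (ve_inc E)) t))
  | ImZero : im_psi (gone NE (dual_alg OE))
  | ImAdd x y : im_psi x -> im_psi y -> im_psi (gmul x y)
  | ImScale c x : im_psi x -> im_psi (lie_scale c x).

(* The classes of the [e i] provide an isomorphism from the direct sum of   *)
(* the [O_E / m_E ^ (j i)] to the cokernel.                                 *)
Definition coker_exponents (g : nat) (j : 'I_g -> nat) :=
  (forall i i' : 'I_g, (i <= i')%N -> (j i <= j i')%N) /\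
  exists e : 'I_g -> NE (dual_alg OE),
    [/\ forall i, in_lie (e i),
        forall x, in_lie x -> exists c : 'I_g -> OE,
          im_psi (gmul x (ginv (lie_comb c e))) &
        forall c : 'I_g -> OE, im_psi (lie_comb c e) <->
          forall i, vge (ve_val E) (j i)%:Z (int_val (c i))].
End Cokernel.

(* [j d i] is [j_(d, i)] *)
Definition ord_of (g : nat) (j : nat -> 'I_g -> nat) (d : nat) : nat :=
  \sum_(i < g) j d i.

Definition jump (R : realType) (g : nat) (j : nat -> 'I_g -> nat)
    (dn : nat -> nat) (i : 'I_g) : R :=
  limn (fun n => (j (dn n) i)%:R / (dn n)%:R : R).

Definition c_tame (R : realType) (g : nat) (j : nat -> 'I_g -> nat)
    (dn : nat -> nat) : R :=
  \sum_(i < g) jump R j dn i.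

(* As the residue field is algebraically closed, a finite extension is tame *)
(* when its degree is prime to [p].                                         *)
Definition cofinal_tower (K : fieldType) (v : valuation K) (k : fieldType)
    (red : {rmorphism integers v -> k}) (p : nat) (Kd : nat -> val_ext red)
    (dn : nat -> nat) :=
  [/\ forall n, ~~ (p %| dn n)%N,
      forall n, inhabited 'AHom(Kd (dn n), Kd (dn n.+1)) &
      forall E : fieldExtType K, ~~ (p %| \dim {:E})%N ->
        exists n, inhabited 'AHom(E, Kd (dn n))].

Section PowerSeries.
Variable M : comPzRingType.
Definition powser : Type := nat -> M.
HB.instance Definition _ := GRing.Zmodule.copy powser (nat -> M).

Definition ps_one : powser := fun n => (n == 0)%:R.
Definition ps_mul (f g : powser) : powser :=
  fun n => \sum_(i < n.+1) f i * g (n - i)%N.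

Fact ps_mulC : commutative ps_mul.
Proof.
move=> f g; apply/funext => n; rewrite /ps_mul (reindex_inj rev_ord_inj) /=.
by apply: eq_bigr => i _; rewrite mulrC subSS subKn // -ltnS.
Qed.
Fact ps_mul1 : left_id ps_one ps_mul.
Proof.
move=> f; apply/funext => n; rewrite /ps_mul big_ord_recl /= /ps_one eqxx.
by rewrite mul1r subn0 big1 ?addr0 // => i _; rewrite mul0r.
Qed.
Fact ps_mulDl : left_distributive ps_mul +%R.
Proof.
move=> f g h; apply/funext => n; rewrite /ps_mul -[RHS]/(_ + _) -big_split /=.
by apply: eq_bigr => i _; rewrite -mulrDl.
Qed.
Fact ps_mulA : associative ps_mul.
Proof.
move=> f g h; apply/funext => n; rewrite /ps_mul.
pose F (j i : nat) := f j * g (i - j)%N * h (n - i)%N.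
transitivity (\sum_(j < n.+1) \sum_(i < n.+1 | (j <= i)%N) F j i).
  apply: eq_bigr => j _; rewrite mulr_sumr.
  have jn : (j <= n)%N by rewrite -ltnS.
  rewrite -(big_mkord xpredT (fun m => f j * (g m * h (n - j - m)%N))).
  rewrite -(big_mkord (fun i => j <= i)%N (F j)) [RHS](@big_cat_nat _ _ _ j) //=;
    last exact: leqW.
  rewrite [X in _ = X + _]big_nat_cond [X in _ = X + _]big1 ?add0r; last first.
    by move=> i /andP[/andP[_ ij] ji]; rewrite leqNgt ij in ji.
  rewrite -[X in _ = \sum_(X <= _ < _ | _) _](add0n j) big_addn subSn //.
  rewrite [RHS]big_mkcond; apply: eq_bigr => m _.
  by rewrite leq_addl /F addnK mulrA addnC subnDA.
rewrite (exchange_big_dep predT) //=; apply: eq_bigr => i _.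
rewrite mulr_suml.
rewrite -(big_mkord (fun j => j <= i)%N (F^~ i)).
rewrite -(big_mkord xpredT (fun j => f j * g (i - j)%N * h (n - i)%N)).
rewrite [LHS](@big_cat_nat _ _ _ i.+1) //=.
rewrite [X in _ + X]big_nat_cond [X in _ + X]big1 ?addr0; last first.
  by move=> j /andP[/andP[ij _] ji]; rewrite ltnNge ji in ij.
rewrite big_nat_cond [RHS]big_nat_cond; apply: eq_bigl => j.
by rewrite andbT ltnS /=; case: (j <= i)%N.
Qed.
HB.instance Definition _ := GRing.Zmodule_isComPzRing.Build powser
  ps_mulA ps_mulC ps_mul1 ps_mulDl.

Definition ps_monom (c : M) (n : nat) : powser :=
  fun d => if d == n then c else 0.
Definition is_polynomial (f : powser) :=
  exists n, forall d, (n <= d)%N -> f d = 0.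

Definition ps_rational (f : powser) :=
  exists P Q Q' : powser, [/\ is_polynomial P, is_polynomial Q,
    Q * Q' = 1 & f = P * Q'].

Variable q : M.

(* [u] is [1 / (1 - q ^ a z ^ b)], which exists in [M[[z]]] for [0 < b] *)
Definition ps_geom_inv (a b : nat) (u : powser) :=
  (1 - ps_monom (q ^+ a) b) * u = 1.

(* The subring [M[z, 1 / (1 - q ^ a z ^ b)]], for the [(a, b)] in [I].  Only *)
(* [0 <= a] is needed: [a / b] will be [c_tame], a limit of nonnegative      *)
(* rational numbers.                                                        *)
Inductive in_subring (I : nat -> nat -> Prop) : powser -> Prop :=
  | SrConst c : in_subring I (ps_monom c 0)
  | SrVar : in_subring I (ps_monom 1 1)
  | SrGeom a b u : I a b -> ps_geom_inv a b u -> in_subring I u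
  | SrAdd f g : in_subring I f -> in_subring I g -> in_subring I (f + g)
  | SrOpp f : in_subring I f -> in_subring I (- f)
  | SrMul f g : in_subring I f -> in_subring I g -> in_subring I (f * g).

(* a term: a finite multiset of pairs, and the inverse of the associated    *)
(* product                                                                  *)
Definition pole_term (s0 : rat) (m : nat) (mu : seq (nat * nat)) (u : powser) :=
  [/\ all (fun ab => 0 < ab.2)%N mu,
      (count (fun ab => ab.1%:R / ab.2%:R == s0 :> rat) mu <= m)%N &
      (\prod_(ab <- mu) (1 - ps_monom (q ^+ ab.1) ab.2)) * u = 1].

Definition pole_order_le (f : powser) (s0 : rat) (m : nat) :=
  exists n (P u : 'I_n -> powser) (mu : 'I_n -> seq (nat * nat)),
    (forall i, is_polynomial (P i) /\ pole_term s0 m (mu i) (u i)) /\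
    f = \sum_(i < n) P i * u i.

Definition pole_order (f : powser) (s0 : rat) (m : nat) :=
  [/\ (0 < m)%N, pole_order_le f s0 m & ~ pole_order_le f s0 m.-1].

Definition is_pole (f : powser) (s0 : rat) := ~ pole_order_le f s0 0.
End PowerSeries.

(* [Nd d] is the Neron lft-model over the integers of [K(d)], [Q d] its     *)
(* maximal quasi-compact open subgroup scheme.  The coefficient of [z ^ 0]  *)
(* vanishes since [p %| 0].                                                 *)
Definition motivic_zeta (K : fieldType) (v : valuation K) (k : fieldType)
    (red : {rmorphism integers v -> k}) (p : nat) (Kd : nat -> val_ext red)
    (B : group_functor K)
    (Nd : forall d, neron_lft (ve_val (Kd d))
       (gbase_change (GRing.in_alg (Kd d) : {rmorphism K -> Kd d}) B))
    (g : nat) (j : nat -> 'I_g -> nat) (Q : forall d, subfunctor (Nd d))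
    (K0 : comPzRingType) (cl : presheaf k -> K0) : powser K0 :=
  fun d => if (p %| d)%N then 0 else
    cl (base_change (ve_red (Kd d)) (sub_presheaf (Q d))) *
    cl (affine_line k) ^+ ord_of j d.

(* Main.v *)
(* As the residue field [k] is algebraically closed and [L/K] is purely wild,
   [L/K] is totally ramified of degree [n = p ^ r]: a uniformizer [t] of [L]
   makes [1, t, ..., t ^ (n - 1)] a basis with valuations [0, 1, ..., n - 1].
   For [d] prime to [p], [n] and [d] are coprime, so [L (x) K(d)] is again
   totally ramified over [K(d)], and the elements [pi ^ (m j) * t ^ (a j)] of
   valuation [j], [d * a j + n * m j = j], span its ring of integers.  The
   units of this ring form a smooth group scheme [T], and gluing the translates
   of [T] gives the Neron lft-model; [T] is its maximal quasi-compact open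
   subgroup.  Modulo [pi] the product of the [i]-th and [j]-th basis vectors
   has no component of index [< i + j], so the special fibre of [T] is
   [Gm x A ^ (n - 1)].  On Lie algebras the base change morphism is diagonal,
   whence [j_(d, i) = floor (d * i / n)], [ord d = (d - 1) * (n - 1) / 2] and
   [c_tame = (n - 1) / 2]; the zeta function is then a geometric series.

   For the order of the pole one needs that [LL] satisfies no polynomial
   equation over the integers.  A finite part of [k] maps to a finite field
   [F_q] compatibly with the operations, so that [k] embeds into an ultraproduct
   [F] of finite fields.  The number of [F]-points, computed in the
   corresponding ultraproduct of the integers, is additive on varieties, and it
   sends [LL ^ m] to the class of the [q ^ m], which are unbounded and linearly
   independent.  Once [LL] is replaced by an indeterminate it can be specialized
   to [4]; then the numerator of the zeta function is positive at
   [z = 2 ^ (1 - n)], where the denominator vanishes. *)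
Require Import Defs.
From HB Require Import structures.
From mathcomp Require Import all_boot all_order all_algebra all_field.
From mathcomp Require Import boolp classical_sets functions reals.
From mathcomp Require Import topology normedtype sequences.
From mathcomp Require Import ring lra zify.
From mathcomp Require Import cyclic.

Set Implicit Arguments.
Unset Strict Implicit.
Unset Printing Implicit Defensive.

Import Order.TTheory GRing.Theory Num.Theory.
Import numFieldNormedType.Exports.

Local Open Scope ring_scope.
Local Notation pmap := Defs.pmap.

(** The Neron lft-models are data, not constructions, so no translates are glued: the mapping
    property only gives a morphism [al] from [T] to the model [N], and the difficulty is to show
    that it is an open immersion onto the maximal quasi-compact subgroup. The valuation of the
    generic coordinates is a homomorphism from the integral points of [N] to the integers, bounded
    below on every affine chart. Near a point of least value [w0] the chart is moved into the image
    of [al] by any integral point of value [- w0], and these translates cover the special fibre of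
    [T]. This rests on two properties of the coordinate ring [A] of a smooth chart: the uniformizer
    is regular in [A], and a function divisible by it at all integral points is divisible in [A].
    They are drawn from formal smoothness: with [A = P / (f_l)] for a polynomial ring [P], the
    identity of [A] lifts to a section into [P / (f_l ^ p)], where the freeness of Frobenius on [P]
    modulo the uniformizer applies. Integral points are provided by the Nullstellensatz over [k] and
    by completeness. *)

Definition rmorph_of (A B : pzRingType) (f : A -> B)
    (fB : zmod_morphism f) (fM : monoid_morphism f) : {rmorphism A -> B} :=
  HB.pack f (GRing.isZmodMorphism.Build A B f fB)
    (GRing.isMonoidMorphism.Build A B f fM).

(** * Ideals, quotients and residue fields *)

Record ideal (A : comPzRingType) := Ideal {
  mem_id :> A -> Prop;
  id0 : mem_id 0;
  idD : forall x y, mem_id x -> mem_id y -> mem_id (x + y);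
  idMl : forall a x, mem_id x -> mem_id (a * x) }.

Section IdealTheory.
Variables (A : comPzRingType) (I : ideal A).
Lemma idN x : I x -> I (- x).
Proof. by move=> Ix; rewrite -mulN1r; apply: idMl. Qed.
Lemma idB x y : I x -> I y -> I (x - y).
Proof. by move=> Ix Iy; apply: idD => //; apply: idN. Qed.
Lemma idMr a x : I x -> I (x * a).
Proof. by move=> Ix; rewrite mulrC; apply: idMl. Qed.
Lemma idBC x y : I (x - y) -> I (y - x).
Proof. by move=> /idN; rewrite opprB. Qed.
Lemma id_trans x y z : I (x - y) -> I (y - z) -> I (x - z).
Proof. by move=> h1 h2; have := idD h1 h2; rewrite addrA subrK. Qed.
Lemma id_sum (T : Type) (r : seq T) (P : pred T) (f : T -> A) :
  (forall i, P i -> I (f i)) -> I (\sum_(i <- r | P i) f i).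
Proof. by move=> h; apply: big_ind => //; [exact: id0|exact: idD]. Qed.
Lemma id_mul_cong x x' y y' :
  I (x - x') -> I (y - y') -> I (x * y - x' * y').
Proof.
move=> hx hy; have -> : x * y - x' * y' = y * (x - x') + x' * (y - y').
  by rewrite !mulrBr [y * x]mulrC [y * x']mulrC addrA subrK.
by apply: idD; apply: idMl.
Qed.
End IdealTheory.

Definition zero_ideal (A : comPzRingType) : ideal A.
Proof.
exists (fun x => x = 0) => // [x y -> ->|a x ->]; first by rewrite addr0.
by rewrite mulr0.
Defined.

Definition preim_ideal (A B : comPzRingType) (f : {rmorphism A -> B})
  (I : ideal B) : ideal A.
Proof.
exists (fun x => I (f x)) => [|x y hx hy|a x hx].
- by rewrite rmorph0; apply: id0.
- by rewrite rmorphD; apply: idD.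
- by rewrite rmorphM; apply: idMl.
Defined.

(** The intersection of all ideals containing [S]: inclusions out of it need no explicit
    combination, which [sum_idealE] recovers when required. *)
Definition idgen (A : comPzRingType) (S : A -> Prop) : ideal A.
Proof.
exists (fun x => forall J : ideal A, (forall s, S s -> J s) -> J x).
- by move=> J _; apply: id0.
- by move=> x y hx hy J h; apply: idD; [apply: hx|apply: hy].
- by move=> a x hx J h; apply: idMl; apply: hx.
Defined.

Lemma idgen_mem (A : comPzRingType) (S : A -> Prop) s : S s -> idgen S s.
Proof. by move=> h J; apply. Qed.

Lemma idgen_min (A : comPzRingType) (S : A -> Prop) (J : ideal A) :
  (forall s, S s -> J s) -> forall x, idgen S x -> J x.
Proof. by move=> h x; apply. Qed.

Definition lincomb_ideal (A : comPzRingType) (T : finType) (f : T -> A) :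
  ideal A.
Proof.
exists (fun x => exists c : T -> A, x = \sum_i c i * f i).
- by exists (fun=> 0); rewrite big1 // => i _; rewrite mul0r.
- move=> _ _ [c ->] [d ->]; exists (fun i => c i + d i).
  by rewrite -big_split; apply: eq_bigr => i _; rewrite mulrDl.
- move=> a _ [c ->]; exists (fun i => a * c i).
  by rewrite mulr_sumr; apply: eq_bigr => i _; rewrite mulrA.
Defined.

Lemma lincomb_mem (A : comPzRingType) (T : finType) (f : T -> A) i :
  lincomb_ideal f (f i).
Proof.
exists (fun j => (j == i)%:R); rewrite (bigD1 i) //= eqxx mul1r big1 ?addr0 //.
by move=> j /negPf ->; rewrite mul0r.
Qed.

Definition sum_ideal (A : comPzRingType) (I J : ideal A) : ideal A.
Proof.
exists (fun x => exists y z, [/\ I y, J z & x = y + z]).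
- by exists 0, 0; rewrite addr0; split=> //; apply: id0.
- move=> _ _ [y [z [Iy Jz ->]]] [y' [z' [Iy' Jz' ->]]].
  by exists (y + y'), (z + z'); rewrite addrACA; split=> //; apply: idD.
- move=> a _ [y [z [Iy Jz ->]]]; exists (a * y), (a * z).
  by rewrite mulrDr; split=> //; apply: idMl.
Defined.

Lemma sum_idealE (A : comPzRingType) (S : A -> Prop) x :
  idgen S x -> exists n (b : 'I_n -> A) (s : 'I_n -> A),
    (forall i, S (s i)) /\ \sum_(i < n) b i * s i = x.
Proof.
pose J := fun x => exists n (b : 'I_n -> A) (s : 'I_n -> A),
    (forall i, S (s i)) /\ \sum_(i < n) b i * s i = x.
have J0 : J 0.
  by exists 0%N, (fun=> 0), (fun=> 0); split=> [[]//|]; rewrite big_ord0.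
have JD x1 y : J x1 -> J y -> J (x1 + y).
  move=> [n [b [s [hs <-]]]] [m [c [t [ht <-]]]].
  exists (n + m)%N, (fun i => match fintype.split i with inl j => b j | inr j => c j end).
  exists (fun i => match fintype.split i with inl j => s j | inr j => t j end).
  split; first by move=> i; case: splitP.
  rewrite big_split_ord; congr (_ + _); apply: eq_bigr => i _.
    by rewrite (unsplitK (inl i)).
  by rewrite (unsplitK (inr i)).
have JM a x1 : J x1 -> J (a * x1).
  move=> [n [b [s [hs <-]]]]; exists n, (fun i => a * b i), s; split=> //.
  by rewrite mulr_sumr; apply: eq_bigr => i _; rewrite mulrA.
move/(_ (Ideal J0 JD JM)); apply => s hs.
exists 1%N, (fun=> 1), (fun=> s); split=> //.
by rewrite big_ord_recl big_ord0 addr0 mul1r.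
Qed.

Section Quotient.
Variables (A : comPzRingType) (I : ideal A).
(** A representative of the class of [x] that depends only on the class, since [choose] depends only
    on the predicate once it is satisfied. The quotient is then the subtype of the fixed points of
    [canon]. *)
Definition canon (x : A) : A := choose (fun y => `[<I (y - x)>]) x.
Lemma canonP x : I (canon x - x).
Proof.
apply/asboolP; apply: (@chooseP _ (fun y => `[<I (y - x)>]) x).
by apply/asboolP; rewrite subrr; apply: id0.
Qed.
Lemma canon_eq x y : I (x - y) -> canon x = canon y.
Proof.
move=> h; rewrite /canon.
have -> : (fun z => `[<I (z - x)>]) = (fun z => `[<I (z - y)>]).
  apply/funext => z; apply: asbool_equiv_eq; split=> hz.
    exact: id_trans hz h.
  by apply: id_trans hz _; apply: idBC.
by apply: choose_id; apply/asboolP => //; rewrite subrr; apply: id0.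
Qed.
Lemma canonK x : canon (canon x) = canon x.
Proof. exact: canon_eq (canonP x). Qed.

Record quo := Quo { quo_val : A; _ : canon quo_val == quo_val }.
HB.instance Definition _ := [isSub for quo_val].
HB.instance Definition _ := [Choice of quo by <:].

Definition qpi (x : A) : quo := @Quo (canon x) (introT eqP (canonK x)).
Lemma qpi_eq x y : qpi x = qpi y <-> I (x - y).
Proof.
split=> [[e]|h]; last by apply: val_inj; apply: canon_eq.
by apply: id_trans (canonP y); rewrite -e; apply/idBC/canonP.
Qed.
Lemma qpiK (q : quo) : qpi (quo_val q) = q.
Proof. by apply: val_inj => /=; apply/eqP; case: q. Qed.
Definition qadd (x y : quo) := qpi (quo_val x + quo_val y).
Definition qmul (x y : quo) := qpi (quo_val x * quo_val y).
Definition qopp (x : quo) := qpi (- quo_val x).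
Lemma qpiD x y : qadd (qpi x) (qpi y) = qpi (x + y).
Proof.
by apply/qpi_eq; rewrite opprD addrACA; apply: idD; apply: canonP.
Qed.
Lemma qpiM x y : qmul (qpi x) (qpi y) = qpi (x * y).
Proof. by apply/qpi_eq; apply: id_mul_cong; apply: canonP. Qed.
Lemma qpiN x : qopp (qpi x) = qpi (- x).
Proof. by apply/qpi_eq; rewrite -opprD; apply/idN/canonP. Qed.
Local Ltac qtac := repeat move=> ?; repeat match goal with x : quo |- _ =>
  rewrite -(qpiK x); move: (quo_val x) => {}x end; rewrite !(qpiD, qpiM, qpiN).
Lemma qaddA : associative qadd. Proof. by qtac; rewrite addrA. Qed.
Lemma qaddC : commutative qadd. Proof. by qtac; rewrite addrC. Qed.
Lemma qadd0 : left_id (qpi 0) qadd. Proof. by qtac; rewrite add0r. Qed.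
Lemma qaddN : left_inverse (qpi 0) qopp qadd.
Proof. by qtac; rewrite addNr. Qed.
HB.instance Definition _ := GRing.isZmodule.Build quo qaddA qaddC qadd0 qaddN.
Lemma qmulA : associative qmul. Proof. by qtac; rewrite mulrA. Qed.
Lemma qmulC : commutative qmul. Proof. by qtac; rewrite mulrC. Qed.
Lemma qmul1 : left_id (qpi 1) qmul. Proof. by qtac; rewrite mul1r. Qed.
Lemma qmulD : left_distributive qmul +%R.
Proof.
by move=> x y z; rewrite -[_ + _]/(qadd _ _) -[RHS]/(qadd _ _); qtac;
   rewrite mulrDl.
Qed.
HB.instance Definition _ :=
  GRing.Zmodule_isComPzRing.Build quo qmulA qmulC qmul1 qmulD.
Fact qpi_zmod : zmod_morphism qpi.
Proof. by move=> x y; rewrite -[RHS]/(qadd _ (qopp _)) qpiN qpiD. Qed.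
Fact qpi_monoid : monoid_morphism qpi.
Proof. by split=> // x y; rewrite -[RHS]/(qmul _ _) qpiM. Qed.
HB.instance Definition _ := GRing.isZmodMorphism.Build A quo qpi qpi_zmod.
HB.instance Definition _ := GRing.isMonoidMorphism.Build A quo qpi qpi_monoid.
Lemma qpi0 x : qpi x = 0 <-> I x.
Proof. by rewrite -(rmorph0 qpi) qpi_eq subr0. Qed.
End Quotient.

Definition quo_alg (R : comPzRingType) (A : algebra R) (I : ideal A) :
  algebra R := @Algebra R (quo I) (qpi I \o alg_in A : {rmorphism R -> quo I}).

Definition quo_hom (R : comPzRingType) (A : algebra R) (I : ideal A) :
  alghom A (quo_alg I) :=
  @AlgHom R A (quo_alg I) (qpi I : {rmorphism A -> quo I}) (fun=> erefl).

Lemma quo_homK (R : comPzRingType) (A : algebra R) (I : ideal A) (x : A) :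
  quo_hom I x = 0 <-> I x.
Proof. exact: qpi0. Qed.

Lemma quo_surj (R : comPzRingType) (A : algebra R) (I : ideal A)
  (y : quo_alg I) : exists x, quo_hom I x = y.
Proof. by exists (quo_val y); apply: qpiK. Qed.

Lemma surj_factor (A B C : comPzRingType) (f : {rmorphism A -> B})
    (g : {rmorphism A -> C}) :
  (forall b, exists a, f a = b) -> (forall a, f a = 0 -> g a = 0) ->
  exists h : {rmorphism B -> C}, forall a, h (f a) = g a.
Proof.
move=> fs fg; pose s b := sval (cid (fs b)).
have sK b : f (s b) = b by rewrite /s; case: cid.
have gs a b : f a = f b -> g a = g b.
  move=> e; apply/eqP; rewrite -subr_eq0 -rmorphB; apply/eqP/fg.
  by rewrite rmorphB e subrr.
have hB : zmod_morphism (g \o s).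
  by move=> x y /=; rewrite -rmorphB; apply: gs; rewrite rmorphB !sK.
have hM : monoid_morphism (g \o s).
  split=> [|x y] /=; first by rewrite -(rmorph1 g); apply: gs; rewrite sK rmorph1.
  by rewrite -rmorphM; apply: gs; rewrite rmorphM !sK.
by exists (rmorph_of hB hM) => a /=; apply: gs; rewrite sK.
Qed.

Lemma quo_lift (R : comPzRingType) (A C : algebra R) (I : ideal A)
    (g : alghom A C) : (forall a, I a -> g a = 0) ->
  exists h : alghom (quo_alg I) C, forall a, h (quo_hom I a) = g a.
Proof.
move=> h; have [|a|f fE] := @surj_factor A (quo I) C (qpi I) g.
- by move=> b; exists (quo_val b); apply: qpiK.
- by move/qpi0; apply: h.
unshelve eexists (@AlgHom R (quo_alg I) C f _); last exact: fE.
by move=> r; rewrite -(hom_in g); apply: fE.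
Qed.

Lemma field_of (B : comPzRingType) : 1 != 0 :> B ->
  (forall x : B, x != 0 -> exists y, y * x = 1) ->
  exists (F : fieldType) (f : {rmorphism B -> F}), bijective f.
Proof.
move=> h1 hinv.
have /choice[inv invP] : forall x : B, exists y, (x != 0 -> y * x = 1) /\
    (x = 0 -> y = 0).
  move=> x; case: (eqVneq x 0) => [->|x0]; first by exists 0.
  have [y e] := hinv x x0; exists y; split=> // e0; by rewrite e0 eqxx in x0.
pose B1 : comNzRingType := HB.pack (B : Type) (GRing.ComPzRing.class B)
  (GRing.PzSemiRing_isNonZero.Build B h1).
have hV (x : B1) : x != 0 -> inv x * x = 1 by move=> x0; apply: (invP x).1.
have hV0 : inv (0 : B1) = 0 by apply: (invP 0).2.
pose F : fieldType := HB.pack (B : Type) (GRing.ComNzRing.class B1)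
  (GRing.ComNzRing_isField.Build B1 hV hV0).
exists F, (idfun : {rmorphism B -> B}); by exists id.
Qed.

Lemma max_ideal (A : comPzRingType) (I : ideal A) : ~ I 1 ->
  exists M : ideal A, [/\ forall x, I x -> M x, ~ M 1 &
    forall x, ~ M x -> exists y, M (y * x - 1)].
Proof.
move=> I1.
(* Taking unions with [I] lets the empty set satisfy [P], as Zorn's lemma requires of the union of
   the empty chain. *)
pose P (X : set A) := exists J : ideal A, ~ J 1 /\
  forall x, J x <-> X x \/ I x.
have [|X [[J [J1 JE]] Xmax]] := @Zorn_bigcup A P.
  move=> F FP tot.
  pose U x := (\bigcup_(X in F) X)%classic x \/ I x.
  have UD x y : U x -> U y -> U (x + y).
    move=> [[X FX Xx]|Ix] [[Y FY Yy]|Iy]; last by right; apply: idD.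
    - have [h|h] := tot _ _ FX FY.
        have [J [_ JE]] := FP _ FY.
        have : J (x + y) by apply: idD; apply/JE; left=> //; apply: h.
        by case/JE => ?; [left; exists Y|right].
      have [J [_ JE]] := FP _ FX.
      have : J (x + y) by apply: idD; apply/JE; left=> //; apply: h.
      by case/JE => ?; [left; exists X|right].
    - have [J [_ JE]] := FP _ FX.
      have : J (x + y) by apply: idD; apply/JE; [left|right].
      by case/JE => ?; [left; exists X|right].
    - have [J [_ JE]] := FP _ FY.
      have : J (x + y) by apply: idD; apply/JE; [right|left].
      by case/JE => ?; [left; exists Y|right].
  have UM a x : U x -> U (a * x).
    move=> [[X FX Xx]|Ix]; last by right; apply: idMl.
    have [J [_ JE]] := FP _ FX.
    have : J (a * x) by apply: idMl; apply/JE; left.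
    by case/JE => ?; [left; exists X|right].
  exists (@Ideal A U (or_intror (id0 I)) UD UM); split=> //=.
  case=> // -[X FX X1]; have [J [J1 JE]] := FP _ FX.
  by apply: J1; apply/JE; left.
exists J; split=> // [x Ix|x Jx]; first by apply/JE; right.
apply: contrapT => nex.
pose K := sum_ideal J (idgen (fun z => z = x)).
have Kx : K x.
  exists 0, x; rewrite add0r; split=> //; [exact: id0|exact: idgen_mem].
have JK z : J z -> K z.
  by move=> Jz; exists z, 0; rewrite addr0; split=> //; apply: id0.
apply: (Xmax (fun z => K z)).
  split=> [z Xz|h]; first by apply: JK; apply/JE; left.
  by apply: Jx; apply/JE; left; apply: h.
exists K; split=> [[y [z [Jy gz e]]]|z]; last first.
  by split=> [|[|Iz]] //; [left|apply: JK; apply/JE; right].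
apply: nex; have [n [b [s [hs ez]]]] := sum_idealE gz.
exists (\sum_i b i); rewrite e opprD addrCA -ez mulr_suml.
rewrite (_ : \sum_i b i * x - _ = 0) ?addr0; first exact: idN.
by apply/eqP; rewrite subr_eq0; apply/eqP/eq_bigr => i _; rewrite hs.
Qed.

Lemma ideal_field (A : comPzRingType) (I : ideal A) : ~ I 1 ->
  exists (F : fieldType) (f : {rmorphism A -> F}),
    (forall y, exists x, f x = y) /\ (forall x, I x -> f x = 0).
Proof.
move=> /max_ideal[M [IM M1 Mmax]].
have q1 : 1 != 0 :> quo M.
  by apply/eqP => /esym e; apply: M1; apply/qpi0; rewrite rmorph1 e.
have [x x0|F [f fbij]] := field_of q1.
  have /Mmax[y hy] : ~ M (quo_val x).
    by move=> /qpi0; rewrite qpiK => /eqP e; rewrite e in x0.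
  exists (qpi M y); rewrite -[x]qpiK -rmorphM -(rmorph1 (qpi M)).
  exact/qpi_eq.
exists F, (f \o qpi M : {rmorphism A -> F}); split=> [y|x /IM /qpi0 /= ->].
  have [g _ gK] := fbij; exists (quo_val (g y)); by rewrite /= qpiK gK.
exact: rmorph0.
Qed.

Definition alg_comp (R : comPzRingType) (A B C : algebra R)
  (g : alghom B C) (f : alghom A B) : alghom A C.
Proof.
exists (g \o f : {rmorphism A -> C}) => r /=; by rewrite !hom_in.
Defined.

Definition alg_id (R : comPzRingType) (A : algebra R) : alghom A A :=
  @AlgHom R A A (idfun : {rmorphism A -> A}) (fun=> erefl).

Definition alg_over (R : comPzRingType) (A : algebra R) (B : comPzRingType)
  (f : {rmorphism A -> B}) : algebra R :=
  @Algebra R B (f \o alg_in A : {rmorphism R -> B}).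

Definition over_hom (R : comPzRingType) (A : algebra R) (B : comPzRingType)
  (f : {rmorphism A -> B}) : alghom A (alg_over f) :=
  @AlgHom R A (alg_over f) f (fun=> erefl).

(** A proper ideal lies in a maximal one: the failure of [gen_unit_ideal] is always seen at a point
    with values in a field. *)
Lemma not_unit_field (R : comPzRingType) (A B : algebra R) (f : alghom A B)
    (S : A -> Prop) : ~ gen_unit_ideal f S ->
  exists (F : fieldType) (g : {rmorphism B -> F}), forall s, S s -> g (f s) = 0.
Proof.
move=> nS; have [h1|F [g [_ hg]]] :=
    @ideal_field B (idgen (fun b => exists2 s, S s & b = f s)).
  apply: nS; have [n [b [s [hs e]]]] := sum_idealE h1.
  have /choice[t tP] : forall i, exists t, S t /\ s i = f t.
    by move=> i; have [t] := hs i; exists t.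
  exists n, b, t; split=> [i|]; first by case: (tP i).
  by rewrite -e; apply: eq_bigr => i _; case: (tP i) => _ ->.
by exists F, g => s Ss; apply: hg; apply: idgen_mem; exists s.
Qed.

Lemma gen_unitW (R : comPzRingType) (A B : algebra R) (f : alghom A B)
  (S : A -> Prop) s y : S s -> f s * y = 1 -> gen_unit_ideal f S.
Proof.
move=> Ss e; exists 1%N, (fun=> y), (fun=> s); split=> //.
by rewrite big_ord_recl big_ord0 addr0 mulrC.
Qed.

Lemma gen_unit_field (R : comPzRingType) (A B : algebra R) (F : fieldType)
    (f : alghom A B) (g : {rmorphism B -> F}) (S : A -> Prop) :
  gen_unit_ideal f S -> exists2 s, S s & g (f s) != 0.
Proof.
move=> [n [b [s [hs e]]]]; apply: contrapT => h.
have : (1 : F) = 0; last by move/eqP; rewrite oner_eq0.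
rewrite -(rmorph1 g) -e rmorph_sum big1 // => i _; rewrite rmorphM.
case: (eqVneq (g (f (s i))) 0) => [->|n0]; first by rewrite mulr0.
by case: h; exists (s i).
Qed.

(** The annihilator of [x - y] is contained in no maximal ideal, so it contains 1. *)
Lemma annih_eq (A : comPzRingType) (x y : A) :
  (forall (F : fieldType) (f : {rmorphism A -> F}), exists2 s, f s != 0 &
     s * (x - y) = 0) -> x = y.
Proof.
move=> h; have i0 : 0 * (x - y) = 0 by rewrite mul0r.
have iD a b : a * (x - y) = 0 -> b * (x - y) = 0 -> (a + b) * (x - y) = 0.
  by move=> e1 e2; rewrite mulrDl e1 e2 addr0.
have iM c a : a * (x - y) = 0 -> c * a * (x - y) = 0.
  by move=> e1; rewrite -mulrA e1 mulr0.
pose J := @Ideal A (fun s => s * (x - y) = 0) i0 iD iM.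
apply/eqP; rewrite -subr_eq0 -[_ - _]mul1r; apply/eqP.
apply: contrapT => nJ.
have [F [f [_ hf]]] := @ideal_field A J nJ.
have [s s0 e] := h F f; by rewrite (hf s) ?eqxx in s0.
Qed.

(** * Localization at one element *)

Definition nz_ring (A : comPzRingType) (h : 1 != 0 :> A) : comNzRingType :=
  HB.pack (A : Type) (GRing.ComPzRing.class A)
    (GRing.PzSemiRing_isNonZero.Build A h).

(** The localization is [A[X] / (s X - 1)]. If [a = q (s X - 1)], comparison of coefficients gives
    [q_i = - s ^ i a], and this vanishes for [i = size q]. *)
Lemma loc_ring (A : comNzRingType) (s : A) :
  exists (B : comPzRingType) (l : {rmorphism A -> B}),
  [/\ exists y, l s * y = 1, forall a, l a = 0 -> exists m, s ^+ m * a = 0 &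
      forall b, exists m a, l s ^+ m * b = l a].
Proof.
pose J := idgen (fun q : {poly A} => q = s *: 'X - 1).
exists (quo J), (qpi J \o (polyC : {rmorphism A -> {poly A}})).
have sX : qpi J s%:P * qpi J 'X = 1.
  rewrite -rmorphM -(rmorph1 (qpi J)); apply/qpi_eq/idgen_mem.
  by rewrite mul_polyC.
split; first by exists (qpi J 'X).
- move=> a /qpi0 h.
  have [n [b [t [ht e]]]] := sum_idealE h.
  have {n b t ht e h} [q e] : exists q : {poly A}, a%:P = q * (s *: 'X - 1).
    by exists (\sum_i b i); rewrite -e mulr_suml; apply: eq_bigr => i _; rewrite ht.
  have cE i : (a%:P)`_i = (if i is j.+1 then s * q`_j else 0) - q`_i.
    rewrite e mulrBr mulr1 coefB -scalerAr coefZ coefMX; congr (_ - _).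
    by case: i => [|i] //=; rewrite mulr0.
  have qE i : q`_i = - (s ^+ i * a).
    elim: i => [|i IH].
      by have := cE 0%N; rewrite coefC /= sub0r expr0 mul1r => ->; rewrite opprK.
    have /eqP := cE i.+1; rewrite coefC /= eq_sym subr_eq0 => /eqP <-.
    by rewrite IH mulrN mulrA -exprS.
  exists (size q); apply: oppr_inj; rewrite oppr0 -qE.
  by rewrite nth_default.
- move=> b; rewrite -[b]qpiK; move: (quo_val b) => {}b.
  elim/poly_ind: b => [|q c [m [a e]]].
    by exists 0%N, 0; rewrite !rmorph0 mulr0.
  exists m.+1, (a + s ^+ m.+1 * c).
  rewrite /= in e *; rewrite !rmorphD !rmorphM !rmorphXn /= mulrDr -e.
  congr (_ + _); rewrite exprSr -!mulrA; congr (_ * _).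
  by rewrite mulrCA sX mulr1.
Qed.

Section Localization.
Variables (R : comPzRingType).
Implicit Types A B C : algebra R.

Lemma loc_exists A (s : A) : exists B (l : alghom A B), is_localization l s.
Proof.
case: (eqVneq (1 : A) 0) => [e1|n1].
  have z (x y : A) : x = y by rewrite -[x]mul1r -[y]mul1r e1 !mul0r.
  exists A, (alg_id A); split; first by exists 0; apply: z.
    by move=> a _; exists 0%N; apply: z.
  by move=> b; exists 0%N, b; apply: z.
have [B [l lP]] := @loc_ring (nz_ring n1) s.
by exists (@alg_over R A B l), (@over_hom R A B l).
Qed.

Lemma loc_hom_eq A B C (l : alghom A B) s (g g' : alghom B C) :
  is_localization l s -> (forall a, g (l a) = g' (l a)) -> g =1 g'.
Proof.
move=> [[y ey] _ ls] h b; have [m [a e]] := ls b.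
have hb : b = y ^+ m * l a by rewrite -e mulrA -exprMn [y * _]mulrC ey expr1n mul1r.
rewrite hb !rmorphM h; congr (_ * _); rewrite !rmorphXn; congr (_ ^+ _).
by rewrite -[LHS]mul1r -(rmorph1 g') -ey rmorphM -h mulrAC -rmorphM ey rmorph1 mul1r.
Qed.

Lemma loc_lift A B C (l : alghom A B) s (f : alghom A C) :
  is_localization l s -> (exists y, f s * y = 1) ->
  exists g : alghom B C, forall a, g (l a) = f a.
Proof.
move=> [[y ey] l0 ls] [z ez].
have /choice[u uP] : forall b, exists u : nat * A, l s ^+ u.1 * b = l u.2.
  by move=> b; have [m [a e]] := ls b; exists (m, a).
have zs m (x : C) : f s ^+ m * (z ^+ m * x) = x.
  by rewrite mulrA -exprMn ez expr1n mul1r.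
have sI m (x x' : C) : f s ^+ m * x = f s ^+ m * x' -> x = x'.
  move=> e; rewrite -(zs m x) -(zs m x') mulrCA e; by rewrite mulrCA.
have lf a a' : l a = l a' -> f a = f a'.
  move=> e; have [|m em] := l0 (a - a'); first by rewrite rmorphB e subrr.
  apply: (sI m); apply/eqP; rewrite -subr_eq0 -mulrBr -rmorphB -rmorphXn.
  by rewrite -rmorphM em rmorph0.
(* As [z] inverts [f s], this is the fraction [f (u b).2 / f s ^ (u b).1]; [gP] shows that every
   other fraction for [b] gives the same value. *)
pose g b := z ^+ (u b).1 * f (u b).2.
have gP b m a : l s ^+ m * b = l a -> f s ^+ m * g b = f a.
  move=> e; apply: (sI (u b).1); rewrite mulrCA /g zs.
  rewrite -!rmorphXn -!rmorphM; apply: lf; rewrite !rmorphM !rmorphXn -uP -e.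
  by rewrite mulrCA.
have gB : zmod_morphism g.
  move=> b b'; set m := (u b).1; set m' := (u b').1.
  apply: (sI (m + m')%N).
  rewrite (gP _ _ (s ^+ m' * (u b).2 - s ^+ m * (u b').2)).
    rewrite rmorphB !rmorphM !rmorphXn -(gP b _ _ (uP b)) -(gP b' _ _ (uP b')).
    by rewrite mulrBr !exprD; congr (_ - _); rewrite !mulrA [f s ^+ m * _]mulrC.
  rewrite rmorphB !rmorphM !rmorphXn -!uP mulrBr !exprD.
  by congr (_ - _); rewrite !mulrA // [l s ^+ _ * _]mulrC.
have gM : monoid_morphism g.
  split=> [|b b'].
    apply: (sI 0%N); rewrite (gP _ 0%N 1) ?expr0 ?mul1r ?rmorph1 //.
  apply: (sI ((u b).1 + (u b').1)%N).
  rewrite (gP _ _ ((u b).2 * (u b').2)).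
    rewrite rmorphM -(gP b _ _ (uP b)) -(gP b' _ _ (uP b')).
    by rewrite exprD mulrACA.
  by rewrite rmorphM -!uP exprD mulrACA.
have gl a : g (l a) = f a.
  by have := gP (l a) 0%N a; rewrite !expr0 !mul1r; apply.
unshelve eexists (@AlgHom R B C (rmorph_of gB gM) _); last exact: gl.
by move=> r /=; rewrite -(hom_in l) gl hom_in.
Qed.
End Localization.

(** * Polynomial rings and presentations *)

Fixpoint mp (R : comNzRingType) (n : nat) : comNzRingType :=
  if n is m.+1 then ({poly mp R m} : comNzRingType) else R.

Fixpoint mpC (R : comNzRingType) (n : nat) : {rmorphism R -> mp R n} :=
  match n return {rmorphism R -> mp R n} with
  | 0%N => (idfun : {rmorphism R -> R})
  | m.+1 => (polyC \o mpC R m : {rmorphism R -> {poly mp R m}})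
  end.

(** The variable [ord0] is the outermost one and [ord_max] the innermost; eliminating variables from
    the outside leaves [ord_max]. *)
Fixpoint mpX (R : comNzRingType) (n : nat) : 'I_n -> mp R n :=
  match n return 'I_n -> mp R n with
  | 0%N => fun=> 0
  | m.+1 => fun i => if unlift ord0 i is Some j then (mpX R j)%:P else 'X
  end.

Arguments mpX R {n} _.

Definition mp_alg (R : comNzRingType) n : algebra R := @Algebra R (mp R n) (mpC R n).

Lemma hom_peval (R : comPzRingType) (A B : algebra R) (f : alghom A B) n
  (a : 'I_n -> A) e : f (peval a e) = peval (f \o a) e.
Proof.
by elim: e => [r|i|e1 IH1 e2 IH2|e1 IH1 e2 IH2] //=;
  rewrite ?hom_in ?rmorphD ?rmorphM ?IH1 ?IH2.
Qed.

Lemma peval_ext (R : comPzRingType) (A : algebra R) n (a b : 'I_n -> A) e :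
  a =1 b -> peval a e = peval b e.
Proof.
by move=> ab; elim: e => //= e1 -> e2 ->.
Qed.

Fixpoint plift R n (e : pexpr R n) : pexpr R n.+1 :=
  match e with
  | PConst r => PConst _ r
  | PVar i => PVar _ (lift ord0 i)
  | PAdd e1 e2 => PAdd (plift e1) (plift e2)
  | PMul e1 e2 => PMul (plift e1) (plift e2)
  end.

Lemma mp_pexpr (R : comNzRingType) n (q : mp R n) :
  exists e, q = peval (mpX R : 'I_n -> mp_alg R n) e.
Proof.
elim: n q => [|n IH] q; first by exists (PConst _ q).
have liftE (e : pexpr R n) :
    peval (mpX R : 'I_n.+1 -> mp_alg R n.+1) (plift e) =
    (peval (mpX R : 'I_n -> mp_alg R n) e)%:P.
  elim: e => [r|i|e1 IH1 e2 IH2|e1 IH1 e2 IH2] //=.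
  - by rewrite liftK.
  - by rewrite IH1 IH2 polyCD.
  - by rewrite IH1 IH2 polyCM.
elim/poly_ind: q => [|q c [e ->]].
  by exists (PConst _ 0); rewrite /= rmorph0.
have [e' ->] := IH c.
exists (PAdd (PMul e (PVar _ ord0)) (plift e')) => /=.
by rewrite unlift_none liftE.
Qed.

Lemma mp_eval (R : comNzRingType) n (A : algebra R) (a : 'I_n -> A) :
  exists g : alghom (mp_alg R n) A, forall i, g (mpX R i) = a i.
Proof.
elim: n A a => [|n IH] A a.
  by exists (@AlgHom R (mp_alg R 0) A (alg_in A) (fun=> erefl)) => -[].
have [g gE] := IH A (a \o lift ord0).
case: (eqVneq (1 : A) 0) => [e1|n1].
  have z (x y : A) : x = y by rewrite -[x]mul1r -[y]mul1r e1 !mul0r.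
  have [fB fM] : zmod_morphism (fun _ : mp R n.+1 => 0 : A) /\
     monoid_morphism (fun _ : mp R n.+1 => 0 : A) by split; [|split].
  unshelve eexists (@AlgHom R (mp_alg R n.+1) A (rmorph_of fB fM) _) => *;
    exact: z.
pose A1 := nz_ring n1; pose g1 : {rmorphism mp R n -> A1} := g.
have cg : commr_rmorph g1 (a ord0) by move=> x; apply: mulrC.
pose h : {rmorphism {poly mp R n} -> A1} := horner_morph cg.
unshelve eexists (@AlgHom R (mp_alg R n.+1) A h _) => [r|i].
  by rewrite /= /h horner_morphC -(hom_in g).
rewrite /=; case: unliftP => [j ->|->]; first by rewrite /h horner_morphC; apply: gE.
by rewrite /h horner_morphX.
Qed.

Lemma mp_hom_eq (R : comNzRingType) n (A : algebra R) (g h : alghom (mp_alg R n) A) :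
  (forall i, g (mpX R i) = h (mpX R i)) -> g =1 h.
Proof.
by move=> e q; have [x ->] := mp_pexpr q; rewrite !hom_peval; apply: peval_ext.
Qed.

Lemma pres_exists (R : comNzRingType) n (rels : pexpr R n -> Prop) :
  exists (A : algebra R) (a : 'I_n -> A), presents a rels.
Proof.
pose x := mpX R : 'I_n -> mp_alg R n.
pose J := idgen (fun q => exists2 e, rels e & q = peval x e).
exists (quo_alg (A := mp_alg R n) J), (quo_hom (A := mp_alg R n) J \o x).
split=> [e he|B b hb].
  by rewrite -hom_peval; apply/quo_homK; apply: idgen_mem; exists e.
split=> [|f g e y].
  have [g gE] := mp_eval b.
  have [|h hE] := @quo_lift _ _ _ J g.
    apply: (@idgen_min _ _ (preim_ideal g (zero_ideal _))) => _ [e he ->] /=.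
    by rewrite hom_peval -(hb e he); apply: peval_ext.
  by exists h => i; rewrite -gE -hE.
have [q <-] := quo_surj y.
exact: (@mp_hom_eq _ _ _ (alg_comp f (quo_hom J)) (alg_comp g (quo_hom J))).
Qed.

Section Presented.
Variables (R : comNzRingType) (n : nat) (A : algebra R) (a : 'I_n -> A).
Variable rels : pexpr R n -> Prop.
Hypothesis aP : presents a rels.

(** The universal property yields a map [f] from [A] to the quotient of the polynomial ring by the
    relations, and [h] goes back; surjectivity and kernel of [g] are read off that quotient. *)
Lemma pres_mp : exists g : alghom (mp_alg R n) A,
  [/\ forall i, g (mpX R i) = a i, forall y, exists q, g q = y &
      forall q, g q = 0 <->
        idgen (fun q => exists2 e, rels e & q = peval (mpX R : _ -> mp_alg R n) e) q].
Proof.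
have [g gE] := mp_eval a; exists g.
pose x := mpX R : 'I_n -> mp_alg R n.
pose J := idgen (fun q => exists2 e, rels e & q = peval x e).
have [|[f fE] _] := aP.2 (quo_alg (A := mp_alg R n) J) (quo_hom (A := mp_alg R n) J \o x).
  move=> e he; rewrite -hom_peval; apply/quo_homK; apply: idgen_mem; by exists e.
have fg q : f (g q) = quo_hom (A := mp_alg R n) J q.
  apply: (@mp_hom_eq _ _ _ (alg_comp f g) (quo_hom J)) => i /=.
  by rewrite gE fE.
have gJ q : J q -> g q = 0.
  apply: (@idgen_min _ _ (preim_ideal g (zero_ideal _))) => _ [e he ->] /=.
  by rewrite hom_peval -[RHS](aP.1 e he); apply: peval_ext.
split; first exact: gE; last first.
  move=> q; split=> [e|]; last exact: gJ.
  by apply/(@quo_homK _ (mp_alg R n)); rewrite -fg e rmorph0.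
move=> y.
have [h hE] := quo_lift gJ.
have /aP.2[_ u] : forall e, rels e -> peval a e = 0 by case: aP.
have [q qE] := quo_surj (f y).
exists q; rewrite -hE qE; apply: (u (alg_comp h f) (alg_id A)) => i /=.
by rewrite fE /= hE gE.
Qed.

Lemma pres_gen (y : A) : exists e, y = peval a e.
Proof.
have [g [gE gs _]] := pres_mp; have [q <-] := gs y.
have [e ->] := mp_pexpr q; exists e; rewrite hom_peval; exact: peval_ext.
Qed.

Lemma pres_hom (B : algebra R) (b : 'I_n -> B) :
  (forall e, rels e -> peval b e = 0) ->
  exists f : alghom A B, forall i, f (a i) = b i.
Proof. by move=> h; case: (aP.2 B b h). Qed.

Lemma pres_eq (B : algebra R) (f g : alghom A B) :
  (forall i, f (a i) = g (a i)) -> f =1 g.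
Proof.
move=> e y; have [x ->] := pres_gen y; rewrite !hom_peval; exact: peval_ext.
Qed.

Lemma pres_rel (B : algebra R) (f : alghom A B) e :
  rels e -> peval (f \o a) e = 0.
Proof. by move=> he; rewrite -hom_peval (aP.1 _ he) rmorph0. Qed.
End Presented.

Lemma loc_gen (R : comPzRingType) (A : algebra R) n (a : 'I_n -> A) (B : algebra R) (l : alghom A B) s :
  (forall y : A, exists e, y = peval a e) -> is_localization l s ->
  exists b : 'I_n.+1 -> B, forall y, exists e, y = peval b e.
Proof.
move=> ag [[w we] _ ls].
pose b i := if unlift ord0 i is Some j then l (a j) else w.
exists b => y; have [m [c cE]] := ls y; have [e eE] := ag c.
have bl e' : peval b (plift e') = l (peval a e').
  rewrite hom_peval; elim: e' => [r|i|e1 IH1 e2 IH2|e1 IH1 e2 IH2] //=.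
  - by rewrite /b liftK.
  - by rewrite IH1 IH2.
  - by rewrite IH1 IH2.
have yE : y = w ^+ m * l c by rewrite -cE mulrA -exprMn [w * _]mulrC we expr1n mul1r.
exists (iter m (PMul (PVar _ ord0)) (plift e)); rewrite yE eE.
elim: m {cE yE} => [|m IH]; first by rewrite expr0 mul1r bl.
by rewrite iterS /= /b unlift_none -/b -IH exprS mulrA.
Qed.

(** * Zariski's lemma and the Nullstellensatz *)

Section SubringIntegral.
Variables (F : fieldType) (S : {pred F}).

Definition intg (x : F) := exists p : {poly F},
  [/\ p \is monic, forall i, p`_i \in S & root p x].

(** A copy of [S] that carries the closure proof, so that ring structures can be attached to a
    variable predicate. *)
Definition sr_pred (h : subring_closed S) : {pred F} := S.
Hypothesis SP : subring_closed S.
Local Notation S' := sr_pred.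
Record srt := Srt { srt_val : F; _ : srt_val \in S' SP }.
Fact srt_closed : subring_closed (S' SP). Proof. exact: SP. Qed.
HB.instance Definition _ := [isSub for srt_val].
HB.instance Definition _ := [Choice of srt by <:].
HB.instance Definition _ := GRing.isSubringClosed.Build F (S' SP) srt_closed.
HB.instance Definition _ := [SubChoice_isSubComNzRing of srt by <:].

Lemma intgE x : intg x <-> integralOver (\val : srt -> F) x.
Proof.
split=> [[p [pm pS rp]]|[p pm rp]].
  apply: (integral_root_monic pm rp) => y /(nthP 0)[i _ <-].
  have -> : p`_i = \val (Srt (pS i : _ \in S' SP)) by [].
  exact: integral_id.
exists (map_poly \val p); split=> //; first exact: monic_map.
by move=> i; rewrite coef_map; case: (p`_i).
Qed.
Lemma intg_id x : x \in S -> intg x.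
Proof.
move=> xS; apply/intgE; have -> : x = \val (Srt (xS : _ \in S' SP)) by [].
exact: integral_id.
Qed.
Lemma intgD x y : intg x -> intg y -> intg (x + y).
Proof. by move=> /intgE hx /intgE hy; apply/intgE/integral_add. Qed.
Lemma intgM x y : intg x -> intg y -> intg (x * y).
Proof. by move=> /intgE hx /intgE hy; apply/intgE/integral_mul. Qed.
Lemma intgX x n : intg x -> intg (x ^+ n).
Proof.
move=> h; elim: n => [|n IH]; last by rewrite exprS; apply: intgM.
by rewrite expr0; apply: intg_id; case: SP.
Qed.
Lemma intg_sum n (f : 'I_n -> F) : (forall i, intg (f i)) -> intg (\sum_i f i).
Proof.
move=> h; apply: big_ind => //; last exact: intgD.
by apply: intg_id; have [h1 hB _] := SP; rewrite -(subrr 1); apply: (hB).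
Qed.
End SubringIntegral.

Lemma intg_sub (F : fieldType) (S T : {pred F}) x :
  {subset S <= T} -> intg S x -> intg T x.
Proof. by move=> h [p [pm pS rp]]; exists p; split=> // i; apply: h. Qed.

Lemma recip_root (F : fieldType) (p : {poly F}) x : x != 0 -> p.[x] = 0 ->
  (\poly_(i < size p) p`_((size p).-1 - i)).[x^-1] = 0.
Proof.
move=> x0 h; rewrite horner_poly; set m := (size p).-1.
apply: (mulfI (expf_neq0 m x0)); rewrite mulr0; transitivity p.[x] => //.
rewrite horner_coef mulr_sumr.
rewrite (reindex_inj rev_ord_inj); apply: eq_bigr => i _ /=.
have im : (i <= m)%N by rewrite /m; case: (size p) i => [[]|n i] //=; rewrite -ltnS.
have -> : (size p - i.+1 = m - i)%N by rewrite /m -subn1 -subnDA add1n.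
rewrite subKn // mulrCA; congr (_ * _).
by rewrite -{1}(subnK im) addnC exprD -mulrA -exprMn divff // expr1n mulr1.
Qed.

Section Fractions.
Variables (R : comNzRingType) (F : fieldType) (f : {rmorphism R -> F}) (s : R).
Hypothesis s0 : f s != 0.
(** The image of [R[1/s]] in [F]. *)
Definition frs : {pred F} := fun x => `[< exists N r, x * f s ^+ N = f r >].
Lemma frsP x : reflect (exists N r, x * f s ^+ N = f r) (x \in frs).
Proof. exact: asboolP. Qed.
Lemma frs_im r : f r \in frs.
Proof. by apply/frsP; exists 0%N, r; rewrite expr0 mulr1. Qed.
Lemma frs_closed : subring_closed frs.
Proof.
split=> [|x y /frsP[N [r hr]] /frsP[M [t ht]]|x y /frsP[N [r hr]] /frsP[M [t ht]]].
- by rewrite -(rmorph1 f) frs_im.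
- apply/frsP; exists (N + M)%N, (r * s ^+ M - t * s ^+ N).
  rewrite rmorphB !rmorphM !rmorphXn -hr -ht mulrBl exprD.
  by congr (_ - _); [rewrite mulrA | rewrite mulrAC -!mulrA].
- apply/frsP; exists (N + M)%N, (r * t).
  by rewrite rmorphM -hr -ht exprD mulrACA.
Qed.
Lemma frs_div r : f r / f s \in frs.
Proof. by apply/frsP; exists 1%N, r; rewrite expr1 divfK. Qed.
End Fractions.

Lemma frs_subl (R : comNzRingType) (F : fieldType) (f : {rmorphism R -> F}) s t :
  {subset frs f s <= frs f (s * t)}.
Proof.
move=> x /frsP[N [r hr]]; apply/frsP; exists N, (r * t ^+ N).
by rewrite rmorphM exprMn mulrA hr rmorphM rmorphXn.
Qed.

(* A nonzero [s] becomes a field after inverting one element; this passes  *)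
(* from [R[x]] to [R], which is the inductive step of Zariski's lemma.      *)
Definition near_field (R : comNzRingType) (F : fieldType) (f : {rmorphism R -> F}) :=
  exists2 s : R, f s != 0 &
    forall d, f d != 0 -> exists N d', f d * f d' = f s ^+ N.

Section ZariskiStep.
Variables (R : comNzRingType) (F : fieldType) (g : {rmorphism {poly R} -> F}).
Variables (f : {rmorphism R -> F}).
Hypothesis gC : forall r, g r%:P = f r.
Let b := g 'X.

Lemma poly_evalE q : g q = (map_poly f q).[b].
Proof.
have cg : commr_rmorph f b by move=> x; apply: mulrC.
rewrite -[RHS]/(horner_morph cg q).
elim/poly_ind: q => [|q c IH]; first by rewrite !rmorph0.
by rewrite !rmorphD !rmorphM IH gC /= horner_morphX horner_morphC.
Qed.

(** Otherwise evaluation at [g 'X] kills no nonzero polynomial, and the condition on [t], applied to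
    [1 + 'X * t], becomes an identity of polynomials: the nonconstant [1 + 'X * T] divides a power
    of [T], to which it is coprime. *)
Lemma near_field_alg : near_field g -> exists2 q, g q = 0 & map_poly f q != 0.
Proof.
move=> [t t0 tP]; apply: contrapT => trans.
have inj q : map_poly f q != 0 -> g q != 0.
  by move=> q0; apply/eqP => e; apply: trans; exists q.
pose T := map_poly f t.
have T0 : T != 0 by apply: contraNneq t0 => e; rewrite poly_evalE -/T e horner0.
have sq : size (1 + 'X * T) = (size T).+1.
  rewrite addrC mulrC size_polyDl ?size_mulX // size_poly1 ltnS.
  by rewrite size_poly_gt0.
have [q1 mq] : exists q1, map_poly f q1 = 1 + 'X * T.
  by exists (1 + 'X * t); rewrite rmorphD rmorphM rmorph1 /= map_polyX.
have q0 : map_poly f q1 != 0.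
  by rewrite mq -size_poly_eq0 sq.
have [N [d e]] := tP _ (inj _ q0).
have {}e : (1 + 'X * T) * map_poly f d = T ^+ N.
  apply/eqP; rewrite -subr_eq0; apply/negP => /negP ne.
  have mE : map_poly f (q1 * d - t ^+ N) = (1 + 'X * T) * map_poly f d - T ^+ N.
    by rewrite [LHS]rmorphB rmorphM rmorphXn /= mq.
  have := inj (q1 * d - t ^+ N); rewrite mE => /(_ ne).
  by rewrite rmorphB rmorphM rmorphXn e subrr eqxx.
have cop : coprimep (1 + 'X * T) (T ^+ N).
  apply: coprimep_expr; apply/Bezout_coprimepP; exists (1, - 'X).
  by rewrite mul1r mulNr addrK eqpxx.
have : 1 + 'X * T %= 1.
  by move/coprimepP: cop; apply; rewrite // -e dvdp_mulIl.
by move/eqp_size; rewrite sq size_poly1 => -[] /eqP; rewrite size_poly_eq0 (negPf T0).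
Qed.

(** An equation for [b] with leading coefficient [c] makes the image of [g] integral over [R[1/c]];
    inverting also the constant term of an equation for [g t] makes [(g t)^-1] integral. Then
    [(f u)^-1] is integral over [R[1/s]], hence belongs to it. *)
Lemma near_field_step : near_field g -> near_field f.
Proof.
move=> h; have [q gq q0] := near_field_alg h; have [t t0 tP] := h.
(* Leading terms killed by [f] are removed until [f] preserves the degree. *)
have {q gq q0} [q [gq sq q0]] : exists q : {poly R},
    [/\ g q = 0, size (map_poly f q) = size q & q != 0].
  have [n] := ubnP (size q); elim: n q gq q0 => // n IH q gq q0 sq.
  have qn0 : q != 0 by apply: contraNneq q0 => ->; rewrite rmorph0.
  case: (eqVneq (f (lead_coef q)) 0) => [l0|l0]; last first.
    by exists q; rewrite size_map_poly_id0.
  pose q' := take_poly (size q).-1 q.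
  have qE : q = q' + (lead_coef q)%:P * 'X^((size q).-1).
    apply/polyP => i; rewrite coefD coef_take_poly mul_polyC coefZ coefXn.
    case: (ltngtP i (size q).-1) => [_|hi|->].
    - by rewrite mulr0 addr0.
    - rewrite mulr0 addr0 nth_default //; by rewrite (polySpred qn0).
    - by rewrite mulr1 add0r lead_coefE.
  apply: (IH q').
  - by rewrite -gq [in RHS]qE rmorphD rmorphM /= gC l0 mul0r addr0.
  - by move: q0; rewrite [in X in X -> _]qE rmorphD rmorphM /= map_polyC /= l0 mul0r addr0.
  - apply: leq_ltn_trans (size_take_poly _ _) _.
    by move: sq; rewrite (polySpred qn0).
pose c := lead_coef q; pose P := map_poly f q.
have Pl : lead_coef P = f c.
  by rewrite lead_coefE sq coef_map.
have P0 : P != 0 by rewrite -size_poly_eq0 sq size_poly_eq0.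
have c0 : f c != 0 by rewrite -Pl lead_coef_eq0.
have bP : intg (frs f c) b.
  exists ((f c)^-1 *: P); split.
  - by rewrite monicE lead_coefZ Pl mulVf.
  - by move=> i; rewrite coefZ coef_map mulrC frs_div.
  - by rewrite rootZ ?invr_eq0 // /root -poly_evalE gq.
have Sc := frs_closed f c.
have gint u : intg (frs f c) (g u).
  rewrite poly_evalE horner_coef; apply: (intg_sum Sc) => i.
  by apply: (intgM Sc); [apply: (intg_id Sc); rewrite coef_map frs_im|exact: intgX].
(* Since [g t] is nonzero, factors ['X] can be divided out until the constant term is nonzero. *)
have [p [pm pS rp p00]] : exists p : {poly F}, [/\ p \is monic,
    forall i, p`_i \in frs f c, root p (g t) & p`_0 != 0].
  have [p [pm pS rp]] := gint t.
  have [n] := ubnP (size p); elim: n p pm pS rp => // n IH p pm pS rp sp.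
  case: (eqVneq p`_0 0) => [e|]; last by exists p.
  have [p' pE] : exists p', p = p' * 'X.
    exists (drop_poly 1 p).
    by rewrite -{1}(poly_take_drop 1 p) expr1 (_ : take_poly 1 p = 0) ?add0r //;
       apply/polyP => -[|i]; rewrite coef_take_poly coef0.
  have p'm : p' \is monic by move: pm; rewrite pE monicMr ?monicX.
  apply: (IH p') => //.
  - by move=> i; move: (pS i.+1); rewrite pE coefMX.
  - by move: rp; rewrite pE rootM rootX (negPf t0) orbF.
  - by move: sp; rewrite pE size_mulX ?monic_neq0.
have /frsP[N [d hd]] := pS 0%N.
have d0 : f d != 0 by rewrite -hd mulf_neq0 ?expf_neq0.
pose s := c * d; have s0 : f s != 0 by rewrite rmorphM mulf_neq0.
have Ss := frs_closed f s.
have cs x : intg (frs f c) x -> intg (frs f s) x.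
  by apply: intg_sub; apply: frs_subl.
have tV : intg (frs f s) (g t)^-1.
  have p'S i : p`_i / p`_0 \in frs f s.
    have [_ _ SM] := Ss; apply: SM; first exact: frs_subl (pS i).
    apply/frsP; exists 1%N, (c ^+ N * c); rewrite expr1.
    apply: (mulfI p00); rewrite mulrA mulfV // mul1r /s !rmorphM rmorphXn.
    by rewrite -hd mulrCA; congr (_ * _); rewrite mulrC.
  exists (\poly_(i < size p) (p`_((size p).-1 - i) / p`_0)); split.
  - have sp0 : (0 < size p)%N by rewrite size_poly_gt0 monic_neq0.
    rewrite monicE lead_coefE size_poly_eq ?subnn ?divff ?oner_eq0 //.
    by rewrite coef_poly prednK // leqnn subnn divff.
  - move=> i; rewrite coef_poly; case: ifP => _; first exact: p'S.
    by have [h1 hB _] := Ss; rewrite -(subrr 1); apply: (hB).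
  - have e0 := recip_root t0 (rootP rp); rewrite horner_poly in e0.
    have E := congr1 ( *%R (p`_0)^-1) e0; rewrite mulr0 mulr_sumr in E.
    rewrite /root horner_poly; apply/eqP; rewrite -[RHS]E.
    by apply: eq_bigr => i _; rewrite mulrA [_ / _]mulrC.
exists s => // u u0; have [M [u' eu]] : exists M u', f u * g u' = g t ^+ M.
  by rewrite -gC; apply: tP; rewrite gC.
have tM0 : g t ^+ M != 0 by apply: expf_neq0.
have uV : (f u)^-1 = g u' * (g t)^-1 ^+ M.
  by apply: (mulfI u0); rewrite mulfV // mulrA eu exprVn divff.
have : intg (frs f s) (f u)^-1.
  by rewrite uV; apply: (intgM Ss); [apply: cs|apply: intgX].
move=> [e [em eS re]].
(* Multiplying the monic equation of [(f u)^-1] by a power of [f u] expresses [(f u)^-1] by elements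
   of the ring. *)
have /frsP[K [r hr]] : (f u)^-1 \in frs f s.
  have se : (1 < size e)%N.
    rewrite ltnNge; apply/negP => /size1_polyC ee; move: em re; rewrite ee.
    by rewrite monicE lead_coefC => /eqP ->; rewrite rootC oner_eq0.
  have := rootP re; rewrite horner_coef (polySpred (monic_neq0 em)) big_ord_recr /=.
  rewrite -lead_coefE (monicP em) mul1r => /eqP; rewrite addrC addr_eq0 => /eqP E.
  have -> : (f u)^-1 = - \sum_(i < (size e).-1) e`_i * f u ^+ ((size e).-2 - i).
    have -> : (f u)^-1 = (f u)^-1 ^+ (size e).-1 * f u ^+ (size e).-2.
      case: (size e) se => [|[|m]] // _ /=.
      by rewrite exprS -mulrA -exprMn mulVf // expr1n mulr1.
    rewrite E mulNr mulr_suml; congr (- _); apply: eq_bigr => i _.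
    rewrite -mulrA; congr (_ * _).
    have im : (i <= (size e).-2)%N by case: (size e) se i => [|[|m]] // _ [i /=].
    by rewrite -{1}(subnK im) addnC exprD mulrA -exprMn mulVf // expr1n mul1r.
  have [h1 hB hM] := Ss.
  have h0 : 0 \in frs f s by rewrite -(subrr 1); apply: (hB).
  rewrite -sub0r; apply: (hB) => //.
  apply: (big_ind (fun x => x \in frs f s)) => // [x y hx hy|i _].
    by rewrite -[y]opprK -[- y]sub0r; apply: (hB) => //; apply: (hB).
  apply: (hM); first exact: eS.
  by rewrite -rmorphXn frs_im.
exists K, r; by rewrite -hr mulrA divff // mul1r.
Qed.
End ZariskiStep.

(** [near_field_step] strips the outer variables one by one; the last variable is then algebraic
    over [k], whose polynomials split. *)
Lemma innermost_scalar (k : closedFieldType) n (F : fieldType)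
    (h : {rmorphism mp k n.+1 -> F}) :
  near_field h -> exists c, h (mpX k ord_max) = h (mpC k n.+1 c).
Proof.
elim: n h => [|n IH] h hh.
  pose f : {rmorphism k -> F} := h \o polyC.
  have [q hq q0] := @near_field_alg _ _ h f (fun=> erefl) hh.
  have q00 : q != 0 by apply: contraNneq q0 => ->; rewrite rmorph0.
  have [r qE] := closed_field_poly_normal q.
  have -> : mpX k (ord_max : 'I_1) = 'X by rewrite /= (_ : ord_max = ord0) ?unlift_none //; apply: val_inj.
  move: hq; rewrite (poly_evalE (f := f)) // => hq.
  suff : has (fun c => h 'X == f c) r.
    by case/hasP => c _ /eqP e; exists c.
  apply/negPn/negP => nh; move/eqP: hq; rewrite {1}qE map_polyZ hornerZ mulf_eq0 fmorph_eq0.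
  rewrite lead_coef_eq0 (negPf q00) /= rmorph_prod horner_prod.
  rewrite prodf_seq_eq0 => /hasP[c cr]; rewrite rmorphB /= map_polyX map_polyC.
  rewrite hornerXsubC subr_eq0 => e; case/hasP: nh; by exists c.
pose f : {rmorphism mp k n.+1 -> F} := h \o polyC.
have [c e] := IH f (@near_field_step _ _ h f (fun=> erefl) hh).
exists c; rewrite [RHS]/= -[RHS]e /f.
rewrite [mpX]lock /= -lock; congr (h _) => /=.
by have -> : (ord_max : 'I_n.+2) = lift ord0 ord_max; [apply: val_inj|rewrite liftK].
Qed.

Lemma nullstellensatz (k : closedFieldType) n (I : ideal (mp k n)) : ~ I 1 ->
  exists g : alghom (mp_alg k n) (self_alg k), forall q, I q -> g q = 0.
Proof.
move=> /ideal_field[F [f [fs fI]]].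
pose FA : algebra k := @alg_over k (mp_alg k n) F f.
pose f' : alghom (mp_alg k n) FA := @over_hom k (mp_alg k n) F f.
(* A further innermost variable takes the value of the [i]-th one, so that [innermost_scalar]
   applies to each coordinate. As [f] is onto a field, inverses lie in the image. *)
have sc i : exists c, f (mpX k i) = f (mpC k n c).
  pose a (j : 'I_n.+1) := if unlift ord_max j is Some j' then f (mpX k j') else f (mpX k i).
  have [h hE] := @mp_eval k n.+1 FA a.
  have /choice[w wE] : forall q : mp k n, exists y : mp k n.+1, h y = f q.
    move=> q; have [e ->] := mp_pexpr q; elim: e => [r|j|e1 [w1 h1] e2 [w2 h2]|e1 [w1 h1] e2 [w2 h2]].
    - by exists (mpC k n.+1 r); rewrite [LHS](hom_in h).
    - by exists (mpX k (lift ord_max j)); rewrite hE /a liftK.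
    - by exists (w1 + w2); rewrite /= !rmorphD h1 h2.
    - by exists (w1 * w2); rewrite /= !rmorphM h1 h2.
  have [|c hc] := @innermost_scalar k n F (h : {rmorphism mp k n.+1 -> F}).
    exists 1; rewrite ?rmorph1 ?oner_eq0 // => d d0.
    have [q qE] := fs (h d)^-1; exists 0%N, (w q).
    by rewrite wE qE divff // expr0.
  exists c; move: hc; rewrite hE /a unlift_none => ->; exact: (hom_in h).
have /choice[c cP] := sc.
have [g gE] := @mp_eval k n (self_alg k) c; exists g => q Iq.
pose kF : alghom (self_alg k) FA := @AlgHom k (self_alg k) FA (alg_in FA) (fun=> erefl).
have fc : f' =1 alg_comp kF g.
  by apply: mp_hom_eq => i /=; rewrite gE cP.
have /eqP : f' q = 0 by apply: fI.
rewrite fc /= => /eqP e; apply/eqP.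
have /eqP : (f \o mpC k n) (g q) = 0 by [].
by rewrite (fmorph_eq0 (f \o mpC k n : {rmorphism k -> F})).
Qed.

(** [A / J] is a finitely generated algebra over [k], because [red] is onto and its kernel is sent
    into [J]. *)
Lemma closed_point (R : comNzRingType) (k : closedFieldType) (red : {rmorphism R -> k})
    n (A : algebra R) (a : 'I_n -> A) (J : ideal A) :
  (forall y, exists x, red x = y) -> (forall y : A, exists e, y = peval a e) ->
  (forall r, red r = 0 -> J (alg_in A r)) -> ~ J 1 ->
  exists f : alghom A (Algebra red), forall x, J x -> f x = 0.
Proof.
move=> rs ag Jr J1.
have [h hE] : exists h : {rmorphism k -> quo J}, forall r, h (red r) = qpi J (alg_in A r).
  apply: (surj_factor (g := qpi J \o alg_in A : {rmorphism R -> quo J}) rs) => r /Jr ?.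
  exact/qpi0.
pose B : algebra k := Algebra h.
have [g gE] := @mp_eval k n B (qpi J \o a).
have gs (y : quo J) : exists q, g q = y.
  rewrite -[y]qpiK; have [e ->] := ag (quo_val y).
  elim: e => [r|i|e1 [q1 h1] e2 [q2 h2]|e1 [q1 h1] e2 [q2 h2]].
  - by exists (mpC k n (red r)); rewrite /= -hE; exact: (hom_in g).
  - by exists (mpX k i); rewrite gE.
  - by exists (q1 + q2); rewrite !rmorphD h1 h2.
  - by exists (q1 * q2); rewrite !rmorphM h1 h2.
have [|G GK] := @nullstellensatz k n (preim_ideal g (zero_ideal (quo J))).
  by rewrite /= rmorph1 -(rmorph1 (qpi J)) => /qpi0.
have [d dE] := surj_factor gs GK.
unshelve eexists (@AlgHom R A (Algebra red) (d \o qpi J : {rmorphism A -> k}) _).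
  move=> r /=; rewrite -hE -[h _](hom_in g) dE; exact: (hom_in G).
by move=> x /qpi0 /= ->; rewrite rmorph0.
Qed.

(** * Frobenius and smooth algebras *)

Lemma frob_add (A : comPzRingType) p (x y : A) : prime p ->
  exists z, (x + y) ^+ p = x ^+ p + y ^+ p + p%:R * (x * z).
Proof.
case: p => [|[|p]] // pp.
exists (\sum_(i < p.+1) ('C(p.+2, i.+1) %/ p.+2)%:R * (x ^+ (p - i) * y ^+ i.+1)).
rewrite exprDn big_ord_recl big_ord_recr /= /bump /= !add1n subn0 subnn bin0 binn.
rewrite !expr0 mulr1 mul1r !mulr1n -addrA [_ + y ^+ _]addrC; congr (_ + (_ + _)).
rewrite mulr_sumr mulr_sumr; apply: eq_bigr => i _.
rewrite !add1n -[LHS]mulr_natl; set C := 'C(_, _).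
have {1}-> : C = (p.+2 * (C %/ p.+2))%N.
  by rewrite mulnC divnK // prime_dvd_bin //= ltnS ltn_ord.
have -> : (p.+2 - i.+1 = (p - i).+1)%N by rewrite subSS subSn // -ltnS.
by rewrite exprS natrM -!mulrA; congr (_ * _); rewrite mulrCA.
Qed.

(** The ideal [I] records where the mixed terms lie; [frob_flat] needs them in the ideal of the
    equations. *)
Lemma frob_sum (A : comPzRingType) (I : ideal A) p (r : seq A) : prime p ->
  (forall x, x \in r -> I x) ->
  exists2 z, I z & (\sum_(x <- r) x) ^+ p = \sum_(x <- r) x ^+ p + p%:R * z.
Proof.
move=> pp; elim: r => [|x r IH] rI.
  by exists 0; rewrite ?big_nil ?mulr0 ?addr0 ?expr0n ?(gtn_eqF (prime_gt0 pp)) //; apply: id0.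
have [|z Iz ez] := IH; first by move=> y yr; apply: rI; rewrite inE yr orbT.
rewrite !big_cons; have [w ->] := frob_add x (\sum_(y <- r) y) pp.
exists (z + x * w); last by rewrite ez -!addrA mulrDr.
by apply: idD => //; apply/idMr/rI; rewrite inE eqxx.
Qed.

Lemma frob_sumT (A : comPzRingType) (I : ideal A) p (T : finType) (f : T -> A) :
  prime p -> (forall t, I (f t)) ->
  exists2 z, I z & (\sum_t f t) ^+ p = \sum_t f t ^+ p + p%:R * z.
Proof.
move=> pp fI; have [|z Iz] := @frob_sum A I p [seq f t | t <- index_enum T] pp.
  by move=> _ /mapP[t _ ->].
by rewrite !big_map => e; exists z.
Qed.

Definition multiple (A : comPzRingType) (a x : A) := exists y, x = a * y.

Definition mult_ideal (A : comPzRingType) (a : A) : ideal A.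
Proof.
exists (multiple a) => [|_ _ [y ->] [z ->]|b _ [y ->]].
- by exists 0; rewrite mulr0.
- by exists (y + z); rewrite mulrDr.
- by exists (b * y); rewrite mulrCA.
Defined.

Lemma frob_addm (A : comPzRingType) p (a x y : A) : prime p -> multiple a p%:R ->
  multiple a ((x + y) ^+ p - (x ^+ p + y ^+ p)).
Proof.
move=> pp ap; have [z ->] := frob_add x y pp.
by rewrite [_ + p%:R * _]addrC addrK; apply: (idMr (I := mult_ideal a)).
Qed.

(* Modulo [a], the ring is free over its image under Frobenius, with a basis *)
(* containing 1.                                                            *)
Definition pbasis (A : comPzRingType) (a : A) (p : nat) :=
  exists (T : finType) (b : T -> A) (t0 : T),
  [/\ b t0 = 1,
      forall c, exists d : T -> A, multiple a (c - \sum_t b t * d t ^+ p) &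
      forall d : T -> A, multiple a (\sum_t b t * d t ^+ p) ->
        forall t, multiple a (d t)].

Lemma multiple_poly (A : comNzRingType) (a : A) (q : {poly A}) :
  (forall i, multiple a q`_i) <-> multiple a%:P q.
Proof.
split=> [/choice[f fE]|[r ->] i]; last by exists r`_i; rewrite coefCM.
exists (\poly_(i < size q) f i); apply/polyP => i; rewrite coefCM coef_poly.
by case: ltnP => [_|h]; [exact: fE|rewrite mulr0 nth_default].
Qed.

(** The products of a basis for [A] with the powers ['X^i], [i < p], form one for [{poly A}]: a
    monomial of degree [m p + i] is ['X^i] times a [p]-th power, and distinct pairs [(m, i)] give
    distinct degrees. *)
Lemma pbasis_poly (A : comNzRingType) (a : A) p : prime p -> multiple a p%:R ->
  pbasis a p -> pbasis (a%:P : {poly A}) p.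
Proof.
move=> pp ap [T [b [t0 [b0 bE bU]]]]; have p0 := prime_gt0 pp.
have aPp : multiple a%:P (p%:R : {poly A}).
  by have [y e] := ap; exists y%:P; rewrite -polyCM -e polyC_natr.
pose I := mult_ideal (a%:P : {poly A}).
exists ((T * 'I_p)%type : finType), (fun u : T * 'I_p => (b u.1)%:P * 'X^(u.2)), (t0, Ordinal p0).
split=> [|c|d].
- by rewrite /= b0 mul1r expr0.
- pose Dec (c : {poly A}) := exists d : T * 'I_p -> {poly A},
    I (c - \sum_(u : T * 'I_p) (b u.1)%:P * 'X^(u.2) * d u ^+ p).
  have DD x y : Dec x -> Dec y -> Dec (x + y).
    move=> [d hd] [d' hd']; exists (fun u => d u + d' u).
    have h := idD hd hd'; rewrite addrACA -opprD in h; apply: (id_trans h).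
    have : I (\sum_(u : T * 'I_p) (b u.1)%:P * 'X^(u.2) *
       ((d u + d' u) ^+ p - (d u ^+ p + d' u ^+ p))).
      by apply: id_sum => u _; apply: idMl; apply: frob_addm.
    under eq_bigr do rewrite mulrBr mulrDr.
    by rewrite sumrB big_split /= => /(idBC (I := I)).
  have D0 : Dec 0.
    exists (fun=> 0); rewrite big1 ?subr0; first exact: id0.
    by move=> u _; rewrite expr0n gtn_eqF // mulr0.
  rewrite -[c]coefK poly_def; apply: (big_ind Dec) => // j _.
  have [d [e ed]] := bE c`_j.
  have jE : j = (j %/ p * p + j %% p)%N :> nat := divn_eq j p.
  pose i0 := Ordinal (ltn_pmod j p0).
  exists (fun u => if u.2 == i0 then (d u.1)%:P * 'X^(j %/ p) else 0).
  exists (e%:P * 'X^j); rewrite mulrA -polyCM -ed.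
  rewrite -(pair_bigA _ (fun t (i : 'I_p) => (b t)%:P * 'X^i *
     (if i == i0 then (d t)%:P * 'X^(j %/ p) else 0) ^+ p)) /=.
  rewrite polyCB mulrBl mul_polyC; congr (_ - _).
  rewrite raddf_sum mulr_suml; apply: eq_bigr => t _.
  rewrite (bigD1 i0) //= eqxx big1 ?addr0; last first.
    by move=> i /negPf ->; rewrite expr0n gtn_eqF // mulr0.
  rewrite exprMn -exprM polyCM rmorphXn -!mulrA; congr (_ * _).
  by rewrite mulrCA -exprD addnC -jE.
- move=> hd [t0' i0]; apply/multiple_poly => m0.
  (* The [p]-th power without its mixed terms, which are multiples of [a]; its coefficients are
     explicit. *)
  pose fr (q : {poly A}) := \sum_(m < size q) q`_m ^+ p *: 'X^(m * p).
  have frE q : I (q ^+ p - fr q).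
    rewrite -{1}[q]coefK poly_def.
    have [z _ ->] := @frob_sumT _ (idgen (fun=> True)) p _
      (fun m : 'I_(size q) => q`_m *: 'X^m) pp (fun t => @idgen_mem _ (fun=> True) _ Logic.I).
    rewrite (_ : \sum_t _ = fr q); last first.
      by apply: eq_bigr => m _; rewrite exprZn -exprM.
    by rewrite addrAC subrr add0r; apply: (idMr (I := I)).
  have : I (\sum_(u : T * 'I_p) (b u.1)%:P * 'X^(u.2) * fr (d u)).
    have : I (\sum_(u : T * 'I_p) (b u.1)%:P * 'X^(u.2) * (d u ^+ p - fr (d u))).
      by apply: id_sum => u _; apply: idMl.
    under eq_bigr do rewrite mulrBr.
    rewrite sumrB => /(idBC (I := I)) h.
    by have := idD h hd; rewrite subrK.
  move/multiple_poly/(_ (m0 * p + i0)%N).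
  have -> : \sum_(u : T * 'I_p) (b u.1)%:P * 'X^(u.2) * fr (d u) =
      \sum_t \sum_(i < p) (b t)%:P * 'X^i * fr (d (t, i)).
    by rewrite pair_bigA; apply: eq_bigr => -[].
  rewrite coef_sum (_ : \sum_t _ = \sum_t b t * (d (t, i0))`_m0 ^+ p).
    by move/bU; apply.
  apply: eq_bigr => t _; rewrite coef_sum (bigD1 i0) //= big1 ?addr0.
    rewrite -mulrA coefCM coefXnM ltnNge leq_addl /= addnK; congr (_ * _).
    rewrite coef_sum; case: (ltnP m0 (size (d (t, i0)))) => h.
      rewrite (bigD1 (Ordinal h)) //= coefZ coefXn eqxx mulr1 big1 ?addr0 //.
      move=> m /negPf nm; rewrite coefZ coefXn eqn_pmul2r // eq_sym.
      by rewrite (_ : (m : nat) == m0 = false) ?mulr0.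
    rewrite [in RHS]nth_default // expr0n gtn_eqF // big1 // => m _.
    rewrite coefZ coefXn eqn_pmul2r // gtn_eqF ?mulr0 //.
    exact: leq_trans (ltn_ord m) h.
  move=> i ni; rewrite -mulrA coefCM coefXnM; case: ltnP => hi; first by rewrite mulr0.
  rewrite coef_sum big1 ?mulr0 // => m _; rewrite coefZ coefXn.
  case: eqP => [e|]; rewrite ?mulr0 //.
  have : (m0 * p + i0 = m * p + i)%N by rewrite -e subnK.
  move/(congr1 (modn^~ p)); rewrite !modnMDl !modn_small // => /val_inj ei.
  by rewrite ei eqxx in ni.
Qed.

Lemma pbasis_mp (R : comNzRingType) (a : R) p n : prime p -> multiple a p%:R ->
  pbasis a p -> pbasis (mpC R n a) p /\ multiple (mpC R n a) p%:R.
Proof.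
move=> pp ap pb; elim: n => [|n [IH1 IH2]]; first by split.
split; first exact: pbasis_poly.
by have [y e] := IH2; exists y%:P; rewrite -[mpC R n.+1 a]/(mpC R n a)%:P -polyCM -e polyC_natr.
Qed.

(** Pigeonhole: a monomial of degree [m p + 1] in [m] elements contains one of them at least [p]
    times. So the ideal of the [f l] is nilpotent modulo their [p]-th powers. *)
Lemma prod_lincomb (A : comPzRingType) m p (f : 'I_m -> A) (a : 'I_(m * p).+1 -> A) :
  (forall i, lincomb_ideal f (a i)) ->
  lincomb_ideal (fun l => f l ^+ p) (\prod_i a i).
Proof.
move=> /choice[c cE]; under eq_bigr do rewrite cE.
rewrite bigA_distr_bigA; apply: id_sum => s _.
rewrite big_split; apply: idMl.
have [l lP] : exists l, (p <= #|[set i | s i == l]|)%N.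
  apply/existsP; apply: contraT => /existsPn h.
  have : (#|'I_(m * p).+1| <= m * p)%N; last by rewrite card_ord ltnn.
  rewrite -sum1_card (partition_big s predT) //=.
  apply: (@leq_trans (\sum_(l < m) p)); last by rewrite sum_nat_const card_ord.
  apply: leq_sum => l _; rewrite sum1dep_card.
  by apply: ltnW; rewrite ltnNge; exact: h.
rewrite (bigID (fun i => s i == l)); apply: idMr.
rewrite (eq_bigr (fun=> f l)); last by move=> i /eqP ->.
rewrite prodr_const; set c0 := #|_|.
have lc : (p <= c0)%N by rewrite /c0 -cardsE; exact: lP.
rewrite -(subnK lc) exprD; apply: idMl.
exact: (lincomb_mem (fun l => f l ^+ p)).
Qed.

Section FrobeniusTrick.
Variables (P : comNzRingType) (a : P) (p : nat).
Hypotheses (areg : forall x, a * x = 0 -> x = 0) (pp : prime p).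
Hypotheses (ap : multiple a p%:R) (pb : pbasis a p).
Variables (m : nat) (f : 'I_m -> P).
Local Notation I := (lincomb_ideal f).
Local Notation J := (lincomb_ideal (fun l => f l ^+ p)).

(** Writing the coefficients of [a h] in the Frobenius basis turns [a h] into [sum b_t D_t ^ p]
    modulo [a], with all [D_t] in [I]. Uniqueness makes each [D_t] a multiple of [a]; after division
    by [a] every summand keeps a factor from [I]. *)
Lemma frob_flat h : J (a * h) -> I h.
Proof.
have [T [b [t0 [b0 bE bU]]]] := pb; move=> [c e].
have /choice[d dE] : forall i, exists d : T -> P, multiple a (c i - \sum_t b t * d t ^+ p).
  by move=> i; apply: bE.
have /choice[u uE] := dE.
pose D t := \sum_i d i t * f i.
have DI t : I (D t) by exists (fun i => d i t).
have /choice[Y YE] : forall t, exists Y, I Y /\ D t ^+ p = \sum_i (d i t * f i) ^+ p + p%:R * Y.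
  move=> t; have [i|Y IY eY] := @frob_sumT P I p _ (fun i => d i t * f i) pp.
    by apply: idMl; exact: (lincomb_mem f).
  by exists Y.
have [q qE] := ap.
have E : a * h = \sum_t b t * D t ^+ p +
    a * (\sum_i u i * f i ^+ p - q * \sum_t b t * Y t).
  rewrite e mulrBr mulrA -qE !mulr_sumr addrCA -sumrB addrC.
  transitivity (\sum_i \sum_t b t * (d i t * f i) ^+ p + \sum_i a * (u i * f i ^+ p)).
    rewrite -big_split; apply: eq_bigr => i _.
    have -> : \sum_t b t * (d i t * f i) ^+ p = (\sum_t b t * d i t ^+ p) * f i ^+ p.
      by rewrite mulr_suml; apply: eq_bigr => t _; rewrite exprMn mulrA.
    by rewrite mulrA -uE mulrBl [RHS]addrC subrK.
  congr (_ + _); rewrite exchange_big; apply: eq_bigr => t _ /=.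
  have [_ ->] := YE t; rewrite -mulr_sumr mulrDr mulrCA addrK //.
have aD : multiple a (\sum_t b t * D t ^+ p).
  move/eqP: E; rewrite -subr_eq -mulrBr => /eqP <-; by eexists.
have /choice[h' hE] := bU _ aD.
have p2 : (0 < p.-1)%N by case: p pp => [|[]].
suff -> : h = \sum_t b t * (h' t * D t ^+ p.-1) + (\sum_i u i * f i ^+ p - q * \sum_t b t * Y t).
  have fI i : I (f i) by exact: (lincomb_mem f).
  apply: idD; first apply: id_sum => t _; first do 2![apply: idMl].
    by rewrite -(prednK p2) exprS; apply: idMr.
  apply: idB.
    apply: id_sum => i _; apply: idMl.
    by rewrite -(prednK (prime_gt0 pp)) exprS; apply: idMr.
  by apply: idMl; apply: id_sum => t _; apply: idMl; case: (YE t).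
apply/eqP; rewrite -subr_eq0; apply/eqP; apply: areg.
rewrite mulrBr mulrDr E opprD addrACA subrr addr0 mulr_sumr -sumrB big1 // => t _.
by rewrite -{1}(prednK (prime_gt0 pp)) exprS {1}hE -!mulrA mulrCA subrr.
Qed.

(** The expansion of [frob_flat], with [g ^+ p] moved to the basis element 1: uniqueness gives
    [g = D_(t0)] modulo [a], and [D_(t0)] lies in [I]. *)
Lemma frob_reduced g b' : J (g ^+ p - a * b') -> exists y, I (g - a * y).
Proof.
have [T [b [t0 [b0 bE bU]]]] := pb; move=> [c e].
have /choice[d dE] : forall i, exists d : T -> P, multiple a (c i - \sum_t b t * d t ^+ p).
  by move=> i; apply: bE.
pose D t := \sum_i d i t * f i.
have DI t : I (D t) by exists (fun i => d i t).
pose M := mult_ideal a.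
have M1 : M (\sum_i c i * f i ^+ p - \sum_t b t * D t ^+ p).
  have h t : M (D t ^+ p - \sum_i (d i t * f i) ^+ p).
    have [//|z _ ->] := @frob_sumT P (idgen (fun=> True)) p _ (fun i => d i t * f i) pp.
      by move=> i; apply: idgen_mem.
    by rewrite addrC addKr; apply: (idMr (I := M)).
  have h1 : M (\sum_t b t * D t ^+ p - \sum_t b t * \sum_i (d i t * f i) ^+ p).
    by rewrite -sumrB; apply: id_sum => t _; rewrite -mulrBr; apply: idMl.
  apply: (id_trans (I := M) _ (idBC h1)).
  rewrite (_ : \sum_t b t * \sum_i (d i t * f i) ^+ p = \sum_i (\sum_t b t * d i t ^+ p) * f i ^+ p).
    rewrite -sumrB; apply: id_sum => i _; rewrite -mulrBl; apply: idMr; exact: dE.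
  under eq_bigr do rewrite mulr_sumr.
  rewrite exchange_big; apply: eq_bigr => i _ /=; rewrite mulr_suml.
  by apply: eq_bigr => t _; rewrite exprMn mulrA.
have M2 : M (g ^+ p - \sum_t b t * D t ^+ p).
  apply: (id_trans (I := M) _ M1); rewrite -e opprB addrC subrK.
  by exists b'.
pose D' t := if t == t0 then D t - g else D t.
have M3 : M (\sum_t b t * D' t ^+ p).
  rewrite (bigD1 t0) //= /D' eqxx b0 mul1r.
  rewrite (eq_bigr (fun t => b t * D t ^+ p)); last by move=> t /negPf ->.
  have h := frob_addm (D t0 - g) g pp ap.
  rewrite subrK in h; rewrite (bigD1 t0) //= b0 mul1r in M2.
  have := idN (idD (i := M) M2 h); congr (M _).
  by ring.
have [y yE] := bU _ M3 t0; rewrite /D' eqxx in yE.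
exists (- y); rewrite mulrN opprK -yE addrCA subrr addr0; exact: DI.
Qed.
End FrobeniusTrick.

(** Formal smoothness of the affine scheme with coordinate ring [A]. *)
Definition liftable (R : comPzRingType) (A : algebra R) :=
  forall (B C : algebra R) (f : alghom B C), (forall x, exists y, f y = x) ->
  (exists n, forall a : 'I_n -> B, (forall i, f (a i) = 0) -> \prod_(i < n) a i = 0) ->
  forall g : alghom A C, exists s : alghom A B, forall x, f (s x) = g x.

Section SmoothAlgebra.
Variables (R : comNzRingType) (a : R) (p : nat).
Hypotheses (areg : forall n x, mpC R n a * x = 0 -> x = 0) (pp : prime p).
Hypotheses (ap : multiple a p%:R) (pb : pbasis a p).
Variable A : algebra R.
Hypotheses (fpA : finitely_presented A) (liftA : liftable A).

(** The ideal of the equations [f l] is nilpotent modulo their [p]-th powers, so the identity of [A]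
    lifts along the projection of that quotient to [A]. The section [s] turns equations of [A] into
    congruences modulo the [f l ^+ p], to which [frob_flat] and [frob_reduced] apply. *)
Lemma smooth_section : exists n (g : alghom (mp_alg R n) A) m (f : 'I_m -> mp R n)
   (s : {rmorphism A -> quo (lincomb_ideal (fun l => f l ^+ p))}),
  [/\ forall y, exists q, g q = y,
      forall q, g q = 0 <-> lincomb_ideal f q,
      forall r, s (alg_in A r) = qpi _ (mpC R n r) &
      forall q q' : mp R n, s (g q) = qpi _ q' -> lincomb_ideal f (q - q')].
Proof.
have [n [x [m [rels aP]]]] := fpA; have [g [gE gs gK]] := pres_mp aP.
pose f i := peval (mpX R : 'I_n -> mp_alg R n) (rels i).
have gI q : g q = 0 <-> lincomb_ideal f q.
  rewrite gK; split=> h.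
    apply: (idgen_min _ h) => _ [e [i <-] ->]; exact: (lincomb_mem f).
  have [c ->] := h; apply: id_sum => i _; apply: idMl; apply: idgen_mem.
  by exists (rels i); first exists i.
pose J := lincomb_ideal (fun l => f l ^+ p).
have JI q : J q -> g q = 0.
  move=> [c ->]; rewrite rmorph_sum big1 // => i _; rewrite rmorphM rmorphXn /=.
  have -> : g (f i) = 0 by apply/gI/(lincomb_mem f).
  by rewrite expr0n gtn_eqF ?prime_gt0 // mulr0.
have [h hE] := @quo_lift R (mp_alg R n) A J g JI.
have [||s sE] := @liftA _ _ h _ _ (alg_id A).
- by move=> y; have [q <-] := gs y; exists (quo_hom J q); apply: hE.
- exists (m * p).+1 => b hb.
  pose q i := quo_val (b i).
  have -> : \prod_i b i = qpi J (\prod_i q i).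
    by rewrite rmorph_prod; apply: eq_bigr => i _; apply/esym/qpiK.
  apply/qpi0; apply: prod_lincomb => i; apply/gI.
  by rewrite -hE -[RHS](hb i); congr (h _); apply: qpiK.
exists n, g, m, f, (s : {rmorphism A -> quo J}); split=> [//|//|r|q q' e].
  exact: (hom_in s).
apply/gI; rewrite rmorphB; apply/eqP; rewrite subr_eq0; apply/eqP.
have sE' x' : h (s x') = x' by exact: sE.
by rewrite -[RHS]hE /= -e sE'.
Qed.

Lemma smooth_torsion_free x : alg_in A a * x = 0 -> x = 0.
Proof.
have [n [g [m [f [s [gs gI sR sI]]]]]] := smooth_section.
have [pbn apn] := pbasis_mp n pp ap pb.
have [q <-] := gs x => e.
have gC : g (mpC R n a) = alg_in A a by exact: (hom_in g).
apply/gI; have h := sI q (quo_val (s (g q))) (esym (qpiK (s (g q)))).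
rewrite -[q](subrK (quo_val (s (g q)))); apply: idD => //.
apply: (frob_flat (areg (n := n)) pp apn pbn); apply/qpi0.
transitivity (s (alg_in A a) * s (g q)); last by rewrite -rmorphM e rmorph0.
by rewrite rmorphM; congr (_ * _); [exact/esym/sR|exact: qpiK].
Qed.

(** Reducedness of [A] modulo [a], tested on [p]-th powers only. *)
Lemma smooth_reduced x y : x ^+ p = alg_in A a * y -> exists z, x = alg_in A a * z.
Proof.
have [n [g [m [f [s [gs gI sR sI]]]]]] := smooth_section.
have [pbn apn] := pbasis_mp n pp ap pb.
have gC : g (mpC R n a) = alg_in A a by exact: (hom_in g).
have [q <-] := gs x; move=> e.
pose t z := quo_val (s z); have tE z : qpi _ (t z) = s z by exact: qpiK.
move: t tE => t tE; have h := sI q _ (esym (tE (g q))).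
have [|w hw] := @frob_reduced _ _ _ pp apn pbn _ f (t (g q)) (t y).
  apply/qpi0; rewrite rmorphB rmorphXn rmorphM /= !tE -sR -rmorphXn e rmorphM.
  by rewrite subrr.
have /gI := idD h hw; rewrite addrA subrK rmorphB rmorphM gC => /eqP.
by rewrite subr_eq0 => /eqP ->; exists (g w).
Qed.
End SmoothAlgebra.

Lemma mpC_reg (R : comNzRingType) (a : R) n : (forall x, a * x = 0 -> x = 0) ->
  forall x, mpC R n a * x = 0 -> x = 0.
Proof.
move=> areg; elim: n => [|n IH] //= x e; apply/polyP => i.
by rewrite coef0; apply: IH; rewrite -coefCM e coef0.
Qed.

Lemma peval_cong (R : comPzRingType) (A : algebra R) (I : ideal A) n
    (x y : 'I_n -> A) e :
  (forall i, I (x i - y i)) -> I (peval x e - peval y e).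
Proof.
move=> h; have E : quo_hom I (peval x e) = quo_hom I (peval y e).
  by rewrite !hom_peval; apply: peval_ext => i /=; apply/qpi_eq.
exact/qpi_eq.
Qed.

(** * Discrete valuation rings and integral points of smooth algebras *)

Section Valuation.
Variables (K : fieldType) (v : valuation K).
Implicit Types (x y : K) (m n : int).

Lemma vge0 m : vge v m 0. Proof. by rewrite /vge eqxx. Qed.
Lemma vge_le m n x : m <= n -> vge v n x -> vge v m x.
Proof. by rewrite /vge => mn; case: (x == 0) => //=; apply: le_trans. Qed.
Lemma vgeD m x y : vge v m x -> vge v m y -> vge v m (x + y).
Proof.
rewrite /vge; case: (eqVneq x 0) => [->|x0]; first by rewrite add0r.
case: (eqVneq y 0) => [->|y0] /=; first by rewrite addr0 => -> _; rewrite orbT.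
case: (eqVneq (x + y) 0) => //= xy0 hx hy.
by apply: le_trans (vmapD v x0 y0 xy0); rewrite le_min hx.
Qed.
Lemma vgeM m n x y : vge v m x -> vge v n y -> vge v (m + n) (x * y).
Proof.
rewrite /vge mulf_eq0; case: (eqVneq x 0) => //= x0; case: (eqVneq y 0) => //= y0.
by rewrite vmapM //; apply: lerD.
Qed.
Lemma vmapN x : x != 0 -> v (- x) = v x.
Proof. by move=> x0; rewrite -mulN1r vmapM ?oppr_eq0 ?oner_eq0 // vmapN1 add0r. Qed.
Lemma vgeN m x : vge v m (- x) = vge v m x.
Proof. by rewrite /vge oppr_eq0; case: (eqVneq x 0) => //= x0; rewrite vmapN. Qed.
Lemma vgeB m x y : vge v m x -> vge v m y -> vge v m (x - y).
Proof. by move=> hx hy; apply: vgeD => //; rewrite vgeN. Qed.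
Lemma vge_sum m (T : Type) (r : seq T) (P : pred T) (f : T -> K) :
  (forall i, P i -> vge v m (f i)) -> vge v m (\sum_(i <- r | P i) f i).
Proof. by move=> h; apply: (big_ind (fun x => vge v m x)) => //; [exact: vge0|exact: vgeD]. Qed.
Lemma vmapV x : x != 0 -> v x^-1 = - v x.
Proof.
move=> x0; have := vmapM v (invr_neq0 x0) x0; rewrite mulVf // vmap1.
by move/eqP; rewrite eq_sym addr_eq0 => /eqP.
Qed.
Lemma vmapX x (m : nat) : x != 0 -> v (x ^+ m) = v x *+ m.
Proof.
move=> x0; elim: m => [|m IH]; first by rewrite expr0 vmap1.
by rewrite exprS vmapM ?expf_neq0 // IH mulrS.
Qed.
Lemma vmapXz x (m : int) : x != 0 -> v (x ^ m) = v x *~ m.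
Proof.
by move=> x0; case: m => m; rewrite ?NegzE -?exprnN -?exprnP ?vmapV ?expf_neq0 //
  vmapX // ?mulrNz.
Qed.
Lemma vge_all0 x : (forall m : nat, vge v m%:Z x) -> x = 0.
Proof.
move=> h; apply/eqP; apply: contraT => x0.
by have := h `|v x|.+1; rewrite /vge (negPf x0) /=; lia.
Qed.
Lemma vmap_lt_add x y : x != 0 -> vge v (v x + 1) y -> x + y != 0 /\ v (x + y) = v x.
Proof.
move=> x0; rewrite /vge; case: (eqVneq y 0) => [->|y0] /= hy; first by rewrite addr0.
have xy0 : x + y != 0.
  by apply/eqP => /eqP; rewrite addr_eq0 => /eqP e; move: hy; rewrite e vmapN //; lia.
have ny0 : - y != 0 by rewrite oppr_eq0.
have h1 : (v x <= v (x + y)) || (v y <= v (x + y)) by rewrite -ge_min vmapD.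
have h2 : (v (x + y) <= v x) || (v y <= v x).
  rewrite -ge_min -(vmapN y0) -{2}(addrK y x); apply: vmapD => //; by rewrite addrK.
by split=> //; lia.
Qed.

Definition unif : K := s2val (cid2 (vmap_unif v)).
Lemma unif_neq0 : unif != 0. Proof. by rewrite /unif; case: cid2. Qed.
Lemma unifE : v unif = 1. Proof. by rewrite /unif; case: cid2. Qed.
Lemma unifXz (m : int) : v (unif ^ m) = m.
Proof. by rewrite vmapXz ?unif_neq0 // unifE intz. Qed.
Lemma unifXz_neq0 (m : int) : unif ^ m != 0.
Proof. by rewrite expfz_neq0 ?unif_neq0. Qed.

Lemma vge_scale m n x : vge v (m + n) (unif ^ n * x) = vge v m x.
Proof.
rewrite /vge mulf_eq0 (negPf (unifXz_neq0 n)) /=.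
by case: (eqVneq x 0) => //= x0; rewrite vmapM ?unifXz_neq0 // unifXz addrC lerD2l.
Qed.

Local Notation O := (integers v).
Lemma int_valP (x : O) : vge v 0 (int_val x). Proof. by case: x. Qed.
Lemma int_valM (x y : O) : int_val (x * y) = int_val x * int_val y.
Proof. exact: (rmorphM (int_incl v)). Qed.
Lemma int_valD (x y : O) : int_val (x + y) = int_val x + int_val y.
Proof. exact: (rmorphD (int_incl v)). Qed.
Lemma int_valB (x y : O) : int_val (x - y) = int_val x - int_val y.
Proof. exact: (rmorphB (int_incl v)). Qed.
Lemma int_valX (x : O) (n : nat) : int_val (x ^+ n) = int_val x ^+ n.
Proof. exact: (rmorphXn (int_incl v)). Qed.
Lemma int_val0 : int_val (0 : O) = 0. Proof. exact: (rmorph0 (int_incl v)). Qed.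
Lemma int_val1 : int_val (1 : O) = 1. Proof. exact: (rmorph1 (int_incl v)). Qed.
Lemma int_val_inj : injective (@int_val K v). Proof. exact: val_inj. Qed.
Definition mkint x (h : vge v 0 x) : O := Integers (h : x \in integer v).

Lemma unif_int : vge v 0 unif. Proof. by rewrite /vge unifE orbT. Qed.
Definition opi : O := mkint unif_int.
Lemma opi_val : int_val opi = unif. Proof. by []. Qed.

Lemma opi_multP (m : nat) (x : O) : multiple (opi ^+ m) x <-> vge v m%:Z (int_val x).
Proof.
split=> [[y ->]|h].
  rewrite int_valM int_valX opi_val.
  rewrite -[unif ^+ m]/(unif ^ m%:Z) -[m%:Z]add0r.
  by rewrite vge_scale int_valP.
have hy : vge v 0 (unif ^ (- m%:Z) * int_val x).
  by rewrite -(vge_scale _ m%:Z) add0r mulrA -expfzDr ?unif_neq0 // subrr expr0z mul1r.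
exists (mkint hy); apply: int_val_inj.
rewrite int_valM int_valX opi_val.
by rewrite -[unif ^+ m]/(unif ^ m%:Z) mulrA -expfzDr ?unif_neq0 // subrr expr0z mul1r.
Qed.

Lemma opi_reg (x : O) : opi * x = 0 -> x = 0.
Proof.
move/(congr1 (@int_val K v)); rewrite int_valM int_val0 opi_val => /eqP.
by rewrite mulf_eq0 (negPf unif_neq0) => /eqP e; apply: int_val_inj.
Qed.

Lemma int_unit (x : O) : ~~ vge v 1 (int_val x) -> exists y : O, x * y = 1.
Proof.
move=> h; have x0 : int_val x != 0 by apply: contraNneq h => ->; rewrite vge0.
have hx : vge v 0 (int_val x)^-1.
  by move: h; rewrite /vge (negPf x0) invr_eq0 (negPf x0) /= vmapV //; lia.
by exists (mkint hx); apply: int_val_inj; rewrite int_valM int_val1 /= divff.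
Qed.
End Valuation.

Section DVR.
Variables (K : fieldType) (v : valuation K) (k : closedFieldType).
Variables (red : {rmorphism integers v -> k}) (p : nat).
Hypotheses (redP : residue_map red) (p_char : p \in [pchar k]).
Local Notation O := (integers v).
Local Notation pi := (opi v).

Lemma red0P (x : O) : red x = 0 <-> multiple pi x.
Proof.
have [_ h] := redP; rewrite h -(expr1 pi); apply: iff_sym; exact: (opi_multP 1).
Qed.

Lemma red_unit (x : O) : red x != 0 -> exists y, x * y = 1.
Proof.
move=> h; apply: int_unit; apply: contraNN h => h; apply/eqP.
by have [_ ->] := redP.
Qed.

Lemma opi_mult_p : multiple pi (p%:R : O).
Proof. by apply/red0P; rewrite rmorph_nat; apply: pcharf0. Qed.

(** [k] is perfect, so modulo the uniformizer every element is a [p]-th power and the basis is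
    reduced to 1. *)
Lemma pbasis_dvr : pbasis pi p.
Proof.
have p0 := prime_gt0 (pcharf_prime p_char); have [rs _] := redP.
exists ('I_1 : finType), (fun=> 1), ord0; split=> // [c|d].
  have [r rE] : exists r, r ^+ p = red c.
    have [r] := @solve_monicpoly k p (fun i => if i == 0%N then red c else 0) p0.
    rewrite (bigD1 (Ordinal p0)) //= expr0 mulr1 big1 ?addr0; first by exists r.
    by move=> i; rewrite -val_eqE /= => /negPf ->; rewrite mul0r.
  have [d dE] := rs r; exists (fun=> d); apply/red0P.
  by rewrite big_ord_recl big_ord0 addr0 mul1r rmorphB rmorphXn dE rE subrr.
rewrite big_ord_recl big_ord0 addr0 mul1r => /red0P /eqP h t; rewrite ord1.
by apply/red0P/eqP; move: h; rewrite rmorphXn expf_eq0 p0.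
Qed.

Hypothesis Kc : complete_field v.

Lemma int_complete (u : nat -> O) :
  (forall j, multiple (pi ^+ j.+1) (u j.+1 - u j)) ->
  exists l, forall j, multiple (pi ^+ j.+1) (l - u j).
Proof.
move=> h; pose w j := int_val (u j).
have wE i j : (i <= j)%N -> vge v i.+1%:Z (w j - w i).
  elim: j => [|j IH]; first by rewrite leqn0 => /eqP ->; rewrite subrr vge0.
  rewrite leq_eqVlt => /predU1P[->|]; first by rewrite subrr vge0.
  rewrite ltnS => ij; have -> : w j.+1 - w i = (w j.+1 - w j) + (w j - w i) by ring.
  apply: vgeD; last exact: IH.
  apply: (@vge_le _ _ _ j.+1%:Z); first by lia.
  by rewrite -int_valB; apply/opi_multP.
have [|l hl] := Kc (u := w).
  move=> N; exists N => m n Nm Nn.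
  have H q : (N <= q)%N -> vge v N%:Z (w q - w N).
    by move=> Nq; apply: (@vge_le _ _ _ N.+1%:Z); [rewrite lez_nat leqnSn|apply: wE].
  have -> : w m - w n = (w m - w N) - (w n - w N) by ring.
  by apply: vgeB; apply: (H).
have lE j : vge v j.+1%:Z (l - w j).
  have [n0 hn] := hl j.+1; pose n := maxn n0 j.
  have -> : l - w j = (w n - w j) - (w n - l) by ring.
  by apply: vgeB; [apply: wE; rewrite leq_maxr|apply: hn; rewrite leq_maxl].
have l0 : vge v 0 l.
  rewrite -(subrK (w 0%N) l); apply: vgeD; last exact: int_valP.
  by apply: vge_le (lE 0%N).
by exists (mkint l0) => j; apply/opi_multP; apply: lE.
Qed.

Lemma opi_sep (x : O) : (forall j, multiple (pi ^+ j.+1) x) -> x = 0.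
Proof.
move=> h; apply: int_val_inj; apply: (@vge_all0 _ v) => m.
apply: (@vge_le _ _ _ m.+1%:Z); first by rewrite lez_nat leqnSn.
exact/opi_multP.
Qed.

Section Lift.
Variables (A : algebra O).
Hypotheses (fpA : finitely_presented A) (liftA : liftable A).

(** Formal smoothness lifts a solution modulo [pi ^ (j + 1)] to one modulo [pi ^ (j + 2)], congruent
    to it; completeness provides the limit, which satisfies the equations exactly. *)
Lemma lift_point (f0 : alghom A (Algebra red)) :
  exists f : alghom A (self_alg O), forall x, red (f x) = f0 x.
Proof.
have [n [a [m [rels aP]]]] := fpA; have [rs _] := redP.
pose sA := self_alg O.
pose P j (x : 'I_n -> sA) := forall i, multiple (pi ^+ j) (peval x (rels i)).
have step j x : P j.+1 x -> exists x', P j.+2 x' /\ forall i, multiple (pi ^+ j.+1) (x' i - x i).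
  move=> hx.
  pose I i := mult_ideal (pi ^+ i.+1 : O).
  have [y yE] : exists y : alghom A (quo_alg (A := sA) (I j)), forall i, y (a i) = qpi (I j) (x i).
    apply: (pres_hom aP) => _ [i <-].
    by rewrite -(hom_peval (quo_hom (A := sA) (I j))); apply/quo_homK; apply: hx.
  have [|f fE] := @quo_lift _ sA (quo_alg (A := sA) (I j)) (I j.+1) (quo_hom (A := sA) (I j)).
    by move=> z [w ->]; apply/quo_homK; rewrite exprSr -mulrA; eexists.
  have [||s sE] := @liftA _ _ f _ _ y.
  - move=> z; have [w <-] := quo_surj z; exists (quo_hom (A := sA) (I j.+1) w); exact: fE.
  (* The kernel is generated by [pi ^ (j + 1)], whose square is a multiple of [pi ^ (j + 2)]. *)
  - exists 2 => b bP; rewrite big_ord_recl big_ord_recl big_ord0 mulr1.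
    have bq i : exists2 w, b i = qpi (I j.+1) w & multiple (pi ^+ j.+1) w.
      exists (quo_val (b i)); first by rewrite qpiK.
      apply/(@quo_homK _ sA (I j)); rewrite -fE -[RHS](bP i); congr (f _); exact: qpiK.
    have [w1 -> [z1 ->]] := bq ord0; have [w2 -> [z2 ->]] := bq (lift ord0 ord0).
    rewrite -rmorphM; apply/qpi0; exists (pi ^+ j * (z1 * z2)).
    by rewrite mulrACA -exprD addSn -addnS addnC exprD -mulrA.
  pose x' i := quo_val (s (a i)).
  have x'E i : qpi (I j.+1) (x' i) = s (a i) by apply: qpiK.
  exists x'; split=> [i|i].
    apply/(@quo_homK _ sA (I j.+1)); rewrite hom_peval.
    rewrite -(pres_rel aP s (e := rels i)); last by exists i.
    exact: peval_ext.
  apply/(@qpi_eq _ (I j)); rewrite -yE -sE -x'E; exact/esym/fE.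
(* A total successor function; pairs that are not approximate solutions receive an arbitrary
   value. *)
have /choice[st stP] : forall u : nat * ('I_n -> sA), exists x' : 'I_n -> sA, P u.1.+1 u.2 ->
    P u.1.+2 x' /\ forall i, multiple (pi ^+ u.1.+1) (x' i - u.2 i).
  move=> [j x]; case: (pselect (P j.+1 x)) => [/step[x' ?]|nP]; first by exists x'.
  by exists x.
have /choice[x0 x0E] : forall i : 'I_n, exists x : sA, red x = f0 (a i) by move=> i; apply: rs.
pose X := fix X j := if j is j'.+1 then st (j', X j') else x0.
have XP j : P j.+1 (X j).
  elim: j => [|j IH]; last by have [] := stP (j, X j) IH.
  move=> i; rewrite expr1; apply/red0P.
  pose rk : alghom sA (Algebra red) := @AlgHom O sA (Algebra red) red (fun=> erefl).
  transitivity (rk (peval (x0 : 'I_n -> sA) (rels i))) => //; rewrite hom_peval.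
  transitivity (peval (f0 \o a) (rels i)); last by apply: (pres_rel aP f0); exists i.
  by apply: (@peval_ext _ (Algebra red)) => l; apply: x0E.
have /choice[l lE] : forall i : 'I_n, exists l : sA, forall j, multiple (pi ^+ j.+1) (l - X j i).
  move=> i; apply: (int_complete (u := fun j => X j i)) => j.
  by have [_ h] := stP (j, X j) (XP j); apply: h.
have [|f fE] := pres_hom aP (B := sA) (b := l).
  move=> _ [i <-]; apply: opi_sep => j.
  pose I := mult_ideal (pi ^+ j.+1 : O).
  rewrite -[peval l _](subrK (peval (X j) (rels i))); apply: (idD (i := I)).
    by apply: (@peval_cong _ sA) => i'; apply: lE.
  exact: XP.
exists f => x.
pose rf : alghom A (Algebra red) := alg_comp (@AlgHom O sA (Algebra red) red (fun=> erefl)) f.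
apply: (pres_eq aP (f := rf) (g := f0)) => i /=; rewrite fE -x0E.
apply/eqP; rewrite -subr_eq0 -rmorphB; apply/eqP/red0P; rewrite -{1}(expr1 pi); exact: (lE i 0%N).
Qed.

Lemma chart_torsion_free x : alg_in A pi * x = 0 -> x = 0.
Proof.
have pp := pcharf_prime p_char.
apply: (smooth_torsion_free _ pp opi_mult_p pbasis_dvr fpA liftA).
by move=> n y; apply: mpC_reg; apply: opi_reg.
Qed.


(** If no power of [g] were a multiple of [pi], the localization at [g] would have a point over [k];
    pulled back to [A] and lifted to an integral point, it would give [g] a value prime to [pi]. So
    some power of [g] is divisible, and [smooth_reduced] extracts [p]-th roots. *)
Lemma chart_divisible (g : A) :
  (forall f : alghom A (self_alg O), multiple pi (f g)) -> multiple (alg_in A pi) g.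
Proof.
move=> h; have pp := pcharf_prime p_char; have [rs _] := redP.
have [M hM] : exists M, multiple (alg_in A pi) (g ^+ M).
  have [B [l lP]] := loc_exists g; have [[w we] l0 ls] := lP.
  have [n [a [m [rels aP]]]] := fpA.
  have [b bg] := loc_gen (pres_gen aP) lP.
  have J1 : mult_ideal (alg_in B pi) 1.
    apply: contrapT => J1.
    have [|f fJ] := closed_point rs bg _ J1.
      by move=> r /red0P[y ->]; rewrite rmorphM; eexists.
    have [f' f'E] := lift_point (alg_comp f l).
    have := f'E g; have /red0P -> := h f' => /esym /= e.
    have : f (l g * w) = 0 by rewrite rmorphM e mul0r.
    by rewrite we rmorph1 => /eqP; rewrite oner_eq0.
  have [y ey] := J1; have [m1 [c cE]] := ls y.
  have /l0[m2 e2] : l (g ^+ m1 - alg_in A pi * c) = 0.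
    rewrite rmorphB rmorphM rmorphXn hom_in -cE mulrCA -ey mulr1 subrr //.
  exists (m2 + m1)%N; exists (g ^+ m2 * c).
  by apply/eqP; rewrite exprD mulrCA -subr_eq0 -mulrBr e2.
have hp : forall e, multiple (alg_in A pi) (g ^+ (p ^ e)) -> multiple (alg_in A pi) g.
  elim=> [|e IH]; first by rewrite expn0 expr1.
  move=> [y]; rewrite expnSr exprM => /(smooth_reduced pp opi_mult_p pbasis_dvr fpA liftA).
  exact: IH.
apply: (hp M); have Mp : (M <= p ^ M)%N by apply/ltnW/ltn_expl/prime_gt1.
by rewrite -(subnK Mp) exprD; apply: (idMl (i := mult_ideal _)).
Qed.
End Lift.
End DVR.

(** * Gluing of functions; affine schemes through coordinates *)

Lemma unit_powers (A : comPzRingType) n (f c : 'I_n -> A) m :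
  \sum_i c i * f i = 1 -> exists d : 'I_n -> A, \sum_i d i * f i ^+ m = 1.
Proof.
move=> e; have [d dE] : lincomb_ideal (fun i => f i ^+ m) 1; last by exists d.
apply: contrapT => /ideal_field[F [g [_ gI]]].
have : (1 : F) = 0; last by move/eqP; rewrite oner_eq0.
rewrite -(rmorph1 g) -e rmorph_sum big1 // => i _; rewrite rmorphM.
have : g (f i ^+ m) = 0 by apply: gI; exact: (lincomb_mem (fun i => f i ^+ m)).
by rewrite rmorphXn => /eqP; rewrite expf_eq0 => /andP[_ /eqP ->]; rewrite mulr0.
Qed.

Lemma local_eq (A : comPzRingType) n (f c : 'I_n -> A) (x y : A) :
  \sum_i c i * f i = 1 -> (forall i, exists m, f i ^+ m * (x - y) = 0) -> x = y.
Proof.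
move=> e /choice[m mE]; apply: annih_eq => F g.
have [i gi] : exists i, g (f i) != 0.
  apply: contrapT => h; have : (1 : F) = 0; last by move/eqP; rewrite oner_eq0.
  rewrite -(rmorph1 g) -e rmorph_sum big1 // => i _; rewrite rmorphM.
  case: (eqVneq (g (f i)) 0) => [->|ni]; first by rewrite mulr0.
  by case: h; exists i.
by exists (f i ^+ m i) => //; rewrite rmorphXn expf_neq0.
Qed.

Lemma max_exists (T : finType) (P : T -> nat -> Prop) :
  (forall t m m', (m <= m')%N -> P t m -> P t m') ->
  (forall t, exists m, P t m) -> exists m, forall t, P t m.
Proof.
move=> up /choice[m mP]; exists (\max_t m t) => t.
by apply: up (mP t); apply: (leq_bigmax t).
Qed.

Section Gluing.
Variables (R : comPzRingType) (A : algebra R) (n : nat) (f c : 'I_n -> A).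
Hypothesis e1 : \sum_i c i * f i = 1.
Variables (B : 'I_n -> algebra R) (l : forall i, alghom A (B i)).
Hypothesis lP : forall i, is_localization (l i) (f i).

Lemma glue_uniq (y y' : A) : (forall i, l i y = l i y') -> y = y'.
Proof.
move=> h; apply: (local_eq e1) => i; have [_ l0 _] := lP i.
by apply: l0; rewrite rmorphB h subrr.
Qed.

Lemma loc_cancel i (x y : B i) m : l i (f i) ^+ m * x = l i (f i) ^+ m * y -> x = y.
Proof.
have [[w we] _ _] := lP i => /(congr1 ( *%R (w ^+ m))).
by rewrite !mulrA -exprMn [w * _]mulrC we expr1n !mul1r.
Qed.

(** Each [x i] is a fraction [a i / f i ^ m], and agreement on overlaps gives
    [f j ^ m a i = f i ^ m a j] up to a power [N] of [f i f j]. A relation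
    [sum d j f j ^ (m + N) = 1] then assembles the numerators. *)
Lemma glue (x : forall i, B i) :
  (forall i j (C : algebra R) (g : alghom (B i) C) (h : alghom (B j) C),
     g \o l i =1 h \o l j -> g (x i) = h (x j)) ->
  exists y, forall i, l i y = x i.
Proof.
move=> agree.
have [m mE] : exists m, forall i, exists a, l i (f i) ^+ m * x i = l i a.
  apply: max_exists => [i m m' mm' [a e]|i]; last first.
    by have [_ _ /(_ (x i))] := lP i.
  exists (f i ^+ (m' - m) * a).
  by rewrite rmorphM rmorphXn -e mulrA -exprD subnK.
have /choice[a aE] := mE.
have [N NE] : exists N, forall u : 'I_n * 'I_n,
    (f u.1 * f u.2) ^+ N * (f u.2 ^+ m * a u.1 - f u.1 ^+ m * a u.2) = 0.
  apply: max_exists => [u M M' MM' e|[i j] /=].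
    by rewrite -(subnK MM') exprD -mulrA e mulr0.
  have [C [q [[w we] q0 _]]] := loc_exists (f i * f j).
  have [|g gE] := loc_lift (f := q) (lP i).
    by exists (q (f j) * w); rewrite mulrA -rmorphM.
  have [|h hE] := loc_lift (f := q) (lP j).
    by exists (q (f i) * w); rewrite mulrA -rmorphM [f j * _]mulrC.
  have e : g (x i) = h (x j) by apply: agree => z /=; rewrite gE hE.
  have Ei : q (a i) = q (f i) ^+ m * g (x i) by rewrite -gE -aE rmorphM rmorphXn gE.
  have Ej : q (a j) = q (f j) ^+ m * h (x j) by rewrite -hE -aE rmorphM rmorphXn hE.
  by apply: q0; rewrite rmorphB !rmorphM !rmorphXn Ei Ej e mulrCA subrr.
have [d dE] := unit_powers (m + N) e1.
have aa i j : f i ^+ (m + N) * (f j ^+ N * a j) = f j ^+ (m + N) * (f i ^+ N * a i).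
  have /eqP := NE (i, j); rewrite mulrBr subr_eq0 exprMn => /eqP /= E.
  rewrite !exprD; transitivity (f i ^+ N * f j ^+ N * (f i ^+ m * a j)); first by ring.
  by rewrite -E; ring.
exists (\sum_j d j * (f j ^+ N * a j)) => i.
apply: (@loc_cancel i _ _ (m + N)).
have E : f i ^+ (m + N) * \sum_j d j * (f j ^+ N * a j) = f i ^+ N * a i.
  rewrite -[RHS]mul1r -dE mulr_suml mulr_sumr; apply: eq_bigr => j _.
  by rewrite mulrCA aa [LHS]mulrA.
by rewrite -rmorphXn -rmorphM E rmorphM -aE rmorphXn mulrA -exprD addnC rmorphXn.
Qed.
End Gluing.

(** [X] is the closed subscheme of affine [N]-space cut out by [rels], stated on points; this yields
    the sheaf property and separatedness without a choice of coordinate ring. *)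
Definition coords (R : comPzRingType) (X : presheaf R) N (rels : pexpr R N -> Prop)
    (co : forall A, X A -> 'I_N -> A) :=
  [/\ forall A B (f : alghom A B) x i, co B (pmap f x) i = f (co A x i),
      forall A x y, (forall i, co A x i = co A y i) -> x = y,
      forall A x e, rels e -> peval (co A x) e = 0 &
      forall A a, (forall e, rels e -> peval a e = 0) -> exists x, forall i, co A x i = a i].

Section Coords.
Variables (R : comNzRingType) (X : presheaf R) (N : nat) (rels : pexpr R N -> Prop).
Variable co : forall A, X A -> 'I_N -> A.
Hypothesis coP : coords rels co.

Lemma coords_sheaf : zariski_sheaf X.
Proof.
have [com coi cor cos] := coP.
move=> A n f c e1 B l lP x agree.
have /choice[a aE] : forall j, exists a, forall i, l i a = co (x i) j.
  move=> j; apply: (glue e1 lP (x := fun i => co (x i) j)) => i i' C g h gh.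
  by rewrite -!com (agree _ _ _ _ _ gh).
have [e he|y yE] := cos A a.
  apply: (glue_uniq e1 lP) => i; rewrite rmorph0 hom_peval -[RHS](cor _ (x i) e he).
  by apply: peval_ext => j /=; rewrite aE.
exists y; split=> [i|y' yE'].
  by apply: coi => j; rewrite com yE aE.
apply: coi => j; rewrite yE; apply: (glue_uniq e1 lP) => i.
by rewrite aE -com yE'.
Qed.

Lemma coords_sep : Defs.separated X.
Proof.
have [com coi cor cos] := coP; move=> A x y.
exists (fun s => exists i, s = co x i - co y i) => B f; split=> [e _ [i ->]|h].
  by rewrite rmorphB -!com e subrr.
by apply: coi => i; rewrite !com; apply/eqP; rewrite -subr_eq0 -rmorphB h //; exists i.
Qed.

Definition full_sub : subfunctor X :=
  @Subfunctor R X (fun _ _ => True) (fun _ _ _ _ => id).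

Lemma coords_rep (U : subfunctor X) A a : presents (A := A) a rels ->
  (forall B x, U B x) -> represented U A.
Proof.
have [com coi cor cos] := coP; move=> aP UT.
have [u uE] := cos A a aP.1; exists u => B; split=> [y|f g e].
  split=> // _; have [f fE] := pres_hom aP (cor B y).
  by exists f; apply: coi => i; rewrite com uE fE.
by apply: (pres_eq aP) => i; rewrite -uE -!com e.
Qed.

Lemma coords_cover (P : algebra R -> Prop) A a : presents (A := A) a rels -> P A ->
  affine_cover X 'I_1 P.
Proof.
move=> aP PA; exists (fun=> full_sub); split=> [_|F s x]; last by exists ord0.
split; last by exists A => //; apply: (coords_rep aP).
move=> B x; exists (fun=> True) => C f; split=> // _.
by apply: (gen_unitW (s := 1) (y := 1)); rewrite // rmorph1 mul1r.
Qed.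

Lemma coords_variety : variety X.
Proof.
have [A [a aP]] := pres_exists rels.
split; [exact: coords_sheaf|exact: coords_sep|exists 1%N].
by apply: (coords_cover aP); exists N, a, rels.
Qed.

Lemma coords_smooth m (r : 'I_m -> pexpr R N) : (forall e, rels e <-> exists i, r i = e) ->
  formally_smooth X -> smooth_scheme X.
Proof.
move=> rE fs; have [A [a aP]] := pres_exists (fun e => exists i, r i = e).
split=> //; first exact: coords_sheaf.
exists 'I_1; have relsE : rels = (fun e => exists i, r i = e).
  by apply/funext => e; apply/propext/rE.
apply: (@coords_cover _ A a); first by rewrite relsE.
by exists N, a, m, r.
Qed.
End Coords.

Lemma coords_iso (R : comPzRingType) (X Y : presheaf R) N (rels : pexpr R N -> Prop)
    (co : forall A, X A -> 'I_N -> A) (f : morphism Y X) :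
  (forall A, bijective (f A)) -> coords rels co -> coords rels (fun A y => co A (f A y)).
Proof.
move=> fb [com coi cor cos]; split.
- by move=> A B g x i; rewrite mor_map com.
- move=> A x y h; apply: (bij_inj (fb A)); exact: coi.
- by move=> A x e he; apply: cor.
- move=> A a h; have [x xE] := cos A a h; have [g _ gK] := fb A.
  by exists (g x) => i; rewrite gK.
Qed.

Section AffineSpace.
Variable R : comNzRingType.
Fact asp_id m (A : algebra R) (f : alghom A A) (x : 'rV[A]_m) :
  f =1 id -> map_mx f x = x.
Proof. by move=> e; apply/rowP => i; rewrite mxE e. Qed.
Fact asp_comp m (A B C : algebra R) (f : alghom A B) (g : alghom B C)
  (h : alghom A C) (x : 'rV[A]_m) :
  h =1 g \o f -> map_mx h x = map_mx g (map_mx f x).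
Proof. by move=> e; apply/rowP => i; rewrite !mxE e. Qed.
Definition asp (m : nat) : presheaf R :=
  @Presheaf R (fun A => 'rV[A]_m) (fun A B f x => map_mx f x) (@asp_id m) (@asp_comp m).

Lemma asp_coords m : coords (X := asp m) (fun=> False) (fun A x i => (x : 'rV[A]_m) 0 i).
Proof.
split=> //.
- by move=> A B f x i; rewrite mxE.
- by move=> A x y h; apply/rowP.
- by move=> A a _; exists (\row_i a i) => i; rewrite mxE.
Qed.

Lemma line_coords : coords (X := affine_line R) (fun _ : pexpr R 1 => False) (fun A x i => x).
Proof.
split=> //; first by move=> A x y /(_ ord0).
by move=> A a _; exists (a ord0) => i; rewrite (ord1 i).
Qed.

Lemma Gm_coords : coords (X := Gm R)
  (fun e => e = PAdd (PMul (PVar _ ord0) (PVar _ (lift ord0 ord0))) (PConst 2 (-1)))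
  (fun A u i => if i == ord0 then (sval (u : unit_pair A)).1 else (sval (u : unit_pair A)).2).
Proof.
split.
- by move=> A B f x i; case: ifP.
- move=> A x y h; apply: unit_pair_inj; have := h ord0; have /= := h (lift ord0 ord0).
  by case: (sval x) (sval y) => [? ?] [? ?] /= -> ->.
- by move=> A [u /= /eqP uP] _ -> /=; rewrite uP rmorphN1 subrr.
- move=> A a /(_ _ erefl) /= /eqP; rewrite rmorphN1 subr_eq0 => h.
  exists (exist (fun u => u.1 * u.2 == 1) (a ord0, a (lift ord0 ord0)) h) => i /=.
  case: eqVneq => [->//|i0]; congr a; apply: val_inj.
  by case: i i0 => [[|[|i]] hi].
Qed.

Lemma Gm_asp_coords m : coords (X := prod_presheaf (Gm R) (asp m))
  (fun e => e = PAdd (PMul (PVar _ (lshift m ord0)) (PVar _ (lshift m (lift ord0 ord0))))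
     (PConst (2 + m) (-1)))
  (fun A u i => match fintype.split i with
     | inl i => if i == ord0 then (sval (u.1 : unit_pair A)).1 else (sval (u.1 : unit_pair A)).2
     | inr j => (u.2 : 'rV[A]_m) 0 j end).
Proof.
split.
- move=> A B f x i; case: fintype.split => j; first by case: ifP.
  by rewrite mxE.
- move=> A [x x'] [y y'] h /=; congr (_, _).
    apply: unit_pair_inj.
    have := h (lshift m ord0); have := h (lshift m (lift ord0 ord0)).
    rewrite !(unsplitK (inl _ : 'I_2 + 'I_m)) /=.
    by case: (sval x) (sval y) => [? ?] [? ?] /= -> ->.
  by apply/rowP => j; have := h (rshift 2 j); rewrite (unsplitK (inr _ : 'I_2 + 'I_m)).
- move=> A [[u /= /eqP uP] x] _ -> /=; rewrite !(unsplitK (inl _ : 'I_2 + 'I_m)) /=.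
  by rewrite uP rmorphN1 subrr.
- move=> A a /(_ _ erefl) /= /eqP; rewrite rmorphN1 subr_eq0 => h.
  exists (exist (fun u => u.1 * u.2 == 1) (a (lshift m ord0), a (lshift m (lift ord0 ord0))) h,
    \row_j a (rshift 2 j)) => i /=.
  case: splitP => j e; last by rewrite mxE; congr a; apply: val_inj.
  case: eqVneq => [j0|j0]; congr a; apply: val_inj; rewrite /= e ?j0 //.
  by case: j j0 {e} => [[|[|j]] hj].
Qed.
End AffineSpace.

Fixpoint pren R n m (s : 'I_n -> 'I_m) (e : pexpr R n) : pexpr R m :=
  match e with
  | PConst r => PConst _ r
  | PVar i => PVar _ (s i)
  | PAdd e1 e2 => PAdd (pren s e1) (pren s e2)
  | PMul e1 e2 => PMul (pren s e1) (pren s e2)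
  end.

Lemma peval_ren (R : comPzRingType) (A : algebra R) n m (s : 'I_n -> 'I_m)
  (a : 'I_m -> A) e : peval a (pren s e) = peval (a \o s) e.
Proof. by elim: e => //= e1 -> e2 ->. Qed.

Lemma coords_prod (R : comNzRingType) (X Y : presheaf R) N M
    (rX : pexpr R N -> Prop) (rY : pexpr R M -> Prop) cX cY :
  coords (X := X) rX cX -> coords (X := Y) rY cY ->
  coords (X := prod_presheaf X Y)
    (fun e => (exists2 e', rX e' & e = pren (lshift M) e') \/
              (exists2 e', rY e' & e = pren (@rshift N M) e'))
    (fun A u i => match fintype.split i with
       inl i => cX A u.1 i | inr i => cY A u.2 i end).
Proof.
move=> [Xm Xi Xr Xs] [Ym Yi Yr Ys].
have cl A (u : X A * Y A) i : match fintype.split (lshift M i) with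
       inl i => cX A u.1 i | inr i => cY A u.2 i end = cX A u.1 i.
  by rewrite (unsplitK (inl _ : 'I_N + 'I_M)).
have cr A (u : X A * Y A) i : match fintype.split (@rshift N M i) with
       inl i => cX A u.1 i | inr i => cY A u.2 i end = cY A u.2 i.
  by rewrite (unsplitK (inr _ : 'I_N + 'I_M)).
split.
- by move=> A B f x i; case: fintype.split => j; rewrite /= ?Xm ?Ym.
- move=> A [x x'] [y y'] h; congr (_, _).
    by apply: Xi => i; have := h (lshift M i); rewrite !cl.
  by apply: Yi => i; have := h (rshift N i); rewrite !cr.
- move=> A u e [[e' he ->]|[e' he ->]]; rewrite peval_ren.
    by rewrite -(Xr A u.1 e' he); apply: peval_ext => i; apply: cl.
  by rewrite -(Yr A u.2 e' he); apply: peval_ext => i; apply: cr.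
- move=> A a h.
  have [x xE] : exists x, forall i, cX A x i = a (lshift M i).
    apply: Xs => e he; have := h (pren (lshift M) e); rewrite peval_ren.
    by apply; left; exists e.
  have [y yE] : exists y, forall i, cY A y i = a (rshift N i).
    apply: Ys => e he; have := h (pren (@rshift N M) e); rewrite peval_ren.
    by apply; right; exists e.
  exists (x, y) => i; case: splitP => j e /=; rewrite ?xE ?yE; congr a; exact: val_inj.
Qed.

(** An inverse modulo the nilpotent kernel is corrected by a finite geometric series. *)
Lemma nilp_unit (R : comPzRingType) (B C : algebra R) (f : alghom B C) (b : B) (y : C) :
  (forall x, exists y, f y = x) ->
  (exists n, forall a : 'I_n -> B, (forall i, f (a i) = 0) -> \prod_(i < n) a i = 0) ->
  f b * y = 1 -> exists w, b * w = 1.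
Proof.
move=> fs [n hn] e; have [z zE] := fs y.
pose nu := 1 - b * z.
have nu0 : nu ^+ n = 0.
  have := hn (fun=> nu) _; rewrite prodr_const card_ord; apply => i.
  by rewrite rmorphB rmorph1 rmorphM zE e subrr.
exists (z * \sum_(i < n) nu ^+ i); rewrite mulrA.
have -> : b * z = 1 - nu by rewrite /nu opprB addrC subrK.
have := subrX1 nu n; rewrite nu0 sub0r => h.
by apply: oppr_inj; rewrite -mulNr opprB -h.
Qed.

(** * The unit group of a finite free algebra *)

Section Lattice.
Variables (R : comNzRingType) (n : nat) (i0 : 'I_n) (c : 'I_n -> 'I_n -> 'I_n -> R).

Definition cmul (A : algebra R) (x y : 'rV[A]_n) : 'rV[A]_n :=
  \row_l \sum_i \sum_j x 0 i * y 0 j * alg_in A (c i j l).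
Definition cone (A : algebra R) : 'rV[A]_n := \row_l (l == i0)%:R.
Definition cmx (A : algebra R) (x : 'rV[A]_n) : 'M[A]_n :=
  \matrix_(j, l) \sum_i x 0 i * alg_in A (c i j l).

(** Only commutativity, associativity and the unit [i0] are recorded: bilinearity is built into
    [cmul]. *)
Record lattice_law : Prop := LatticeLaw {
  llC : forall i j l, c i j l = c j i l;
  llA : forall i j k l, \sum_m c i j m * c m k l = \sum_m c j k m * c i m l;
  ll1 : forall j l, c i0 j l = (j == l)%:R }.

Hypothesis law : lattice_law.
Section Alg.
Variable A : algebra R.
Implicit Types x y z : 'rV[A]_n.

Lemma cmulE x y : cmul x y = y *m cmx x.
Proof.
apply/rowP => l; rewrite !mxE exchange_big; apply: eq_bigr => j _.
by rewrite mxE mulr_sumr; apply: eq_bigr => i _; rewrite mulrCA mulrA.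
Qed.

Lemma cmulC x y : cmul x y = cmul y x.
Proof.
apply/rowP => l; rewrite !mxE exchange_big; apply: eq_bigr => j _.
by apply: eq_bigr => i _; rewrite llC // [x _ _ * _]mulrC.
Qed.

Lemma cmxM x y : cmx (cmul x y) = cmx x *m cmx y.
Proof.
apply/matrixP => k l; rewrite !mxE.
transitivity (\sum_i \sum_j x 0 i * y 0 j * alg_in A (\sum_m c i j m * c m k l)).
  under eq_bigr => m _ do rewrite mxE mulr_suml.
  rewrite exchange_big; apply: eq_bigr => i _ /=.
  under eq_bigr => m _ do rewrite mulr_suml.
  rewrite exchange_big; apply: eq_bigr => j _ /=.
  by rewrite rmorph_sum mulr_sumr; apply: eq_bigr => m _; rewrite rmorphM mulrA.
under [RHS]eq_bigr => m _ do rewrite !mxE mulr_suml.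
rewrite [RHS]exchange_big; apply: eq_bigr => i _ /=.
under [RHS]eq_bigr => m _ do rewrite mulr_sumr.
rewrite [RHS]exchange_big; apply: eq_bigr => j _ /=.
have -> : \sum_m c i j m * c m k l = \sum_m c i k m * c j m l.
  under eq_bigr => m _ do rewrite llC // .
  by rewrite llA //; under [in RHS]eq_bigr => m _ do rewrite (llC law i k).
rewrite rmorph_sum mulr_sumr; apply: eq_bigr => m _; rewrite rmorphM.
ring.
Qed.

Lemma cmx1 : cmx (cone A) = 1%:M.
Proof.
apply/matrixP => j l; rewrite !mxE (bigD1 i0) //= big1 ?addr0; last first.
  by move=> i /negPf ni; rewrite mxE ni mul0r.
by rewrite mxE eqxx mul1r ll1 // rmorph_nat.
Qed.

Lemma cmul1 x : cmul (cone A) x = x.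
Proof. by rewrite cmulE cmx1 mulmx1. Qed.

Lemma cmulA x y z : cmul x (cmul y z) = cmul (cmul x y) z.
Proof. by rewrite [cmul x y]cmulC [in LHS]cmulE [cmul y z]cmulE -mulmxA -cmxM -cmulE. Qed.

Lemma cmulACA x y z w : cmul (cmul x y) (cmul z w) = cmul (cmul x z) (cmul y w).
Proof. by rewrite -cmulA [cmul y _]cmulA [cmul y z]cmulC -[cmul (cmul z y) w]cmulA cmulA. Qed.

Lemma cmulDr x y z : cmul x (y + z) = cmul x y + cmul x z.
Proof. by rewrite !cmulE mulmxDl. Qed.
Lemma cmulZr a x y : cmul x (a *: y) = a *: cmul x y.
Proof. by rewrite !cmulE -scalemxAl. Qed.

Lemma cinv_uniq x y z : cmul x y = cone A -> cmul x z = cone A -> y = z.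
Proof. by move=> e1 e2; rewrite -[y]cmul1 -e2 -cmulA [cmul z y]cmulC cmulA e1 cmul1. Qed.

(** Units are detected by the norm, the determinant of multiplication: the adjugate supplies the
    inverse. *)
Lemma cunit_det x : (exists y, cmul x y = cone A) <-> exists d, \det (cmx x) * d = 1.
Proof.
split=> [[y e]|[d e]].
  by exists (\det (cmx y)); rewrite -det_mulmx -cmxM e cmx1 det1.
exists (cone A *m (d *: \adj (cmx x))); rewrite cmulE -mulmxA -scalemxAl mul_adj_mx.
by rewrite -mul_scalar_mx -scalar_mxM mulrC e mulmx1.
Qed.
End Alg.

Lemma cmul_map (A B : algebra R) (f : alghom A B) (x y : 'rV[A]_n) :
  map_mx f (cmul x y) = cmul (map_mx f x) (map_mx f y).
Proof.
apply/rowP => l; rewrite !mxE rmorph_sum; apply: eq_bigr => i _.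
rewrite rmorph_sum; apply: eq_bigr => j _.
by rewrite !mxE !rmorphM hom_in.
Qed.
Lemma cone_map (A B : algebra R) (f : alghom A B) : map_mx f (cone A) = cone B.
Proof. by apply/rowP => l; rewrite !mxE rmorph_nat. Qed.
Lemma cmx_map (A B : algebra R) (f : alghom A B) (x : 'rV[A]_n) :
  map_mx f (cmx x) = cmx (map_mx f x).
Proof.
apply/matrixP => j l; rewrite !mxE rmorph_sum; apply: eq_bigr => i _.
by rewrite mxE rmorphM hom_in.
Qed.

Definition tpt (A : algebra R) := {u : 'rV[A]_n * 'rV[A]_n | cmul u.1 u.2 == cone A}.
Definition tx (A : algebra R) (t : tpt A) : 'rV[A]_n := (sval t).1.
Definition ty (A : algebra R) (t : tpt A) : 'rV[A]_n := (sval t).2.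
Lemma txy A (t : tpt A) : cmul (tx t) (ty t) = cone A.
Proof. exact/eqP/(svalP t). Qed.
Definition mkt (A : algebra R) (x y : 'rV[A]_n) (e : cmul x y = cone A) : tpt A :=
  exist (fun u : 'rV[A]_n * 'rV[A]_n => cmul u.1 u.2 == cone A) (x, y) (introT eqP e).
Lemma tpt_eq A (t s : tpt A) : tx t = tx s -> t = s.
Proof.
move=> e; apply: val_inj => /=.
have := cinv_uniq (txy t) (z := ty s); rewrite e txy => /(_ erefl).
by move: e; rewrite /tx /ty; case: (sval t) (sval s) => [? ?] [? ?] /= -> ->.
Qed.

Fact tmap_sub (A B : algebra R) (f : alghom A B) (t : tpt A) :
  cmul (map_mx f (tx t)) (map_mx f (ty t)) = cone B.
Proof. by rewrite -cmul_map txy cone_map. Qed.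
Definition tmap (A B : algebra R) (f : alghom A B) (t : tpt A) : tpt B := mkt (tmap_sub f t).
Fact tmap_id (A : algebra R) (f : alghom A A) (t : tpt A) : f =1 id -> tmap f t = t.
Proof. by move=> e; apply: tpt_eq; apply/rowP => i; rewrite mxE e. Qed.
Fact tmap_comp (A B C : algebra R) (f : alghom A B) (g : alghom B C) (h : alghom A C)
  (t : tpt A) : h =1 g \o f -> tmap h t = tmap g (tmap f t).
Proof. by move=> e; apply: tpt_eq; apply/rowP => i; rewrite !mxE e. Qed.
Definition tor : presheaf R := Presheaf tmap_id tmap_comp.

Definition tone A : tpt A := mkt (cmul1 (cone A)).
Fact tmul_sub A (t s : tpt A) : cmul (cmul (tx t) (tx s)) (cmul (ty t) (ty s)) = cone A.
Proof. by rewrite cmulACA !txy cmul1. Qed.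
Definition tmul A (t s : tpt A) : tpt A := mkt (tmul_sub t s).
Fact tinv_sub A (t : tpt A) : cmul (ty t) (tx t) = cone A.
Proof. by rewrite cmulC txy. Qed.
Definition tinv A (t : tpt A) : tpt A := mkt (tinv_sub t).
Lemma tmul_map (A B : algebra R) (f : alghom A B) (t s : tpt A) :
  tmap f (tmul t s) = tmul (tmap f t) (tmap f s).
Proof. by apply: tpt_eq; apply: cmul_map. Qed.

Lemma tx_map (A B : algebra R) (f : alghom A B) (t : tpt A) : tx (tmap f t) = map_mx f (tx t).
Proof. by []. Qed.

Lemma psum_exists (A : algebra R) N T (r : seq T) (E : T -> pexpr R N) :
  exists e : pexpr R N, forall (B : algebra R) (a : 'I_N -> B),
    peval a e = \sum_(t <- r) peval a (E t).
Proof.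
elim: r => [|t r [e IH]]; first by exists (PConst _ 0) => B a; rewrite big_nil /= rmorph0.
by exists (PAdd (E t) e) => B a; rewrite big_cons /= IH.
Qed.

Lemma tor_rels : exists r : 'I_n -> pexpr R (n + n), forall (B : algebra R) (a : 'I_(n + n) -> B) l,
  peval a (r l) = cmul (\row_i a (lshift n i)) (\row_i a (rshift n i)) 0 l - (l == i0)%:R.
Proof.
have /choice[r rE] : forall l : 'I_n, exists e : pexpr R (n + n), forall (B : algebra R) (a : 'I_(n + n) -> B),
  peval a e = cmul (\row_i a (lshift n i)) (\row_i a (rshift n i)) 0 l - (l == i0)%:R.
  move=> l.
  have [e eE] := psum_exists (self_alg R) (index_enum ('I_n * 'I_n)%type)
    (fun u : 'I_n * 'I_n => PMul (PMul (PVar R (lshift n u.1)) (PVar _ (rshift n u.2)))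
       (PConst _ (c u.1 u.2 l))).
  exists (PAdd e (PConst _ (- (l == i0)%:R))) => B a /=.
  rewrite rmorphN rmorph_nat eE mxE pair_bigA; congr (_ - _).
  by apply: eq_bigr => -[i j] _ /=; rewrite !mxE.
by exists r => B a l; apply: rE.
Qed.

Lemma tor_coords : exists (r : 'I_n -> pexpr R (n + n)) (co : forall A, tor A -> 'I_(n + n) -> A),
  coords (X := tor) (fun e => exists i, r i = e) co.
Proof.
have [r rE] := tor_rels; exists r.
exists (fun A (t : tpt A) i => match fintype.split i with
  inl i => tx t 0 i | inr i => ty t 0 i end).
have el A (t : tpt A) : (\row_i match fintype.split (lshift n i) with
     inl i => tx t 0 i | inr i => ty t 0 i end) = tx t.
  by apply/rowP => i; rewrite mxE (unsplitK (inl _ : 'I_n + 'I_n)).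
have er A (t : tpt A) : (\row_i match fintype.split (rshift n i) with
     inl i => tx t 0 i | inr i => ty t 0 i end) = ty t.
  by apply/rowP => i; rewrite mxE (unsplitK (inr _ : 'I_n + 'I_n)).
split.
- by move=> A B f x i; case: fintype.split => j; rewrite mxE.
- move=> A x y h; apply: tpt_eq; rewrite -el -[RHS]el.
  by apply/rowP => i; rewrite !mxE h.
- move=> A x _ [l <-]; rewrite rE el er txy mxE subrr //.
- move=> A a h.
  have e : cmul (\row_i a (lshift n i)) (\row_i a (rshift n i)) = cone A.
    apply/rowP => l; apply/eqP; rewrite -subr_eq0 [cone A _ _]mxE -rE h //; by exists l.
  exists (mkt e) => i; case: splitP => j ej; rewrite mxE; congr a; exact: val_inj.
Qed.

(** Any lift of the coordinates of a unit is a unit: its norm is invertible modulo a nilpotent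
    kernel, hence invertible. *)
Lemma tor_fsmooth : formally_smooth tor.
Proof.
move=> A B f fs fn t.
have /choice[g gE] := fs; pose x := map_mx g (tx t).
have fx : map_mx f x = tx t by apply/rowP => i; rewrite !mxE gE.
have [[y /= e]|] := pselect (exists y, cmul x y = cone A).
  by exists (mkt e); apply: tpt_eq.
case; apply/cunit_det.
have /cunit_det[d dE] : exists y, cmul (tx t) y = cone B by exists (ty t); rewrite txy.
apply: (nilp_unit fs fn (y := d)); rewrite -dE -det_map_mx cmx_map fx //.
Qed.

Lemma tor_smooth : smooth_scheme tor.
Proof.
have [r [co coP]] := tor_coords.
exact: (coords_smooth coP (r := r) (fun=> iff_refl _) tor_fsmooth).
Qed.
End Lattice.

Lemma pmapc (R : comPzRingType) (Y : presheaf R) (A B C : algebra R)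
  (f : alghom A B) (g : alghom B C) (x : Y A) : pmap (alg_comp g f) x = pmap g (pmap f x).
Proof. exact: pmap_comp. Qed.

Lemma pmap_ext (R : comPzRingType) (Y : presheaf R) (A B : algebra R)
  (f g : alghom A B) (x : Y A) : f =1 g -> pmap f x = pmap g x.
Proof. by move=> e; rewrite (@pmap_comp _ Y _ _ _ (alg_id A) g f) // pmap_id. Qed.

Lemma pmapcE (R : comPzRingType) (Y : presheaf R) (A B C : algebra R)
  (f : alghom A B) (g : alghom B C) (h : alghom A C) (x : Y A) :
  (forall a, g (f a) = h a) -> pmap g (pmap f x) = pmap h x.
Proof. by move=> e; rewrite -pmapc; apply: pmap_ext => a /=. Qed.

Lemma field_unit (R : comPzRingType) (F : fieldType) (s : {rmorphism R -> F})
  (x : Algebra s) : x != 0 -> exists y, x * y = 1.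
Proof. by move=> x0; exists (x : F)^-1; apply: divff. Qed.

Lemma gen_unit_pt (R : comPzRingType) (C : algebra R) (F : fieldType)
    (s : {rmorphism R -> F}) (g : alghom C (Algebra s)) (S : C -> Prop) :
  gen_unit_ideal g S -> exists2 a, S a & g a != 0.
Proof.
exact: (@gen_unit_field R C (Algebra s) F g (idfun : {rmorphism F -> F})).
Qed.

Lemma unit_field (F : fieldType) (x y : F) : x * y = 1 -> x != 0.
Proof. by move=> e; apply/eqP => x0; move/eqP: e; rewrite x0 mul0r eq_sym oner_eq0. Qed.

(** * Open subfunctors and charts *)

Section Openness.
Variables (R : comPzRingType) (Y : presheaf R).
Implicit Types (P U : subfunctor Y) (C : algebra R).

(* [P] holds around [x] on a basic open neighbourhood of the point [g] *)
Definition near_pt P C (x : Y C) (F : fieldType) (s : {rmorphism R -> F})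
    (g : alghom C (Algebra s)) :=
  exists2 a : C, g a != 0 & forall C' (f : alghom C C'), (exists w, f a * w = 1) ->
    P C' (pmap f x).

Lemma open_near P C x F s g : is_open P -> P _ (pmap g x) -> @near_pt P C x F s g.
Proof.
move=> Po; have [S SE] := Po C x => /SE h.
have [a Sa ga] := gen_unit_pt h.
by exists a => // C' f [w e]; apply/SE/(gen_unitW Sa e).
Qed.

Lemma open_local P C x : is_open P ->
  (forall F s g, @near_pt P C x F s g) -> P C x.
Proof.
move=> Po h; have [S SE] := Po C x.
rewrite -[x](pmap_id (f := alg_id C)) //; apply/SE; apply: contrapT => nS.
have [F [g gS]] := not_unit_field nS.
have [a ga aP] := h F _ (over_hom g); move: (aP _ _ (field_unit ga)).
move/SE => /gen_unit_pt[b Sb].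
by rewrite /= (gS b Sb) eqxx.
Qed.

(** The set required by [is_open] consists of all [a] over whose basic open set [x] satisfies [P].
    The first hypothesis makes [P] local, the second makes it an open condition at field-valued
    points. *)
Lemma open_intro P :
  (forall C x, (forall F s g, @near_pt P C x F s g) -> P C x) ->
  (forall C x F s g, P _ (pmap g x) -> @near_pt P C x F s g) -> is_open P.
Proof.
move=> L Nr C x.
pose S a := forall C' (f : alghom C C'), (exists w, f a * w = 1) -> P C' (pmap f x).
exists S => C' f; split=> [Pf|gu].
  apply: contrapT => /not_unit_field[F [g gS]].
  have [|a ga aP] := Nr C x F _ (alg_comp (over_hom g) f).
    by rewrite pmapc; apply: sf_map.
  by move/eqP: ga; apply; apply: gS.
apply: L => F s g; have [a Sa ga] := gen_unit_field g gu.
by exists (f a) => // C'' f' fw; rewrite -pmapc; apply: Sa.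
Qed.

(** A lift of the point to [Y] stays in the open part: [U] at the lift asks for a unit ideal, and
    units are detected modulo a nilpotent kernel. *)
Lemma chart_liftable U (A : algebra R) : is_open U -> formally_smooth Y ->
  represented U A -> liftable A.
Proof.
move=> Uo fs [u uP] B C f fsu fnil g.
have [x xE] := fs _ _ f fsu fnil (pmap g u).
have [US Uu] := uP C; have Ug : U C (pmap g u) by apply/US; exists g.
have [S SE] := Uo B x.
have Ux : U B x.
  rewrite -[x](pmap_id (f := alg_id B)) //; apply/SE.
  move: Ug; rewrite -xE => /SE[m [b [s [hs e]]]].
  have /choice[b' bE] : forall i, exists y, f y = b i by move=> i; apply: fsu.
  have [|w we] := nilp_unit (b := \sum_i b' i * s i) (y := 1) fsu fnil.
    rewrite mulr1 rmorph_sum -e; apply: eq_bigr => i _; by rewrite rmorphM bE.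
  exists m, (fun i => w * b' i), s; split=> //=.
  by rewrite -we mulr_suml; apply: eq_bigr => i _; rewrite -mulrA mulrC.
have [/(_ x)[/(_ Ux) [s sE] _] _] := uP B.
exists s => a; apply: (Uu (alg_comp f s) g).
by rewrite pmapc sE.
Qed.

(* the point [u] of [Y(A)] is an open immersion of [Spec A] *)
Definition chart (A : algebra R) (u : Y A) :=
  (forall C (f g : alghom A C), pmap f u = pmap g u -> f =1 g) /\
  exists2 U : subfunctor Y, is_open U &
    forall C y, U C y <-> exists f : alghom A C, pmap f u = y.

(** Membership in the smaller open set is the invertibility of [h]: on a basic open set of [C] sent
    into [U], the pull-back of [h] is a fraction with numerator [d], and [a * d] defines the
    neighbourhood. *)
Lemma chart_loc (A : algebra R) (u : Y A) h (A1 : algebra R) (l : alghom A A1) :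
  chart u -> is_localization l h -> chart (pmap l u).
Proof.
move=> [ui [U Uo UE]] lP; have [[w we] _ ls] := lP.
have li C (f g : alghom A1 C) : pmap f (pmap l u) = pmap g (pmap l u) -> f =1 g.
  rewrite -!pmapc => /ui e; apply: (loc_hom_eq lP); exact: e.
split=> //.
pose V C y := exists f : alghom A1 C, pmap f (pmap l u) = y.
have Vm C C' (f : alghom C C') y : V C y -> V C' (pmap f y).
  by move=> [g <-]; exists (alg_comp f g); rewrite pmapc.
exists (@Subfunctor R Y V Vm) => // {li}.
have VU C y : V C y -> U C y.
  by move=> [f <-]; apply/UE; exists (alg_comp f l); rewrite pmapc.
apply: open_intro => [C x nr|C x F s g Vg] /=.
  have /UE[f fE] : U C x.
    by apply: open_local => // F s g; have [a ga aP] := nr F s g; exists a => // C' f' /aP/VU.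
  suff [z ze] : exists z, f h * z = 1.
    have [f1 f1E] := loc_lift lP (ex_intro _ z ze).
    by exists f1; rewrite (pmapcE (h := f)).
  have [m [b [s [hs e]]]] : gen_unit_ideal f (fun a => a = h); last first.
    exists (\sum_i b i); rewrite mulrC -e mulr_suml; apply: eq_bigr => i _; by rewrite hs.
  apply: contrapT => /not_unit_field[F [g gh]].
  have [a ga aP] := nr F _ (over_hom g); have [f1] := aP _ _ (field_unit ga).
   rewrite -fE -!pmapc => /ui /(_ h) /= e.
  have : g (f h) * f1 w = 1 by rewrite -e -rmorphM we rmorph1.
  by move/unit_field; rewrite gh ?eqxx.
have [a ga aP] : near_pt U x g by apply: open_near => //; apply: VU.
have [D [q qP]] := loc_exists a; have [[b be] _ qs] := qP.
have /UE[f fE] : U D (pmap q x) by apply: aP; exists b.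
have [m [d dE]] := qs (f h).
have [g' g'E] := loc_lift qP (field_unit ga).
have [f1 f1E] := Vg.
have f1h z : g' (f z) = f1 (l z).
  apply: (ui _ (alg_comp g' f) (alg_comp f1 l)).
  by rewrite !pmapc f1E fE (pmapcE (h := g)).
have gd : g d != 0.
  rewrite -g'E -dE rmorphM rmorphXn g'E mulf_neq0 ?expf_neq0 //.
  apply: (@unit_field F _ (f1 w)); by rewrite f1h -rmorphM we rmorph1.
exists (a * d); first by rewrite rmorphM mulf_neq0.
move=> C' f' [z]; rewrite rmorphM => ez.
have [f2 f2E] : exists f2 : alghom D C', forall a, f2 (q a) = f' a.
  by apply: (loc_lift qP); exists (f' d * z); rewrite mulrA.
have [f3 f3E] : exists f3 : alghom A1 C', forall a, f3 (l a) = f2 (f a).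
  apply: (loc_lift (f := alg_comp f2 f) lP); exists (f' a ^+ m * f' a * z).
  have : f2 (q a ^+ m * f h) = f' d by rewrite dE f2E.
  by rewrite rmorphM rmorphXn f2E /= => E; rewrite !mulrA [f2 _ * _]mulrC E [f' d * _]mulrC.
exists f3; rewrite (pmapcE (h := alg_comp f2 f)) ?pmapc //= fE.
exact: pmapcE.
Qed.
End Openness.

Section Group.
Variables (R : comPzRingType) (G : group_functor R) (A : algebra R).
Implicit Types x y z : G A.
Lemma gmulKV x y : gmul (ginv x) (gmul x y) = y.
Proof. by rewrite gmulA gmulV gmul1. Qed.
Lemma gmulI x y z : gmul x y = gmul x z -> y = z.
Proof. by move=> e; rewrite -(gmulKV x y) e gmulKV. Qed.
Lemma gmulrV x : gmul x (ginv x) = gone G A.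
Proof.
by rewrite -[LHS]gmul1 -[in LHS](gmulV (ginv x)) -gmulA (gmulKV x) gmulV.
Qed.
Lemma gmulr1 x : gmul x (gone G A) = x.
Proof. by rewrite -(gmulV x) gmulA gmulrV gmul1. Qed.
Lemma gidem x : gmul x x = x -> x = gone G A.
Proof. by move=> e; apply: (@gmulI x); rewrite e gmulr1. Qed.
Lemma ginv_uniq x y : gmul x y = gone G A -> y = ginv x.
Proof. by move=> e; apply: (@gmulI x); rewrite e gmulrV. Qed.
Lemma gmulKr x y : gmul x (gmul (ginv x) y) = y.
Proof. by rewrite gmulA gmulrV gmul1. Qed.
End Group.

Lemma pmap_gone (R : comPzRingType) (G : group_functor R) (A B : algebra R)
  (f : alghom A B) : pmap f (gone G A) = gone G B.
Proof. by apply: gidem; rewrite -gmul_map gmul1. Qed.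
Lemma pmap_ginv (R : comPzRingType) (G : group_functor R) (A B : algebra R)
  (f : alghom A B) (x : G A) : pmap f (ginv x) = ginv (pmap f x).
Proof. by apply: ginv_uniq; rewrite -gmul_map gmulrV pmap_gone. Qed.

(** * Generic fibres *)

Section GenericFibre.
Variables (K : fieldType) (v : valuation K).
Local Notation O := (integers v).
Local Notation iK := (int_incl v).
Local Notation pi := (opi v).

Definition jK : alghom (self_alg O) (restr iK (self_alg K)) :=
  @AlgHom O (self_alg O) (restr iK (self_alg K)) iK (fun=> erefl).
Definition str (C : algebra O) : alghom (self_alg O) C :=
  @AlgHom O (self_alg O) C (alg_in C) (fun=> erefl).

Lemma jK_loc : is_localization jK pi.
Proof.
split.
- by exists (unif v)^-1; apply: divff; exact: unif_neq0.
- by move=> a e; exists 0%N; rewrite expr0 mul1r; apply: int_val_inj.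
- move=> b; case: (eqVneq b 0) => [->|b0]; first by exists 0%N, 0; rewrite mulr0 rmorph0.
  pose m := `|v b|%N; have h : vge v 0 (unif v ^+ m * b).
    rewrite /vge vmapM ?expf_neq0 ?unif_neq0 // vmapX ?unif_neq0 // unifE.
    by apply/orP; right; rewrite /m natz; lia.
  by exists m, (mkint h); rewrite /= -[RHS]/(unif v ^+ m * b).
Qed.

(** Inverting the uniformizer in [A] gives an algebra over [K], since [K] is itself the localization
    of its integers there; [AK] is the coordinate ring of the generic fibre. *)
Lemma gen_fiber (A : algebra O) : exists (AK : algebra K) (l : alghom A (restr iK AK)),
  is_localization l (alg_in A pi) /\
  forall (C : algebra K) (f : alghom A (restr iK C)),
    exists g : alghom AK C, forall a, g (l a) = f a.
Proof.
have [B [l0 lP]] := loc_exists (alg_in A pi); have [[w we] lk ls] := lP.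
have [|g gE] := loc_lift (f := str B) jK_loc.
  by exists w; rewrite /= -(hom_in l0).
pose AK : algebra K := @Algebra K B (g : {rmorphism K -> B}).
have lin r : l0 (alg_in A r) = alg_in (restr iK AK) r.
  by rewrite hom_in /=; rewrite -[RHS]/(g (jK r)) gE.
pose l : alghom A (restr iK AK) := @AlgHom O A (restr iK AK) l0 lin.
exists AK, l; split=> [|C f]; first by split=> //; exists w.
have lP' : is_localization l (alg_in A pi) by split=> //; exists w.
have ipi : alg_in C (unif v) * alg_in C (unif v)^-1 = 1.
  by rewrite -rmorphM divff ?unif_neq0 // rmorph1.
have [|g' g'E] := loc_lift (f := f) lP'.
  by exists (alg_in C (unif v)^-1); rewrite hom_in.
unshelve eexists (@AlgHom K AK C g' _); last exact: g'E.
pose h1 : alghom (restr iK (self_alg K)) (restr iK C) := @AlgHom O (restr iK (self_alg K)) (restr iK C) (alg_in C) (fun=> erefl).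
have h2in r : (g' \o alg_in AK) (alg_in (restr iK (self_alg K)) r) = alg_in (restr iK C) r.
  exact: (hom_in g' r).
pose h2 : alghom (restr iK (self_alg K)) (restr iK C) :=
  @AlgHom O (restr iK (self_alg K)) (restr iK C) (g' \o alg_in AK : {rmorphism K -> C}) h2in.
move=> r; apply: (loc_hom_eq (g := h2) (g' := h1) jK_loc) => a.
exact: (hom_in g' a).
Qed.
End GenericFibre.

(** * The Neron lft-model of the unit group of a lattice *)

Section Neron.
Variables (K : fieldType) (v : valuation K) (k : closedFieldType).
Variables (red : {rmorphism integers v -> k}) (p : nat).
Hypotheses (redP : residue_map red) (p_char : p \in [pchar k]) (Kc : complete_field v).
Local Notation O := (integers v).
Local Notation iK := (int_incl v).
Local Notation pi := (opi v).
Local Notation sK := (self_alg K).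
Local Notation sO := (self_alg O).
Local Notation jK := (jK v).
Variables (n : nat) (i0 : 'I_n) (c : 'I_n -> 'I_n -> 'I_n -> O).
Hypothesis law : lattice_law i0 c.
Variables (B : group_functor K) (co : forall A : algebra K, B A -> 'rV[A]_n).
Hypotheses
  (com : forall A A' (f : alghom A A') x, co (pmap f x) = map_mx f (co x))
  (coi : forall A, injective (@co A))
  (coM : forall A (x y : B A), co (gmul x y) = cmul (A := restr iK A) c (co x) (co y))
  (co1 : forall A, co (gone B A) = cone i0 (restr iK A))
  (cos : forall (A : algebra K) (x y : 'rV[A]_n), cmul (A := restr iK A) c x y = cone i0 (restr iK A) ->
    exists b, co b = x).
Variable W : 'rV[K]_n -> int.
Local Notation cmulK := (cmul (A := restr iK sK) c).
Hypotheses
  (Wge : forall (x : 'rV[K]_n) m, x != 0 ->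
    (m <= W x <-> forall i, x 0 i != 0 -> m <= n%:Z * v (x 0 i) + (i : nat)%:Z))
  (WM : forall x y : 'rV[K]_n, x != 0 -> y != 0 ->
     cmulK x y != 0 /\ W (cmulK x y) = W x + W y).
Variable N : neron_lft v B.
Local Notation T := (tor law).

Let n0 : (0 < n)%N := leq_ltn_trans (leq0n i0) (ltn_ord i0).

Lemma W_attained (x : 'rV[K]_n) : x != 0 ->
  exists2 i, x 0 i != 0 & W x = n%:Z * v (x 0 i) + (i : nat)%:Z.
Proof.
move=> x0; apply: contrapT => h.
have /(Wge (W x) x0) w1 := lexx (W x).
suff : W x + 1 <= W x by lia.
apply/(Wge _ x0) => i xi; have := w1 i xi; rewrite le_eqVlt => /predU1P[e|]; last by lia.
by case: h; exists i.
Qed.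

(** The offset [i] is smaller than [n], too small to compensate a negative valuation. *)
Lemma W_int (x : 'rV[K]_n) : x != 0 -> 0 <= W x -> forall i, vge v 0 (x 0 i).
Proof.
move=> x0 /(Wge _ x0) h i; rewrite /vge; case: eqVneq => //= xi.
have := h i xi; have := ltn_ord i; nia.
Qed.

Definition gco (A : algebra K) (x : N (restr iK A)) : 'rV[A]_n := co (nm_generic N A x).

Lemma gco_map (A A' : algebra K) (f : alghom A A') x :
  gco (pmap (restr_hom iK f) x) = map_mx f (gco x).
Proof. by rewrite /gco -com -(mor_map (nm_generic N)). Qed.
Lemma gcoM (A : algebra K) (x y : N (restr iK A)) :
  gco (gmul x y) = cmul (A := restr iK A) c (gco x) (gco y).
Proof. by rewrite /gco nm_generic_hom coM. Qed.
Lemma gco1 (A : algebra K) : gco (gone N (restr iK A)) = cone i0 (restr iK A).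
Proof. by rewrite /gco -co1; congr co; apply: gidem; rewrite -nm_generic_hom gmul1. Qed.
Lemma gco_inj (A : algebra K) : injective (@gco A).
Proof. by move=> x y /coi e; apply: (bij_inj (nm_generic_bij N A)). Qed.

Definition torsion_free (A : algebra O) := forall x : A, alg_in A pi * x = 0 -> x = 0.

Lemma tf_loc (A A' : algebra O) (l : alghom A A') s : torsion_free A -> is_localization l s -> torsion_free A'.
Proof.
move=> tA [[w we] l0 ls] x e; have [m [a ea]] := ls x.
have xE : x = w ^+ m * l a by rewrite -ea mulrA -exprMn [w * _]mulrC we expr1n mul1r.
have /l0[m' e'] : l (alg_in A pi * a) = 0.
  by rewrite rmorphM hom_in -ea mulrCA e mulr0.
have /tA e1 : alg_in A pi * (s ^+ m' * a) = 0 by rewrite mulrCA.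
rewrite xE -[l a](mul1r) -(expr1n _ m') -we exprMn mulrAC -rmorphXn -rmorphM.
by rewrite e1 rmorph0 mul0r mulr0.
Qed.

Lemma tf_inj (A A' : algebra O) (l : alghom A A') : torsion_free A ->
  is_localization l (alg_in A pi) -> injective l.
Proof.
move=> tA [_ l0 _] x y e; apply/eqP; rewrite -subr_eq0; apply/eqP.
have [|m em] := l0 (x - y); first by rewrite rmorphB e subrr.
by elim: m em => [|m IH]; rewrite ?expr0 ?mul1r // exprS -mulrA => /tA.
Qed.

(** By separatedness the locus of equality is closed, and over a torsion-free [A] a closed condition
    that holds generically holds. *)
Lemma N_eq (A : algebra O) (AK : algebra K) (l : alghom A (restr iK AK)) (x y : N A) :
  torsion_free A -> is_localization l (alg_in A pi) ->
  gco (pmap l x) = gco (pmap l y) -> x = y.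
Proof.
move=> tA lP /gco_inj e; have [S SE] := nm_separated x y.
have Sl := (SE _ l).1 e.
rewrite -[x](pmap_id (f := alg_id A)) // -[y](pmap_id (f := alg_id A)) //.
by apply/SE => s /Sl ls; apply: (tf_inj tA lP); rewrite ls rmorph0.
Qed.

Lemma alpha_exists : exists al : morphism T N, forall (A : algebra K) (t : T (restr iK A)),
  gco (al (restr iK A) t) = tx t.
Proof.
have cu (A : algebra K) (t : tpt i0 c (restr iK A)) := cos (txy t).
pose u A t := sval (cid (cu A t)).
have uE A t : co (u A t) = tx t by rewrite /u; case: cid.
have um A A' (f : alghom A A') (t : base_change iK T A) : u A' (pmap f t) = pmap f (u A t).
  by apply: coi; rewrite com !uE.
have [[w wE] _] := nm_mapping N (tor_smooth law) (Morphism um).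
by exists w => A t; rewrite /gco wE /= uE.
Qed.

Variable al : morphism T N.
Hypothesis alE : forall (A : algebra K) (t : T (restr iK A)), gco (al (restr iK A) t) = tx t.

Lemma al_tf_inj (C : algebra O) (t s : T C) : torsion_free C -> al C t = al C s -> t = s.
Proof.
move=> tC e; have [CK [l [lP _]]] := gen_fiber C.
apply: tpt_eq => //; apply/rowP => i; apply: (tf_inj tC lP).
have := congr1 (fun z => gco (pmap l z)) e; rewrite -!mor_map !alE => /rowP/(_ i).
by rewrite !mxE.
Qed.

(** Identities between points over any [C], with torsion or not, follow by functoriality from the
    universal point; its ring is smooth, hence torsion free, and there they are checked on the
    generic fibre. *)
Lemma univ_point (Y : presheaf O) m r (rels : pexpr O r -> Prop) (R : 'I_m -> pexpr O r) cY :
  coords (X := Y) rels cY -> (forall e, rels e <-> exists i, R i = e) ->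
  formally_smooth Y ->
  exists (A : algebra O) (u : Y A), [/\ finitely_presented A, liftable A &
    forall C (y : Y C), exists f : alghom A C, pmap f u = y].
Proof.
move=> cP rE fs; have [A [a aP]] := pres_exists (fun e => exists i, R i = e).
have relsE : rels = (fun e => exists i, R i = e) by apply/funext => e; apply/propext/rE.
rewrite relsE in cP.
have Ar := coords_rep cP (U := full_sub Y) aP (fun _ _ => Logic.I).
have Uo : is_open (full_sub Y).
  move=> C y; exists (fun=> True) => D f; split=> // _.
  by apply: (gen_unitW (s := 1) (y := 1)); rewrite // rmorph1 mul1r.
have lA := chart_liftable Uo fs Ar.
have [u uP] := Ar; exists A, u; split=> //; first by exists r, a, m, R.
by move=> C y; have [/(_ y)[/(_ Logic.I)]] := uP C.
Qed.

Lemma univT : exists (A : algebra O) (u : T A), [/\ finitely_presented A, liftable A &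
    forall C (t : T C), exists f : alghom A C, pmap f u = t].
Proof.
have [R [cT cP]] := tor_coords law.
have h := univ_point (R := R) cP (fun=> iff_refl _) (@tor_fsmooth _ _ _ _ law).
exact: h.
Qed.

Lemma al_mul (C : algebra O) (t s : T C) : al C (tmul law t s) = gmul (al C t) (al C s).
Proof.
have [R [cT cP]] := tor_coords law.
pose R2 (i : 'I_(n + n)) := match fintype.split i with
  inl i => pren (lshift (n + n)) (R i) | inr i => pren (@rshift (n + n) (n + n)) (R i) end.
have [||A [u [fpA lA uA]]] := univ_point (coords_prod cP cP) (R := R2).
- move=> e; split=> [[[_ [i <-] ->]|[_ [i <-] ->]]|[i <-]].
  + by exists (lshift n i); rewrite /R2 (unsplitK (inl _ : 'I_n + 'I_n)).
  + by exists (rshift n i); rewrite /R2 (unsplitK (inr _ : 'I_n + 'I_n)).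
  + by rewrite /R2; case: fintype.split => j; [left|right]; exists (R j) => //; exists j.
- move=> D D' f fs fn [y y'].
  have [x xE] := tor_fsmooth fs fn y; have [x' xE'] := tor_fsmooth fs fn y'.
  by exists (x, x'); rewrite /= /prod_map xE xE'.
have [f /= fE] := uA C (t, s).
have [-> ->] : t = pmap f u.1 /\ s = pmap f u.2 by rewrite -[t]/(t, s).1 -[s]/(t, s).2 -fE.
rewrite !mor_map -gmul_map -(tmul_map law) mor_map; congr pmap.
have [AK [l [lP _]]] := gen_fiber A.
apply: (N_eq (chart_torsion_free redP p_char fpA lA) lP).
by rewrite gmul_map gcoM -!mor_map !alE /= tx_map cmul_map.
Qed.

Lemma al_inv (C : algebra O) (t : T C) : al C (tinv law t) = ginv (al C t).
Proof.
apply: ginv_uniq; rewrite -al_mul.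
have -> : tmul law t (tinv law t) = tone law C.
  by apply: tpt_eq => //; apply: txy.
by apply: gidem; rewrite -al_mul; congr (al C _); apply: tpt_eq => //; apply: cmul1.
Qed.

Lemma al_one (C : algebra O) : al C (tone law C) = gone N C.
Proof.
by apply: gidem; rewrite -al_mul; congr (al C _); apply: tpt_eq => //; apply: cmul1.
Qed.

(** Integral coordinates for [y] and for its inverse suffice: that they multiply to 1 is true
    generically, hence over the torsion-free [A]. *)
Lemma point_lift (A : algebra O) (AK : algebra K) (l : alghom A (restr iK AK))
    (y : N A) (x x' : 'rV[A]_n) :
  torsion_free A -> is_localization l (alg_in A pi) ->
  map_mx l x = gco (pmap l y) -> map_mx l x' = gco (pmap l (ginv y)) ->
  exists t, al A t = y.
Proof.
move=> tA lP hx hx'.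
have e : cmul c x x' = cone i0 A.
  apply/rowP => i; apply: (tf_inj tA lP).
  have := cmul_map c l x x'; rewrite hx hx' -gcoM -gmul_map gmulrV pmap_gone gco1.
  by rewrite -(cone_map i0 l) => /rowP/(_ i); rewrite !mxE.
exists (mkt e); apply: (N_eq tA lP).
by rewrite -mor_map alE tx_map.
Qed.

Definition generic_coord (y : N sO) : 'rV[K]_n := gco (pmap jK y).

Lemma generic_coordM y z : generic_coord (gmul y z) = cmulK (generic_coord y) (generic_coord z).
Proof. by rewrite /generic_coord gmul_map gcoM. Qed.
Lemma generic_coordV y : cmulK (generic_coord y) (generic_coord (ginv y)) = cone i0 (restr iK sK).
Proof. by rewrite -generic_coordM gmulrV /generic_coord pmap_gone gco1. Qed.
Lemma generic_coord_neq0 y : generic_coord y != 0.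
Proof.
apply/eqP => e; have /rowP/(_ i0) := generic_coordV y; rewrite e !mxE eqxx big1 => [/eqP|i _].
  by rewrite eq_sym oner_eq0.
by rewrite big1 // => j _; rewrite mxE !mul0r.
Qed.
(** The valuation of an integral point: a homomorphism to the additive group of integers, whose
    kernel is the image of [al] on integral points ([gval0_al], [al_gval0]). *)
Definition gval (y : N sO) : int := W (generic_coord y).
Lemma gvalM y z : gval (gmul y z) = gval y + gval z.
Proof. by rewrite /gval generic_coordM; case: (WM (generic_coord_neq0 y) (generic_coord_neq0 z)). Qed.
Lemma gval1 : gval (gone N sO) = 0.
Proof. by have := gvalM (gone N sO) (gone N sO); rewrite gmul1; lia. Qed.
Lemma gvalV y : gval (ginv y) = - gval y.
Proof. by have := gvalM y (ginv y); rewrite gmulrV gval1; lia. Qed.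

Lemma torsion_free_base : torsion_free sO. Proof. exact: opi_reg. Qed.

Lemma gval0_al y : gval y = 0 -> exists t, al sO t = y.
Proof.
move=> wy; have int_row z : gval z = 0 -> exists x : 'rV[O]_n, map_mx jK x = generic_coord z.
  move=> wz; have h := W_int (generic_coord_neq0 z); rewrite -/(gval z) wz lexx in h.
  by exists (\row_i mkint (h isT i)); apply/rowP => i; rewrite !mxE.
have [x hx] := int_row y wy.
have [x' hx'] := int_row (ginv y) (etrans (gvalV y) (congr1 -%R wy)).
exact: (point_lift torsion_free_base (jK_loc v) hx hx').
Qed.

Lemma al_gval0 (t : T sO) : gval (al sO t) = 0.
Proof.
have le0 (s : T sO) : 0 <= gval (al sO s).
  apply/(Wge _ (generic_coord_neq0 _)) => i; rewrite /generic_coord -mor_map alE tx_map mxE => xi.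
  have := int_valP (tx s 0 i); rewrite /vge; rewrite -[int_val _]/(jK (tx s 0 i)) (negPf xi) /=.
  by nia.
have := le0 t; have := le0 (tinv law t); rewrite al_inv gvalV; lia.
Qed.
Section ChartBounds.
Variables (A : algebra O).

Lemma chart_coord (AK : algebra K) (l : alghom A (restr iK AK)) (y : N A)
    (f : alghom A sO) :
  (forall (C : algebra K) (f : alghom A (restr iK C)),
    exists g : alghom AK C, forall a, g (l a) = f a) ->
  exists fK : alghom AK sK, (forall a, fK (l a) = int_val (f a)) /\
    generic_coord (pmap f y) = map_mx fK (gco (pmap l y)).
Proof.
move=> uK; have [fK fE] := uK sK (alg_comp jK f); exists fK; split; first exact: fE.
rewrite -gco_map /generic_coord; apply: (congr1 (@gco sK)).
by rewrite (pmapcE (h := alg_comp jK f)) // (pmapcE (h := alg_comp jK f)).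
Qed.

Lemma row_denominator (AK : algebra K) (l : alghom A (restr iK AK)) (F : 'rV[AK]_n) :
  is_localization l (alg_in A pi) ->
  exists s (g : 'I_n -> A), forall i, l (alg_in A pi) ^+ s * F 0 i = l (g i).
Proof.
move=> [_ _ ls].
have [s sE] : exists s, forall i, exists a, l (alg_in A pi) ^+ s * F 0 i = l a.
  apply: max_exists => [i m m' mm' [a e]|i]; last exact: ls.
  exists (alg_in A pi ^+ (m' - m) * a).
  by rewrite rmorphM rmorphXn -e mulrA -exprD subnK.
by have /choice[g gE] := sE; exists s, g.
Qed.

Lemma denom_val (AK : algebra K) (l : alghom A (restr iK AK)) (f : alghom A sO)
    (fK : alghom AK sK) s (x : AK) g : (forall a, fK (l a) = int_val (f a)) ->
  l (alg_in A pi) ^+ s * x = l g -> unif v ^+ s * fK x = int_val (f g).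
Proof.
move=> fE e; rewrite -fE -e rmorphM rmorphXn fE; congr (_ ^+ _ * _).
by rewrite hom_in.
Qed.

(** On an affine chart the generic coordinates have a common denominator [pi ^ s], and weights count
    valuations [n] times. *)
Lemma chart_bound (y : N A) : exists s : nat, forall f : alghom A sO, - s%:Z <= gval (pmap f y).
Proof.
have [AK [l [lP uK]]] := gen_fiber A.
have [s [g gE]] := row_denominator (gco (pmap l y)) lP.
exists (n * s)%N => f; have [fK [fE XE]] := chart_coord y f uK.
apply/(Wge _ (generic_coord_neq0 _)) => i; rewrite XE mxE => xi.
have := int_valP (f (g i)); rewrite -(denom_val fE (gE i)) /vge mulf_eq0 (negPf xi) orbF.
rewrite expf_eq0 (negPf (unif_neq0 v)) andbF /= vmapM ?expf_neq0 ?unif_neq0 //.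
by rewrite vmapX ?unif_neq0 // unifE natz; nia.
Qed.

Hypotheses (fpA : finitely_presented A) (lA : liftable A).

(** One factor [pi] is divided out at a time. Multiplying by [h] each time makes the function
    divisible also at the integral points where [h] reduces to 0, as [chart_divisible] requires. *)
Lemma chart_div_pow h M g :
  (forall f : alghom A sO, ~~ vge v 1 (int_val (f h)) -> vge v M%:Z (int_val (f g))) ->
  exists a, h ^+ M * g = alg_in A pi ^+ M * a.
Proof.
elim: M g => [|M IH] g hg; first by exists g.
have [|g1 g1E] := chart_divisible redP p_char Kc fpA lA (g := h * g).
  move=> f; rewrite rmorphM; case: (boolP (vge v 1 (int_val (f h)))) => hf.
    by apply: (idMr (I := mult_ideal pi)); rewrite -(expr1 pi); apply/opi_multP.
  apply: (idMl (i := mult_ideal pi)); rewrite -(expr1 pi); apply/opi_multP.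
  by apply: vge_le (hg f hf).
have [|a aE] := IH g1.
  move=> f hf; have /opi_multP[y yE] := hg f hf.
  have e : f g1 = pi ^+ M * (f h * y).
    apply/eqP; rewrite -subr_eq0; apply/eqP/(@opi_reg _ v).
    have := congr1 f g1E; rewrite !rmorphM hom_in yE => E.
    by rewrite mulrBr -E exprS; ring.
  by apply/opi_multP; exists (f h * y).
by exists a; rewrite exprSr -mulrA g1E mulrCA aE mulrA exprS.
Qed.
End ChartBounds.

Lemma int_min (T0 : Type) (f : T0 -> int) (s : nat) (t0 : T0) :
  (forall t, - s%:Z <= f t) -> exists t1, forall t, f t1 <= f t.
Proof.
move=> h; pose P m := `[< exists t, f t = m%:Z - s%:Z >].
have exP : exists m, P m.
  by exists (absz (f t0 + s%:Z)); apply/asboolP; exists t0; have := h t0; lia.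
case: (ex_minnP exP) => m /asboolP[t1 e1] mmin; exists t1 => t.
have /mmin : P (absz (f t + s%:Z)) by apply/asboolP; exists t; have := h t; lia.
by have := h t; lia.
Qed.

Lemma pmap_str (C : algebra O) (f : alghom C sO) (z : N sO) : pmap f (pmap (str C) z) = z.
Proof.
by rewrite (pmapcE (h := alg_id sO)) ?pmap_id // => a; rewrite /= hom_in.
Qed.

Lemma pmap_str2 (C D : algebra O) (f : alghom C D) (z : N sO) :
  pmap f (pmap (str C) z) = pmap (str D) z.
Proof. by apply: pmapcE => a; rewrite /= hom_in. Qed.

Lemma scale_le (a b i : int) : n%:Z * a + i <= n%:Z * b + i -> a <= b.
Proof. by rewrite lerD2r ler_pM2l // ltz_nat. Qed.

(** At an integral point of least weight some coordinate [i1] attains the weight, with valuation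
    [v1], and at no integral point of the chart is its valuation smaller. Hence that coordinate is
    [pi ^ v1] times a regular function [h], and where [h] is a unit the weight is constant, equal to
    [w0]. After localization at [h], a translate of value 0 has integral coordinates, as has its
    inverse, and [point_lift] applies. *)
Lemma good_chart : exists (A1 : algebra O) (u1 : N A1) (w0 : int),
  [/\ torsion_free A1, chart u1, exists f : alghom A1 sO, gval (pmap f u1) = w0 &
    forall z : N sO, gval z = - w0 -> exists t, al A1 t = gmul (pmap (str A1) z) u1].
Proof.
have [Nsh [I [U [Uc cov]]] fs] := nm_smooth N.
(* A chart that meets the special fibre, here at the neutral element, has an integral point [g0] to
   start from. *)
have [ii Ui] := cov k red (gone N (Algebra red)).
have [Uo [A fpA Ar]] := Uc ii; have lA := chart_liftable Uo fs Ar.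
have [u uP] := Ar.
have uc : chart u.
  split; first by move=> C; case: (uP C).
  by exists (U ii) => // C y; case: (uP C).
have [f0 f0E] : exists f : alghom A (Algebra red), pmap f u = gone N (Algebra red).
  by have [+ _] := uP (Algebra red); move=> /(_ (gone N (Algebra red)))[/(_ Ui)].
have [g0 _] := lift_point redP p_char Kc fpA lA f0.
have [s0 s0P] := chart_bound u.
have [f1 f1min] := int_min g0 s0P.
have [AK [l [lP uK]]] := gen_fiber A.
set F := gco (pmap l u).
have [i1 xi1 wi1] := W_attained (generic_coord_neq0 (pmap f1 u)).
set v1 := v (generic_coord (pmap f1 u) 0 i1) in wi1.
have [s [g gE]] := row_denominator F lP.
have Fge (f : alghom A sO) (fK : alghom AK sK) : (forall a, fK (l a) = int_val (f a)) ->
    generic_coord (pmap f u) = map_mx fK F -> vge v v1 (fK (F 0 i1)).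
  move=> fE XE; rewrite /vge; case: eqVneq => //= nz.
  have := f1min f; rewrite /gval => /(Wge _ (generic_coord_neq0 _))/(_ i1).
  rewrite XE mxE => /(_ nz); rewrite wi1; exact: scale_le.
have [h hE] : exists h, forall (f : alghom A sO) (fK : alghom AK sK), (forall a, fK (l a) = int_val (f a)) ->
    generic_coord (pmap f u) = map_mx fK F -> fK (F 0 i1) = unif v ^ v1 * int_val (f h).
  have u0 := unif_neq0 v.
  (* As [F 0 i1 = g i1 / pi ^ s], the function [h] is [g i1 / pi ^ (v1 + s)]: a division when the
     exponent is nonnegative, a multiplication otherwise. *)
  case: (leP 0 (v1 + s%:Z)) => sv.
    have [|a aE] := @chart_div_pow A fpA lA 1 (absz (v1 + s%:Z)) (g i1).
      move=> f _; have [fK [fE XE]] := chart_coord u f uK.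
      rewrite -(denom_val fE (gE i1)) gez0_abs // -[unif v ^+ s]/(unif v ^ s%:Z).
      by rewrite vge_scale; apply: (Fge f fK).
    exists a => f fK fE XE; apply: (mulfI (expf_neq0 s u0)).
    rewrite (denom_val fE (gE i1)); move: aE; rewrite expr1n mul1r => ->.
    rewrite rmorphM rmorphXn hom_in int_valM int_valX mulrA; congr (_ * _).
    rewrite -[unif v ^+ s]/(unif v ^ s%:Z) -expfzDr // [s%:Z + v1]addrC -[_ ^+ (absz _)]/(unif v ^ (absz (v1 + s%:Z))%:Z).
    by rewrite gez0_abs.
  exists (alg_in A pi ^+ (absz (v1 + s%:Z)) * g i1) => f fK fE XE.
  rewrite rmorphM rmorphXn hom_in int_valM int_valX -(denom_val fE (gE i1)) !mulrA.
  rewrite -[LHS]mul1r; congr (_ * _).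
  rewrite -[unif v ^+ s]/(unif v ^ s%:Z) -[_ ^+ (absz _)]/(unif v ^ (absz (v1 + s%:Z))%:Z).
  rewrite -!expfzDr // (_ : _ + _ = 0) ?expr0z //; lia.
have wh (f : alghom A sO) : ~~ vge v 1 (int_val (f h)) -> gval (pmap f u) = gval (pmap f1 u).
  move=> hf; have [fK [fE XE]] := chart_coord u f uK.
  have fh0 : int_val (f h) != 0 by apply: contraNneq hf => ->; rewrite vge0.
  have vfh : v (int_val (f h)) = 0.
    by have := int_valP (f h); move: hf; rewrite /vge (negPf fh0) /=; lia.
  have eF := hE f fK fE XE.
  have nz : generic_coord (pmap f u) 0 i1 != 0 by rewrite XE mxE eF mulf_neq0 ?unifXz_neq0.
  have /(Wge _ (generic_coord_neq0 _))/(_ i1 nz) := lexx (gval (pmap f u)).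
  rewrite XE mxE eF vmapM ?unifXz_neq0 // unifXz vfh addr0 -wi1 => le1.
  by have := f1min f; rewrite /gval in le1 *; lia.
have f1h : ~~ vge v 1 (int_val (f1 h)).
  have [fK [fE XE]] := chart_coord u f1 uK; have := hE f1 fK fE XE.
  have -> : fK (F 0 i1) = generic_coord (pmap f1 u) 0 i1 by rewrite XE mxE.
  move=> e; have fh0 : int_val (f1 h) != 0.
    by apply: contraNneq xi1 => h0; rewrite e h0 mulr0.
  have := erefl v1; rewrite {1}/v1 e vmapM ?unifXz_neq0 // unifXz /vge (negPf fh0) /=; lia.
have [A1 [q qP]] := loc_exists h; have [[wi we] _ _] := qP.
have tA := chart_torsion_free redP p_char fpA lA.
have tA1 := tf_loc tA qP.
exists A1, (pmap q u), (gval (pmap f1 u)); split=> //.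
- exact: chart_loc uc qP.
- have [f1' f1E] := loc_lift (f := f1) qP (int_unit f1h).
  by exists f1'; rewrite (pmapcE (h := f1)).
move=> z zw; have [A1K [l1 [l1P u1K]]] := gen_fiber A1.
have [r rE] := uK A1K (alg_comp l1 q).
have [[pw pwE] _ _] := l1P.
(* A point whose weight is nonnegative wherever [h] is a unit has regular coordinates once [h] is
   inverted. *)
have row (y : N A) : (forall f : alghom A sO, ~~ vge v 1 (int_val (f h)) -> 0 <= gval (pmap f y)) ->
    exists x : 'rV[A1]_n, map_mx l1 x = gco (pmap l1 (pmap q y)).
  move=> hy; have [s' [g' g'E]] := row_denominator (gco (pmap l y)) lP.
  have /choice[a aE] : forall i, exists a, h ^+ s' * g' i = alg_in A pi ^+ s' * a.
    move=> i; apply: chart_div_pow => // f hf.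
    have [fK [fE XE]] := chart_coord y f uK.
    rewrite -(denom_val fE (g'E i)) -[unif v ^+ s']/(unif v ^ s'%:Z) -[s'%:Z]add0r vge_scale.
    by have := W_int (generic_coord_neq0 _) (hy f hf) i; rewrite XE mxE.
  exists (\row_i (q (a i) * wi ^+ s')).
  have -> : gco (pmap l1 (pmap q y)) = map_mx r (gco (pmap l y)).
    rewrite -gco_map; apply: (congr1 (@gco A1K)).
    by rewrite (pmapcE (h := alg_comp l1 q)) // (pmapcE (h := alg_comp l1 q)).
  apply/rowP => i; rewrite !mxE.
  have cancel_pi (x x' : A1K) : l1 (alg_in A1 pi) ^+ s' * x = l1 (alg_in A1 pi) ^+ s' * x' -> x = x'.
    move/(congr1 ( *%R (pw ^+ s'))); rewrite !mulrA -exprMn [pw * _]mulrC.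
    by rewrite pwE expr1n !mul1r.
  apply: cancel_pi.
  have e1 : l1 (alg_in A1 pi) ^+ s' * r (gco (pmap l y) 0 i) = l1 (q (g' i)).
    by have := congr1 r (g'E i); rewrite rmorphM rmorphXn !rE /= hom_in.
  rewrite e1 rmorphM rmorphXn mulrA.
  have e2 : l1 (alg_in A1 pi) ^+ s' * l1 (q (a i)) = l1 (q h) ^+ s' * l1 (q (g' i)).
    have := congr1 (fun b => l1 (q b)) (aE i).
    by rewrite !rmorphM !rmorphXn hom_in.
  by rewrite e2 mulrAC -exprMn -rmorphM we rmorph1 expr1n mul1r.
have wz (f : alghom A sO) : ~~ vge v 1 (int_val (f h)) -> gval (pmap f (gmul (pmap (str A) z) u)) = 0.
  by move=> hf; rewrite gmul_map gvalM pmap_str zw wh // addNr.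
have [f hf|x xE] := row (gmul (pmap (str A) z) u); first by rewrite wz.
have [f hf|x' xE'] := row (ginv (gmul (pmap (str A) z) u)).
  by rewrite pmap_ginv gvalV wz.
have -> : gmul (pmap (str A1) z) (pmap q u) = pmap q (gmul (pmap (str A) z) u).
  by rewrite gmul_map pmap_str2.
by apply: (point_lift (x' := x') tA1 l1P xE); rewrite -pmap_ginv; exact: xE'.
Qed.
Section GoodChart.
Variables (A1 : algebra O) (u1 : N A1) (w0 : int).
Hypotheses (tA1 : torsion_free A1) (u1c : chart u1).
Hypothesis u1w : exists f : alghom A1 sO, gval (pmap f u1) = w0.
Hypothesis u1t : forall z : N sO, gval z = - w0 ->
  exists t, al A1 t = gmul (pmap (str A1) z) u1.

Definition translate_pred (z : N sO) C (x : N C) :=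
  exists f : alghom A1 C, x = gmul (pmap (str C) z) (pmap f u1).
Fact translate_map z C C' (f : alghom C C') (x : N C) : translate_pred z x -> translate_pred z (pmap f x).
Proof. by move=> [g ->]; exists (alg_comp f g); rewrite gmul_map pmap_str2 pmapc. Qed.
Definition translate z : subfunctor N := @Subfunctor O N (@translate_pred z) (@translate_map z).

Lemma vc_open z : is_open (translate z).
Proof.
move=> C x; have [_ [U Uo UE]] := u1c.
have [S SE] := Uo C (gmul (pmap (str C) (ginv z)) x); exists S => C' f.
rewrite -SE gmul_map pmap_str2; split=> [[g ->]|/UE[g gE]].
  by apply/UE; exists g; rewrite pmap_ginv gmulKV.
by exists g; rewrite gE pmap_ginv gmulKr.
Qed.

Definition img_pred C (x : N C) := exists t, al C t = x.
Fact img_map C C' (f : alghom C C') (x : N C) : img_pred x -> img_pred (pmap f x).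
Proof. by move=> [t <-]; exists (pmap f t); rewrite mor_map. Qed.
Definition al_image : subfunctor N := @Subfunctor O N (@img_pred) (@img_map).

Lemma vc_img z C (x : N C) : gval z = - w0 -> translate z _ x -> al_image _ x.
Proof.
move=> /u1t[t tE] [f ->]; exists (pmap f t).
by rewrite mor_map tE gmul_map pmap_str2.
Qed.

Lemma gen_tf (C : algebra O) : (exists y, alg_in C pi * y = 1) -> torsion_free C.
Proof.
move=> [y e] x ex; by rewrite -[x]mul1r -e mulrAC ex mul0r.
Qed.

Lemma gen_img (C : algebra O) (x : N C) : (exists y, alg_in C pi * y = 1) -> al_image _ x.
Proof.
move=> ey; have [CK [l [lP _]]] := gen_fiber C.
have [g gE] := loc_lift (f := alg_id C) lP ey.
have e : cmul (A := restr iK CK) c (gco (pmap l x)) (gco (pmap l (ginv x))) = cone i0 (restr iK CK).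
  by rewrite -gcoM -gmul_map gmulrV pmap_gone gco1.
have alx : al (restr iK CK) (mkt e) = pmap l x by apply: gco_inj; rewrite alE.
exists (pmap g (mkt e : T (restr iK CK))); rewrite mor_map alx (pmapcE (h := alg_id C)) //.
exact: pmap_id.
Qed.

Lemma vc_point (t : T sO) : exists2 z, gval z = - w0 & translate z _ (al sO t).
Proof.
have [f fw] := u1w; exists (gmul (al sO t) (ginv (pmap f u1))).
  by rewrite gvalM al_gval0 gvalV fw add0r.
exists f; rewrite [pmap (str sO) _]pmap_id //.
by rewrite -gmulA gmulV gmulr1.
Qed.

Definition red_hom : alghom sO (Algebra red) := @AlgHom O sO (Algebra red) red (fun=> erefl).

Lemma special_point (A : algebra O) (F : fieldType) (s : {rmorphism O -> F})
    (f : alghom A (Algebra s)) :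
  finitely_presented A -> s pi = 0 -> exists g : alghom A (Algebra red),
    forall a, f a = 0 -> g a = 0.
Proof.
move=> [m [a [r [R aP]]]] s0; have [rs _] := redP.
have [|r0|g gE] := closed_point rs (pres_gen aP) (J := preim_ideal f (zero_ideal F)).
- by move=> r0 /(red0P redP)[y ->]; rewrite /= hom_in /= rmorphM s0 mul0r.
- by rewrite /= rmorph1 in r0; move/eqP: r0; rewrite oner_eq0.
- by exists g.
Qed.

(** Over the closed point of the base, [t] specializes to a [k]-point of the universal ring, which
    lifts to an integral point; the latter lies in a translate by [vc_point], and openness brings
    [t] into the same translate. *)
Lemma cover (F : fieldType) (s : {rmorphism O -> F}) (t : T (Algebra s)) :
  s pi != 0 \/ exists2 z, gval z = - w0 & translate z _ (al (Algebra s) t).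
Proof.
case: (eqVneq (s pi) 0) => [s0|]; [right|by left].
have [A [u [fpA lA uA]]] := univT; have [f fE] := uA _ t.
have [g gE] := special_point f fpA s0.
have [g' g'E] := lift_point redP p_char Kc fpA lA g.
have [z wz vz] := vc_point (pmap g' u).
exists z => //; have := sf_map red_hom vz; rewrite -mor_map (pmapcE (h := g)) // mor_map.
have [S SE] := vc_open z (al A u) => /SE/gen_unit_pt[a Sa ga].
rewrite -fE mor_map; apply/SE; have fa : f a != 0.
  by apply: contraNneq ga => fa; rewrite gE.
have [y ye] := field_unit fa; exact: gen_unitW Sa ye.
Qed.

(** Equality is checked near each point. Where [pi] is invertible the generic coordinates decide.
    Near a special point both [t] and [s] factor through the point [t0] of a translated chart, by
    morphisms that agree because [u1] is a monomorphism. *)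
Lemma al_inj (C : algebra O) (t s : T C) : al C t = al C s -> t = s.
Proof.
move=> e; apply: tpt_eq => //; apply/rowP => i; apply: annih_eq => F g.
suff [a ga aP] : exists2 a : C, g a != 0 & forall C' (f : alghom C C'),
    (exists y, f a * y = 1) -> pmap f t = pmap f s.
  have [D [q qP]] := loc_exists a; have [qu q0 _] := qP.
  have /(congr1 (fun t : tpt i0 c D => tx t 0 i)) := aP D q qu.
  rewrite !mxE => eq; have [|m em] := q0 (tx t 0 i - tx s 0 i).
    by rewrite rmorphB eq subrr.
  by exists (a ^+ m) => //; rewrite rmorphXn expf_neq0.
case: (cover (pmap (over_hom g) t)) => [spi|[z wz vz]].
  exists (alg_in C pi) => // C' f fu; apply: al_tf_inj.
    by apply: gen_tf; rewrite -(hom_in f).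
  by rewrite !mor_map e.
have [A [u [fpA lA uA]]] := univT.
have [t0 t0E] := u1t wz.
have key (s' : T C) : al C s' = al C t -> exists2 a : C, g a != 0 & forall C' (f : alghom C C'),
    (exists y, f a * y = 1) -> exists f1 : alghom A1 C', pmap f s' = pmap f1 t0 /\
      pmap f (al C t) = gmul (pmap (str C') z) (pmap f1 u1).
  move=> es; have [f0 f0E] := uA _ s'.
  have /(open_near (vc_open z))[a ga aP] : translate z _ (pmap (alg_comp (over_hom g) f0) (al A u)).
    by rewrite pmapc -mor_map f0E es -mor_map.
  exists (f0 a) => // C' f fu.
  have [Aa [q qP]] := loc_exists a; have [qu _ _] := qP.
  have [f2 f2E] : translate z _ (pmap q (al A u)) by apply: aP.
  have tAa : torsion_free Aa := tf_loc (chart_torsion_free redP p_char fpA lA) qP.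
  have uE : pmap q u = pmap f2 t0.
    apply: al_tf_inj => //; rewrite !mor_map t0E f2E gmul_map pmap_str2 //.
  have [f3 f3E] := loc_lift (f := alg_comp f f0) qP fu.
  have sE : pmap f s' = pmap (alg_comp f3 f2) t0.
    by rewrite -f0E pmapc -uE -!pmapc; apply: pmap_ext => x; rewrite /= f3E.
  exists (alg_comp f3 f2); split=> //.
  by rewrite -es -mor_map sE mor_map t0E gmul_map pmap_str2.
have [a ga aP] := key t erefl; have [b gb bP] := key s (esym e).
exists (a * b); first by rewrite rmorphM mulf_neq0.
move=> C' f [y]; rewrite rmorphM => ye.
have [|f1 [-> E1]] := aP C' f; first by exists (f b * y); rewrite mulrA.
have [|f2 [-> E2]] := bP C' f; first by exists (f a * y); rewrite mulrA [f b * _]mulrC.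
apply: pmap_ext; have [u1i _] := u1c; apply: u1i.
by apply: (@gmulI _ _ _ (pmap (str C') z)); rewrite -E1 -E2.
Qed.

Lemma near_img (C : algebra O) (x : N C) F s (g : alghom C (Algebra s)) :
  al_image _ (pmap g x) -> @near_pt _ _ al_image C x F s g.
Proof.
move=> [t tE]; case: (cover t) => [spi|[z wz]].
  exists (alg_in C pi); first by rewrite hom_in.
  by move=> C' f fu; apply: gen_img; rewrite -(hom_in f).
rewrite tE => /(open_near (vc_open z))[a ga aP].
by exists a => // C' f /aP; apply: vc_img.
Qed.

(** Local preimages under [al] are unique by [al_inj], so they glue by the sheaf property of [T];
    the sheaf property of [N] identifies the image of the result. *)
Lemma img_open : is_open al_image.
Proof.
apply: open_intro => [C x nr|C x F s g]; last exact: near_img.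
pose S a := forall C' (f : alghom C C'), (exists y, f a * y = 1) -> al_image _ (pmap f x).
have [m [b [a [aS e]]]] : gen_unit_ideal (alg_id C) S.
  apply: contrapT => /not_unit_field[F [g gS]].
  have [a ga aP] := nr F _ (over_hom g).
  by move/eqP: ga; apply; apply: gS.
have /choice[D DP] : forall i, exists D : algebra O, exists l : alghom C D, is_localization l (a i).
  by move=> i; apply: loc_exists.
pose l i := sval (cid (DP i)); have lP i : is_localization (l i) (a i) := svalP (cid (DP i)).
have tP i : exists t, al (D i) t = pmap (l i) x.
  by have [lu _ _] := lP i; exact: (aS i (D i) (l i) lu).
pose t i := sval (cid (tP i)); have tE i : al (D i) (t i) = pmap (l i) x := svalP (cid (tP i)).
have [Tsh _ _] := tor_smooth law; have [Nsh _ _] := nm_smooth N.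
have [|t' [t'E _]] := Tsh C m a b e D l lP t.
  move=> i j E g h gh; apply: al_inj; rewrite !mor_map !tE -!pmapc; exact: pmap_ext.
exists t'; have [|y [_ yU]] := Nsh C m a b e D l lP (fun i => pmap (l i) x).
  by move=> i j E g h gh; rewrite -!pmapc; apply: pmap_ext.
rewrite -(yU x) // -(yU (al C t')) // => i.
by rewrite -mor_map t'E.
Qed.

Lemma img_group : open_subgroup al_image.
Proof.
split; first exact: img_open.
- by move=> A; exists (tone law A); apply: al_one.
- by move=> A x y [t <-] [s <-]; exists (tmul law t s); apply: al_mul.
- by move=> A x [t <-]; exists (tinv law t); apply: al_inv.
Qed.

Lemma img_sub_coords (Q : subfunctor N) : (forall C x, Q C x <-> al_image _ x) ->
  exists f : morphism (sub_presheaf Q) T, (forall C, bijective (f C)) /\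
    forall C x, al C (f C x) = sval x.
Proof.
move=> QE; have fP C (x : {x | Q C x}) : al_image _ (sval x) by apply/QE; apply: svalP.
pose f C (x : sub_presheaf Q C) := sval (cid (fP C x)).
have fE C x : al C (f C x) = sval x := svalP (cid (fP C x)).
have fm C C' (g : alghom C C') x : f C' (pmap g x) = pmap g (f C x).
  by apply: al_inj; rewrite fE mor_map fE.
exists (Morphism fm); split=> // C.
have Qt (t : T C) : Q C (al C t) by apply/QE; exists t.
exists (fun t => exist _ (al C t) (Qt t)) => [x|t].
  have := fE C x; case: x => x Qx /= e; exact: eq_exist.
by apply: al_inj; rewrite /= fE.
Qed.

Lemma img_qc : quasi_compact (sub_presheaf al_image).
Proof.
have [f [fb _]] := img_sub_coords (fun _ _ => iff_refl _).
have [R [cT cP]] := tor_coords law.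
have [A [a aP]] := pres_exists (fun e => exists i, R i = e).
by exists 1%N; apply: (coords_cover (coords_iso fb cP) aP).
Qed.

Lemma qc_bound (Q : subfunctor N) : is_open Q -> quasi_compact (sub_presheaf Q) ->
  exists s : nat, forall y : N sO, Q sO y -> - s%:Z <= gval y.
Proof.
move=> Qo [m [U [Uc cov]]].
have [s sP] : exists s, forall i (y : sub_presheaf Q sO), U i sO y -> - s%:Z <= gval (sval y).
  apply: max_exists => [i s s' ss h y /h|i]; first by lia.
  have [_ [A _ [u uP]]] := Uc i; have [s sP] := chart_bound (sval u).
  exists s => y; have [/(_ y)[+ _] _] := uP sO => h /h[f <-]; exact: sP.
exists s => y Qy; pose y' : sub_presheaf Q sO := exist _ y Qy.
have [i Ui] := cov k red (pmap red_hom y'); apply: (sP i y').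
(* The integers are a local ring: an integral point whose reduction lies in an open set lies in
   it. *)
have [Uo _] := Uc i; have [S SE] := Uo sO y'.
have /SE/gen_unit_pt[a Sa ga] := Ui.
rewrite -[y'](pmap_id (f := alg_id sO)) //; apply/SE.
have [x xe] := red_unit redP (x := a) ga.
exact: (gen_unitW (f := alg_id sO) Sa xe).
Qed.

(** The values on a quasi-compact open subgroup form a subgroup of the integers that is bounded
    below, hence zero: otherwise powers of [y] or of its inverse pass the bound. *)
Lemma qc_w0 (Q : subfunctor N) y : open_subgroup Q -> quasi_compact (sub_presheaf Q) ->
  Q sO y -> gval y = 0.
Proof.
move=> [Qo Q1 QM QV] qc Qy; have [s sP] := qc_bound Qo qc.
have pw x m : Q sO x -> Q sO (iter m (gmul x) (gone N sO)).
  by move=> Qx; elim: m => [|m IH] //=; apply: QM.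
have wpw x m : gval (iter m (gmul x) (gone N sO)) = m%:Z * gval x.
  by elim: m => [|m IH]; rewrite ?iterS ?gvalM ?IH ?[gval _]gval1 ?mul0r //= ?gval1 //; lia.
have := sP _ (pw _ s.+1 Qy); have := sP _ (pw _ s.+1 (QV _ _ Qy)).
rewrite !wpw gvalV; nia.
Qed.

(** Only points over the closed point matter. If one of [Q] missed the image of [al], so would a
    [k]-point of [Q] by the Nullstellensatz; lifted to an integral point it has value 0 by [qc_w0],
    hence lies in the image. *)
Lemma max_qc_img (Q : subfunctor N) : max_qc_subgroup Q -> forall C x, Q C x <-> al_image _ x.
Proof.
move=> [Qg Qqc Qmax] C x; split; last by apply: (Qmax al_image); [exact: img_group|exact: img_qc].
have [Qo Q1 QM QV] := Qg => Qx.
apply: (open_local img_open) => F s g; apply: near_img.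
have {Qx} : Q _ (pmap g x) by apply: sf_map.
move: (pmap g x) => {g x}{C} x Qx.
case: (eqVneq (s pi) 0) => [s0|spi]; last exact/gen_img/field_unit.
have [Nsh [I [U [Uc cov]]] fs] := nm_smooth N.
have [i Ui] := cov F s x; have [Uo [A fpA Ar]] := Uc i.
have lA := chart_liftable Uo fs Ar.
have [u uP] := Ar; have [+ _] := uP (Algebra s); move=> /(_ x)[/(_ Ui)[f fE] _].
have [SQ SQE] := Qo A u; have [SV SVE] := img_open u.
move: Qx; rewrite -fE => /SQE/gen_unit_pt[a SQa fa].
apply: contrapT => nV.
have fV b : SV b -> f b = 0.
  move=> Sb; apply/eqP; apply: contrapT => /negP fb; apply: nV; apply/SVE.
  have [y ye] := field_unit fb; exact: gen_unitW Sb ye.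
have [m [a0 [r [R aP]]]] := fpA; have [rs _] := redP.
have [Aa [q qP]] := loc_exists a; have [b bg] := loc_gen (pres_gen aP) qP.
have [f' f'E] := loc_lift qP (field_unit fa).
have [|r0|g gE] := closed_point rs bg (J := preim_ideal f' (zero_ideal F)).
- by move=> r0 /(red0P redP)[y ->]; rewrite /= hom_in /= rmorphM s0 mul0r.
- by rewrite /= rmorph1 in r0; move/eqP: r0; rewrite oner_eq0.
have [g' g'E] := lift_point redP p_char Kc fpA lA (alg_comp g q).
have ga : g (q a) != 0.
  have [[y ye] _ _] := qP; apply: (@unit_field k _ (g y)).
  by rewrite -rmorphM ye rmorph1.
have Qy : Q sO (pmap g' u).
  apply/SQE; have [|y ye] := red_unit redP (x := g' a); first by rewrite g'E.
  exact: (gen_unitW (f := g') SQa ye).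
have [t tE] := gval0_al (qc_w0 Qg Qqc Qy).
have : al_image _ (pmap (alg_comp g q) u).
  exists (pmap red_hom t); rewrite mor_map tE; apply: pmapcE => z; exact: g'E.
move/SVE/gen_unit_pt => [d Sd]; rewrite /= gE ?eqxx //.
by rewrite /= f'E fV.
Qed.
End GoodChart.
End Neron.

Section Image.
Variables (K : fieldType) (v : valuation K) (k : closedFieldType).
Variables (red : {rmorphism integers v -> k}) (p : nat).
Hypotheses (redP : residue_map red) (p_char : p \in [pchar k]) (Kc : complete_field v).
Local Notation O := (integers v).
Local Notation iK := (int_incl v).
Variables (n : nat) (i0 : 'I_n) (c : 'I_n -> 'I_n -> 'I_n -> O).
Hypothesis law : lattice_law i0 c.
Variables (B : group_functor K) (co : forall A : algebra K, B A -> 'rV[A]_n).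
Hypotheses
  (com : forall A A' (f : alghom A A') x, co (pmap f x) = map_mx f (co x))
  (coi : forall A, injective (@co A))
  (coM : forall A (x y : B A), co (gmul x y) = cmul (A := restr iK A) c (co x) (co y))
  (co1 : forall A, co (gone B A) = cone i0 (restr iK A))
  (cos : forall (A : algebra K) (x y : 'rV[A]_n), cmul (A := restr iK A) c x y = cone i0 (restr iK A) ->
    exists b, co b = x).
Variable W : 'rV[K]_n -> int.
Hypotheses
  (Wge : forall (x : 'rV[K]_n) m, x != 0 ->
    (m <= W x <-> forall i, x 0 i != 0 -> m <= n%:Z * v (x 0 i) + (i : nat)%:Z))
  (WM : forall x y : 'rV[K]_n, x != 0 -> y != 0 ->
     cmul (A := restr iK (self_alg K)) c x y != 0 /\
     W (cmul (A := restr iK (self_alg K)) c x y) = W x + W y).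
Variable N : neron_lft v B.

Lemma neron_torus : exists al : morphism (tor law) N,
  [/\ forall (A : algebra K) t, co (nm_generic N A (al (restr iK A) t)) = tx t,
      forall C t s, al C (tmul law t s) = gmul (al C t) (al C s),
      forall C, injective (al C),
      forall x : N (dual_alg O), in_lie x -> exists t, al _ t = x &
      forall Q : subfunctor N, max_qc_subgroup Q ->
        (forall C x, Q C x <-> exists t, al C t = x) /\
        exists f : morphism (sub_presheaf Q) (tor law), forall C, bijective (f C)].
Proof.
have [al alE] := alpha_exists law com coi cos N.
have [A1 [u1 [w0 [tA1 u1c u1w u1t]]]] := good_chart redP p_char Kc com coi coM co1 Wge WM alE.
exists al; split=> //.
- exact: (al_mul redP p_char coi coM alE).
- exact: (al_inj redP p_char Kc coi coM co1 Wge WM alE u1c u1w u1t).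
- move=> x xl.
  have io := img_open redP p_char Kc coi coM co1 Wge WM alE u1c u1w u1t.
  have [S SE] := io _ x.
  have /SE[m [b [s [Ss e]]]] : al_image al _ (pmap (dual_proj_hom O) x).
    by rewrite xl; exists (tone law _); apply: (al_one redP p_char coi coM alE).
  (* The image is open, so it suffices to lift the unit ideal relation from [epsilon = 0]: a dual
     number with first component 1 is invertible. *)
  suff /SE : gen_unit_ideal (alg_id (dual_alg O)) S by rewrite pmap_id.
  pose b' i : dual_alg O := (b i, 0); pose t : dual O := \sum_i b' i * s i.
  have t1 : t.1 = 1.
    by rewrite -e -[t.1]/(dual_proj_hom O t) rmorph_sum; apply: eq_bigr => i _; rewrite rmorphM.
  pose t' : dual_alg O := (1, - t.2).
  exists m, (fun i => t' * b' i), s; split=> //=.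
  under eq_bigr do rewrite -mulrA; rewrite -mulr_sumr -/t [LHS]/(_ * _) /= /dual_mul /=.
  by rewrite t1 !mul1r mulr1 addrN.
move=> Q QP; have QE := max_qc_img redP p_char Kc com coi coM co1 Wge WM alE u1c u1w u1t QP.
split; first exact: QE.
have [f [fb _]] := img_sub_coords redP p_char Kc coi coM co1 Wge WM alE u1c u1w u1t QE.
by exists f.
Qed.
End Image.

(** * The special fibre and its class in the Grothendieck ring *)

Section SpecialFibre.
Variables (R : comNzRingType) (n : nat) (i0 : 'I_n) (c : 'I_n -> 'I_n -> 'I_n -> R).
Variables (k : comNzRingType) (red : {rmorphism R -> k}).
Hypothesis law : lattice_law i0 c.
Hypotheses (i00 : i0 = 0%N :> nat)
  (red_c : forall i j l : 'I_n, (l < i + j)%N -> red (c i j l) = 0).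

(** Modulo the uniformizer, multiplication by [x] is triangular with [x 0 i0] on the diagonal, so a
    point is a unit exactly when its first coordinate is. *)
Lemma det_cmx_special (A : algebra k) (x : 'rV[A]_n) :
  \det (cmx c (A := restr red A) x) = x 0 i0 ^+ n.
Proof.
rewrite -det_tr det_trig; last first.
  apply/is_trig_mxP => l j lj; rewrite !mxE big1 // => i _ /=.
  by rewrite red_c ?rmorph0 ?mulr0 // (leq_trans lj) ?leq_addl.
transitivity (\prod_(l < n) (x 0 i0 : A)); last by rewrite prodr_const card_ord.
apply: eq_bigr => l _.
rewrite !mxE (bigD1 i0) //= big1 ?addr0 => [|i ni].
  by rewrite ll1 // eqxx !rmorph1 mulr1.
rewrite red_c ?rmorph0 ?mulr0 // -[X in (X < _)%N]add0n ltn_add2r lt0n.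
by apply: contraNneq ni => i_0; apply/eqP/val_inj; rewrite /= i_0 i00.
Qed.

Lemma cmul_special0 (A : algebra k) (x y : 'rV[A]_n) :
  cmul c (A := restr red A) x y 0 i0 = x 0 i0 * y 0 i0.
Proof.
rewrite mxE (bigD1 i0) //= [X in _ + X]big1 ?addr0 => [|i ni].
  rewrite (bigD1 i0) //= [X in _ + X]big1 ?addr0 => [|i ni].
    by rewrite ll1 // eqxx !rmorph1 mulr1.
  rewrite red_c ?rmorph0 ?mulr0 // i00 add0n lt0n.
  by apply: contraNneq ni => i_0; apply/eqP/val_inj; rewrite /= i_0 i00.
rewrite big1 // => j _; rewrite red_c ?rmorph0 ?mulr0 // i00.
rewrite ltn_addr // lt0n.
by apply: contraNneq ni => i_0; apply/eqP/val_inj; rewrite /= i_0 i00.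
Qed.

Lemma special_fibre : exists f : morphism (base_change red (tor law)) (prod_presheaf (Gm k) (asp k n.-1)),
  forall A, bijective (f A).
Proof.
have uP (A : algebra k) (t : tpt i0 c (restr red A)) :
    (tx t 0 i0 : A) * (ty t 0 i0 : A) == 1 :> A.
  have /rowP/(_ i0) := txy t; rewrite cmul_special0 mxE eqxx => ->.
  by rewrite eqxx.
pose f (A : algebra k) (t : tpt i0 c (restr red A)) : prod_presheaf (Gm k) (asp k n.-1) A :=
  (exist (fun u : A * A => u.1 * u.2 == 1) (tx t 0 i0 : A, ty t 0 i0 : A) (uP A t),
   \row_l tx t 0 (lift i0 l)).
have fm A A' (g : alghom A A') (t : base_change red (tor law) A) :
    f A' (pmap g t) = pmap g (f A t).
  congr (_, _); first by apply: unit_pair_inj; rewrite /= /tx /ty /= !mxE.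
  by apply/rowP => l; rewrite !mxE.
exists (Morphism fm) => A.
have vP (u : prod_presheaf (Gm k) (asp k n.-1) A) : exists t : tpt i0 c (restr red A), f A t = u.
  case: u => [[[a b] /= ab] x].
  pose y : 'rV[A]_n := \row_i if unlift i0 i is Some l then (x : 'rV[A]_n.-1) 0 l else a.
  have y0 : y 0 i0 = a by rewrite mxE unlift_none.
  have [z yz] : exists z, cmul c (A := restr red A) y z = cone i0 (restr red A).
    apply/(cunit_det law); exists (b ^+ n).
    by rewrite det_cmx_special y0 -exprMn (eqP ab) expr1n.
  exists (mkt yz); congr (_, _).
    apply: unit_pair_inj; rewrite /= /tx /ty /= y0; congr (_, _).
    have /rowP/(_ i0) := yz; rewrite cmul_special0 y0 mxE eqxx => e.
    by rewrite -[LHS]mul1r -(eqP ab) [a * b]mulrC -mulrA e mulr1.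
  by apply/rowP => l; rewrite /tx /= !mxE liftK.
pose g u := sval (cid (vP u)); have gE u : f A (g u) = u := svalP (cid (vP u)).
have fi : injective (f A).
  move=> t s [e1 e2 e3]; apply: tpt_eq => //; apply/rowP => i.
  case: (unliftP i0 i) => [l|] -> //.
  by have /rowP/(_ l) := e3; rewrite !mxE.
by exists g => u /=; [apply: fi; rewrite gE|rewrite gE].
Qed.
End SpecialFibre.

Section Classes.
Variables (k : fieldType) (K0 : comPzRingType) (cl : presheaf k -> K0).
Hypothesis clP : grothendieck_ring cl.
Local Notation LL := (cl (affine_line k)).

Lemma cl_iso (X Y : presheaf k) (f : morphism X Y) :
  (forall A, bijective (f A)) -> variety X -> variety Y -> cl X = cl Y.
Proof. by move=> fb vX vY; apply: (gr_inv clP).1 => //; exists f. Qed.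

Lemma cl_asp m : cl (asp k m) = LL ^+ m.
Proof.
have va m' : variety (asp k m') := coords_variety (asp_coords k m').
elim: m => [|m IH].
  rewrite expr0 -(gr_one clP).
  have vp : variety (Defs.point k).
    apply: (@coords_variety _ _ 0 (fun=> False) (fun A _ _ => 0 : A)).
    split=> //; [by move=> A B f x [] | by move=> A [] [] | by move=> A a _; exists tt; case].
  have fm (A B : algebra k) (f : alghom A B) (x : asp k 0 A) :
    (fun _ _ => tt) B (pmap f x) = pmap f ((fun (A : algebra k) (_ : asp k 0 A) => tt : Defs.point k A) A x) by [].
  apply: (cl_iso (f := @Morphism _ (asp k 0) (Defs.point k) (fun _ _ => tt) fm)) => // A.
  by exists (fun=> 0) => [x|[]] //; apply/rowP => -[].
rewrite exprS -IH -(gr_mul clP) //; last exact: coords_variety (line_coords k).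
pose f A (x : asp k m.+1 A) : prod_presheaf (affine_line k) (asp k m) A :=
  ((x : 'rV[A]_m.+1) 0 ord0, \row_i (x : 'rV[A]_m.+1) 0 (lift ord0 i)).
have fm A B (g : alghom A B) x : f B (pmap g x) = pmap g (f A x).
  by congr (_, _); rewrite /= ?mxE //; apply/rowP => i; rewrite !mxE.
apply: (cl_iso (f := Morphism fm)) => //.
  move=> A; exists (fun u : A * 'rV[A]_m => \row_i if unlift ord0 i is Some l then u.2 0 l else u.1).
    by move=> x; apply/rowP => i; rewrite mxE; case: unliftP => [l|] -> //; rewrite mxE.
  move=> [a x]; congr (_, _); rewrite /= ?mxE ?unlift_none //.
  by apply/rowP => i; rewrite !mxE liftK.
exact: (coords_variety (coords_prod (line_coords k) (asp_coords k m))).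
Qed.

(** The line is cut into the origin and the locus where the coordinate is invertible. *)
Lemma cl_Gm : cl (Gm k) = LL - 1.
Proof.
pose Zp A (x : affine_line k A) := (x : A) = 0.
pose Up A (x : affine_line k A) := exists y : A, (x : A) * y = 1.
have Zm A B (f : alghom A B) (x : affine_line k A) : Zp A x -> Zp B (pmap f x).
  by move=> /= e; rewrite /Zp /= [x]e rmorph0.
have Um A B (f : alghom A B) (x : affine_line k A) : Up A x -> Up B (pmap f x).
  by move=> [y e]; exists (f y); rewrite /= -rmorphM e rmorph1.
have cp : complementary (Subfunctor Zm) (Subfunctor Um).
  move=> A x; exists (fun s => s = x) => B f; split; first split.
  - by move=> e s ->.
  - by move=> h; apply: h.
  split=> [[y e]|[n [b [s [sE e]]]]]; first exact: (gen_unitW (s := x) (y := y)).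
  exists (\sum_i b i); rewrite mulr_sumr -e; apply: eq_bigr => i _.
  by rewrite sE mulrC.
have vA : variety (affine_line k) := coords_variety (line_coords k).
rewrite ((gr_inv clP).2 _ _ _ vA cp).
have -> : cl (sub_presheaf (Subfunctor Zm)) = 1.
  rewrite -(expr0 LL) -cl_asp.
  have fm A B (f : alghom A B) (x : sub_presheaf (Subfunctor Zm) A) :
     (fun _ _ => 0) B (pmap f x) = pmap f ((fun _ _ => 0 : asp k 0 A) A x).
    by apply/rowP => -[].
  have fb A : bijective (@Morphism _ (sub_presheaf (Subfunctor Zm)) (asp k 0) (fun _ _ => 0) fm A).
    exists (fun=> exist (@Zp A) 0 erefl) => [[x /= hx]|x]; last by apply/rowP => -[].
    by apply: eq_exist; rewrite [x]hx.
  apply: (cl_iso fb); last exact: coords_variety (asp_coords k 0).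
  exact: coords_variety (coords_iso fb (asp_coords k 0)).
rewrite addrAC subrr add0r.
pose f A (u : Gm k A) : sub_presheaf (Subfunctor Um) A :=
  exist _ ((sval (u : unit_pair A)).1) (ex_intro _ _ (eqP (svalP (u : unit_pair A)))).
have fm A B (g : alghom A B) x : f B (pmap g x) = pmap g (f A x).
  exact: eq_exist.
have fs A (y : sub_presheaf (Subfunctor Um) A) : exists u, f A u = y.
  case: y => x [y e]; exists (exist (fun u : A * A => u.1 * u.2 == 1) (x, y) (introT eqP e)).
  exact: eq_exist.
have fi A : injective (f A).
  move=> [[a b] /= ab] [[a' b'] /= ab'] [e]; apply: unit_pair_inj => /=; rewrite -e in ab' *.
  congr (_, _); rewrite -[b]mulr1 -(eqP ab') mulrA [b * a]mulrC (eqP ab) mul1r //.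
have fb A : bijective (f A).
  pose g u := sval (cid (fs A u)); have gE u : f A (g u) = u := svalP (cid (fs A u)).
  by exists g => u; [apply: fi; rewrite gE|rewrite gE].
apply: (cl_iso (f := Morphism fm)) => //; first exact: coords_variety (Gm_coords k).
have [F FE] : exists F : morphism (sub_presheaf (Subfunctor Um)) (Gm k), forall A, bijective (F A).
  pose g A u := sval (cid (fs A u)); have gE A u : f A (g A u) = u := svalP (cid (fs A u)).
  have gm A B (h : alghom A B) x : g B (pmap h x) = pmap h (g A x).
    by apply: fi; rewrite gE fm gE.
  by exists (Morphism gm) => A; exists (f A) => u; [rewrite gE|apply: fi; rewrite gE].
exact: coords_variety (coords_iso FE (Gm_coords k)).
Qed.

Lemma cl_Gm_asp (X : presheaf k) m (f : morphism X (prod_presheaf (Gm k) (asp k m))) :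
  (forall A, bijective (f A)) -> cl X = (LL - 1) * LL ^+ m.
Proof.
move=> fb; have vX := coords_variety (coords_iso fb (Gm_asp_coords k m)).
rewrite (cl_iso fb vX (coords_variety (Gm_asp_coords k m))) (gr_mul clP).
- by rewrite cl_Gm cl_asp.
- exact: coords_variety (Gm_coords k).
- exact: coords_variety (asp_coords k m).
Qed.
End Classes.

Definition mor_base_change (R S : comPzRingType) (phi : {rmorphism R -> S}) (X Y : presheaf R)
    (f : morphism X Y) : morphism (base_change phi X) (base_change phi Y) :=
  @Morphism S (base_change phi X) (base_change phi Y) (fun A => f (restr phi A))
    (fun A B g => mor_map f (restr_hom phi g)).

Definition mor_comp (R : comPzRingType) (X Y Z : presheaf R) (f : morphism X Y) (g : morphism Y Z) :
    morphism X Z :=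
  @Morphism R X Z (fun A x => g A (f A x))
    (fun A B h x => etrans (congr1 (g B) (mor_map f h x)) (mor_map g h (f A x))).

(** * Extension of the valuation to a finite extension *)

Section Chevalley.
Variables (K : fieldType) (v : valuation K) (L : fieldExtType K).
Local Notation t := ((unif v)%:A : L).

(** Chevalley's construction: a subring over the integers of [K], maximal among those in which the
    uniformizer is not invertible, is a valuation ring of [L]. *)
Record good_ring (A : L -> Prop) : Prop := GoodRing {
  gr_base : forall c, vge v 0 c -> A c%:A;
  gr_sub : forall x y, A x -> A y -> A (x - y);
  gr_mult : forall x y, A x -> A y -> A (x * y);
  gr_unif : ~ A t^-1 }.

Lemma good_ring1 A : good_ring A -> A 1.
Proof. by move=> Ag; rewrite -(scale1r (1 : L)); apply: gr_base => //; rewrite /vge vmap1 orbT. Qed.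
Lemma good_ring0 A : good_ring A -> A 0.
Proof. by move=> Ag; rewrite -(subrr (1 : L)); apply: gr_sub => //; apply: good_ring1. Qed.
Lemma good_ringN A x : good_ring A -> A x -> A (- x).
Proof. by move=> Ag Ax; rewrite -sub0r; apply: gr_sub => //; apply: good_ring0. Qed.
Lemma good_ringD A x y : good_ring A -> A x -> A y -> A (x + y).
Proof. by move=> Ag Ax Ay; rewrite -[y]opprK; apply: gr_sub => //; apply: good_ringN. Qed.
Lemma good_ringX A x m : good_ring A -> A x -> A (x ^+ m).
Proof.
move=> Ag Ax; elim: m => [|m IH]; rewrite ?expr0 ?exprS; first exact: good_ring1.
exact: gr_mult.
Qed.
Lemma good_ring_sum A (T : Type) (r : seq T) (F : T -> L) :
  good_ring A -> (forall i, A (F i)) -> A (\sum_(i <- r) F i).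
Proof.
by move=> Ag h; apply: (big_ind A) => // [|x y]; [exact: good_ring0|exact: good_ringD].
Qed.

Lemma t_neq0 : t != 0.
Proof. by rewrite scaler_eq0 negb_or unif_neq0 oner_eq0. Qed.

Definition base_ring (x : L) := exists2 c, vge v 0 c & x = c%:A.

Lemma base_good : good_ring base_ring.
Proof.
split.
- by move=> c hc; exists c.
- by move=> _ _ [c hc ->] [d hd ->]; exists (c - d); rewrite ?vgeB ?scalerBl.
- move=> _ _ [c hc ->] [d hd ->]; exists (c * d); last by rewrite -scalerAl mul1r scalerA.
  by rewrite -[0 : int]addr0 vgeM.
- move=> [c hc e]; have e1 : c = (unif v)^-1.
    apply/(mulfI (unif_neq0 v)); rewrite divff ?unif_neq0 //.
    apply: (fmorph_inj (GRing.in_alg L : {rmorphism K -> L})).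
    by rewrite rmorphM rmorph1 /= -e divff ?t_neq0.
  by move: hc; rewrite e1 /vge invr_eq0 (negPf (unif_neq0 v)) vmapV ?unif_neq0 // unifE.
Qed.

Lemma max_good : exists A, good_ring A /\
  forall A', good_ring A' -> (forall x, A x -> A' x) -> forall x, A' x -> A x.
Proof.
(* The union with [base_ring] settles the empty chain in Zorn's lemma. *)
pose P (X : set L) := good_ring (fun x => X x \/ base_ring x).
have Bg := base_good.
have [|X [PX Xmax]] := @Zorn_bigcup L P.
  move=> F FP tot.
  have two (x y : L) : ((\bigcup_(X in F) X)%classic x \/ base_ring x) ->
      ((\bigcup_(X in F) X)%classic y \/ base_ring y) ->
      (base_ring x /\ base_ring y) \/ exists2 X, F X & (X x \/ base_ring x) /\ (X y \/ base_ring y).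
    move=> [[X FX Xx]|Ix] [[Y FY Yy]|Iy]; last by left.
    - right; have [h|h] := tot _ _ FX FY.
        by exists Y => //; split; left=> //; apply: h.
      by exists X => //; split; left=> //; apply: h.
    - by right; exists X => //; split; [left|right].
    - by right; exists Y => //; split; [right|left].
  split.
  - by move=> c hc; right; exists c.
  - move=> x y hx hy; have [[bx by_]|[X FX [h1 h2]]] := two x y hx hy.
      by right; apply: (gr_sub Bg).
    by case: (gr_sub (FP _ FX) h1 h2) => h; [left; exists X|right].
  - move=> x y hx hy; have [[bx by_]|[X FX [h1 h2]]] := two x y hx hy.
      by right; apply: (gr_mult Bg).
    by case: (gr_mult (FP _ FX) h1 h2) => h; [left; exists X|right].
  - by case=> [[X FX h]|/(gr_unif Bg)//]; apply: (gr_unif (FP _ FX)); left.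
exists (fun x => X x \/ base_ring x); split=> // A' gA' sub x A'x; apply: contrapT => nx.
apply: (Xmax A'); last first.
  rewrite /P; have -> : (fun x => A' x \/ base_ring x) = A'; last by [].
  apply/funext => y; apply/propext; split=> [[//|By]|]; last by left.
  by apply: sub; right.
split; first by move=> y Xy; apply: sub; left.
by move=> h; apply: nx; left; apply: h.
Qed.

Section Max.
Variable A : L -> Prop.
Hypotheses (Ag : good_ring A)
  (Amax : forall A', good_ring A' -> (forall x, A x -> A' x) -> forall x, A' x -> A x).

(** Expresses [t^-1] in [A[x]] by a polynomial of degree at most [n]; equivalently, 1 lies in [t
    A[x]]. *)
Definition inv_relation x n := exists a : nat -> L, (forall i, A (a i)) /\ \sum_(i < n.+1) a i * x ^+ i = t^-1.

Lemma adjoin_rel x : ~ A x -> exists n, inv_relation x n.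
Proof.
move=> nx; pose A' y := exists2 q : {poly L}, (forall i, A q`_i) & y = q.[x].
have AA' y : A y -> A' y.
  move=> Ay; exists y%:P; last by rewrite hornerC.
  by move=> i; rewrite coefC; case: ifP => // _; apply: good_ring0.
apply: contrapT => nr; apply: nx; apply: (Amax (A' := A')) => //.
  split.
  - by move=> c hc; apply: AA'; apply: gr_base.
  - move=> _ _ [q hq ->] [r hr ->]; exists (q - r); last by rewrite hornerD hornerN.
    by move=> i; rewrite coefB; apply: gr_sub.
  - move=> _ _ [q hq ->] [r hr ->]; exists (q * r); last by rewrite hornerM.
    by move=> i; rewrite coefM; apply: good_ring_sum => // j; apply: gr_mult.
  - move=> [q hq e]; apply: nr; exists (size q), (fun i => q`_i); split=> //.
    by rewrite -horner_coef_wide // e.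
exists 'X; last by rewrite hornerX.
move=> i; rewrite coefX; case: eqP => _; [exact: good_ring1|exact: good_ring0].
Qed.

(** [t] lies in the Jacobson radical: if [s = 1 - t a] had no inverse in [A], adjoining the inverse
    would produce [t^-1], so [t^-1 s ^ m] would lie in [A]; but [s ^ m] is 1 modulo [t]. *)
Lemma good_unit a : A a -> t^-1 - a != 0 /\ A (t^-1 - a)^-1.
Proof.
move=> Aa.
have s0 : t^-1 - a != 0.
  by apply/eqP => /eqP; rewrite subr_eq0 => /eqP e; apply: (gr_unif Ag); rewrite e.
split=> //.
have tA : A t by apply: gr_base => //; rewrite /vge unifE orbT.
pose s := 1 - t * a.
have sE : t^-1 - a = t^-1 * s by rewrite /s mulrBr mulr1 mulKf ?t_neq0.
have s'0 : s != 0 by move: s0; rewrite sE mulf_eq0 negb_or => /andP[].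
suff : A s^-1 by move=> h; rewrite sE invfM invrK; apply: gr_mult.
apply: contrapT => /adjoin_rel[m [b [bA e]]].
have As : A s by apply: gr_sub; [|exact: good_ring1|exact: gr_mult].
have h : A (t^-1 * s ^+ m).
  rewrite -e mulr_suml; apply: good_ring_sum => // i.
  rewrite -mulrA; apply: gr_mult => //.
  case: i => i /=; rewrite ltnS => im; rewrite -{1}(subnKC im).
  by rewrite exprVn exprD mulKf ?expf_neq0 //; apply: good_ringX.
have [b' Ab' e'] : exists2 b', A b' & s ^+ m = 1 + t * b'.
  elim: (m) => [|j [b' Ab' IH]]; first by exists 0; rewrite ?mulr0 ?addr0 //; apply: good_ring0.
  exists (b' - a * (1 + t * b')); last by rewrite exprS IH /s; ring.
  apply: gr_sub => //; apply: gr_mult => //; apply: good_ringD => //; first exact: good_ring1.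
  exact: gr_mult.
apply: (gr_unif Ag); move: h; rewrite e' mulrDr mulr1 mulKf ?t_neq0 // => h.
by rewrite -[t^-1](addrK b'); apply: gr_sub.
Qed.

(** In the relation for [x^-1] the constant part [t^-1 - b 0] has an inverse in [A]; multiplication
    by [x ^ (n + 1)] expresses [x ^ (n + 1)] by lower powers, which removes the top term of the
    relation for [x]. *)
Lemma rel_step x n m : x != 0 -> inv_relation x n.+1 -> inv_relation x^-1 m -> (m <= n.+1)%N -> inv_relation x n.
Proof.
move=> x0 [a [aA ae]] [b [bA be]] mn.
pose b' j := if (j <= m)%N then b j else 0.
have b'A j : A (b' j) by rewrite /b'; case: ifP => // _; apply: good_ring0.
have be' : \sum_(j < n.+2) b' j * x^-1 ^+ j = t^-1.
  rewrite -be [RHS](big_ord_widen_cond n.+2 xpredT (fun j => b j * x^-1 ^+ j)) //.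
  rewrite [RHS]big_mkcond; apply: eq_bigr => j _ /=; rewrite /b' ltnS.
  by case: ifP => // _; rewrite mul0r.
have [s0 sA] := good_unit (bA 0); set s := t^-1 - b 0 in s0 sA.
have xE : s * x ^+ n.+1 = \sum_(i < n.+1) b' (n.+1 - i)%N * x ^+ i.
  rewrite /s mulrBl -be' mulr_suml (reindex_inj rev_ord_inj) big_ord_recr /=.
  rewrite subnn expr0 mulr1 {2}/b' leq0n addrK; apply: eq_bigr => i _.
  rewrite subSS -mulrA exprVn; congr (_ * _).
  case: i => i /= /ltnW im; rewrite -{2}(subnK im).
  by rewrite exprD mulKf ?expf_neq0.
have xE' : x ^+ n.+1 = \sum_(i < n.+1) s^-1 * b' (n.+1 - i)%N * x ^+ i.
  by under eq_bigr do rewrite -mulrA; rewrite -mulr_sumr -xE mulKf.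
exists (fun i => a i + a n.+1 * (s^-1 * b' (n.+1 - i)%N)); split.
  by move=> i; apply: good_ringD => //; do !apply: gr_mult => //.
rewrite -ae [RHS]big_ord_recr /= xE' mulr_sumr -big_split /=.
by apply: eq_bigr => i _; rewrite mulrDl !mulrA.
Qed.

(** Descent on [n + m]: of two relations, for [x] and for [x^-1], the longer one is shortened by the
    other. *)
Lemma max_valuation_ring x : x != 0 -> A x \/ A x^-1.
Proof.
move=> x0; apply: contrapT => /not_orP[/adjoin_rel[n rn] /adjoin_rel[m rm]].
have r0 y : ~ inv_relation y 0.
  by move=> [a [aA]]; rewrite big_ord1 expr0 mulr1 => e; apply: (gr_unif Ag); rewrite -e.
move: (leqnn (n + m)); move: {2}(n + m)%N => q; elim: q n m x x0 rn rm => [|q IH] n m x x0 rn rm.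
  by rewrite leqn0 addn_eq0 => /andP[/eqP n0 _]; rewrite n0 in rn; apply: r0 rn.
case: (leqP m n) => [mn|nm] le.
  case: n rn mn le => [/r0//|n] rn mn le.
  by apply: (IH n m x x0 _ rm le); apply: rel_step rn rm mn.
case: m rm nm le => [//|m] rm nm le.
have x0' : x^-1 != 0 by rewrite invr_eq0.
apply: (IH n m x x0 rn); last by move: le; rewrite addnS.
by apply: (rel_step (m := n) x0' rm); rewrite ?invrK // ltnW.
Qed.
End Max.

Section Discrete.
Variable A : L -> Prop.
Hypotheses (Ag : good_ring A) (Av : forall x, x != 0 -> A x \/ A x^-1).

Definition aunit x := [/\ x != 0, A x & A x^-1].

Lemma aunitM x y : aunit x -> aunit y -> aunit (x * y).
Proof.
move=> [x0 Ax Ax'] [y0 Ay Ay']; split; first exact: mulf_neq0.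
  exact: gr_mult.
by rewrite invfM; apply: gr_mult.
Qed.
Lemma aunitV x : aunit x -> aunit x^-1.
Proof. by move=> [x0 Ax Ax']; split; rewrite ?invr_eq0 ?invrK. Qed.
Lemma aunitX x m : aunit x -> aunit (x ^+ m).
Proof.
move=> ux; elim: m => [|m IH]; last by rewrite exprS; apply: aunitM.
by rewrite expr0; split; rewrite ?oner_eq0 ?invr1 //; apply: good_ring1.
Qed.

Definition nonunit z := A z /\ forall u, A u -> z * u <> 1.
Lemma nonunit0 : nonunit 0.
Proof.
split; first exact: good_ring0.
by move=> u _ /eqP; rewrite mul0r eq_sym oner_eq0.
Qed.
Lemma nonunitD x y : nonunit x -> nonunit y -> nonunit (x + y).
Proof.
move=> [Ax nx] [Ay ny]; split=> [|u Au e]; first exact: good_ringD.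
case: (eqVneq x 0) => [x0|x0]; first by apply: (ny u) => //; rewrite -e x0 add0r.
case: (eqVneq y 0) => [y0|y0]; first by apply: (nx u) => //; rewrite -e y0 addr0.
have [|h|] := Av (x := x / y); first by rewrite mulf_neq0 ?invr_eq0.
  apply: (ny ((x / y + 1) * u)).
    by apply: gr_mult => //; apply: good_ringD => //; apply: good_ring1.
  by rewrite mulrA mulrDr mulr1 [y * _]mulrC mulfVK.
rewrite invf_div => h; apply: (nx ((1 + y / x) * u)).
  by apply: gr_mult => //; apply: good_ringD => //; apply: good_ring1.
by rewrite mulrA mulrDr mulr1 [x * _]mulrC mulfVK.
Qed.

Lemma A_scale c : c != 0 -> exists2 u, aunit u & c%:A = t ^ (v c) * u :> L.
Proof.
move=> c0; pose c' := c / unif v ^ v c.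
have c'0 : c' != 0 by rewrite mulf_neq0 ?invr_eq0 ?unifXz_neq0.
have vc' : v c' = 0 by rewrite vmapM ?invr_eq0 ?unifXz_neq0 // vmapV ?unifXz_neq0 // unifXz subrr.
have i0 : (c'%:A : L) != 0 by rewrite scaler_eq0 negb_or c'0 oner_eq0.
exists (c'%:A); first split=> //.
- by apply: gr_base => //; rewrite /vge vc' orbT.
- rewrite -[X in A X^-1]/(GRing.in_alg L c') -fmorphV; apply: gr_base => //.
  by rewrite /vge vmapV // vc' orbT.
rewrite -[t]/(GRing.in_alg L (unif v)) -fmorphXz -[RHS](rmorphM (GRing.in_alg L)) /c'.
by rewrite mulrCA divff ?mulr1 // unifXz_neq0.
Qed.

Lemma tX_A (m : int) : A (t ^ m) <-> 0 <= m.
Proof.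
have tA : A t by apply: gr_base => //; rewrite /vge unifE orbT.
split; last by case: m => // m _; apply: good_ringX.
case: m => // m h; exfalso; apply: (gr_unif Ag).
rewrite NegzE -exprnN in h.
have -> : t^-1 = t ^- m.+1 * t ^+ m.
  by rewrite exprS invfM mulrAC -mulrA divff ?mulr1 ?expf_neq0 ?t_neq0.
by apply: gr_mult => //; apply: good_ringX.
Qed.

(* A linear relation between the powers of [x] has two terms of least value, *)
(* so that a power of [x] is a scalar up to a unit of [A].                    *)
Lemma power_scalar x : x != 0 -> exists m a u, [/\ (0 < m <= \dim {:L})%N, aunit u & x ^+ m = t ^ a * u].
Proof.
move=> x0; pose n := \dim {:L}.
have [c c0 cE] : exists2 c : 'I_n.+1 -> K, exists i, c i != 0 & \sum_i c i *: x ^+ i = 0.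
  pose s := [tuple x ^+ i | i < n.+1].
  have : ~~ free s.
    apply/negP => /eqP fs; have := dimvS (subvf <<s>>%VS).
    by rewrite fs size_tuple ltnn.
  move=> /freeP h; apply: contrapT => nc; apply: h => c e i.
  apply/eqP; apply: contrapT => /negP ci; apply: nc; exists c; first by exists i.
  by rewrite -[RHS]e; apply: eq_bigr => j _; rewrite -tnth_nth tnth_mktuple.
pose y i := c i *: x ^+ i.
pose I := {i | c i != 0}.
have y0 i : c i != 0 -> y i != 0 by move=> ci; rewrite scaler_eq0 negb_or ci expf_neq0.
have [i ci imin] : exists2 i, c i != 0 & forall j, c j != 0 -> A (y j / y i).
  have : forall s : seq 'I_n.+1, has (fun i => c i != 0) s ->
      exists2 i, c i != 0 & forall j, j \in s -> c j != 0 -> A (y j / y i).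
    elim=> //= i s IH; case: (boolP (has _ s)) => [/IH[i' ci' h] _|hs].
      case: (eqVneq (c i) 0) => [ci|ci].
        exists i' => // j; rewrite inE => /predU1P[->|]; last exact: h.
        by rewrite ci eqxx.
      have [] := Av (x := y i / y i'); first by rewrite mulf_neq0 ?invr_eq0 ?y0.
        by move=> hi; exists i' => // j; rewrite inE => /predU1P[->//|]; apply: h.
      rewrite invf_div => hi; exists i => // j; rewrite inE => /predU1P[->|js] cj.
        by rewrite divff ?y0 //; apply: good_ring1.
      have -> : y j / y i = y j / y i' * (y i' / y i) by rewrite mulrA mulfVK ?y0.
      by apply: gr_mult => //; apply: h.
    rewrite orbF => ci; exists i => // j; rewrite inE => /predU1P[->|js] cj.
      by rewrite divff ?y0 //; apply: good_ring1.
    by move/hasPn: hs => /(_ j js); rewrite cj.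
  case: c0 => i0 ci0 /(_ (index_enum 'I_n.+1)) h.
  have [|i ci hi] := h; first by apply/hasP; exists i0; rewrite ?mem_index_enum.
  by exists i => // j cj; apply: hi; rewrite ?mem_index_enum.
have zA j : A (y j / y i).
  case: (eqVneq (c j) 0) => [cj|]; last exact: imin.
  by rewrite /y cj scale0r mul0r; apply: good_ring0.
have [j ji uj] : exists2 j, j != i & aunit (y j / y i).
  apply: contrapT => nj.
  have Nz : nonunit (\sum_(j | j != i) y j / y i).
    apply: (big_ind nonunit); [exact: nonunit0|exact: nonunitD|].
    move=> j ji; split=> // u Au e; apply: nj; exists j => //.
    have z0 : y j / y i != 0 by apply: contraTneq isT => z0; move/eqP: e; rewrite z0 mul0r eq_sym oner_eq0.
    by split=> //; rewrite -[_^-1]mulr1 -e mulKf.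
  have e : \sum_(j | j != i) y j / y i = -1.
    apply/eqP; rewrite -subr_eq0 opprK addrC; apply/eqP.
    have := congr1 ( *%R^~ (y i)^-1) cE; rewrite mul0r mulr_suml (bigD1 i) //=.
    by rewrite divff ?y0.
  have [_ /(_ (-1))] := Nz; rewrite e mulrNN mulr1; apply=> //.
  by apply: good_ringN => //; apply: good_ring1.
have cj : c j != 0.
  have [z0 _ _] := uj; apply: contraNneq z0 => cj.
  by rewrite /y cj scale0r mul0r.
have key (i' j' : 'I_n.+1) : c i' != 0 -> c j' != 0 -> aunit (y j' / y i') -> (i' < j')%N ->
    exists m a u, [/\ (0 < m <= n)%N, aunit u & x ^+ m = t ^ a * u].
  move=> ci' cj' uz ij; pose d := c i' / c j'.
  have d0 : d != 0 by rewrite mulf_neq0 ?invr_eq0.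
  have [u uu dE] := A_scale d0.
  exists (j' - i')%N, (v d), (u * (y j' / y i')); split; last 1 first.
  - rewrite mulrA -dE /y.
    have -> : d%:A = (c i')%:A / (c j')%:A :> L by rewrite /d; exact: (fmorph_div (GRing.in_alg L)).
    have yE (j0 : 'I_n.+1) : c j0 *: x ^+ j0 = (c j0)%:A * x ^+ j0 by rewrite mulr_algl.
    rewrite !yE.
    have i0 a : a != 0 -> a%:A != 0 :> L by move=> a0; rewrite scaler_eq0 negb_or a0 oner_eq0.
    have xj : x ^+ j' = x ^+ (j' - i') * x ^+ i' by rewrite -exprD subnK // ltnW.
    rewrite xj; move: (i0 _ ci') (i0 _ cj') (expf_neq0 i' x0).
    move: ((c i')%:A) ((c j')%:A) (x ^+ i') (x ^+ (j' - i')) => a b y1 y2 a0 b0 y10.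
    by field; rewrite a0 b0 y10.
  - by rewrite subn_gt0 ij (leq_trans (leq_subr _ _)) // -ltnS.
  - exact: aunitM.
case: (ltngtP i j) ji => [ij _|ji _|/val_inj->]; last by rewrite eqxx.
- exact: (key i j).
- by apply: (key j i) => //; rewrite -invf_div; apply: aunitV.
Qed.

(** [power_scalar] yields an exponent at most the dimension that varies with [x]; the factorial of
    the dimension is a multiple of all of them. So [a] is that factorial times the rational
    extension of [v]. *)
Definition val_is x a := exists2 u, aunit u & x ^+ (\dim {:L})`! = t ^ a * u.

Lemma value_exists x : x != 0 -> exists a, val_is x a.
Proof.
move=> x0; have [m [a [u [/andP[m0 mn] uu xm]]]] := power_scalar x0.
have /dvdnP[q qE] : (m %| (\dim {:L})`!)%N by rewrite dvdn_fact // m0.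
exists (a * q%:Z), (u ^+ q); first exact: aunitX.
by rewrite qE mulnC exprM xm exprMn -[(t ^ a) ^+ q]/((t ^ a) ^ q%:Z) exprz_exp.
Qed.

Lemma aunit_t a : aunit (t ^ a) -> a = 0.
Proof. by move=> [_ /tX_A h]; rewrite invr_expz => /tX_A; lia. Qed.

Lemma t_neq0z a : t ^ a != 0. Proof. by rewrite expfz_neq0 ?t_neq0. Qed.

Lemma aunit0 u : aunit u -> u != 0. Proof. by case. Qed.

Lemma val_is_uniq x a b : val_is x a -> val_is x b -> a = b.
Proof.
move=> [u uu xa] [u' uu']; rewrite xa => e; apply/eqP; rewrite -subr_eq0; apply/eqP/aunit_t.
have -> : t ^ (a - b) = u' * u^-1; last by apply: aunitM => //; apply: aunitV.
apply: (mulIf (aunit0 uu)); rewrite mulfVK ?(aunit0 uu) //.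
apply: (mulfI (t_neq0z b)); rewrite -e mulrA -expfzDr ?t_neq0 //; congr (_ ^ _ * _); lia.
Qed.

Lemma val_isM x y a b : val_is x a -> val_is y b -> val_is (x * y) (a + b).
Proof.
move=> [u uu xa] [w uw yb]; exists (u * w); first exact: aunitM.
by rewrite exprMn xa yb mulrACA expfzDr ?t_neq0.
Qed.

Lemma val_is_ge0 x a : x != 0 -> val_is x a -> A x <-> 0 <= a.
Proof.
move=> x0 [u uu xa]; have M0 : (0 < (\dim {:L})`!)%N := fact_gt0 _.
have h : A (x ^+ (\dim {:L})`!) <-> 0 <= a.
  rewrite -tX_A xa; split=> h; last by apply: gr_mult => //; case: uu.
  rewrite -[t ^ a](mulfK (aunit0 uu)); apply: gr_mult => //; by case: uu.
rewrite -h; split=> [Ax|Axm]; first exact: good_ringX.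
have [//|Ax'] := Av x0.
have -> : x = x ^+ (\dim {:L})`! * x^-1 ^+ (\dim {:L})`!.-1.
  by rewrite -{1}(prednK M0) exprS -mulrA -exprMn divff // expr1n mulr1.
by apply: gr_mult => //; apply: good_ringX.
Qed.

(** The values form a nonzero subgroup of the integers; division by its least positive element [g]
    normalizes the valuation. *)
Lemma A_valuation : exists (w : valuation L) (e : int), 0 < e /\ forall c, c != 0 -> w c%:A = e * v c.
Proof.
have M0 : (0 < (\dim {:L})`!)%N := fact_gt0 _.
have /choice[f fP] : forall x : L, exists a, x != 0 -> val_is x a.
  move=> x; case: (eqVneq x 0) => [->|x0]; first by exists 0.
  by have [a] := value_exists x0; exists a.
have fU x a : x != 0 -> val_is x a -> f x = a.
  by move=> x0; apply: val_is_uniq; apply: fP.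
have fM x y : x != 0 -> y != 0 -> f (x * y) = f x + f y.
  by move=> x0 y0; apply: fU; [apply: mulf_neq0|apply: val_isM; apply: fP].
have fA x : x != 0 -> A x <-> 0 <= f x by move=> x0; apply: val_is_ge0 => //; apply: fP.
have f1 : f 1 = 0 by have := fM 1 1 (oner_neq0 L) (oner_neq0 L); rewrite mulr1; lia.
have fV x : x != 0 -> f x^-1 = - f x.
  by move=> x0; have := fM x x^-1 x0; rewrite invr_eq0 divff // f1 => /(_ x0); lia.
have fD x y : x != 0 -> y != 0 -> x + y != 0 -> Num.min (f x) (f y) <= f (x + y).
  wlog h : x y / A (y / x) => [hw|] x0 y0 xy0.
    have yx0 : y / x != 0 by rewrite mulf_neq0 ?invr_eq0.
    have [h|] := Av yx0; first exact: hw.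
    by rewrite invf_div minC addrC => h; apply: hw; rewrite // addrC.
  have xE : x + y = x * (1 + y / x) by rewrite mulrDr mulr1 mulrCA divff ?mulr1.
  have z0 : 1 + y / x != 0 by apply: contraNneq xy0 => z0; rewrite xE z0 mulr0.
  rewrite xE fM // ge_min; have /(fA _ z0) : A (1 + y / x); last by lia.
  by apply: good_ringD => //; apply: good_ring1.
have ft a : f (t ^ a) = a * ((\dim {:L})`!)%:Z.
  apply: fU; first exact: t_neq0z.
  exists 1; last by rewrite mulr1 -[(t ^ a) ^+ _]/((t ^ a) ^ _%:Z) exprz_exp.
  by split; rewrite ?oner_eq0 ?invr1 //; apply: good_ring1.
have fc c : c != 0 -> f c%:A = v c * ((\dim {:L})`!)%:Z.
  move=> c0; have [u uu ->] := A_scale c0.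
  have [u0 Au Au'] := uu; rewrite fM ?t_neq0z // ft.
  have /(fA _ u0) := Au; have := Au'; have u0' : u^-1 != 0 by rewrite invr_eq0.
  by move=> /(fA _ u0'); rewrite fV //; lia.
have [g [g0 [xg xg0 fxg]] gmin] : exists2 g : nat, (0 < g)%N /\ exists2 x, x != 0 & f x = g%:Z &
    forall g' : nat, (0 < g')%N -> (exists2 x, x != 0 & f x = g'%:Z) -> (g <= g')%N.
  pose P (g : nat) := `[< (0 < g)%N /\ exists2 x, x != 0 & f x = g%:Z >].
  have exP : exists g, P g.
    exists (\dim {:L})`!; apply/asboolP; split=> //; exists (t ^ 1); first exact: t_neq0z.
    by rewrite ft mul1r.
  case: (ex_minnP exP) => g /asboolP gP gmin; exists g => // g' g'0 g'P.
  by apply: gmin; apply/asboolP.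
have gdvd x : x != 0 -> exists q, f x = q * g%:Z.
  move=> x0; exists (f x %/ g%:Z)%Z; have e := divz_eq (f x) g%:Z.
  have r0 : (0 <= f x %% g%:Z)%Z by apply: modz_ge0; lia.
  have rg : ((f x %% g%:Z)%Z < g%:Z) by apply: ltz_pmod; lia.
  case: (eqVneq (f x %% g%:Z)%Z 0) => [z0|z0]; first by rewrite {1}e z0 addr0.
  pose y := x * xg ^ (- (f x %/ g%:Z)%Z).
  have xgz a : xg ^ a != 0 /\ f (xg ^ a) = a * g%:Z.
    split; first by rewrite expfz_neq0.
    have nat_case (m : nat) : f (xg ^+ m) = m%:Z * g%:Z.
      elim: m => [|m IH]; first by rewrite expr0 f1 mul0r.
      by rewrite exprS fM ?expf_neq0 // IH fxg; lia.
    case: a => m; first exact: nat_case.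
    by rewrite NegzE -exprnN fV ?expf_neq0 // nat_case; lia.
  have [xz fz] := xgz (- (f x %/ g%:Z)%Z).
  have := gmin (absz (f x %% g%:Z)%Z) _ _.
  have -> : (0 < absz (f x %% g%:Z)%Z)%N by lia.
  move=> /(_ isT); have h : exists2 y, y != 0 & f y = (absz (f x %% g%:Z)%Z)%:Z.
    exists y; first by rewrite mulf_neq0.
    rewrite fM // fz; lia.
  by move=> /(_ h); lia.
pose w x := (f x %/ g%:Z)%Z.
have wE x : x != 0 -> f x = w x * g%:Z.
  by move=> x0; have [q qE] := gdvd x x0; rewrite /w qE mulzK //; lia.
have wM x y : x != 0 -> y != 0 -> w (x * y) = w x + w y.
  move=> x0 y0; have := fM x y x0 y0; rewrite !wE ?mulf_neq0 //.
  by rewrite -mulrDl => /mulIf; apply; lia.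
have wD x y : x != 0 -> y != 0 -> x + y != 0 -> Num.min (w x) (w y) <= w (x + y).
  move=> x0 y0 xy0; have := fD x y x0 y0 xy0; rewrite !wE // !ge_min.
  by rewrite !ler_pM2r ?ltz_nat.
have w1 : exists2 x, x != 0 & w x = 1.
  by exists xg => //; rewrite /w fxg divzz; lia.
have [q qE] := gdvd (t ^ 1) (t_neq0z 1); rewrite ft mul1r in qE.
exists (Valuation wM wD w1), q; split; first by nia.
move=> c c0; have cL : (c%:A : L) != 0 by rewrite scaler_eq0 negb_or c0 oner_eq0.
have := fc c c0; rewrite (wE _ cL) qE mulrA => /mulIf; rewrite [q * _]mulrC; apply; lia.
Qed.
End Discrete.

Lemma valuation_extends : exists (w : valuation L) (e : int),
  0 < e /\ forall c, c != 0 -> w c%:A = e * v c.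
Proof.
have [A [Ag Amax]] := max_good.
exact: (A_valuation Ag (max_valuation_ring Ag Amax)).
Qed.
End Chevalley.

Lemma argmin_int n (P : pred 'I_n) (g : 'I_n -> int) :
  (exists i, P i) -> exists2 i, P i & forall j, P j -> g i <= g j.
Proof.
move=> [i0 Pi0]; case: (Order.TotalTheory.arg_minP g Pi0) => i Pi h.
by exists i.
Qed.

(** * Totally ramified extensions *)

Section Ramified.
Variables (K : fieldType) (v : valuation K) (F : fieldExtType K) (w : valuation F) (e : nat).
Hypotheses (e0 : (0 < e)%N) (we : forall c, c != 0 -> w c%:A = e%:Z * v c).

Lemma scal_neq0 c : c != 0 -> c%:A != 0 :> F.
Proof. by move=> c0; rewrite scaler_eq0 negb_or c0 oner_eq0. Qed.

Lemma vge_in_alg m c : vge v m c -> vge w (e%:Z * m) c%:A.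
Proof.
rewrite /vge; case: (eqVneq c 0) => [->|c0] /=; first by rewrite scale0r eqxx.
by move=> h; rewrite (negPf (scal_neq0 c0)) we //= ler_pM2l ?ltz_nat.
Qed.

Lemma vge0_in_alg c : vge v 0 c -> vge w 0 c%:A.
Proof. by move/vge_in_alg; rewrite mulr0. Qed.

(** An equation of [a], scaled to integral coefficients one of which is 1, reduces to a nonzero
    polynomial over [k], which splits. Lifting its roots gives a product of factors [a - s z] that
    lies in the maximal ideal, so one of the factors does. *)
Lemma residue_full (k : closedFieldType) (red : {rmorphism integers v -> k}) :
  residue_map red -> forall a, vge w 0 a ->
  exists2 c, vge v 0 c & vge w 1 (a - c%:A).
Proof.
move=> redP a wa; have [rs r0] := redP; pose n := \dim {:F}.
have [c [i0 ci0] cE] : exists2 c : 'I_n.+1 -> K, exists i, c i != 0 & \sum_i c i *: a ^+ i = 0.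
  pose s := [tuple a ^+ i | i < n.+1].
  have : ~~ free s.
    apply/negP => /eqP fs; have := dimvS (subvf <<s>>%VS).
    by rewrite fs size_tuple ltnn.
  move=> /freeP h; apply: contrapT => nc; apply: h => c e' i.
  apply/eqP; apply: contrapT => /negP ci; apply: nc; exists c; first by exists i.
  by rewrite -[RHS]e'; apply: eq_bigr => j _; rewrite -tnth_nth tnth_mktuple.
have [i ci imin] := argmin_int (fun i => v (c i)) (ex_intro (fun i => c i != 0) i0 ci0).
have cint j : vge v 0 (c j / c i).
  rewrite /vge mulf_eq0 invr_eq0 (negPf ci) orbF; case: (eqVneq (c j) 0) => //= cj.
  by rewrite vmapM ?invr_eq0 // vmapV // subr_ge0 imin.
pose phi : {rmorphism integers v -> F} := (GRing.in_alg F : {rmorphism K -> F}) \o int_incl v.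
pose P : {poly integers v} := \poly_(j < n.+1) mkint (cint (inord j)).
have Pi : P`_i = 1.
  rewrite coef_poly ltn_ord; apply: int_val_inj; rewrite int_val1 /= inord_val divff //.
have Pa : (map_poly phi P).[a] = 0.
  rewrite (@horner_coef_wide _ n.+1); last first.
    by rewrite /map_poly; apply: leq_trans (size_poly _ _) (size_poly _ _).
  have := congr1 ( *:%R (c i)^-1) cE; rewrite scaler0 scaler_sumr => e'; rewrite -[RHS]e'.
  apply: eq_bigr => j _; rewrite coef_map coef_poly ltn_ord /= inord_val.
  by rewrite mulr_algl scalerA mulrC.
have redP0 : map_poly red P != 0.
  apply/eqP => /polyP/(_ i); rewrite coef_map Pi coef0.
  by move/(etrans (esym (rmorph1 red)))/eqP; rewrite oner_eq0.
have [r rE] := closed_field_poly_normal (map_poly red P).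
have [lc lcE] := rs (lead_coef (map_poly red P)).
have /choice[s sE] := rs.
(* A lift of the factorization of the reduction of [P]: the difference [Q - P] has its coefficients
   in the maximal ideal, and [P] vanishes at [a]. *)
pose Q : {poly integers v} := lc *: \prod_(z <- r) ('X - (s z)%:P).
have QE : map_poly red Q = map_poly red P.
  rewrite [RHS]rE /Q map_polyZ /= lcE rmorph_prod; congr (_ *: _).
  by apply: eq_bigr => z _; rewrite rmorphB /= map_polyX map_polyC /= sE.
have Qa : vge w 1 (map_poly phi Q).[a].
  have -> : (map_poly phi Q).[a] = (map_poly phi (Q - P)).[a].
    by rewrite rmorphB hornerD hornerN Pa subr0.
  rewrite horner_coef; apply: vge_sum => j _; rewrite coef_map -[1 : int]addr0.
  apply: vgeM.
    have : vge v 1 (int_val (Q - P)`_j).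
      by apply/r0; rewrite -coef_map rmorphB /= QE subrr coef0.
    by move/vge_in_alg; apply: vge_le; rewrite mulr1; lia.
  elim: (nat_of_ord j) => [|m IH]; first by rewrite expr0 /vge vmap1 orbT.
  by rewrite exprS -[0 : int]addr0 vgeM.
have lc0 : ~~ vge w 1 (phi lc).
  have : red lc != 0 by rewrite lcE lead_coef_eq0.
  have [h|h] := boolP (vge v 1 (int_val lc)); first by move/eqP; have /r0 := h.
  have l0 : int_val lc != 0 by apply: contraNneq h => ->; rewrite vge0.
  move=> _; rewrite /vge (negPf (scal_neq0 l0)) we //=.
  by have := int_valP lc; move: h; rewrite /vge (negPf l0) /=; nia.
have : vge w 1 (phi lc * \prod_(z <- r) (a - phi (s z))).
  have hz z : (map_poly phi ('X - z%:P)).[a] = a - phi z.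
    by rewrite map_polyXsubC hornerXsubC.
  move: Qa; rewrite map_polyZ hornerZ rmorph_prod horner_prod.
  by congr (vge w 1 (_ * _)); apply: eq_bigr => z _; apply: hz.
elim: r {rE Q QE Qa} => [|z r IH]; first by rewrite big_nil mulr1 (negPf lc0).
rewrite big_cons mulrCA => h.
case: (boolP (vge w 1 (a - phi (s z)))) => [hz|nz]; first by exists (int_val (s z)); first exact: int_valP.
apply: IH; have az : vge w 0 (a - phi (s z)).
  by apply: vgeB => //; apply: vge0_in_alg; apply: int_valP.
move: h nz az; rewrite /vge mulf_eq0; case: eqVneq => //= z0.
case: eqVneq => //= y0; rewrite vmapM //.
move: (w (a - _)) (w (phi lc * _)) => x y.
lia.
Qed.

Hypothesis res : forall a, vge w 0 a -> exists2 c, vge v 0 c & vge w 1 (a - c%:A).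
Local Notation X := (unif w).

Definition comb (c : 'rV[K]_e) : F := \sum_i c 0 i *: X ^+ i.

Lemma combB c d : comb (c - d) = comb c - comb d.
Proof.
by rewrite /comb -sumrB; apply: eq_bigr => i _; rewrite !mxE scalerBl.
Qed.

Lemma term_neq0 c (i : 'I_e) : c != 0 -> c *: X ^+ i != 0.
Proof. by move=> c0; rewrite scaler_eq0 negb_or c0 expf_neq0 ?unif_neq0. Qed.
Lemma term_val c (i : 'I_e) : c != 0 -> w (c *: X ^+ i) = e%:Z * v c + i%:Z.
Proof.
move=> c0; rewrite -mulr_algl vmapM ?scal_neq0 ?expf_neq0 ?unif_neq0 // we //.
by rewrite vmapX ?unif_neq0 // unifE natz.
Qed.

Lemma term_distinct (a b : int) (i j : 'I_e) : (i != j :> 'I_e) -> e%:Z * a + i%:Z <> e%:Z * b + j%:Z.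
Proof.
case: i j => [i' h2] [j' h1] /eqP ij /= E; apply: ij; apply: val_inj => /=.
have : a = b; last by move=> ab; move: E; rewrite ab; lia.
by nia.
Qed.

(** The nonzero terms have valuations in distinct classes modulo [e], so nothing cancels and the
    valuation of the sum is the least of theirs. *)
Lemma comb_vge m c : vge w m (comb c) <-> forall i, c 0 i != 0 -> m <= e%:Z * v (c 0 i) + i%:Z.
Proof.
split=> [h i ci|h]; last first.
  apply: vge_sum => i _; rewrite /vge; case: (eqVneq (c 0 i) 0) => [->|ci]; first by rewrite scale0r eqxx.
  by rewrite term_val // h ?orbT.
have [i1 ci1 imin] := argmin_int (fun i => e%:Z * v (c 0 i) + i%:Z) (ex_intro (fun i => c 0 i != 0) i ci).
apply: le_trans (imin i ci).
have wy : vge w (w (c 0 i1 *: X ^+ i1) + 1) (\sum_(j | j != i1) c 0 j *: X ^+ j).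
  apply: vge_sum => j ji; rewrite /vge; case: (eqVneq (c 0 j) 0) => [->|cj]; first by rewrite scale0r eqxx.
  rewrite !term_val //; apply/orP; right; have := imin j cj.
  have := @term_distinct (v (c 0 j)) (v (c 0 i1)) _ _ ji; lia.
have [y0 wE] := vmap_lt_add (term_neq0 i1 ci1) wy.
by move: h; rewrite /comb (bigD1 i1) //= /vge (negPf y0) wE term_val.
Qed.

Lemma scaled_le (a m : int) (i : 'I_e) : e%:Z * m <= e%:Z * a + i%:Z -> m <= a.
Proof.
move=> h; have h1 : e%:Z * m < e%:Z * (a + 1).
  by apply: le_lt_trans h _; rewrite mulrDr mulr1 ltrD2l ltz_nat.
by move: h1; rewrite ltr_pM2l ?ltz_nat // ltzD1.
Qed.

Lemma le_scaled (N : nat) (a : int) (i : nat) : N%:Z <= a -> N%:Z <= e%:Z * a + i%:Z.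
Proof. by move=> h; have := e0; nia. Qed.

Lemma comb_inj : injective comb.
Proof.
move=> c d E; apply/eqP; rewrite -subr_eq0; apply/eqP/rowP => i; rewrite [RHS]mxE.
apply: (vge_all0 (v := v)) => m; rewrite /vge; case: eqVneq => //= n0.
have : vge w (e%:Z * m%:Z) (comb (c - d)) by rewrite combB E subrr vge0.
by move=> /comb_vge/(_ i n0)/scaled_le.
Qed.

(** Write [m = e q + i]: the term of index [i] with coefficient of valuation [q] has valuation [m],
    and a residue lifted from [K] cancels the leading part of [x]. *)
Lemma comb_step (x : F) (m : int) : vge w m x -> exists c, vge w (m + 1) (x - comb c).
Proof.
move=> wx; have e' : e%:Z != 0 :> int by case: e e0.
pose q := (m %/ e%:Z)%Z; have r0 : (0 <= m %% e%:Z)%Z by apply: modz_ge0.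
have re : (m %% e%:Z)%Z < e%:Z by apply: ltz_pmod; rewrite ltz_nat.
have [i iE] : exists i : 'I_e, i%:Z = (m %% e%:Z)%Z.
  have h : (absz (m %% e%:Z)%Z < e)%N by lia.
  by exists (Ordinal h) => /=; lia.
pose y := (unif v ^ q)%:A * X ^+ i : F.
have u0 : unif v ^ q != 0 := unifXz_neq0 v q.
have y0 : y != 0 by rewrite mulf_neq0 ?scal_neq0 ?expf_neq0 ?unif_neq0.
have wy : w y = m.
  by rewrite /y mulr_algl term_val // unifXz iE mulrC -divz_eq.
have [|a a0 ha] := res (a := x / y).
  rewrite /vge mulf_eq0 invr_eq0 (negPf y0) orbF; move: wx; rewrite /vge.
  by case: eqVneq => //= x0; rewrite vmapM ?invr_eq0 // vmapV // wy subr_ge0.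
exists (\row_j (if j == i then a * unif v ^ q else 0)).
have -> : comb (\row_j (if j == i then a * unif v ^ q else 0)) = a%:A * y.
  rewrite /comb (bigD1 i) //= mxE eqxx big1 ?addr0 => [|j /negPf ji]; last first.
    by rewrite mxE ji scale0r.
  by rewrite /y !mulr_algl scalerA.
have -> : x - a%:A * y = y * (x / y - a%:A) by rewrite mulrBr [y * (_ / _)]mulrC mulfVK // [y * _]mulrC.
by apply: vgeM => //; rewrite /vge wy lexx orbT.
Qed.

Hypothesis Kc : complete_field v.

Lemma comb_approx (x : F) : exists C : nat -> 'rV[K]_e, forall N : nat, vge w N%:Z (x - comb (C N)).
Proof.
suff /choice[C CP] : forall N : nat, exists c, vge w N%:Z (x - comb c) by exists C.
move=> N; have [m wm] : exists m, vge w m x by exists (w x); rewrite /vge lexx orbT.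
have [q qE] : exists q : nat, forall c, vge w (m + q%:Z) c -> vge w N%:Z c.
  by exists (absz (N%:Z - m)) => c; apply: vge_le; lia.
suff [c hc] : exists c, vge w (m + q%:Z) (x - comb c) by exists c; apply: qE.
elim: q {qE} => [|q [c IH]].
  by exists 0; rewrite addr0 /comb big1 ?subr0 // => i _; rewrite mxE scale0r.
have [c' hc'] := comb_step IH; exists (c + c').
have -> : x - comb (c + c') = x - comb c - comb c'.
  by have := combB (c + c') c'; rewrite addrK => ->; ring.
by apply: vge_le hc'; lia.
Qed.

Lemma coord_vge (c : 'rV[K]_e) (N : nat) i : vge w (e%:Z * N%:Z) (comb c) -> vge v N%:Z (c 0 i).
Proof.
move=> /comb_vge/(_ i) h; rewrite /vge; case: eqVneq => //= ci.
by apply: scaled_le (h ci).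
Qed.

Lemma comb_limit (C : nat -> 'rV[K]_e) :
  (forall N : nat, exists n0, forall m n, (n0 <= m)%N -> (n0 <= n)%N -> vge w N%:Z (comb (C m) - comb (C n))) ->
  exists l, forall N : nat, exists n0, forall n, (n0 <= n)%N -> vge w N%:Z (comb (C n) - comb l).
Proof.
move=> h; have /choice[l lE] : forall i, exists l, forall N : nat, exists n0, forall n,
    (n0 <= n)%N -> vge v N%:Z (C n 0 i - l).
  move=> i; apply: Kc => N; have [n0 hn] := h (e * N)%N; exists n0 => m n hm hn'.
  have := hn m n hm hn'; rewrite -combB => hc.
  have := @coord_vge (C m - C n) N i; rewrite !mxE; apply.
  by rewrite -PoszM.
exists (\row_i l i) => N.
have [n0 hn] : exists n0, forall i n, (n0 <= n)%N -> vge v N%:Z (C n 0 i - l i).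
  have : forall s : seq 'I_e, exists n0, forall i n, i \in s -> (n0 <= n)%N -> vge v N%:Z (C n 0 i - l i).
    elim=> [|i s [n0 IH]]; first by exists 0%N.
    have [n1 h1] := lE i N; exists (maxn n0 n1) => j n; rewrite inE geq_max => /predU1P[->|js] /andP[h2 h3].
      exact: h1.
    exact: IH.
  case/(_ (index_enum 'I_e)) => n0 hn; exists n0 => i n; exact: (hn i n (mem_index_enum i)).
exists n0 => n nn; rewrite -combB; apply/comb_vge => i; rewrite !mxE => ni.
have := hn i n nn; by rewrite /vge (negPf ni) /=; apply: le_scaled.
Qed.

(** The approximations by [comb] are Cauchy coordinate by coordinate, since [comb_vge] controls each
    coordinate; completeness of [K] gives the limit. *)
Lemma comb_surj x : exists c, x = comb c.
Proof.
have [C CP] := comb_approx x.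
have [|l lP] := comb_limit (C := C).
  move=> N; exists N => m n hm hn.
  have -> : comb (C m) - comb (C n) = (x - comb (C n)) - (x - comb (C m)) by ring.
  by apply: vgeB; [apply: vge_le (CP n)|apply: vge_le (CP m)].
exists l; apply/eqP; rewrite -subr_eq0; apply/eqP/(vge_all0 (v := w)) => N.
have [n0 hn] := lP N; pose n := maxn N n0.
have -> : x - comb l = (x - comb (C n)) + (comb (C n) - comb l) by ring.
apply: vgeD; last by apply: hn; rewrite leq_maxr.
by apply: vge_le (CP n); rewrite lez_nat leq_maxl.
Qed.

Lemma ext_complete : complete_field w.
Proof.
move=> u uc; have /choice[C CE] := fun n => comb_surj (u n).
have [|l lP] := comb_limit (C := C).
  by move=> N; have [n0 hn] := uc N; exists n0 => m n hm hn'; rewrite -!CE; apply: hn.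
by exists (comb l) => N; have [n0 hn] := lP N; exists n0 => n nn; rewrite CE; apply: hn.
Qed.

Definition powers := [tuple X ^+ i | i < e].

Lemma powers_comb (c : 'I_e -> K) : \sum_i c i *: powers`_i = comb (\row_i c i).
Proof. by apply: eq_bigr => i _; rewrite mxE -tnth_nth tnth_mktuple. Qed.

Lemma powers_basis : basis_of {:F} powers.
Proof.
apply/andP; split.
  rewrite eqEsubv subvf; apply/subvP => x _; have [c ->] := comb_surj x.
  rewrite /comb; apply: memv_suml => i _; apply: memvZ.
  apply: (memv_span (X := tval powers)).
  by apply/tnthP; exists i; rewrite tnth_mktuple.
apply/freeP => c; rewrite powers_comb => h i.
have : comb (\row_i c i) = comb 0 by rewrite h /comb big1 // => j _; rewrite mxE scale0r.
by move/comb_inj/rowP/(_ i); rewrite !mxE.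
Qed.

(** The powers [X ^+ i], [i < e], form a basis over [K]: there is neither residue extension nor
    defect. *)
Lemma ramification_dim : e = \dim {:F}.
Proof. by rewrite -(size_basis powers_basis). Qed.
End Ramified.

(** * A multiplicative weight derived from structure constants *)

Section Weighted.
Variables (K : fieldType) (v : valuation K) (n : nat) (n0 : (0 < n)%N).
Local Notation O := (integers v).
Variable c : 'I_n -> 'I_n -> 'I_n -> O.
Definition weight (x : K) (i : nat) : int := n%:Z * v x + i%:Z.
Hypotheses
  (c_ge : forall i j l, int_val (c i j l) != 0 -> (i + j)%:Z <= weight (int_val (c i j l)) l)
  (c_eq : forall i j, exists2 l, int_val (c i j l) != 0 & weight (int_val (c i j l)) l = (i + j)%:Z).
Local Notation cmulK := (cmul (A := restr (int_incl v) (self_alg K)) c).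

Definition wge m (x : 'rV[K]_n) := forall i, x 0 i != 0 -> m <= weight (x 0 i) i.



Lemma wgeD m x y : wge m x -> wge m y -> wge m (x + y).
Proof.
move=> hx hy i; rewrite mxE; case: (eqVneq (x 0 i) 0) => [->|x0]; first by rewrite add0r; apply: hy.
case: (eqVneq (y 0 i) 0) => [->|y0]; first by rewrite addr0 => _; apply: hx.
move=> xy0; have := vmapD v x0 y0 xy0; have := hx i x0; have := hy i y0; rewrite /weight ge_min.
move=> h1 h2 /orP[] h3; [apply: le_trans h2 _|apply: le_trans h1 _];
  by rewrite lerD2r ler_pM2l // ltz_nat.
Qed.

Lemma wge_sum (T : Type) (r : seq T) (F : T -> 'rV[K]_n) m : (forall t, wge m (F t)) -> wge m (\sum_(t <- r) F t).
Proof.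
move=> h; apply: (big_ind (wge m)) => // [i|x y]; first by rewrite mxE eqxx.
exact: wgeD.
Qed.

Lemma wge_cmul m m' x y : wge m x -> wge m' y -> wge (m + m') (cmulK x y).
Proof.
move=> hx hy.
have -> : cmulK x y = \sum_i \sum_j \row_l (x 0 i * y 0 j * int_val (c i j l)).
  apply/rowP => l; rewrite mxE summxE; apply: eq_bigr => i _.
  by rewrite summxE; apply: eq_bigr => j _; rewrite mxE.
apply: wge_sum => i; apply: wge_sum => j l; rewrite mxE.
rewrite !mulf_eq0 !negb_or => /andP[/andP[xi yj] cl].
have -> : weight (x 0 i * y 0 j * int_val (c i j l)) l =
    weight (x 0 i) i + weight (y 0 j) j + (weight (int_val (c i j l)) l - (i + j)%:Z).
  by rewrite /weight !vmapM ?mulf_neq0 // PoszD; ring.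
by apply: le_trans (lerD (hx i xi) (hy j yj)) _; rewrite lerDl subr_ge0 c_ge.
Qed.

Lemma weight_lead (x : 'rV[K]_n) : x != 0 -> exists i,
  [/\ x 0 i != 0, wge (weight (x 0 i) i) x &
      wge (weight (x 0 i) i + 1) (x - x 0 i *: delta_mx 0 i)].
Proof.
move=> x0; have [|i xi imin] := argmin_int (P := fun i => x 0 i != 0) (fun i => weight (x 0 i) i).
  by apply: contrapT => h; case/eqP: x0; apply/rowP => i; rewrite mxE; apply/eqP;
    apply: contrapT => /negP xi; apply: h; exists i.
exists i; split=> // j; rewrite !mxE eqxx; case: (eqVneq j i) => [->|ji].
  by rewrite mulr1 subrr eqxx.
rewrite mulr0 subr0 => xj; rewrite lezD1 lt_neqAle imin // andbT.
by apply/eqP => /esym; apply: term_distinct.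
Qed.

Lemma weight_unique (x : K) (y : K) i : x != 0 ->
  (y != 0 -> weight x i + 1 <= weight y i) -> x + y != 0 /\ weight (x + y) i = weight x i.
Proof.
move=> x0 h; have hy : vge v (v x + 1) y.
  rewrite /vge; case: (eqVneq y 0) => //= y0; have := h y0; rewrite /weight.
  by rewrite addrAC lerD2r !lezD1 ltr_pM2l ?ltz_nat.
by have [h1 h2] := vmap_lt_add x0 hy; split=> //; rewrite /weight h2.
Qed.

(** The product of the two leading terms attains the sum of the weights at an index [l] supplied by
    [c_eq]; every other contribution has larger weight there, so nothing cancels. *)
Lemma cmul_weight (x y : 'rV[K]_n) i j : x 0 i != 0 -> y 0 j != 0 ->
  wge (weight (x 0 i) i) x -> wge (weight (x 0 i) i + 1) (x - x 0 i *: delta_mx 0 i) ->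
  wge (weight (y 0 j) j) y -> wge (weight (y 0 j) j + 1) (y - y 0 j *: delta_mx 0 j) ->
  exists2 l, cmulK x y 0 l != 0 & weight (cmulK x y 0 l) l = weight (x 0 i) i + weight (y 0 j) j.
Proof.
move=> xi yj hx hx' hy hy'; have [l cl wl] := c_eq i j.
set u := x 0 i *: delta_mx 0 i in hx' *; set t := y 0 j *: delta_mx 0 j in hy' *.
pose r := cmulK (x - u) y + cmulK u (y - t).
have rE : cmulK x y = cmulK u t + r.
  apply/rowP => q; rewrite /r !mxE -!big_split; apply: eq_bigr => i' _.
  by rewrite -!big_split; apply: eq_bigr => j' _; rewrite !mxE /=; ring.
have utE : cmulK u t 0 l = x 0 i * y 0 j * int_val (c i j l).
  rewrite mxE (bigD1 i) //= [X in _ + X]big1 ?addr0 => [|i' /negPf ni]; last first.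
    by rewrite big1 // => j' _; rewrite !mxE ni andbF mulr0 !mul0r.
  rewrite (bigD1 j) //= [X in _ + X]big1 ?addr0 => [|j' /negPf nj].
    by rewrite !mxE !eqxx !mulr1.
  by rewrite !mxE nj andbF !mulr0 !mul0r.
have u0 : cmulK u t 0 l != 0 by rewrite utE !mulf_neq0.
have wu : weight (cmulK u t 0 l) l = weight (x 0 i) i + weight (y 0 j) j.
  rewrite utE; move: wl; rewrite /weight !vmapM ?mulf_neq0 // PoszD => e.
  transitivity (n%:Z * v (x 0 i) + n%:Z * v (y 0 j) + (n%:Z * v (int_val (c i j l)) + l%:Z)); first by ring.
  by rewrite e; ring.
have hu : wge (weight (x 0 i) i) u.
  move=> i'; rewrite !mxE eqxx; case: (eqVneq i' i) => [->|]; rewrite ?mulr1 ?mulr0 ?eqxx //.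
have hr : wge (weight (x 0 i) i + weight (y 0 j) j + 1) r.
  by apply: wgeD; [rewrite addrAC|rewrite -addrA]; apply: wge_cmul.
have hl : r 0 l != 0 -> weight (cmulK u t 0 l) l + 1 <= weight (r 0 l) l.
  by rewrite wu; apply: hr.
have [h1 h2] := weight_unique u0 hl.
by exists l; rewrite rE mxE ?h2.
Qed.

(** [W] is the least weight of a nonzero coordinate. Weights at different indices are distinct
    modulo [n], so the leading coordinate is unique and [W] is additive on products. *)
Lemma weight_exists : exists W : 'rV[K]_n -> int,
  (forall (x : 'rV[K]_n) m, x != 0 ->
    (m <= W x <-> forall i, x 0 i != 0 -> m <= n%:Z * v (x 0 i) + (i : nat)%:Z)) /\
  (forall x y : 'rV[K]_n, x != 0 -> y != 0 -> cmulK x y != 0 /\ W (cmulK x y) = W x + W y).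
Proof.
have [W WE] : exists W : 'rV[K]_n -> int, forall (x : 'rV[K]_n) i, x 0 i != 0 -> wge (weight (x 0 i) i) x ->
    W x = weight (x 0 i) i.
  have /choice[W WE] : forall x : 'rV[K]_n, exists w, forall i, x 0 i != 0 -> wge (weight (x 0 i) i) x ->
      w = weight (x 0 i) i.
    move=> x; case: (eqVneq x 0) => [->|x0]; first by exists 0 => i; rewrite mxE eqxx.
    have [i [xi hi _]] := weight_lead x0; exists (weight (x 0 i) i) => j xj hj.
    by apply/eqP; rewrite eq_le hi // hj.
  by exists W => x i; apply: WE.
exists W; split=> [x m x0|x y x0 y0].
  have [i [xi hi _]] := weight_lead x0; rewrite (WE x i xi hi).
  split=> [h j xj|]; last exact.
  exact: le_trans h (hi j xj).
have [i [xi hi hi']] := weight_lead x0; have [j [yj hj hj']] := weight_lead y0.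
have [l zl wl] := cmul_weight xi yj hi hi' hj hj'.
split; first by apply: contraNneq zl => ->; rewrite mxE.
by rewrite (WE _ l zl) ?wl ?(WE x i) ?(WE y j) //; apply: wge_cmul.
Qed.
End Weighted.

(** * The ring of integers of [L] over an extension of [K], as a lattice *)

Section WeilLattice.
Variables (K : fieldType) (v : valuation K) (L : fieldExtType K) (w : valuation L).
Local Notation n := (\dim {:L}).
Local Notation b := (vbasis {:L}).
Hypotheses (n0 : (0 < n)%N) (we : forall c, c != 0 -> w c%:A = n%:Z * v c).
Hypothesis combS : forall x, exists c, x = @comb _ L w n c.
Local Notation comb := (@comb _ L w n).
Let combI : injective comb := comb_inj n0 we.

Lemma comb_sum (T : Type) (r : seq T) (c : T -> K) (y : T -> 'rV[K]_n) :
  comb (\sum_(t <- r) c t *: y t) = \sum_(t <- r) c t *: comb (y t).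
Proof.
under [RHS]eq_bigr do rewrite scaler_sumr; rewrite exchange_big; apply: eq_bigr => i _ /=.
rewrite summxE scaler_suml; apply: eq_bigr => t _; by rewrite mxE scalerA.
Qed.

Definition coeffs (x : L) : 'rV[K]_n := sval (cid (combS x)).
Lemma coeffsK x : comb (coeffs x) = x. Proof. by rewrite /coeffs; case: cid. Qed.
Lemma combK c : coeffs (comb c) = c. Proof. by apply: combI; rewrite coeffsK. Qed.
Lemma coeffs_sum (T : Type) (r : seq T) (c : T -> K) (y : T -> L) :
  coeffs (\sum_(t <- r) c t *: y t) = \sum_(t <- r) c t *: coeffs (y t).
Proof. by apply: combI; rewrite comb_sum coeffsK; apply: eq_bigr => t _; rewrite coeffsK. Qed.

Lemma comb_delta (i : 'I_n) : comb (delta_mx 0 i) = unif w ^+ i.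
Proof.
rewrite /comb (bigD1 i) //= big1 ?addr0 => [|j /negPf ji]; first by rewrite mxE !eqxx scale1r.
by rewrite mxE ji andbF scale0r.
Qed.
Lemma coeffs_pow (i j : 'I_n) : coeffs (unif w ^+ i) 0 j = (i == j)%:R.
Proof. by rewrite -comb_delta combK mxE eqxx eq_sym. Qed.

Lemma coeffs_mul s (k l : 'I_n) :
  \sum_t coeffs (unif w ^+ s) 0 t * coeffs (unif w ^+ (t + k)) 0 l = coeffs (unif w ^+ (s + k)) 0 l.
Proof.
have -> : unif w ^+ (s + k) = \sum_t coeffs (unif w ^+ s) 0 t *: unif w ^+ (t + k).
  rewrite exprD -{1}(coeffsK (unif w ^+ s)) mulr_suml; apply: eq_bigr => t _.
  by rewrite -scalerAl exprD.
by rewrite coeffs_sum summxE; apply: eq_bigr => t _; rewrite mxE.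
Qed.

Lemma coeffs_pow_ge s t : coeffs (unif w ^+ s) 0 t != 0 -> s%:Z <= weight v n (coeffs (unif w ^+ s) 0 t) t.
Proof.
move=> h; have : vge w s%:Z (comb (coeffs (unif w ^+ s))).
  by rewrite coeffsK /vge vmapX ?unif_neq0 // unifE natz lexx orbT.
by move=> /(comb_vge n0 we)/(_ t h).
Qed.
Lemma coeffs_pow_eq s : exists2 t, coeffs (unif w ^+ s) 0 t != 0 &
  weight v n (coeffs (unif w ^+ s) 0 t) t = s%:Z.
Proof.
apply: contrapT => h; have : vge w (s%:Z + 1) (comb (coeffs (unif w ^+ s))).
  apply/(comb_vge n0 we) => t ht; rewrite lezD1 lt_neqAle coeffs_pow_ge // andbT.
  by apply/eqP => e; apply: h; exists t.
rewrite coeffsK /vge expf_eq0 (negPf (unif_neq0 w)) andbF /= vmapX ?unif_neq0 // unifE natz.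
by rewrite lezD1 ltxx.
Qed.

Definition vec (x : L) : 'rV[K]_n := \row_l coord b l x.
(** The passage from powers of the uniformizer to [vbasis], in which [tensor] is written; [pow_inv]
    is its inverse. *)
Definition pow_mx : 'M[K]_n := \matrix_(i, l) coord b l (unif w ^+ i).
Definition pow_inv : 'M[K]_n := \matrix_(l, i) coeffs (b`_l) 0 i.
Lemma vec_inv x : vec x *m pow_inv = coeffs x.
Proof.
rewrite [in RHS](coord_vbasis (memvf x)) coeffs_sum; apply/rowP => i.
by rewrite mxE summxE; apply: eq_bigr => l _; rewrite !mxE.
Qed.
Lemma pow_mxK : pow_mx *m pow_inv = 1%:M.
Proof.
apply/row_matrixP => i; rewrite row_mul.
have -> : row i pow_mx = vec (unif w ^+ i) by apply/rowP => l; rewrite !mxE.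
by rewrite vec_inv; apply/rowP => j; rewrite coeffs_pow !mxE.
Qed.

Variables (E : fieldType) (vE : valuation E) (phi : {rmorphism K -> E}) (d : nat).
Hypotheses (vphi : forall c, c != 0 -> vE (phi c) = d%:Z * v c) (nd : coprime n d) (d0 : (0 < d)%N).

Lemma exponents_exist : exists (a : 'I_n -> 'I_n) (m : 'I_n -> int),
  forall j, d%:Z * (a j)%:Z + n%:Z * m j = j%:Z.
Proof.
have /choice[am amE] : forall j : 'I_n, exists am : 'I_n * int, d%:Z * am.1%:Z + n%:Z * am.2 = j%:Z.
  (* From [u d = q n + 1]: [a j] is the remainder of [j u] by [n], and [m j] is [- j q] plus [d]
     times the quotient. *)
  move=> j; case: (egcdnP n d0) => u q e _; rewrite gcdnC (eqP nd) in e.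
  exists (Ordinal (ltn_pmod (j * u) n0), j%:Z * - q%:Z + d%:Z * ((j * u) %/ n)%:Z) => /=.
  have := divn_eq (j * u) n; move: ((j * u) %/ n)%N ((j * u) %% n)%N => x y h.
  have h' : j%:Z * u%:Z = x%:Z * n%:Z + y%:Z by rewrite -!PoszM -PoszD h.
  have e' : u%:Z * d%:Z = q%:Z * n%:Z + 1 by rewrite -!PoszM -PoszD e.
  transitivity (d%:Z * (x%:Z * n%:Z + y%:Z) - n%:Z * q%:Z * j%:Z); first by ring.
  rewrite -h'; transitivity (j%:Z * (u%:Z * d%:Z - q%:Z * n%:Z)); first by ring.
  by rewrite e'; ring.
by exists (fun j => (am j).1), (fun j => (am j).2).
Qed.

Variables (a : 'I_n -> 'I_n) (m : 'I_n -> int).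
Hypothesis am : forall j, d%:Z * (a j)%:Z + n%:Z * m j = j%:Z.

Lemma a_inj : injective a.
Proof.
move=> i j e; apply/eqP; apply/negPn/negP => ij.
have := @term_distinct n n0 (- m i) (- m j) i j ij; apply.
by rewrite -(am i) -(am j) e; ring.
Qed.

Local Notation u := (unif vE).
(** Row [j] holds the coordinates of the lattice vector of valuation [j]. As [phi] is any field
    morphism multiplying valuations by [d], one construction serves [K] and all [K(d)]. *)
Definition lat_mx : 'M[E]_n := \matrix_(j, l) (u ^ m j * phi (pow_mx (a j) l)).
Definition lat_inv : 'M[E]_n := \matrix_(l, j) (u ^ (- m j) * phi (pow_inv l (a j))).
Lemma lat_mxK : lat_mx *m lat_inv = 1%:M.
Proof.
apply/matrixP => i j; rewrite !mxE.
transitivity (u ^ m i * u ^ (- m j) * phi ((pow_mx *m pow_inv) (a i) (a j))).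
  rewrite mxE rmorph_sum mulr_sumr; apply: eq_bigr => l _.
  by rewrite !mxE rmorphM; ring.
rewrite pow_mxK mxE (inj_eq a_inj); case: eqVneq => [->|_]; rewrite ?rmorph1 ?rmorph0 ?mulr0 //.
by rewrite -expfzDr ?unif_neq0 // subrr expr0z mulr1.
Qed.
Lemma lat_invK : lat_inv *m lat_mx = 1%:M.
Proof. exact: mulmx1C lat_mxK. Qed.

(** The product of the vectors [i] and [j] is [u ^ (m i + m j)] times a power of the uniformizer of
    [L], whose expansion is rescaled by [u ^ (- m l)]. *)
Definition lat_cE i j l : E := u ^ (m i + m j - m l) * phi (coeffs (unif w ^+ (a i + a j)) 0 (a l)).

(** Over [E] the excess of the weight over [i + j] is [d] times the corresponding excess over [K];
    the next two lemmas thus descend from [coeffs_pow_ge] and [coeffs_pow_eq]. *)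
Lemma weight_cE i j l : lat_cE i j l != 0 ->
  weight vE n (lat_cE i j l) l = d%:Z * (weight v n (coeffs (unif w ^+ (a i + a j)) 0 (a l)) (a l)
     - (a i + a j)%:Z) + (i + j)%:Z.
Proof.
rewrite mulf_eq0 (negPf (unifXz_neq0 _ _)) fmorph_eq0 => c_0.
rewrite /weight vmapM ?unifXz_neq0 ?fmorph_eq0 // unifXz vphi // !PoszD.
by rewrite -(am l) -(am i) -(am j); ring.
Qed.

Lemma lat_cE_ge i j l : lat_cE i j l != 0 -> (i + j)%:Z <= weight vE n (lat_cE i j l) l.
Proof.
move=> h; rewrite weight_cE // lerDr mulr_ge0 // subr_ge0; apply: coeffs_pow_ge.
by move: h; rewrite mulf_eq0 (negPf (unifXz_neq0 _ _)) fmorph_eq0.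
Qed.

Lemma lat_cE_eq i j : exists2 l, lat_cE i j l != 0 & weight vE n (lat_cE i j l) l = (i + j)%:Z.
Proof.
have [t t0 te] := coeffs_pow_eq (a i + a j).
have [l lE] : exists l, a l = t by exists (invF a_inj t); rewrite f_invF.
have h : lat_cE i j l != 0 by rewrite mulf_neq0 ?unifXz_neq0 ?fmorph_eq0 ?lE.
by exists l => //; rewrite weight_cE // lE te subrr mulr0 add0r.
Qed.

Lemma lat_int i j l : vge vE 0 (lat_cE i j l).
Proof.
rewrite /vge; case: eqVneq => //= h; have := lat_cE_ge h; rewrite /weight => le.
have : n%:Z * 0 <= n%:Z * vE (lat_cE i j l) + l%:Z by rewrite mulr0; apply: le_trans le.
exact: scaled_le.
Qed.

Definition lat_c i j l : integers vE := mkint (lat_int i j l).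

Lemma lat_special (k : fieldType) (red : {rmorphism integers vE -> k}) (i j l : 'I_n) : residue_map red ->
  (l < i + j)%N -> red (lat_c i j l) = 0.
Proof.
move=> [_ r0] lij; apply/r0 => /=; rewrite /vge; case: eqVneq => //= h.
have := lat_cE_ge h; rewrite /weight => le.
have : n%:Z * 0 < n%:Z * vE (lat_cE i j l).
  by rewrite mulr0 -(ltrD2r l%:Z) add0r; apply: lt_le_trans le; rewrite ltz_nat.
by rewrite ltr_pM2l ?ltz_nat.
Qed.

Variable i0 : 'I_n.
Hypothesis i00 : i0 = 0%N :> nat.

Lemma a_m0 : a i0 = i0 /\ m i0 = 0.
Proof.
have e := am i0; rewrite i00 in e.
have h : (n %| d * a i0)%N.
  apply/dvdnP; exists (absz (m i0)); have := e; case: (m i0) => x /=.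
    by rewrite -!PoszM -PoszD => -[/eqP]; rewrite addn_eq0 => /andP[/eqP -> /eqP h]; rewrite mulnC h.
  by rewrite NegzE mulrN => /eqP; rewrite subr_eq add0r -!PoszM => /eqP[->]; rewrite mulnC.
rewrite Gauss_dvdr // in h.
have a0 : a i0 = 0%N :> nat.
  by apply/eqP; apply: contraTT h => h; rewrite gtnNdvd // lt0n.
split; first by apply: val_inj; rewrite /= a0 i00.
by move: e; rewrite a0 mulr0 add0r => /eqP; rewrite mulf_eq0 => /predU1P[/eqP|/eqP //]; rewrite gt_eqF // ltz_nat.
Qed.

Lemma lat_law : lattice_law i0 lat_c.
Proof.
have reindex_a (F : 'I_n -> E) : \sum_t F (a t) = \sum_t F t.
  by rewrite [RHS](reindex_inj a_inj).
(* Triple products are given by one formula, symmetric in [i], [j], [k]; associativity follows. *)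
have tri i j k l : \sum_t lat_cE i j t * lat_cE t k l =
    u ^ (m i + m j + m k - m l) * phi (coeffs (unif w ^+ (a i + a j + a k)) 0 (a l)).
  rewrite -coeffs_mul rmorph_sum mulr_sumr -[RHS]reindex_a; apply: eq_bigr => t _.
  rewrite /lat_cE rmorphM mulrACA -expfzDr ?unif_neq0 //; congr (_ ^ _ * _); ring.
split.
- by move=> i j l; apply: int_val_inj; rewrite /= /lat_cE [m i + m j]addrC [(a i + a j)%N]addnC.
- move=> i j k l; apply: int_val_inj.
  rewrite -[LHS]/(int_incl vE _) -[RHS]/(int_incl vE _) !rmorph_sum.
  transitivity (\sum_t lat_cE i j t * lat_cE t k l).
    by apply: eq_bigr => t _; rewrite rmorphM.
  transitivity (\sum_t lat_cE j k t * lat_cE t i l).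
    rewrite !tri (_ : (a j + a k + a i = a i + a j + a k)%N); last by rewrite addnC addnA.
    by congr (_ ^ _ * _); ring.
  apply: eq_bigr => t _; rewrite rmorphM /=; congr (_ * _).
  by rewrite /lat_cE [m i + m t]addrC [(a i + a t)%N]addnC.
move=> j l; apply: int_val_inj; rewrite /= /lat_cE; have [-> ->] := a_m0.
rewrite i00 !add0r add0n coeffs_pow (inj_eq a_inj).
case: eqVneq => [->|_]; last by rewrite rmorph0 mulr0.
by rewrite subrr expr0z rmorph1 mulr1 int_val1.
Qed.

Section Points.
Variable A : algebra E.
Local Notation T := (tensor_sort L (restr phi A)).
Local Notation HA := (map_mx (alg_in A) lat_inv).
Local Notation GA := (map_mx (alg_in A) lat_mx).
Local Notation iE := (int_incl vE).
Definition lat_co (x : T) : 'rV[A]_n := (x : 'rV[A]_n) *m HA.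

Lemma GAK : GA *m HA = 1%:M.
Proof. by rewrite -map_mxM lat_mxK map_mx1. Qed.
Lemma HAK : HA *m GA = 1%:M.
Proof. by rewrite -map_mxM lat_invK map_mx1. Qed.

Lemma lat_co_inj : injective lat_co.
Proof. by move=> x y /(congr1 (mulmx^~ GA)); rewrite -!mulmxA HAK !mulmx1. Qed.

Lemma lat_coK (x : 'rV[A]_n) : lat_co (x *m GA) = x.
Proof. by rewrite /lat_co -mulmxA GAK mulmx1. Qed.
End Points.

Lemma bilinear_mx (A : comPzRingType) (G : 'M[A]_n) (X Y : 'rV[A]_n) (f : 'I_n -> 'I_n -> A) :
  \sum_s \sum_t (X *m G) 0 s * (Y *m G) 0 t * f s t =
  \sum_i \sum_j X 0 i * Y 0 j * \sum_s \sum_t G i s * G j t * f s t.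
Proof.
transitivity (\sum_s \sum_t \sum_i \sum_j X 0 i * Y 0 j * (G i s * G j t * f s t)).
  apply: eq_bigr => s _; apply: eq_bigr => t _; rewrite !mxE mulr_suml mulr_suml.
  apply: eq_bigr => i _; rewrite mulr_sumr mulr_suml; apply: eq_bigr => j _; ring.
under eq_bigr do rewrite exchange_big; rewrite exchange_big; apply: eq_bigr => i _ /=.
under eq_bigr do rewrite exchange_big; rewrite exchange_big; apply: eq_bigr => j _ /=.
by rewrite mulr_sumr; apply: eq_bigr => s _; rewrite mulr_sumr.
Qed.

Lemma lat_mul (A : algebra E) (x y : tensor_sort L (restr phi A)) :
  lat_co (x * y) = cmul (A := restr (int_incl vE) A) lat_c (lat_co x) (lat_co y).
Proof.
(* The lattice structure constants are those of [vbasis], transported by [lat_mx] and its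
   inverse. *)
have key i j l : lat_cE i j l =
    \sum_q (\sum_s \sum_t lat_mx i s * lat_mx j t * phi (struct_const s t q)) * lat_inv q l.
  transitivity (u ^ (m i + m j) * \sum_q phi (vec (unif w ^+ (a i + a j)) 0 q) * lat_inv q l).
    rewrite mulr_sumr /lat_cE -vec_inv mxE rmorph_sum mulr_sumr; apply: eq_bigr => q _.
    by rewrite mxE rmorphM [lat_inv _ _]mxE expfzDr ?unif_neq0 //; ring.
  rewrite mulr_sumr; apply: eq_bigr => q _; rewrite mulrA; congr (_ * _).
  rewrite mxE exprD coord_mul rmorph_sum mulr_sumr; apply: eq_bigr => s _.
  rewrite rmorph_sum mulr_sumr; apply: eq_bigr => t _.
  by rewrite !rmorphM !mxE expfzDr ?unif_neq0 //; ring.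
have coK (z : tensor_sort L (restr phi A)) : z = lat_co z *m map_mx (alg_in A) lat_mx.
  by rewrite /lat_co -mulmxA HAK mulmx1.
move: (lat_co x) (lat_co y) (coK x) (coK y) => X Y -> ->; apply/rowP => l.
rewrite /lat_co mxE [RHS]mxE.
pose f (s t q : 'I_n) : A := alg_in A (phi (struct_const s t q)).
pose G : 'M[A]_n := map_mx (alg_in A) lat_mx.
transitivity (\sum_q (\sum_i \sum_j X 0 i * Y 0 j * \sum_s \sum_t G i s * G j t * f s t q) *
   alg_in A (lat_inv q l)).
  apply: eq_bigr => q _; rewrite -bilinear_mx [map_mx _ _ q l]mxE; congr (_ * _).
  exact: mxE.
under eq_bigr do rewrite mulr_suml; rewrite exchange_big; apply: eq_bigr => i _ /=.
under eq_bigr do rewrite mulr_suml; rewrite exchange_big; apply: eq_bigr => j _ /=.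
rewrite key rmorph_sum mulr_sumr; apply: eq_bigr => q _.
rewrite -mulrA; congr (_ * _); rewrite rmorphM; congr (_ * _).
rewrite rmorph_sum; apply: eq_bigr => s _; rewrite rmorph_sum; apply: eq_bigr => t _.
by rewrite !rmorphM !mxE.
Qed.

Lemma lat_one (A : algebra E) : lat_co (tensor_in (restr phi A) 1) = cone i0 (restr (int_incl vE) A).
Proof.
have [a0 m0] := a_m0.
have -> : tensor_in (restr phi A) 1 = cone i0 (restr (int_incl vE) A) *m map_mx (alg_in A) lat_mx.
  apply/rowP => l; rewrite !mxE (bigD1 i0) //= big1 ?addr0 => [|j /negPf ji]; last first.
    by rewrite mxE ji mul0r.
  by rewrite !mxE eqxx mul1r a0 m0 expr0z mul1r i00 expr0.
exact: lat_coK.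
Qed.
End WeilLattice.

(** * Uniqueness of elementary divisors *)

Lemma indep_card (k : fieldType) (n : nat) (S F : {set 'I_n}) (B : 'I_n -> 'I_n -> k) :
  (forall c : 'I_n -> k, (forall j, j \in F -> \sum_(i in S) c i * B i j = 0) ->
     forall i, i \in S -> c i = 0) -> (#|S| <= #|F|)%N.
Proof.
move=> h; pose M : 'M[k]_(#|S|, #|F|) := \matrix_(i, j) B (enum_val i) (enum_val j).
suff /eqP <- : row_free M by apply: rank_leq_col.
apply: inj_row_free => x xM; pose c i := \sum_s x 0 s * (enum_val s == i)%:R.
have cE s : c (enum_val s) = x 0 s.
  rewrite /c (bigD1 s) //= eqxx mulr1 big1 ?addr0 // => t /negPf ts.
  by rewrite (inj_eq enum_val_inj) ts mulr0.
apply/rowP => s; rewrite mxE -cE; apply: h; last exact: enum_valP.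
move=> j jF; rewrite big_enum_val /=; have /rowP/(_ (enum_rank_in jF j)) := xM.
rewrite !mxE => e; rewrite -[RHS]e; apply: eq_bigr => t _.
by rewrite cE mxE enum_rankK_in.
Qed.

Lemma sorted_card_eq n (g g' : 'I_n -> nat) :
  (forall i j : 'I_n, (i <= j)%N -> (g i <= g j)%N) ->
  (forall i j : 'I_n, (i <= j)%N -> (g' i <= g' j)%N) ->
  (forall m, (0 < m)%N -> #|[set i | (m <= g i)%N]| = #|[set i | (m <= g' i)%N]|) -> g =1 g'.
Proof.
have half (g1 g2 : 'I_n -> nat) : (forall i j : 'I_n, (i <= j)%N -> (g1 i <= g1 j)%N) ->
  (forall i j : 'I_n, (i <= j)%N -> (g2 i <= g2 j)%N) ->
  (forall m, (0 < m)%N -> #|[set i | (m <= g1 i)%N]| = #|[set i | (m <= g2 i)%N]|) ->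
  forall i, (g2 i <= g1 i)%N.
  move=> s1 s2 h i; rewrite leqNgt; apply/negP => lt.
  have := h (g2 i) (leq_ltn_trans (leq0n _) lt); apply/eqP; rewrite neq_ltn; apply/orP; left.
  apply: proper_card; apply/properP; split; last by exists i; rewrite inE // -ltnNge.
  apply/fintype.subsetP => j; rewrite !inE => hj; apply: s2.
  by case: (leqP i j) => // /ltnW/s1; rewrite leqNgt (leq_trans lt hj).
move=> s1 s2 h i; apply/eqP; rewrite eqn_leq !half // => m m0; by rewrite h.
Qed.

Section ElementaryDivisors.
Variables (K : fieldType) (v : valuation K) (k : fieldType).
Variables (red : {rmorphism integers v -> k}) (redP : residue_map red).
Local Notation O := (integers v).
Local Notation pi := (opi v).
Variables (n : nat) (f g : 'I_n -> nat) (y : 'I_n -> 'rV[O]_n).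
Definition in_diag (x : 'rV[O]_n) := forall j, vge v (f j)%:Z (int_val (x 0 j)).
Hypotheses
  (gen : forall x, exists c : 'I_n -> O, in_diag (x - \sum_i c i *: y i))
  (rel : forall c : 'I_n -> O, in_diag (\sum_i c i *: y i) <-> forall i, vge v (g i)%:Z (int_val (c i))).

Lemma in_diagD x x' : in_diag x -> in_diag x' -> in_diag (x + x').
Proof. by move=> h h' j; rewrite mxE int_valD vgeD. Qed.
Lemma in_diagZ a x : in_diag x -> in_diag (a *: x).
Proof. by move=> h j; rewrite mxE int_valM -[(f j)%:Z]add0r vgeM ?int_valP. Qed.

Lemma vge_piX (m m' : nat) x : vge v m%:Z (int_val x) -> vge v (m + m')%:Z (int_val (pi ^+ m' * x)).
Proof. by move=> h; rewrite int_valM int_valX opi_val -[unif v ^+ _]/(unif v ^ m'%:Z) PoszD vge_scale. Qed.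
Lemma piX_vge (m : nat) x : vge v m.+1%:Z (int_val (pi ^+ m * x)) -> red x = 0.
Proof.
have [_ r0] := redP; move=> h; apply/r0; move: h.
by rewrite int_valM int_valX opi_val -[unif v ^+ _]/(unif v ^ m%:Z) -add1n PoszD vge_scale.
Qed.
Lemma red_pi x : red x = 0 -> exists x', x = pi * x'.
Proof.
have [_ r0] := redP; move=> /r0 h; have /opi_multP[x' ->] : vge v 1%:Z (int_val x) by [].
by exists x'; rewrite expr1.
Qed.

Lemma piX_cong (m : nat) x x' : vge v m.+1%:Z (int_val (pi ^+ m * x - pi ^+ m.+1 * x')) -> red x = 0.
Proof.
move=> h; apply: (@piX_vge m); rewrite -[pi ^+ m * x](subrK (pi ^+ m.+1 * x')) int_valD.
apply: vgeD => //; have := @vge_piX 0 m.+1 x'; apply; exact: int_valP.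
Qed.

(** Let [M] be the quotient of the free module by [in_diag]. The vectors [pi ^ m y i] with [m < g i]
    are independent over [k] in [pi ^ m M / pi ^ (m + 1) M], which is spanned by the coordinate
    vectors with [m < f j]; so the matrix of the reductions of the [y i] has independent rows. *)
Lemma divisors_le m : (#|[set i | m < g i]| <= #|[set i | m < f i]|)%N.
Proof.
have [rs _] := redP; have /choice[s sE] := rs.
apply: (indep_card (B := fun i j => red (y i 0 j))) => c cE i0; rewrite inE => mi0.
pose C i := if (m < g i)%N then s (c i) else 0.
have CE i : red (C i) = if (m < g i)%N then c i else 0.
  by rewrite /C; case: ifP => _; rewrite ?sE ?rmorph0.
pose X := \sum_i C i *: y i.
have XF j : (m < f j)%N -> exists z, X 0 j = pi * z.
  move=> mj; apply: red_pi; rewrite /X summxE rmorph_sum /=; rewrite -[RHS](cE j) ?inE //.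
  rewrite [RHS]big_mkcond; apply: eq_bigr => i _; rewrite mxE rmorphM CE inE.
  by case: ifP => _; rewrite ?mul0r.
have /choice[z zE] : forall j, exists z, (m < f j)%N -> X 0 j = pi * z.
  by move=> j; case: ltnP => [/XF[z zE]|_]; [exists z|exists 0].
pose x : 'rV[O]_n := \row_j if (m < f j)%N then z j else 0.
have [b bM] := gen x.
have : in_diag (\sum_i (pi ^+ m * C i - pi ^+ m.+1 * b i) *: y i).
  have -> : \sum_i (pi ^+ m * C i - pi ^+ m.+1 * b i) *: y i =
      (pi ^+ m *: X - pi ^+ m.+1 *: x) + pi ^+ m.+1 *: (x - \sum_i b i *: y i).
    rewrite scalerBr addrA subrK /X !scaler_sumr -sumrB; apply: eq_bigr => i _.
    by rewrite scalerBl !scalerA.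
  apply: in_diagD; last exact: in_diagZ.
  move=> j; rewrite !mxE; case: ltnP => mj.
    by rewrite zE // exprSr mulrA subrr int_val0 vge0.
  rewrite mulr0 subr0; apply: vge_le (vge_piX (m := 0) m (int_valP _)).
  by rewrite lez_nat.
move=> /rel/(_ i0) h; have := CE i0; rewrite mi0 => <-.
by apply: (@piX_cong m _ (b i0)); apply: vge_le h; rewrite lez_nat.
Qed.

(** The argument of [divisors_le] with the two generating families exchanged. *)
Lemma divisors_ge m : (#|[set i | m < f i]| <= #|[set i | m < g i]|)%N.
Proof.
have [rs _] := redP; have /choice[s sE] := rs.
have /choice[B BE] : forall j : 'I_n, exists b : 'I_n -> O, in_diag (delta_mx 0 j - \sum_i b i *: y i).
  by move=> j; apply: gen.
apply: (indep_card (B := fun j i => red (B j i))) => c cE j0; rewrite inE => mj0.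
pose C j := if (m < f j)%N then s (c j) else 0.
have CE j : red (C j) = if (m < f j)%N then c j else 0.
  by rewrite /C; case: ifP => _; rewrite ?sE ?rmorph0.
pose D i := \sum_j C j * B j i.
have /choice[z zE] : forall i, exists z, (m < g i)%N -> D i = pi * z.
  move=> i; case: ltnP => [mi|_]; last by exists 0.
  have [|z zE] := @red_pi (D i); last by exists z.
  rewrite /D rmorph_sum -[RHS](cE i) ?inE // [RHS]big_mkcond; apply: eq_bigr => j _.
  by rewrite rmorphM /= CE inE; case: ifP => _; rewrite ?mul0r.
pose x := \sum_i (if (m < g i)%N then z i else 0) *: y i.
have XM : in_diag (\row_j C j - \sum_i D i *: y i).
  have -> : \row_j C j - \sum_i D i *: y i = \sum_j C j *: (delta_mx 0 j - \sum_i B j i *: y i).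
    under [RHS]eq_bigr do rewrite scalerBr; rewrite sumrB; congr (_ - _).
      by rewrite [LHS]row_sum_delta; apply: eq_bigr => j _; rewrite mxE.
    under [RHS]eq_bigr do rewrite scaler_sumr; rewrite exchange_big; apply: eq_bigr => i _ /=.
    by rewrite scaler_suml; apply: eq_bigr => j _; rewrite scalerA.
  apply: (big_ind in_diag) => [j||j _]; [by rewrite mxE int_val0 vge0|exact: in_diagD|exact: in_diagZ].
have : in_diag (pi ^+ m *: \row_j C j - pi ^+ m.+1 *: x).
  have -> : pi ^+ m *: \row_j C j - pi ^+ m.+1 *: x = pi ^+ m *: (\row_j C j - \sum_i D i *: y i) +
      \sum_i (pi ^+ m * D i - pi ^+ m.+1 * (if (m < g i)%N then z i else 0)) *: y i.
    rewrite scalerBr -addrA; congr (_ + _); rewrite /x !scaler_sumr -!sumrN -big_split /=.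
    by apply: eq_bigr => i _; rewrite scalerBl !scalerA addKr.
  apply: in_diagD; first exact: in_diagZ.
  apply/rel => i; case: ltnP => mi; first by rewrite zE // exprSr mulrA subrr int_val0 vge0.
  rewrite mulr0 subr0; apply: vge_le (vge_piX (m := 0) m (int_valP _)).
  by rewrite lez_nat.
move=> /(_ j0); rewrite !mxE => h; have := CE j0; rewrite mj0 => <-.
by apply: (@piX_cong m _ (x 0 j0)); apply: vge_le h; rewrite lez_nat.
Qed.

Lemma divisors_card m : (0 < m)%N -> #|[set i | (m <= g i)%N]| = #|[set i | (m <= f i)%N]|.
Proof. by case: m => // m _; apply/eqP; rewrite eqn_leq divisors_le divisors_ge. Qed.
End ElementaryDivisors.

(** [a] is a permutation, so the exponents at the [a j] are the sorted sequence of the [(d i) / n]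
    in another order; sorted sequences whose level sets have equal sizes coincide. *)
Lemma divisors_floor (K : fieldType) (v : valuation K) (k : fieldType)
    (red : {rmorphism integers v -> k}) (n d : nat) (a : 'I_n -> 'I_n) (g : 'I_n -> nat)
    (y : 'I_n -> 'rV[integers v]_n) :
  residue_map red -> injective a ->
  (forall i j : 'I_n, (i <= j)%N -> (g i <= g j)%N) ->
  (forall x, exists c : 'I_n -> integers v, in_diag (fun j => (d * a j) %/ n)%N (x - \sum_i c i *: y i)) ->
  (forall c : 'I_n -> integers v, in_diag (fun j => (d * a j) %/ n)%N (\sum_i c i *: y i) <->
     forall i, vge v (g i)%:Z (int_val (c i))) ->
  forall i, g i = ((d * i) %/ n)%N.
Proof.
move=> redP ai gs h1 h2; apply: sorted_card_eq => // [i j ij|m m0].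
  by apply: leq_div2r; rewrite leq_mul2l ij orbT.
rewrite (divisors_card redP h1 h2) //.
rewrite -(card_imset [set i | (m <= (d * a i) %/ n)%N] ai); apply: eq_card => j.
apply/imsetP/idP => [[i + ->]|]; rewrite !inE // => hj.
by exists (invF ai j); rewrite ?inE f_invF.
Qed.

(** * Lie algebras *)

Section LiePoints.
Variables (R : comNzRingType) (n : nat) (i0 : 'I_n) (c : 'I_n -> 'I_n -> 'I_n -> R).
Hypothesis law : lattice_law i0 c.
Local Notation D := (dual_alg R).

Lemma dual_sum1 (S : comPzRingType) (T : Type) (r : seq T) (F : T -> dual S) :
  (\sum_(i <- r) F i).1 = \sum_(i <- r) (F i).1.
Proof. by elim/big_rec2: _ => // i y1 y2 _ <-. Qed.
Lemma dual_sum2 (S : comPzRingType) (T : Type) (r : seq T) (F : T -> dual S) :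
  (\sum_(i <- r) F i).2 = \sum_(i <- r) (F i).2.
Proof. by elim/big_rec2: _ => // i y1 y2 _ <-. Qed.

(** The coordinates of [1 + epsilon z], with 1 at the index [i0]. *)
Definition lie_row (z : 'rV[R]_n) : 'rV[D]_n := \row_l (((l == i0)%:R, z 0 l) : dual R).

Lemma lie_row_mul z z' : cmul c (lie_row z) (lie_row z') = lie_row (z + z').
Proof.
apply/rowP => l; rewrite [RHS]mxE [LHS]mxE.
have P1 : \sum_i \sum_j (i == i0)%:R * (j == i0)%:R * c i j l = (l == i0)%:R.
  rewrite (bigD1 i0) //= [X in _ + X]big1 ?addr0 => [|i /negPf ni]; last first.
    by rewrite big1 // => j _; rewrite ni !mul0r.
  rewrite (bigD1 i0) //= [X in _ + X]big1 ?addr0 => [|j /negPf nj]; last first.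
    by rewrite nj mulr0 mul0r.
  by rewrite eqxx !mul1r ll1 // eq_sym.
have P2 : \sum_i \sum_j ((i == i0)%:R * z' 0 j + z 0 i * (j == i0)%:R) * c i j l = z 0 l + z' 0 l.
  under eq_bigr do under eq_bigr do rewrite mulrDl.
  under eq_bigr do rewrite big_split; rewrite big_split [RHS]addrC /=; congr (_ + _).
    rewrite (bigD1 i0) //= [X in _ + X]big1 ?addr0 => [|i /negPf ni]; last first.
      by rewrite big1 // => j _; rewrite ni !mul0r.
    transitivity (\sum_j z' 0 j * (j == l)%:R).
      by apply: eq_bigr => j _; rewrite eqxx mul1r ll1.
    rewrite (bigD1 l) //= eqxx mulr1 big1 ?addr0 // => i /negPf ->; exact: mulr0.
  transitivity (\sum_i z 0 i * (i == l)%:R).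
    apply: eq_bigr => i _; rewrite (bigD1 i0) //= [X in _ + X]big1 ?addr0 => [|j /negPf nj].
      by rewrite eqxx mulr1 (llC law) ll1.
    by rewrite nj mulr0 mul0r.
  rewrite (bigD1 l) //= eqxx mulr1 big1 ?addr0 // => i /negPf ->; exact: mulr0.
rewrite -P1 mxE -P2; apply: injective_projections.
  rewrite dual_sum1; apply: eq_bigr => i _; rewrite dual_sum1; apply: eq_bigr => j _.
  by rewrite !mxE.
rewrite dual_sum2; apply: eq_bigr => i _; rewrite dual_sum2; apply: eq_bigr => j _.
by rewrite !mxE /= mulr0 add0r.
Qed.

Lemma lie_row0 : lie_row 0 = cone i0 D.
Proof.
apply/rowP => l; rewrite !mxE; case: (l == i0); rewrite ?mulr1n ?mulr0n //.
Qed.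

Fact lie_pt_sub z : cmul c (lie_row z) (lie_row (- z)) = cone i0 D.
Proof. by rewrite lie_row_mul subrr lie_row0. Qed.
Definition lie_pt z : tpt i0 c D := mkt (lie_pt_sub z).

Lemma lie_ptD z z' : tmul law (lie_pt z) (lie_pt z') = lie_pt (z + z').
Proof. by apply: tpt_eq => //; apply: lie_row_mul. Qed.
Lemma lie_pt0 : lie_pt 0 = tone law D.
Proof. by apply: tpt_eq => //; apply: lie_row0. Qed.
Lemma lie_pt_inj : injective lie_pt.
Proof.
by move=> z z' e; apply/rowP => l; have /rowP/(_ l) := congr1 (@tx _ _ _ _ _) e; rewrite !mxE => -[].
Qed.
Lemma lie_pt_scale a z : pmap (p := tor law) (dual_scale a) (lie_pt z) = lie_pt (a *: z).
Proof.
by apply: tpt_eq => //; apply/rowP => l; rewrite !mxE.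
Qed.
Lemma lie_pt_proj z : pmap (p := tor law) (dual_proj_hom R) (lie_pt z) = tone law (self_alg R).
Proof. by apply: tpt_eq => //; apply/rowP => l; rewrite !mxE. Qed.
Lemma lie_ptP (t : tor law D) : pmap (dual_proj_hom R) t = tone law (self_alg R) ->
  exists z, t = lie_pt z.
Proof.
move=> e; exists (\row_l (tx t 0 l).2); apply: tpt_eq => //; apply/rowP => l; rewrite !mxE.
have /rowP/(_ l) := congr1 (@tx _ _ _ _ _) e; rewrite !mxE /= /dual_proj => <-.
by case: (tx t 0 l).
Qed.
End LiePoints.

Section LieNeron.
Variables (R : comNzRingType) (n : nat) (i0 : 'I_n) (c : 'I_n -> 'I_n -> 'I_n -> R).
Hypothesis law : lattice_law i0 c.
Variables (G : group_functor R) (al : morphism (tor law) G).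
Hypotheses (alM : forall C t s, al C (tmul law t s) = gmul (al C t) (al C s))
  (al_I : forall C, injective (al C))
  (alL : forall x : G (dual_alg R), in_lie x -> exists t, al _ t = x).

Lemma al_one1 C : al C (tone law C) = gone G C.
Proof.
by apply: gidem; rewrite -alM; congr (al C _); apply: tpt_eq => //; apply: cmul1.
Qed.

(** By the lemmas below, a linear isomorphism from row vectors onto the Lie algebra of [G]. *)
Definition lieG z := al (dual_alg R) (lie_pt law z).

Lemma lieG_in z : in_lie (lieG z).
Proof. by rewrite /in_lie /lieG -mor_map lie_pt_proj al_one1. Qed.
Lemma lieG_ex x : in_lie x -> exists z, x = lieG z.
Proof.
move=> xl; have [t tE] := alL xl; have [|z zE] := @lie_ptP _ _ _ _ law t.
  by apply: al_I; rewrite mor_map tE al_one1.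
by exists z; rewrite -tE zE.
Qed.
Lemma lieG_inj : injective lieG. Proof. by move=> z z' /al_I/lie_pt_inj. Qed.
Lemma lieGD z z' : gmul (lieG z) (lieG z') = lieG (z + z').
Proof. by rewrite /lieG -alM lie_ptD. Qed.
Lemma lieG0 : lieG 0 = gone G _.
Proof. by rewrite /lieG lie_pt0 al_one1. Qed.
Lemma lieGN z : ginv (lieG z) = lieG (- z).
Proof. by apply/esym/ginv_uniq; rewrite lieGD subrr lieG0. Qed.
Lemma lieGZ a z : lie_scale a (lieG z) = lieG (a *: z).
Proof. by rewrite /lie_scale /lieG -mor_map lie_pt_scale. Qed.
Lemma lieG_comb m (a : 'I_m -> R) z :
  lie_comb a (fun i => lieG (z i)) = lieG (\sum_i a i *: z i).
Proof.
rewrite /lie_comb; elim/big_rec2: _ => [|i x y _ ->]; first by rewrite lieG0.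
by rewrite lieGZ lieGD.
Qed.
End LieNeron.

(** * The Weil restriction and its Neron lft-models *)

Section WeilGroup.
Variables (K : fieldType) (v : valuation K) (L : fieldExtType K) (w : valuation L).
Local Notation n := (\dim {:L}).
Hypotheses (n0 : (0 < n)%N) (we : forall c, c != 0 -> w c%:A = n%:Z * v c).
Hypothesis combS : forall x, exists c, x = @comb _ L w n c.
Variables (E : fieldType) (vE : valuation E) (phi : {rmorphism K -> E}) (d : nat).
Hypotheses (vphi : forall c, c != 0 -> vE (phi c) = d%:Z * v c).
Variables (a : 'I_n -> 'I_n) (m : 'I_n -> int).
Hypotheses (am : forall j, d%:Z * (a j)%:Z + n%:Z * m j = j%:Z) (nd : coprime n d).
Variable i0 : 'I_n.
Hypothesis i00 : i0 = 0%N :> nat.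

Local Notation lc := (lat_c n0 we combS vphi am).
Local Notation iE := (int_incl vE).
Local Notation T A := (tensor_sort L (restr phi A)).
Definition wco (A : algebra E) (x : T A) : 'rV[A]_n := lat_co combS vE a m x.

Lemma wco_map (A A' : algebra E) (f : alghom A A') (x : T A) :
  wco (tensor_fun (restr_hom phi f) x : T A') = map_mx f (wco x).
Proof.
rewrite /wco /lat_co map_mxM -map_mx_comp; congr (_ *m _).
  by apply/rowP => l; rewrite !mxE.
by apply/matrixP => i j; rewrite !mxE /= hom_in.
Qed.

Lemma wco_inj (A : algebra E) (u u' : unit_pair (tensor L (restr phi A))) :
  wco (sval u).1 = wco (sval u').1 -> u = u'.
Proof.
case: u u' => [[x y] /= h] [[x' y'] /= h'] e0; have e : x = x' := lat_co_inj n0 we am e0.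
apply: unit_pair_inj => /=; congr (_, _) => //; move/eqP: h' => h'.
by rewrite -[y]mul1r -h' -e mulrAC (eqP h) mul1r.
Qed.

Lemma wco_mul (A : algebra E) (x y : T A) :
  wco (x * y) = cmul (A := restr iE A) lc (wco x) (wco y).
Proof. exact: lat_mul. Qed.

Lemma wco_one (A : algebra E) : wco (1 : T A) = cone i0 (restr iE A).
Proof. exact: (lat_one n0 we combS vE phi nd am i00 A). Qed.

Lemma wco_surj (A : algebra E) (x : 'rV[A]_n) : exists b : T A, wco b = x.
Proof.
by exists (x *m map_mx (alg_in A) (lat_mx w vE phi a m)); apply: (lat_coK n0 we combS vE phi am x).
Qed.

Lemma wco_unit (A : algebra E) (x y : 'rV[A]_n) :
  cmul (A := restr iE A) lc x y = cone i0 (restr iE A) ->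
  exists u : unit_pair (tensor L (restr phi A)), wco (sval u).1 = x.
Proof.
move=> e; have [b bE] := wco_surj x; have [b' bE'] := wco_surj y.
have h : b * b' == 1.
  apply/eqP; apply: (lat_co_inj n0 we am); apply: (etrans (wco_mul b b')).
  by rewrite bE bE' e; apply/esym/wco_one.
by exists (exist (fun u : T A * T A => u.1 * u.2 == 1) (b, b') h).
Qed.

Lemma wco_weight : exists W : 'rV[E]_n -> int,
  (forall (x : 'rV[E]_n) m, x != 0 ->
    (m <= W x <-> forall i, x 0 i != 0 -> m <= n%:Z * vE (x 0 i) + (i : nat)%:Z)) /\
  (forall x y : 'rV[E]_n, x != 0 -> y != 0 -> cmul (A := restr iE (self_alg E)) lc x y != 0 /\
     W (cmul (A := restr iE (self_alg E)) lc x y) = W x + W y).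
Proof.
apply: (weight_exists n0) => [i j l|i j].
  exact: (lat_cE_ge n0 we vphi am).
exact: (lat_cE_eq n0 we combS vphi am).
Qed.
End WeilGroup.

Section WeilNeron.
Variables (K : fieldType) (v : valuation K) (L : fieldExtType K) (w : valuation L).
Local Notation n := (\dim {:L}).
Hypotheses (n0 : (0 < n)%N) (we : forall c, c != 0 -> w c%:A = n%:Z * v c).
Hypothesis combS : forall x, exists c, x = @comb _ L w n c.
Variable i0 : 'I_n.
Hypothesis i00 : i0 = 0%N :> nat.
Variables (k : closedFieldType) (p : nat).
Hypothesis p_char : p \in [pchar k].

Lemma weil_neron (E : fieldType) (vE : valuation E) (phi : {rmorphism K -> E}) (d : nat)
    (vphi : forall c, c != 0 -> vE (phi c) = d%:Z * v c) (nd : coprime n d)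
    (a : 'I_n -> 'I_n) (m : 'I_n -> int) (am : forall j, d%:Z * (a j)%:Z + n%:Z * m j = j%:Z)
    (red : {rmorphism integers vE -> k}) (redP : residue_map red) (Ec : complete_field vE)
    (N : neron_lft vE (gbase_change phi (res_Gm L))) :
  let law := lat_law n0 we combS vphi nd am i00 in
  exists al : morphism (tor law) N,
  [/\ forall (A : algebra E) t, wco combS vE a m (sval (nm_generic N A (al (restr (int_incl vE) A) t))).1 = tx t,
      forall C t s, al C (tmul law t s) = gmul (al C t) (al C s),
      forall C, injective (al C),
      forall x : N (dual_alg (integers vE)), in_lie x -> exists t, al _ t = x &
      forall Q : subfunctor N, max_qc_subgroup Q ->
        (forall C x, Q C x <-> exists t, al C t = x) /\
        exists f : morphism (sub_presheaf Q) (tor law), forall C, bijective (f C)].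
Proof.
move=> law; have [W [Wge WM]] := wco_weight n0 we combS vphi am.
apply: (neron_torus redP p_char Ec law (B := gbase_change phi (res_Gm L))
  (co := fun A (u : unit_pair (tensor L (restr phi A))) => wco combS vE a m (sval u).1) _ _ _ _ _ Wge WM N).
- by move=> A A' f x; apply: wco_map.
- by move=> A x y; apply: (wco_inj n0 we am).
- by move=> A x y; apply: (wco_mul n0 we combS vphi am).
- by move=> A; apply: (wco_one n0 we combS vE phi am nd i00).
- by move=> A x y; apply: (wco_unit (n0:=n0) (we:=we) (vphi:=vphi) (am:=am) nd i00).
Qed.

(** The case [d = 1] over [K], with [res_Gm L] itself in place of a base change; [a] is the identity
    and the exponents [m] are forced to be 0. *)
Lemma weil_neron_base (m : 'I_n -> int) (am : forall j : 'I_n, 1%:Z * j%:Z + n%:Z * m j = j%:Z)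
    (vphi : forall c, c != 0 -> v (idfun c) = 1%:Z * v c)
    (red : {rmorphism integers v -> k}) (redP : residue_map red) (Kc : complete_field v)
    (N : neron_lft v (res_Gm L)) :
  let law := lat_law n0 we combS (phi := idfun) vphi (coprimen1 n) am i00 in
  exists al : morphism (tor law) N,
  [/\ forall (A : algebra K) t, wco (phi := idfun) combS v id m (sval (nm_generic N A (al (restr (int_incl v) A) t))).1 = tx t,
      forall C t s, al C (tmul law t s) = gmul (al C t) (al C s),
      forall C, injective (al C) &
      forall x : N (dual_alg (integers v)), in_lie x -> exists t, al _ t = x].
Proof.
move=> law; have [W [Wge WM]] := wco_weight n0 we combS vphi am.
have [|||||al [h1 h2 h3 h4 _]] := neron_torus redP p_char Kc law (B := res_Gm L)
  (co := fun A (u : unit_pair (tensor L A)) => wco (phi := idfun) combS v id m (sval u).1) _ _ _ _ _ Wge WM N.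
- by move=> A A' f x; have h := wco_map (phi:=idfun) combS v id m f (sval x).1; exact: h.
- by move=> A x y e; have h := wco_inj (phi:=idfun) n0 we am (u:=x) (u':=y); exact: (h combS v e).
- by move=> A x y; have h := wco_mul (phi:=idfun) n0 we combS vphi am (sval x).1 (sval y).1; exact: h.
- by move=> A; have h := wco_one n0 we combS v idfun am (coprimen1 n) i00 A; exact: h.
- by move=> A x y e; have h := wco_unit (phi:=idfun) (n0:=n0) (we:=we) (vphi:=vphi) (am:=am) (coprimen1 n) i00 e; exact: h.
by exists al; split.
Qed.
End WeilNeron.

(** * The base change morphism on Lie algebras *)

Section DualLoc.
Variables (K : fieldType) (v : valuation K).
Local Notation O := (integers v).
Local Notation iK := (int_incl v).

Lemma tf_dual : torsion_free (dual_alg O : algebra O).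
Proof.
move=> [x y] e; have := congr1 fst e; have := congr1 snd e.
by rewrite /= mul0r addr0 => /opi_reg -> /opi_reg ->.
Qed.

Lemma dual_loc : is_localization (dual_change iK) (alg_in (dual_alg O) (opi v)).
Proof.
have u0 := unif_neq0 v.
have pE : dual_change iK (alg_in (dual_alg O) (opi v)) = (unif v, 0) :> dual K.
  by rewrite -[LHS]/(unif v, 1 * iK 0) rmorph0 mulr0.
have mE (x y x' y' : K) : ((x, y) : dual K) * (x', y') = (x * x', x * y' + y * x') by [].
split.
- by exists ((unif v)^-1, 0); rewrite pE [LHS]mE divff // mulr0 mul0r addr0.
- move=> [x y] e; exists 0%N; rewrite expr0 mul1r.
  have := congr1 fst e; have := congr1 snd e; rewrite /= mul1r => e2 e1.
  by congr (_, _); apply: int_val_inj; rewrite int_val0.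
have xN (x : K) : exists m : nat, forall m', (m <= m')%N -> exists y : O, unif v ^+ m' * x = int_val y.
  exists (absz (v x)) => m' h.
  have hx : vge v 0 (unif v ^+ m' * x); last by exists (mkint hx).
  rewrite /vge mulf_eq0; case: (eqVneq x 0) => [_|x0]; rewrite ?orbT //=.
  by rewrite vmapM ?expf_neq0 // vmapX // unifE natz; lia.
move=> [x y]; have [m1 h1] := xN x; have [m2 h2] := xN y.
have [x' ex] := h1 (maxn m1 m2) (leq_maxl _ _); have [y' ey] := h2 (maxn m1 m2) (leq_maxr _ _).
exists (maxn m1 m2), (x', y').
have -> : dual_change iK (alg_in (dual_alg O) (opi v)) ^+ maxn m1 m2 = (unif v ^+ maxn m1 m2, 0) :> dual K.
  rewrite pE; elim: (maxn m1 m2) => [|q IH]; first by rewrite !expr0.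
  by rewrite [LHS]exprS IH [LHS]mE exprS mulr0 mul0r addr0.
by rewrite [LHS]mE ex ey mul0r addr0 -[RHS]/(int_val x', 1 * int_val y') mul1r.
Qed.
End DualLoc.

Section Psi.
Variables (K : fieldType) (v : valuation K) (L : fieldExtType K) (w : valuation L).
Local Notation n := (\dim {:L}).
Hypotheses (n0 : (0 < n)%N) (we : forall c, c != 0 -> w c%:A = n%:Z * v c).
Hypothesis combS : forall x, exists c, x = @comb _ L w n c.
Variable i0 : 'I_n.
Hypothesis i00 : i0 = 0%N :> nat.
Variables (k : closedFieldType) (red : {rmorphism integers v -> k}) (E : val_ext red) (d : nat).
Local Notation vE := (ve_val E).
Local Notation OE := (integers vE).
Local Notation phi := (GRing.in_alg E : {rmorphism K -> E}).
Hypotheses (vphi : forall c, c != 0 -> vE (phi c) = d%:Z * v c) (nd : coprime n d).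
Variables (a : 'I_n -> 'I_n) (m : 'I_n -> int).
Hypothesis am : forall j, d%:Z * (a j)%:Z + n%:Z * m j = j%:Z.
Local Notation m1 := (fun _ : 'I_n => 0 : int).
Hypotheses (am1 : forall j : 'I_n, 1%:Z * j%:Z + n%:Z * m1 j = j%:Z)
  (vphi1 : forall c, c != 0 -> v (idfun c) = 1%:Z * v c).
Local Notation law := (lat_law n0 we combS vphi nd am i00).
Local Notation law1 := (lat_law n0 we combS (phi := idfun) vphi1 (coprimen1 n) am1 i00).
Variables (N : neron_lft v (res_Gm L)) (NE : neron_lft vE (gbase_change phi (res_Gm L))).
Variable h : bc_morphism N NE.
Variables (al1 : morphism (tor law1) N) (al : morphism (tor law) NE).
Hypotheses
  (al1E : forall (A : algebra K) t,
     wco (phi := idfun) combS v id m1 (sval (nm_generic N A (al1 (restr (int_incl v) A) t))).1 = tx t)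
  (alE : forall (A : algebra E) t,
     wco combS vE a m (sval (nm_generic NE A (al (restr (int_incl vE) A) t))).1 = tx t).

Local Notation u := (unif vE).

(** The passage from the lattice over [K] to the one over [E] is monomial: the vector [a j] of the
    first is [u ^ (- m j)] times the vector [j] of the second. *)
Lemma change_lattice (A : algebra E) (r : 'rV[A]_n) :
  r *m map_mx (alg_in A \o phi) (lat_mx w v idfun id m1) *m map_mx (alg_in A) (lat_inv combS vE phi a m) =
  \row_j (alg_in A (u ^ (- m j)) * r 0 (a j)).
Proof.
have e : map_mx phi (lat_mx w v idfun id m1) *m lat_inv combS vE phi a m =
    \matrix_(i, j) ((i == a j)%:R * u ^ (- m j)).
  apply/matrixP => i j; rewrite !mxE.
  transitivity (u ^ (- m j) * phi ((pow_mx w *m pow_inv combS) i (a j))).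
    rewrite mxE rmorph_sum mulr_sumr; apply: eq_bigr => l _.
    by rewrite !mxE expr0z mul1r rmorphM mulrCA.
  by rewrite (pow_mxK n0 we) mxE rmorph_nat mulrC.
rewrite -mulmxA (_ : map_mx (alg_in A \o phi) _ = map_mx (alg_in A) (map_mx phi (lat_mx w v idfun id m1)));
  last by apply/matrixP => i j; rewrite !mxE.
rewrite -map_mxM e; apply/rowP => j; rewrite !mxE (bigD1 (a j)) //= !mxE eqxx mul1r big1 ?addr0.
  by rewrite mulrC.
by move=> i /negPf ni; rewrite !mxE ni mul0r rmorph0 mulr0.
Qed.

(** Dual numbers over the integers of [E] are torsion free, so both sides are compared on the
    generic fibre, where [bc_generic] applies and the coordinates change by [change_lattice]. *)
Lemma psi_lie (z : 'rV[integers v]_n) (z' : 'rV[OE]_n) :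
  (forall j, int_val (z' 0 j) = u ^ (- m j) * phi (int_val (z 0 (a j)))) ->
  h (dual_alg OE) (pmap (dual_change (ve_inc E)) (lieG (law := law1) al1 z)) = lieG (law := law) al z'.
Proof.
move=> zz'.
pose co (A : algebra E) (x : gbase_change phi (res_Gm L) A) : 'rV[A]_n :=
  wco combS vE a m (sval (x : unit_pair (tensor L (restr phi A)))).1.
have coi A : injective (co A) by move=> x y; apply: (wco_inj n0 we am).
pose DE := dual_alg E.
pose l : alghom (dual_alg OE) (restr (int_incl vE) DE) := dual_change (int_incl vE).
apply: (@N_eq E vE n (gbase_change phi (res_Gm L)) co coi NE (dual_alg OE) DE l _ _
  (@tf_dual _ vE) (@dual_loc _ vE)).
rewrite /gco /co -(mor_map al) [RHS]alE.
rewrite -(mor_map (bc h)).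
(* The two algebra structures on the dual numbers over [E], through [K] and through the integers of
   [E], are identified by the identity map. *)
have ein r : (idfun : DE -> DE) (alg_in (restr (int_incl v) (restr phi DE)) r) =
    alg_in (restr (ve_inc E) (restr (int_incl vE) DE)) r.
  by rewrite /= /dual_in ve_incE.
pose e : alghom (restr (int_incl v) (restr phi DE)) (restr (ve_inc E) (restr (int_incl vE) DE)) :=
  @AlgHom _ (restr (int_incl v) (restr phi DE)) (restr (ve_inc E) (restr (int_incl vE) DE))
    (idfun : {rmorphism DE -> DE}) ein.
pose q : alghom (dual_alg (integers v)) (restr (int_incl v) (restr phi DE)) :=
  alg_comp (restr_hom (int_incl v) (dual_change phi)) (dual_change (int_incl v)).
pose y := lieG (law := law1) al1 z.
have -> : pmap (p := base_change (ve_inc E) N) l (pmap (dual_change (ve_inc E)) y) = pmap e (pmap q y).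
  transitivity (pmap (p := N) (alg_comp (restr_hom (ve_inc E) l) (dual_change (ve_inc E))) y).
    by apply/esym; apply: (@pmapc _ N).
  rewrite -(@pmapc _ N); apply: (@pmap_ext _ N) => x /=.
  by rewrite /dual_fun /= !mul1r !ve_incE.
rewrite bc_generic // /y /lieG -(mor_map al1).
have := al1E (pmap (p := tor law1) q (lie_pt law1 z)).
move: (sval (nm_generic N _ _)).1 => x xE.
have -> : x = (tx (pmap (p := tor law1) q (lie_pt law1 z)) : 'rV[DE]_n) *m
    map_mx (alg_in DE \o phi) (lat_mx w v idfun id m1) :> 'rV[DE]_n.
  rewrite -xE /wco /lat_co -mulmxA.
  by have -> := HAK n0 we combS v idfun am1 (restr phi DE); rewrite mulmx1.
rewrite [LHS]change_lattice; apply/rowP => j; rewrite !mxE.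
have [a0 m0] := a_m0 n0 nd am i00.
rewrite -[LHS]/(u ^ (- m j) * phi (int_incl v (a j == i0)%:R),
  u ^ (- m j) * (1 * phi (1 * int_val (z 0 (a j)))) + 0 * phi (int_incl v (a j == i0)%:R)).
rewrite -[RHS]/(int_incl vE (j == i0)%:R, 1 * int_val (z' 0 j)) !rmorph_nat zz' !mul1r mul0r addr0.
congr (_, _); rewrite -{1}a0 (inj_eq (a_inj n0 am)).
by case: eqVneq => [->|_]; rewrite ?mulr0 // m0 expr0z mulr1.
Qed.

Hypotheses
  (al1M : forall C t s, al1 C (tmul law1 t s) = gmul (al1 C t) (al1 C s))
  (al1I : forall C, injective (al1 C))
  (al1L : forall x : N (dual_alg (integers v)), in_lie x -> exists t, al1 _ t = x)
  (alM : forall C t s, al C (tmul law t s) = gmul (al C t) (al C s))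
  (alI : forall C, injective (al C))
  (alL : forall x : NE (dual_alg OE), in_lie x -> exists t, al _ t = x).
Local Notation lie1 := (lieG (law := law1) al1).
Local Notation lie := (lieG (law := law) al).
Local Notation f := (fun j : 'I_n => (d * a j) %/ n)%N.

(** In [d a_j = j - n m_j] the term [j] is the remainder modulo [n]. *)
Lemma floor_m j : - m j = (f j)%:Z.
Proof.
have e := am j; have mj : m j <= 0.
  rewrite -(ler_pM2l (x := n%:Z)) ?ltz_nat // mulr0.
  have : n%:Z * m j < n%:Z * 1.
    rewrite mulr1; apply: le_lt_trans (_ : j%:Z < n%:Z); last by rewrite ltz_nat.
    by rewrite -e lerDr.
  rewrite ltr_pM2l ?ltz_nat // => m_lt1.
  by rewrite mulr_ge0_le0 // -ltzD1.
have [q qE] : exists q : nat, m j = - q%:Z by exists (absz (m j)); lia.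
have e2 : (d * a j = j + q * n)%N.
  apply/eqP; rewrite -eqz_nat PoszM PoszD PoszM; apply/eqP.
  by rewrite -e qE; ring.
by rewrite qE opprK e2 addnC divnMDl // divn_small ?addn0.
Qed.

(** The generator at [j] of the diagonal submodule is the image of the basis vector [a j] of the Lie
    algebra over [K]. *)
Lemma im_psi_diag z' : im_psi h (lie z') <-> in_diag (v := vE) f z'.
Proof.
have inj := lieG_inj alI; split.
  suff key : forall x, im_psi h x -> exists2 z', x = lie z' & in_diag (v := vE) f z'.
    by case/key => z2 /inj <-.
  move=> x; elim=> {x} [t /(lieG_ex al1M al1I al1L)[z ->]||x y _ [z1 -> h1] _ [z2 -> h2]|b x _ [z1 -> h1]].
  - have hf j : vge vE (f j)%:Z (u ^ (- m j) * phi (int_val (z 0 (a j)))).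
      suff : vge vE (0 + (f j)%:Z) (u ^ (- m j) * phi (int_val (z 0 (a j)))) by rewrite add0r.
      rewrite floor_m vge_scale; have := int_valP (z 0 (a j)); rewrite /vge.
      case: eqVneq => [->|c0] /=; first by rewrite scale0r eqxx.
      by move=> hc; rewrite vphi // mulr_ge0 ?orbT.
    have hz j : vge vE 0 (u ^ (- m j) * phi (int_val (z 0 (a j)))) by apply: vge_le (hf j).
    exists (\row_j mkint (hz j)); first by apply: psi_lie => j; rewrite mxE.
    by move=> j; rewrite mxE; apply: hf.
  - by exists 0; [rewrite (lieG0 alM)|move=> j; rewrite mxE int_val0 vge0].
  - by exists (z1 + z2); [rewrite (lieGD alM)|apply: in_diagD].
  - by exists (b *: z1); [rewrite lieGZ|apply: in_diagZ].
move=> hz; have /choice[c cE] : forall j, exists c : OE, z' 0 j = opi vE ^+ f j * c.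
  by move=> j; have /opi_multP := hz j.
have -> : z' = \sum_j c j *: (opi vE ^+ f j *: delta_mx 0 j).
  rewrite [LHS]row_sum_delta; apply: eq_bigr => j _.
  by rewrite scalerA mulrC -cE.
apply: (big_ind (fun z => im_psi h (lie z))) => [|x y hx hy|j _].
- by rewrite (lieG0 alM); apply: ImZero.
- by rewrite -(lieGD alM); apply: ImAdd.
rewrite -lieGZ; apply: ImScale.
rewrite -(@psi_lie (delta_mx 0 (a j))).
  by apply: ImGen; apply: (lieG_in al1M).
move=> l; rewrite !mxE !eqxx !andTb (inj_eq (a_inj n0 am)) int_valM int_valX opi_val floor_m.
case: eqVneq => [->|_]; first by rewrite int_val1 -[RHS]/(_ * phi 1) rmorph1.
by rewrite int_val0 -[RHS]/(_ * phi 0) rmorph0 !mulr0.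
Qed.

Lemma coker_floor (g : 'I_n -> nat) : coker_exponents h g -> forall i, g i = ((d * i) %/ n)%N.
Proof.
move=> [gs [e [el eg er]]].
have /choice[y yE] : forall i, exists y, e i = lie y by move=> i; apply: (lieG_ex alM alI alL).
have combE (c : 'I_n -> OE) : lie_comb c e = lie (\sum_i c i *: y i).
  rewrite -(lieG_comb alM); congr lie_comb; exact/funext.
apply: (divisors_floor (red := ve_red E) (y := y) (ve_redP E) (a_inj n0 am)) => // [x|c].
  have [c hc] := eg _ (lieG_in alM x); exists c.
  by apply/im_psi_diag; rewrite -(lieGD alM) -(lieGN alM) -combE.
by rewrite -im_psi_diag -combE.
Qed.
End Psi.

(** * Hilbert's basis theorem *)

Definition noetherian (A : comNzRingType) := forall I : ideal A, exists s : seq A,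
  (forall x, x \in s -> I x) /\ forall x, I x -> idgen (fun y => y \in s) x.

Lemma idgen_mono (A : comPzRingType) (S T : A -> Prop) x :
  (forall y, S y -> T y) -> idgen S x -> idgen T x.
Proof. by move=> h; apply: idgen_min => y /h; apply: idgen_mem. Qed.

Lemma noetherian_field (F : fieldType) : noetherian F.
Proof.
move=> I; have [[x [Ix x0]]|h] := pselect (exists x, I x /\ x != 0).
  exists [:: x]; split=> [y|y _]; first by rewrite inE => /eqP ->.
  by rewrite -[y](mulfVK x0); apply: idMl; apply: idgen_mem; rewrite inE.
exists [::]; split=> // x Ix; suff -> : x = 0 by apply: id0.
by apply/eqP; apply: contrapT => /negP x0; apply: h; exists x.
Qed.

Section HilbertBasis.
Variables (A : comNzRingType) (An : noetherian A) (I : ideal {poly A}).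

Definition lead_ideal (d : nat) (G : ideal {poly A}) : ideal A.
Proof.
exists (fun a => exists q, [/\ G q, (size q <= d.+1)%N & q`_d = a]).
- by exists 0; rewrite size_poly0 coef0; split=> //; apply: id0.
- move=> _ _ [q [Gq sq <-]] [r [Gr sr <-]]; exists (q + r); rewrite coefD; split=> //.
    exact: idD.
  by rewrite (leq_trans (size_polyD _ _)) // geq_max sq.
- move=> a _ [q [Gq sq <-]]; exists (a%:P * q); rewrite coefCM; split=> //.
    exact: idMl.
  by rewrite mul_polyC (leq_trans (size_scale_leq _ _)).
Defined.

Lemma lead_gens d : exists s : seq {poly A}, (forall q, q \in s -> I q) /\
  forall a, lead_ideal d I a -> lead_ideal d (idgen (fun q => q \in s)) a.
Proof.
have [s [sI sg]] := An (lead_ideal d I).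
suff [t [tI tg]] : exists t : seq {poly A}, (forall q, q \in t -> I q) /\
    forall a, a \in s -> lead_ideal d (idgen (fun q => q \in t)) a.
  by exists t; split=> // a /sg; apply: idgen_min.
elim: s {sg} sI => [|a s IH] sI; first by exists [::].
have [|t [tI tg]] := IH; first by move=> x xs; apply: sI; rewrite inE xs orbT.
have [q [Iq sq qd]] := sI a (mem_head _ _).
exists (q :: t); split=> [r|b]; rewrite inE => /predU1P[->|] //.
- exact: tI.
- by exists q; split=> //; apply: idgen_mem; rewrite mem_head.
move=> /tg[r [Gr sr rd]]; exists r; split=> //.
by apply: idgen_mono Gr => y; rewrite inE => ->; rewrite orbT.
Qed.

Lemma lead_shift d e (q : {poly A}) : (size q <= d.+1)%N -> (d <= e)%N ->
  (size (q * 'X^(e - d))%R <= e.+1)%N /\ (q * 'X^(e - d))`_e = q`_d.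
Proof.
move=> sq de; split; last by rewrite coefMXn ltnNge leq_subr /= subKn.
apply: leq_trans (size_polyMleq _ _) _; rewrite size_polyXn addnS /=.
by apply: leq_trans (leq_add sq (leqnn _)) _; rewrite addSn subnKC.
Qed.

Lemma lead_mono d e a : (d <= e)%N -> lead_ideal d I a -> lead_ideal e I a.
Proof.
move=> de [q [Iq sq <-]]; have [s1 c1] := lead_shift sq de.
by exists (q * 'X^(e - d)); split=> //; apply: idMr.
Qed.

(** The ideal of all leading coefficients is finitely generated, so the leading ideals are
    stationary from some degree [N]. Generators for the degrees up to [N] suffice: subtracting a
    combination with the same top coefficient lowers the degree. *)
Lemma hilbert_basis_step : exists s : seq {poly A},
  (forall x, x \in s -> I x) /\ forall x, I x -> idgen (fun y => y \in s) x.
Proof.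
have UD a b : (exists d, lead_ideal d I a) -> (exists d, lead_ideal d I b) ->
    exists d, lead_ideal d I (a + b).
  move=> [d ha] [e hb]; exists (maxn d e); apply: idD.
    by apply: lead_mono ha; rewrite leq_maxl.
  by apply: lead_mono hb; rewrite leq_maxr.
have UM a b : (exists d, lead_ideal d I b) -> exists d, lead_ideal d I (a * b).
  by move=> [d hb]; exists d; apply: idMl.
have U0 : exists d, lead_ideal d I 0 by exists 0%N; apply: id0.
have [s [sU sg]] := An (@Ideal A (fun a => exists d, lead_ideal d I a) U0 UD UM).
have [N NE] : exists N, forall a, a \in s -> lead_ideal N I a.
  elim: s {sg} sU => [|a s IH] sU; first by exists 0%N.
  have [|N NE] := IH; first by move=> x xs; apply: sU; rewrite inE xs orbT.
  have [d da] := sU a (mem_head _ _); exists (maxn d N) => b; rewrite inE => /predU1P[->|bs].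
    by apply: lead_mono da; rewrite leq_maxl.
  by apply: lead_mono (NE b bs); rewrite leq_maxr.
have stab d a : lead_ideal d I a -> lead_ideal N I a.
  move=> ha; have : idgen (fun y => y \in s) a by apply: sg; exists d.
  exact: idgen_min.
have [G [GI Gg]] : exists G : seq {poly A}, (forall q, q \in G -> I q) /\
    forall d, (d <= N)%N -> forall a, lead_ideal d I a -> lead_ideal d (idgen (fun q => q \in G)) a.
  elim: (N) => [|M [G [GI Gg]]].
    have [G [GI Gg]] := lead_gens 0; exists G; split=> // d.
    by rewrite leqn0 => /eqP ->.
  have [G' [GI' Gg']] := lead_gens M.+1; exists (G ++ G'); split=> [q|d].
    by rewrite mem_cat => /orP[]; [apply: GI|apply: GI'].
  rewrite leq_eqVlt ltnS => /predU1P[->|dM] a.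
    move=> /Gg'[q [Gq sq qd]]; exists q; split=> //.
    by apply: idgen_mono Gq => y; rewrite mem_cat => ->; rewrite orbT.
  move=> /(Gg d dM)[q [Gq sq qd]]; exists q; split=> //.
  by apply: idgen_mono Gq => y; rewrite mem_cat => ->.
exists G; split=> // q.
have GIall h : idgen (fun y => y \in G) h -> I h by apply: idgen_min.
suff key d : forall q, I q -> (size q <= d)%N -> idgen (fun y => y \in G) q by move=> Iq; apply: key.
elim: d => [|d IH] r Ir; first by rewrite leqn0 size_poly_eq0 => /eqP ->; apply: id0.
move=> sr; suff [h [Gh sh hd]] : lead_ideal d (idgen (fun y => y \in G)) r`_d.
  rewrite -[r](subrK h); apply: idD => //; apply: IH; first exact/idB/GIall.
  have s1 : (size (r - h)%R <= d.+1)%N.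
    by rewrite (leq_trans (size_polyD _ _)) // size_polyN geq_max sr.
  apply/leq_sizeP => j; rewrite leq_eqVlt => /predU1P[<-|dj]; first by rewrite coefB hd subrr.
  by move/leq_sizeP: s1 => /(_ j dj).
case: (leqP d N) => [dN|/ltnW Nd]; first by apply: Gg => //; exists r.
have [|h [Gh sh hN]] := Gg N (leqnn _) r`_d; first by apply: (stab d); exists r.
have [s1 c1] := lead_shift sh Nd.
by exists (h * 'X^(d - N)); split=> //; [apply: idMr|rewrite c1].
Qed.
End HilbertBasis.

Lemma noetherian_mp (k : fieldType) n : noetherian (mp k n).
Proof.
elim: n => [|n IH]; first exact: noetherian_field.
by move=> I; apply: hilbert_basis_step.
Qed.

(** Propositional membership: expressions are not compared by a boolean test. *)
Fixpoint pmem (T : Type) (x : T) (l : seq T) : Prop :=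
  if l is y :: l' then y = x \/ pmem x l' else False.

Lemma pmem_cat T (x : T) l l' : pmem x (l ++ l') <-> pmem x l \/ pmem x l'.
Proof. by elim: l => /= [|y l ->]; tauto. Qed.
Lemma pmem_map T T' (f : T -> T') y l : pmem y (map f l) <-> exists2 x, pmem x l & f x = y.
Proof.
elim: l => [|z l IH] /=; first by split=> [//|[]].
rewrite IH; split=> [[<-|[x xl <-]]|[x [<-|xl] e]]; [by exists z; [left|]|by exists x; [right|]|by left|].
by right; exists x.
Qed.
Lemma pmem_all T (f : pred T) l : all f l <-> forall x, pmem x l -> f x.
Proof.
elim: l => [|z l IH] /=; first by split.
split=> [/andP[fz /IH h] x [<-//|]|h]; first exact: h.
by apply/andP; split; [apply: h; left|apply/IH => x xl; apply: h; right].
Qed.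

(** The ideal of the relations in the polynomial ring is generated by finitely many elements, which
    involve finitely many relations. *)
Lemma finite_subsystem (k : fieldType) n (rels : pexpr k n -> Prop) : exists l : seq (pexpr k n),
  (forall e, pmem e l -> rels e) /\
  forall (B : algebra k) (b : 'I_n -> B), (forall e, pmem e l -> peval b e = 0) ->
    forall e, rels e -> peval b e = 0.
Proof.
pose X := mpX k : 'I_n -> mp_alg k n.
pose gen l := idgen (fun q : mp k n => exists2 e, pmem e l & q = peval X e).
pose U (q : mp k n) := exists l, (forall e, pmem e l -> rels e) /\ gen l q.
have gen_sub l l' q : (forall e, pmem e l -> pmem e l') -> gen l q -> gen l' q.
  by move=> h; apply: idgen_mono => y [e el ->]; exists e => //; apply: h.
have U0 : U 0 by exists [::]; split=> //; apply: id0.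
have UD x y : U x -> U y -> U (x + y).
  move=> [l [lr lx]] [l' [lr' ly]]; exists (l ++ l'); split=> [e /pmem_cat[/lr|/lr']//|].
  by apply: idD; [apply: gen_sub lx|apply: gen_sub ly] => e ?; apply/pmem_cat; [left|right].
have UM a x : U x -> U (a * x) by move=> [l [lr lx]]; exists l; split=> //; apply: idMl.
have [s [sU sg]] := @noetherian_mp k n (@Ideal _ U U0 UD UM).
have [l [lr lg]] : exists l, (forall e, pmem e l -> rels e) /\ forall q, q \in s -> gen l q.
  elim: s {sg} sU => [|q s IH] sU; first by exists [::].
  have [|l [lr lg]] := IH; first by move=> x xs; apply: sU; rewrite inE xs orbT.
  have [l' [lr' lg']] := sU q (mem_head _ _).
  exists (l ++ l'); split=> [e /pmem_cat[/lr|/lr']//|r]; rewrite inE => /predU1P[->|/lg].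
    by apply: gen_sub lg' => e ?; apply/pmem_cat; right.
  by apply: gen_sub => e ?; apply/pmem_cat; left.
exists l; split=> // B b bl e re; have [f fE] := mp_eval b.
have fX e' : f (peval X e') = peval b e' by rewrite hom_peval; apply: peval_ext => i /=.
rewrite -fX; suff : idgen (fun y => y \in s) (peval X e).
  apply: (@idgen_min _ _ (preim_ideal f (zero_ideal _))) => q /lg.
  by apply: (@idgen_min _ _ (preim_ideal f (zero_ideal _))) => _ [e' el ->] /=; rewrite fX bl.
apply: sg; exists [:: e]; split=> [e' /= [<-|]//|].
by apply: idgen_mem; exists e => //; left.
Qed.

(** * Finite fields inside [k] *)

Section AlgebraicFinite.
Variables (k : closedFieldType) (p : nat).
Hypothesis p_char : p \in [pchar k].

Let p0 : prime p := pcharf_prime p_char.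

Lemma frobXD N (x y : k) : (x + y) ^+ (p ^ N) = x ^+ (p ^ N) + y ^+ (p ^ N).
Proof.
elim: N x y => [|N IH] x y; first by rewrite expn0 !expr1.
rewrite expnSr !exprM IH -!(pFrobenius_autE p_char); exact: rmorphD.
Qed.
Lemma frobXN N (x : k) : (- x) ^+ (p ^ N) = - x ^+ (p ^ N).
Proof.
by apply/eqP; rewrite -subr_eq0 opprK -frobXD addNr expr0n expn_eq0 (gtn_eqF (prime_gt0 p0)).
Qed.
Lemma fixed_mul N M (x : k) : x ^+ (p ^ N) = x -> x ^+ (p ^ (N * M)) = x.
Proof.
move=> h; elim: M => [|M IH]; first by rewrite muln0 expn0 expr1.
by rewrite mulnS expnD exprM h.
Qed.

(** The algebraic closure of the prime field in [k], as the union of the fixed fields of the powers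
    of Frobenius. *)
Definition fbar : {pred k} := fun x => `[< exists2 N, (0 < N)%N & x ^+ (p ^ N) = x >].

Lemma fbarP2 x y : x \in fbar -> y \in fbar ->
  exists2 N, (0 < N)%N & x ^+ (p ^ N) = x /\ y ^+ (p ^ N) = y.
Proof.
move=> /asboolP[N N0 hN] /asboolP[M M0 hM]; exists (N * M)%N; first by rewrite muln_gt0 N0.
by split; [apply: fixed_mul|rewrite mulnC; apply: fixed_mul].
Qed.

Fact fbar_divring : divring_closed fbar.
Proof.
split=> [|x y hx hy|x y hx hy].
- by apply/asboolP; exists 1%N; rewrite // expr1n.
- have [N N0 [ex ey]] := fbarP2 hx hy; apply/asboolP; exists N => //.
  by rewrite frobXD frobXN ex ey.
- have [N N0 [ex ey]] := fbarP2 hx hy; apply/asboolP; exists N => //.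
  by rewrite exprMn exprVn ex ey.
Qed.
HB.instance Definition _ := GRing.isDivringClosed.Build k fbar fbar_divring.

Record fbar_type := FBar { fbar_val : k; _ : fbar_val \in fbar }.
HB.instance Definition _ := [isSub for fbar_val].
HB.instance Definition _ := [Choice of fbar_type by <:].
HB.instance Definition _ := [SubChoice_isSubIntegralDomain of fbar_type by <:].
HB.instance Definition _ := [SubIntegralDomain_isSubField of fbar_type by <:].

(** A nonzero [x] satisfies [x ^ m = 1]; injectivity of Frobenius allows [m] to be taken prime to
    [p], and Euler's theorem gives a power of [p] congruent to 1 modulo [m]. *)
Lemma periodic_fbar (x : k) i j : (i < j)%N -> x ^+ i = x ^+ j -> x \in fbar.
Proof.
move=> ij e; apply/asboolP; case: (eqVneq x 0) => [->|x0].
  by exists 1%N; rewrite // expr0n expn_eq0 (gtn_eqF (prime_gt0 p0)).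
have e1 : x ^+ (j - i) = 1.
  by apply: (mulfI (expf_neq0 i x0)); rewrite -exprD subnKC ?(ltnW ij) // mulr1.
have m0 : (0 < j - i)%N by rewrite subn_gt0.
move: (j - i)%N m0 e1 => m m0 e1.
have [m' [m'0 cop e']] : exists m', [/\ (0 < m')%N, coprime p m' & x ^+ m' = 1].
  elim/ltn_ind: m m0 e1 => m IH m0 e1.
  case: (boolP (p %| m)%N) => [/dvdnP[q mq]|h]; last by exists m; rewrite prime_coprime.
  have q0 : (0 < q)%N by move: m0; rewrite mq muln_gt0 => /andP[].
  apply: (IH q) => //; first by rewrite mq ltn_Pmulr // prime_gt1.
  have h : (x ^+ q - 1) ^+ (p ^ 1) = 0.
    by rewrite frobXD frobXN expr1n expn1 -exprM -mq e1 subrr.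
  by move/eqP: h; rewrite expf_eq0 subr_eq0 => /andP[_ /eqP].
exists (totient m'); first by rewrite totient_gt0.
have := Euler_exp_totient cop; move: (p ^ totient m')%N (expn_gt0 p (totient m')) => q q0 /eqP.
rewrite (prime_gt0 p0) /= in q0; rewrite eqn_mod_dvd // => /dvdnP[t te].
by rewrite -(subnK q0) exprD te mulnC exprM e' expr1n mul1r expr1.
Qed.

(** The derivative of [X ^ q - X] is -1, so its roots are simple. *)
Lemma fixed_roots N : (0 < N)%N -> exists s : seq k,
  [/\ uniq s, size s = (p ^ N)%N & forall x, (x \in s) = (x ^+ (p ^ N) == x)].
Proof.
move=> N0; set q := (p ^ N)%N.
have q1 : (1 < q)%N by rewrite -(exp1n N) ltn_exp2r // prime_gt1.
have sz : size ('X^q - 'X : {poly k}) = q.+1.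
  by rewrite size_polyDl size_polyXn // size_polyN size_polyX.
have lc : lead_coef ('X^q - 'X : {poly k}) = 1.
  by rewrite lead_coefDl ?lead_coefXn // size_polyXn size_polyN size_polyX.
have [s sE] := closed_field_poly_normal ('X^q - 'X : {poly k}).
rewrite lc scale1r in sE.
have ms x : (x \in s) = (x ^+ q == x).
  by rewrite -root_prod_XsubC -sE rootE !hornerE subr_eq0.
exists s; split=> //; last first.
  by have := congr1 (fun r : {poly k} => size r) sE; rewrite sz size_prod_XsubC => -[].
rewrite -separable_prod_XsubC -sE unlock /separable_poly.
have -> : ('X^q - 'X : {poly k})^`() = (-1) *: 1.
  rewrite derivB derivXn derivX scaleN1r -[_ *+ q]mulr_natr.
  have -> : q%:R = 0 :> {poly k}.
    by rewrite /q natrX -[p%:R]polyC_natr (pcharf0 p_char) polyC0 expr0n (gtn_eqF N0).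
  by rewrite mulr0 sub0r.
by rewrite coprimepZr ?oppr_eq0 ?oner_eq0 // coprimep1.
Qed.

(** A root [x] in [k] of a monic equation over a finite field has all its powers among the finitely
    many combinations of [1, ..., x ^ (n - 1)] over that field. Two powers coincide, and
    [periodic_fbar] applies. *)
Lemma fbar_closed : GRing.closed_field_axiom fbar_type.
Proof.
move=> n P n0; have [x xE] := @solve_monicpoly k n (fun i => fbar_val (P i)) n0.
suff xf : x \in fbar.
  exists (FBar xf); apply: val_inj; rewrite rmorphXn rmorph_sum /= xE.
  apply: eq_bigr => i _; transitivity (val (P i) * val (FBar xf) ^+ i) => //.
  by rewrite -rmorphXn -rmorphM.
have [N N0 PN] : exists2 N, (0 < N)%N & forall i : 'I_n, fbar_val (P i) ^+ (p ^ N) = fbar_val (P i).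
  have : forall m, exists2 N, (0 < N)%N & forall i, (i < m)%N -> fbar_val (P i) ^+ (p ^ N) = fbar_val (P i).
    elim=> [|m [N N0 IH]]; first by exists 1%N.
    have /asboolP[M M0 hM] : fbar_val (P m) \in fbar by case: (P m).
    exists (N * M)%N => [|i]; first by rewrite muln_gt0 N0.
    rewrite ltnS leq_eqVlt => /predU1P[->|/IH]; last exact: fixed_mul.
    by rewrite mulnC; apply: fixed_mul.
  by case/(_ n) => N N0 h; exists N => // i; apply: h.
have [s [us ss ms]] := fixed_roots N0.
pose fix_ c := forall i, (i < n)%N -> c i ^+ (p ^ N) = c i :> k.
have powE j : exists c, fix_ c /\ x ^+ j = \sum_(i < n) c i * x ^+ i.
  elim: j => [|j [c [cf IH]]].
    exists (fun i => (i == 0%N)%:R); split.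
      by move=> i _; case: (i == 0%N); rewrite ?expr1n // expr0n expn_eq0 (gtn_eqF (prime_gt0 p0)).
    rewrite (bigD1 (Ordinal n0)) //= mul1r expr0 big1 ?addr0 // => i ni.
    by rewrite -[nat_of_ord i == 0%N]/(i == Ordinal n0) (negPf ni) mul0r.
  case: n n0 P xE PN @fix_ cf IH => // m n0 P xE PN fix_ cf IH.
  exists (fun i => (if i is i'.+1 then c i' else 0) + c m * fbar_val (P i)); split.
    move=> i im; rewrite frobXD exprMn (cf m) // (PN (Ordinal im)) //=; congr (_ + _).
    by case: i im => [|i] im; rewrite ?cf ?(ltnW im) // expr0n expn_eq0 (gtn_eqF (prime_gt0 p0)).
  rewrite exprS IH mulr_sumr big_ord_recr /= mulrCA -exprS xE.
  under [RHS]eq_bigr do rewrite mulrDl; rewrite big_split /= [X in _ = X + _]big_ord_recl mul0r add0r.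
  rewrite mulr_sumr; congr (_ + _); apply: eq_bigr => i _; last by rewrite mulrA.
  by rewrite mulrCA -exprS.
have /choice[c cE] := powE.
pose T := {ffun 'I_n -> seq_sub s}.
have cs j (i : 'I_n) : c j i \in s by have [cf _] := cE j; rewrite ms cf.
pose F (j : 'I_#|T|.+1) : T := [ffun i => SeqSub (cs j i)].
have [j1 [j2 [j12 Fj]]] : exists j1 j2, j1 != j2 /\ F j1 = F j2.
  apply: contrapT => h; suff /leq_card : injective F by rewrite card_ord ltnn.
  move=> j1 j2 e; apply/eqP; apply: contrapT => /negP ne; apply: h; by exists j1, j2.
have e : x ^+ j1 = x ^+ j2.
  rewrite (cE j1).2 (cE j2).2; apply: eq_bigr => i _; congr (_ * _).
  by have /ffunP/(_ i) := Fj; rewrite !ffunE => -[].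
case: (ltngtP j1 j2) => [lt|gt|/val_inj/eqP]; last by rewrite (negPf j12).
- exact: periodic_fbar lt e.
- exact: periodic_fbar gt (esym e).
Qed.
HB.instance Definition _ := Field_isAlgClosed.Build fbar_type fbar_closed.

(** The algebra generated by [s] over [fbar] has a point with values in [fbar] by the
    Nullstellensatz; it respects all operations that stay within [s]. Multiplying the exponent by
    [m + 1] makes the finite field as large as desired. *)
Lemma finite_approx (s : seq k) (m : nat) : exists (phi : k -> k) (e : nat),
  [/\ (m <= e)%N, (0 < e)%N, forall x, phi x ^+ (p ^ e) = phi x,
     1 \in s -> phi 1 = 1 &
     forall x y, x \in s -> y \in s ->
       (x + y \in s -> phi (x + y) = phi x + phi y) /\
       (x * y \in s -> phi (x * y) = phi x * phi y)].
Proof.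
pose n := size s; pose B : algebra fbar_type := @Algebra fbar_type k (\val : {rmorphism fbar_type -> k}).
have [g gE] := @mp_eval fbar_type n B (fun i => s`_i).
pose I := preim_ideal g (zero_ideal B).
have [|h hI] := @nullstellensatz fbar_type n I.
  by rewrite /I /= rmorph1; apply/eqP/oner_neq0.
have idx x : x \in s -> (index x s < n)%N by rewrite index_mem.
pose X x (xs : x \in s) : mp fbar_type n := mpX fbar_type (Ordinal (idx x xs)).
have gX x (xs : x \in s) : g (X x xs) = x by rewrite gE /= nth_index.
pose phi x := if @idP (x \in s) is ReflectT xs then fbar_val (h (X x xs)) else 0.
have phiE x (xs : x \in s) : phi x = fbar_val (h (X x xs)).
  rewrite /phi; case: {-}_ / idP => [xs'|]; last by rewrite xs.
  by rewrite (bool_irrelevance xs' xs).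
have hfix x : exists2 N, (0 < N)%N & phi x ^+ (p ^ N) = phi x.
  rewrite /phi; case: {-}_ / idP => [xs|_]; last first.
    by exists 1%N; rewrite // expr0n expn_eq0 (gtn_eqF (prime_gt0 p0)).
  by apply/asboolP; case: (h (X x xs)).
have [N N0 NE] : exists2 N, (0 < N)%N & forall x, phi x ^+ (p ^ N) = phi x.
  have [N N0 NE] : exists2 N, (0 < N)%N & forall x, x \in s -> phi x ^+ (p ^ N) = phi x.
    have : forall t : seq k, exists2 N, (0 < N)%N & forall x, x \in t -> phi x ^+ (p ^ N) = phi x.
      elim=> [|x t [N N0 IH]]; first by exists 1%N.
      have [M M0 hM] := hfix x; exists (N * M)%N => [|y]; first by rewrite muln_gt0 N0.
      rewrite inE => /predU1P[->|/IH]; last exact: fixed_mul.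
      by rewrite mulnC; apply: fixed_mul.
    exact.
  exists N => // x; case: (boolP (x \in s)) => [/NE//|xs].
  rewrite /phi; case: {-}_ / idP => [xs'|_]; first by rewrite xs' in xs.
  by rewrite expr0n expn_eq0 (gtn_eqF (prime_gt0 p0)).
have hz q : g q = 0 -> h q = 0 by move=> e; apply: hI.
exists phi, (N * m.+1)%N; split.
- by rewrite (leq_trans (leqnSn m)) // leq_pmull.
- by rewrite muln_gt0 N0.
- by move=> x; apply: fixed_mul.
- move=> s1; rewrite (phiE 1 s1); have : h (X 1 s1 - 1) = 0.
    by apply: hz; rewrite rmorphB rmorph1 gX subrr.
  by rewrite rmorphB rmorph1 => /eqP; rewrite subr_eq0 => /eqP ->.
move=> x y xs ys; split=> xys; rewrite (phiE _ xs) (phiE _ ys) (phiE _ xys).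
  have : h (X _ xys - (X _ xs + X _ ys)) = 0.
    by apply: hz; rewrite rmorphB rmorphD !gX subrr.
  by rewrite rmorphB rmorphD => /eqP; rewrite subr_eq0 => /eqP ->.
have : h (X _ xys - X _ xs * X _ ys) = 0.
  by apply: hz; rewrite rmorphB rmorphM !gX subrr.
by rewrite rmorphB rmorphM => /eqP; rewrite subr_eq0 => /eqP ->.
Qed.
End AlgebraicFinite.

(** * A pseudo-finite field containing [k] *)

Section PseudoFinite.
Variables (k : closedFieldType) (p : nat).
Hypothesis p_char : p \in [pchar k].
Let p0 : prime p := pcharf_prime p_char.

Local Notation I := (seq k * nat)%type.
(** An index is a finite part of [k], on which [phi] is to respect the operations, with a lower
    bound for the exponent of the finite field. *)
Definition above (S0 S : I) := (forall x, x \in S0.1 -> x \in S.1) /\ (S0.2 <= S.2)%N.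
Lemma above_join S1 S2 : exists S0, forall S, above S0 S -> above S1 S /\ above S2 S.
Proof.
exists (S1.1 ++ S2.1, maxn S1.2 S2.2) => S [h1]; rewrite geq_max => /andP[h2 h3].
by split; split=> // x hx; apply: h1; rewrite mem_cat hx ?orbT.
Qed.
Lemma above_refl S : above S S. Proof. by []. Qed.

Definition approx S := cid (finite_approx p_char S.1 S.2).
Definition phi (S : I) : k -> k := sval (approx S).
Definition fexp (S : I) : nat := sval (cid (svalP (approx S))).
Lemma phiP S : [/\ (S.2 <= fexp S)%N, (0 < fexp S)%N,
     forall x, phi S x ^+ (p ^ fexp S) = phi S x,
     1 \in S.1 -> phi S 1 = 1 &
     forall x y, x \in S.1 -> y \in S.1 ->
       (x + y \in S.1 -> phi S (x + y) = phi S x + phi S y) /\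
       (x * y \in S.1 -> phi S (x * y) = phi S x * phi S y)].
Proof. exact: (svalP (cid (svalP (approx S)))). Qed.

(** Membership in the product of the finite fields, that of index [S] having [p ^ fexp S]
    elements. *)
Definition fixed (f : I -> k) : Prop := forall S, f S ^+ (p ^ fexp S) = f S.
Definition fixb : {pred I -> k} := fun f => `[< fixed f >].

Lemma frob0 N : (0 : k) ^+ (p ^ N) = 0.
Proof. by rewrite expr0n expn_eq0 (gtn_eqF (prime_gt0 p0)). Qed.

Fact fixb_subring : subring_closed fixb.
Proof.
split=> [|f g /asboolP hf /asboolP hg|f g /asboolP hf /asboolP hg]; apply/asboolP => S.
- by rewrite expr1n.
- by rewrite [(f - g) S]/(f S - g S) (frobXD p_char) (frobXN p_char) hf hg.
- by rewrite [(f * g) S]/(f S * g S) exprMn hf hg.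
Qed.
HB.instance Definition _ := GRing.isSubringClosed.Build (I -> k) fixb fixb_subring.
Record fix_type := FixT { fix_val : I -> k; _ : fix_val \in fixb }.
HB.instance Definition _ := [isSub for fix_val].
HB.instance Definition _ := [Choice of fix_type by <:].
HB.instance Definition _ :=
  GRing.SubChoice_isSubComPzRing.Build (I -> k) fixb fix_type fixb_subring.

Definition mkfix (f : I -> k) (h : fixed f) : fix_type := FixT (introT (asboolP _) h : f \in fixb).
Lemma fix_valP (f : fix_type) : fixed (fix_val f).
Proof. by apply/asboolP; case: f. Qed.
Lemma fix_ext (f g : fix_type) : (forall S, fix_val f S = fix_val g S) -> f = g.
Proof. by move=> h; apply: val_inj; apply/funext. Qed.
Lemma fix_valD (f g : fix_type) S : fix_val (f + g) S = fix_val f S + fix_val g S.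
Proof. by []. Qed.
Lemma fix_valB (f g : fix_type) S : fix_val (f - g) S = fix_val f S - fix_val g S.
Proof. by []. Qed.
Lemma fix_valM (f g : fix_type) S : fix_val (f * g) S = fix_val f S * fix_val g S.
Proof. by []. Qed.

Definition eventually_zero : ideal fix_type.
Proof.
exists (fun f => exists S0, forall S, above S0 S -> fix_val f S = 0).
- by exists ([::], 0%N).
- move=> f g [S1 h1] [S2 h2]; have [S0 h0] := above_join S1 S2.
  by exists S0 => S /h0[/h1 e1 /h2 e2]; rewrite fix_valD e1 e2 addr0.
- by move=> f g [S1 h1]; exists S1 => S /h1 e; rewrite fix_valM e mulr0.
Defined.

Lemma pseudo_finite_field : exists (F : fieldType) (g : {rmorphism fix_type -> F}),
  (forall y, exists x, g x = y) /\ (forall x, eventually_zero x -> g x = 0).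
Proof.
apply: ideal_field => -[S0 /(_ S0 (above_refl S0))] /eqP.
by rewrite [fix_val 1 S0]/(1 : k) oner_eq0.
Qed.

Variables (F : fieldType) (g : {rmorphism fix_type -> F}).
Hypotheses (gs : forall y, exists x, g x = y) (g0 : forall x, eventually_zero x -> g x = 0).

(* the sets of the ultrafilter associated with [F] *)
Definition large (J : I -> Prop) := exists2 f, g f = 0 & forall S, fix_val f S = 0 -> J S.

Lemma fixed_inv f : fixed f -> fixed (fun S => (f S)^-1).
Proof. by move=> h S; rewrite exprVn h. Qed.
Definition finv (f : fix_type) := mkfix (fixed_inv (fix_valP f)).

(** A product of fields is von Neumann regular: an element whose zero set contains that of [h] is a
    multiple of [h]. So the kernel of [g] is determined by zero sets. *)
Lemma g_zero (f : fix_type) : g f = 0 <-> large (fun S => fix_val f S = 0).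
Proof.
split=> [e|[h gh hf]]; first by exists f.
have -> : f = f * finv h * h; last by rewrite rmorphM gh mulr0.
apply: fix_ext => S; rewrite !fix_valM /=; case: (eqVneq (fix_val h S) 0) => [e|ne].
  by rewrite e mulr0 hf.
by rewrite mulfVK.
Qed.

Lemma large_mono J J' : (forall S, J S -> J' S) -> large J -> large J'.
Proof. by move=> h [f gf hf]; exists f => // S /hf/h. Qed.

Lemma large_and J J' : large J -> large J' -> large (fun S => J S /\ J' S).
Proof.
move=> [f gf hf] [h gh hh]; pose e := f * finv f; pose e' := h * finv h.
(* [e] and [e'] are the idempotents of the supports of [f] and [h]; the combination is the
   idempotent of their union. *)
exists (e + e' - e * e'); first by rewrite rmorphB rmorphD !rmorphM gf gh !mul0r addr0 subr0.
move=> S; rewrite fix_valB fix_valD !fix_valM /=.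
case: (eqVneq (fix_val f S) 0) => [f0|f0]; last first.
  by rewrite divff // mul1r addrK => /eqP; rewrite oner_eq0.
case: (eqVneq (fix_val h S) 0) => [h0 _|h0]; first by split; [apply: hf|apply: hh].
by rewrite f0 !mul0r divff // add0r subr0 => /eqP; rewrite oner_eq0.
Qed.

Lemma fixed_ind (J : I -> Prop) : fixed (fun S => (`[< J S >])%:R).
Proof. by move=> S; case: asboolP => _; rewrite ?expr1n ?frob0. Qed.

(** [F] is a field, so the idempotent of [J] maps to 0 or 1: this makes [large] an ultrafilter. *)
Lemma large_or J : large J \/ large (fun S => ~ J S).
Proof.
pose f := mkfix (fixed_ind J).
have ff : f * f = f.
  by apply: fix_ext => S; rewrite fix_valM /=; case: asboolP; rewrite ?mulr1 ?mulr0.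
have : g f * (g f - 1) = 0 by rewrite mulrBr mulr1 -rmorphM ff subrr.
move/eqP; rewrite mulf_eq0 subr_eq0 => /orP[] /eqP e.
  right; exists f => // S /=; case: asboolP => // _ /eqP; by rewrite oner_eq0.
left; exists (1 - f); first by rewrite rmorphB rmorph1 e subrr.
move=> S; rewrite fix_valB [fix_val 1 S]/(1 : k) /=; case: asboolP => // _ /eqP.
by rewrite subr0 oner_eq0.
Qed.

Lemma large_ev S0 (J : I -> Prop) : (forall S, above S0 S -> J S) -> large J.
Proof.
move=> h; exists (mkfix (fixed_ind (fun S => ~ J S))).
  by apply: g0; exists S0 => S /h hS /=; case: asboolP.
by move=> S /=; case: asboolP => [_ /eqP|/contrapT //]; rewrite oner_eq0.
Qed.

Lemma large_ex J : large J -> exists S, J S.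
Proof.
move=> [f gf hf]; apply: contrapT => nJ.
have : g (f * finv f) = 0 by rewrite rmorphM gf mul0r.
have -> : f * finv f = 1; last by rewrite rmorph1 => /eqP; rewrite oner_eq0.
apply: fix_ext => S; rewrite fix_valM /= divff //.
by apply/eqP => e; apply: nJ; exists S; apply: hf.
Qed.

Lemma large_fin (T : finType) (J : T -> I -> Prop) :
  large (fun S => exists t, J t S) -> exists t, large (J t).
Proof.
move=> h; apply: contrapT => nJ.
have : forall s : seq T, large (fun S => forall t, t \in s -> ~ J t S).
  elim=> [|t s IH]; first exact: (@large_ev ([::], 0%N)).
  have [|ht] := large_or (J t); first by move=> ?; case: nJ; exists t.
  by apply: large_mono (large_and ht IH) => S [h1 h2] t'; rewrite inE => /predU1P[->|/h2].
move=> /(_ (enum T)) h'; have [S [[t Jt] nt]] := large_ex (large_and h h').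
by apply: (nt t) => //; rewrite mem_enum.
Qed.

Definition iota_ (r : k) : fix_type :=
  mkfix (f := fun S => phi S r) (fun S => let: And5 _ _ h _ _ := phiP S in h r).

Lemma kappa_exists : exists kap : {rmorphism k -> F}, forall r, kap r = g (iota_ r).
Proof.
have iB x y : g (iota_ (x + y)) = g (iota_ x) + g (iota_ y).
  apply/eqP; rewrite -rmorphD -subr_eq0 -rmorphB; apply/eqP/g0.
  exists ([:: x; y; x + y], 0%N) => S [h _]; rewrite fix_valB fix_valD /=.
  have [_ _ _ _ hh] := phiP S.
  have xS : x \in S.1 by apply: h; rewrite !inE eqxx.
  have yS : y \in S.1 by apply: h; rewrite !inE eqxx !orbT.
  have [h1 _] := hh x y xS yS; rewrite h1 ?subrr //.
  by apply: h; rewrite !inE eqxx !orbT.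
have iM x y : g (iota_ (x * y)) = g (iota_ x) * g (iota_ y).
  apply/eqP; rewrite -rmorphM -subr_eq0 -rmorphB; apply/eqP/g0.
  exists ([:: x; y; x * y], 0%N) => S [h _]; rewrite fix_valB fix_valM /=.
  have [_ _ _ _ hh] := phiP S.
  have xS : x \in S.1 by apply: h; rewrite !inE eqxx.
  have yS : y \in S.1 by apply: h; rewrite !inE eqxx !orbT.
  have [_ h1] := hh x y xS yS; rewrite h1 ?subrr //.
  by apply: h; rewrite !inE eqxx !orbT.
have i1 : g (iota_ 1) = 1.
  apply/eqP; rewrite -(rmorph1 g) -subr_eq0 -rmorphB; apply/eqP/g0.
  exists ([:: 1], 0%N) => S [h _]; rewrite fix_valB /=.
  have oneS : 1 \in S.1 by apply: h; rewrite inE.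
  have [_ _ _ e1 _] := phiP S; rewrite (e1 oneS); exact: subrr.
have i0 : g (iota_ 0) = 0 by have := iB 0 0; rewrite addr0 -{1}[g _]addr0 => /addrI.
have fB : zmod_morphism (fun r => g (iota_ r)).
  move=> x y; have := iB (x - y) y; rewrite subrK => ->; by rewrite addrK.
by exists (rmorph_of fB (conj i1 iM)).
Qed.
End PseudoFinite.

(** * Counting points over finite fields *)

Section Counting.
Variables (k : closedFieldType) (p : nat).
Hypothesis p_char : p \in [pchar k].
Variables (F : fieldType) (g : {rmorphism fix_type p_char -> F}).
Hypotheses (gs : forall y, exists x, g x = y) (g0 : forall x, eventually_zero p_char x -> g x = 0).
Variable kap : {rmorphism k -> F}.
Hypothesis kapE : forall r, kap r = g (iota_ p_char r).
Local Notation FA := (Algebra kap).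
Local Notation I := (seq k * nat)%type.
Local Notation large := (large g).

Definition froots (S : I) : seq k :=
  sval (cid (fixed_roots p_char (let: And5 _ h _ _ _ := phiP p_char S in h))).
Lemma frootsP S : [/\ uniq (froots S), size (froots S) = (p ^ fexp p_char S)%N &
  forall x, (x \in froots S) = (x ^+ (p ^ fexp p_char S) == x)].
Proof. by rewrite /froots; case: cid. Qed.

Definition pts n S := {ffun 'I_n -> seq_sub (froots S)}.

(** Evaluation over the finite field of index [S], the constants of [k] being replaced by their
    images under [phi]. *)
Fixpoint ev n (S : I) (t : 'I_n -> k) (e : pexpr k n) : k :=
  match e with
  | PConst r => phi p_char S r
  | PVar i => t i
  | PAdd e1 e2 => ev S t e1 + ev S t e2
  | PMul e1 e2 => ev S t e1 * ev S t e2
  end.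

Definition sols n (rels : seq (pexpr k n)) (S : I) : {set pts n S} :=
  [set t : pts n S | all (fun e => ev S (fun i => val (t i)) e == 0) rels].

Definition lift_fun n (t : forall S, pts n S) (i : 'I_n) (S : I) : k := val (t S i).
Lemma lift_fixed n (t : forall S, pts n S) i : fixed p_char (lift_fun t i).
Proof.
by move=> S; have [_ _ h] := frootsP S; apply/eqP; rewrite -h; exact: (ssvalP (t S i)).
Qed.
Definition pt_fix n (t : forall S, pts n S) (i : 'I_n) : fix_type p_char := mkfix (lift_fixed t i).
Definition point n (t : forall S, pts n S) (i : 'I_n) : FA := g (pt_fix t i).

Lemma point_surj n (b : 'I_n -> F) : exists t, b = point t.
Proof.
have /choice[f fE] := fun i => gs (b i).
have fm i S : fix_val (f i) S \in froots S.
  by have [_ _ ->] := frootsP S; apply/eqP; apply: fix_valP.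
exists (fun S => [ffun i => SeqSub (fm i S)]); apply/funext => i.
by rewrite -fE; congr (g _); apply: fix_ext => S; rewrite /= /lift_fun ffunE.
Qed.

Lemma ev_fixed n (t : forall S, pts n S) e : exists f : fix_type p_char,
  (forall S, fix_val f S = ev S (fun i => val (t S i)) e) /\ g f = peval (point t) e.
Proof.
elim: e => [r|i|e1 [f1 [h1 e1']] e2 [f2 [h2 e2']]|e1 [f1 [h1 e1']] e2 [f2 [h2 e2']]].
- by exists (iota_ p_char r); rewrite /= kapE.
- by exists (pt_fix t i).
- by exists (f1 + f2); split=> [S|]; rewrite ?fix_valD ?rmorphD /= ?h1 ?h2 ?e1' ?e2'.
- by exists (f1 * f2); split=> [S|]; rewrite ?fix_valM ?rmorphM /= ?h1 ?h2 ?e1' ?e2'.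
Qed.

(** The transfer principle of ultraproducts, for a single equation. *)
Lemma point_eval n (t : forall S, pts n S) e :
  peval (point t) e = 0 <-> large (fun S => ev S (fun i => val (t S i)) e = 0).
Proof.
have [f [fE <-]] := ev_fixed t e; rewrite g_zero.
by split; apply: large_mono => S; rewrite fE.
Qed.

Lemma point_sols n (t : forall S, pts n S) (rels : seq (pexpr k n)) :
  (forall e, pmem e rels -> peval (point t) e = 0) <-> large (fun S => t S \in sols rels S).
Proof.
split=> [h|h e er]; last first.
  apply/point_eval; apply: large_mono h => S; rewrite inE => /pmem_all/(_ e er)/eqP.
  exact.
suff : large (fun S => all (fun e => ev S (fun i => val (t S i)) e == 0) rels).
  by apply: large_mono => S; rewrite inE.
elim: rels h => [|e l IH] h; first exact: (large_ev g0 (S0 := ([::], 0%N))).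
have he : large (fun S => ev S (fun i => val (t S i)) e = 0) by apply/point_eval/h; left.
have hl := IH (fun e' el => h e' (or_intror el)).
by apply: large_mono (large_and he hl) => S [/= -> ->]; rewrite eqxx.
Qed.

Lemma point_eq n (t t' : forall S, pts n S) : (forall i, point t i = point t' i) <->
  large (fun S => t S = t' S).
Proof.
split=> [h|h i]; last first.
  apply/eqP; rewrite -subr_eq0 -rmorphB; apply/eqP/g_zero.
  by apply: large_mono h => S e; rewrite fix_valB /= /lift_fun e subrr.
have hi i : large (fun S => t S i = t' S i).
  have : g (pt_fix t i - pt_fix t' i) = 0 by rewrite rmorphB [g _]h subrr.
  move/g_zero; apply: large_mono => S; rewrite fix_valB /= /lift_fun => /eqP.
  by rewrite subr_eq0 => /eqP/val_inj.
have : forall s : seq 'I_n, large (fun S => forall i, i \in s -> t S i = t' S i).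
  elim=> [|i s IH]; first exact: (large_ev g0 (S0 := ([::], 0%N))).
  by apply: large_mono (large_and (hi i) IH) => S [h1 h2] j; rewrite inE => /predU1P[->|/h2].
move=> /(_ (enum 'I_n)); apply: large_mono => S hS; apply/ffunP => i; apply: hS.
by rewrite mem_enum.
Qed.

Lemma large_choice n (J : forall S, pts n S -> Prop) :
  large (fun S => exists t, J S t) -> exists t : forall S, pts n S, large (fun S => J S (t S)).
Proof.
have zS S : 0 \in froots S by have [_ _ ->] := frootsP S; rewrite frob0.
have tS S : exists t : pts n S, (exists t, J S t) -> J S t.
  have [[t Jt]|nJ] := pselect (exists t, J S t); first by exists t.
  by exists [ffun=> SeqSub (zS S)].
by move=> h; exists (fun S => sval (cid (tS S))); apply: large_mono h => S; case: cid.
Qed.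

Definition joint n n' S (t : pts n S) (t' : pts n' S) : pts (n + n') S :=
  [ffun i => match fintype.split i with inl i => t i | inr i => t' i end].

Lemma point_joint n n' (t : forall S, pts n S) (t' : forall S, pts n' S) i :
  point (fun S => joint (t S) (t' S)) i =
  match fintype.split i with inl i => point t i | inr i => point t' i end.
Proof.
rewrite /point; case e : (fintype.split i) => [j|j]; congr (g _); apply: fix_ext => S;
  by rewrite /= /lift_fun ffunE e.
Qed.

Definition paste_fun n n' (b : 'I_n -> F) (b' : 'I_n' -> F) : 'I_(n + n') -> FA :=
  fun i => match fintype.split i with inl i => b i | inr i => b' i end.

Definition fsol n (rels : seq (pexpr k n)) (b : 'I_n -> F) :=
  forall e, pmem e rels -> peval (b : 'I_n -> FA) e = 0.

Definition ncount (T : finType) n (rels : T -> seq (pexpr k n)) (S : I) : nat :=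
  \sum_t #|sols (rels t) S|.

(** [E] is a relation between [F]-points that is defined everywhere and injective. If either
    property failed on a large set, witnesses could be chosen there and would form a counterexample
    over [F]. So on a large set the relation gives an injection between finite sets. *)
Lemma ncount_le (T T' : finType) n n' (rels : T -> seq (pexpr k n)) (rels' : T' -> seq (pexpr k n'))
    (E : T -> T' -> seq (pexpr k (n + n'))) :
  (forall t b, fsol (rels t) b -> exists t' b', fsol (rels' t') b' /\ fsol (E t t') (paste_fun b b')) ->
  (forall t1 t2 t' b1 b2 b', fsol (rels t1) b1 -> fsol (rels t2) b2 -> fsol (rels' t') b' ->
     fsol (E t1 t') (paste_fun b1 b') -> fsol (E t2 t') (paste_fun b2 b') -> t1 = t2 /\ b1 = b2) ->
  large (fun S => (ncount rels S <= ncount rels' S)%N).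
Proof.
move=> h1 h2.
have fsolP m (r : seq (pexpr k m)) t : fsol r (point t) <-> large (fun S => t S \in sols r S).
  exact: point_sols.
have pasteP t t' (x : forall S, pts n S) (x' : forall S, pts n' S) :
    fsol (E t t') (paste_fun (point x) (point x')) <->
    large (fun S => joint (x S) (x' S) \in sols (E t t') S).
  rewrite -fsolP; have -> // : paste_fun (point x) (point x') = point (fun S => joint (x S) (x' S)).
  by apply/funext => i; rewrite point_joint.
pose part S t (x : pts n S) t' (x' : pts n' S) :=
  (x' \in sols (rels' t') S) && (joint x x' \in sols (E t t') S).
have L1 : large (fun S => forall t (x : pts n S), x \in sols (rels t) S ->
    exists t' x', part S t x t' x').
  have [//|h] := large_or g (fun S => forall t (x : pts n S), x \in sols (rels t) S ->
    exists t' x', part S t x t' x').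
  have [t ht] : exists t, large (fun S => exists x : pts n S, x \in sols (rels t) S /\
      ~ exists t' x', part S t x t' x').
    apply: (large_fin g0); apply: large_mono h => S nS; apply: contrapT => nh; apply: nS => t x xs.
    by apply: contrapT => np; apply: nh; exists t, x.
  have [x hx] := large_choice ht.
  have /fsolP/h1[t' [b' []]] : large (fun S => x S \in sols (rels t) S).
    by apply: large_mono hx => S [].
  have [x' ->] := point_surj b' => /fsolP s1 /pasteP s2.
  have [S [[_ nS] [s1' s2']]] := large_ex (large_and hx (large_and s1 s2)).
  by case: nS; exists t', (x' S); rewrite /part s1' s2'.
have L2 : large (fun S => forall t1 t2 t' (x1 x2 : pts n S) x', x1 \in sols (rels t1) S ->
    x2 \in sols (rels t2) S -> part S t1 x1 t' x' -> part S t2 x2 t' x' -> t1 = t2 /\ x1 = x2).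
  set J := (X in large X); have [//|h] := large_or g J.
  have [[[t1 t2] t'] ht] : exists u : T * T * T', large (fun S => exists x1 : pts n S, exists x2 : pts n S,
      exists x' : pts n' S, [/\ x1 \in sols (rels u.1.1) S, x2 \in sols (rels u.1.2) S,
        part S u.1.1 x1 u.2 x', part S u.1.2 x2 u.2 x' & ~ (u.1.1 = u.1.2 /\ x1 = x2)]).
    apply: (large_fin g0); apply: large_mono h => S nS; apply: contrapT => nh; apply: nS.
    move=> t1 t2 t' x1 x2 x' s1 s2 p1 p2; apply: contrapT => np; apply: nh.
    by exists (t1, t2, t'), x1, x2, x'.
  have [x1 /large_choice[x2 /large_choice[x' hx]]] := large_choice ht.
  have [e1 e2] : t1 = t2 /\ point x1 = point x2.
    apply: (h2 t1 t2 t' _ _ (point x')).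
    - by apply/fsolP; apply: large_mono hx => S [].
    - by apply/fsolP; apply: large_mono hx => S [].
    - by apply/fsolP; apply: large_mono hx => S [_ _ /andP[]].
    - by apply/pasteP; apply: large_mono hx => S [_ _ /andP[]].
    - by apply/pasteP; apply: large_mono hx => S [_ _ _ /andP[]].
  have /point_eq e3 : forall i, point x1 i = point x2 i by rewrite e2.
  by have [S [[_ _ _ _ nS] e]] := large_ex (large_and hx e3); case: nS.
apply: large_mono (large_and L1 L2) => S [l1 l2].
pose A := [set u : T * pts n S | u.2 \in sols (rels u.1) S].
pose A' := [set u : T' * pts n' S | u.2 \in sols (rels' u.1) S].
have cardE (T0 : finType) m (r : T0 -> seq (pexpr k m)) :
    ncount r S = #|[set u : T0 * pts m S | u.2 \in sols (r u.1) S]|.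
  rewrite /ncount; under eq_bigr do rewrite -sum1_card.
  rewrite (pair_big_dep xpredT (fun t x => x \in sols (r t) S) (fun _ _ => 1%N)) /= -sum1_card.
  by apply: eq_bigl => u; rewrite inE.
rewrite !cardE -/A -/A'.
(* The relation need not be single-valued; any partner will do, since injectivity concerns the
   relation itself. *)
pose f (u : T * pts n S) := [pick u' : T' * pts n' S | part S u.1 u.2 u'.1 u'.2].
have fE u : u \in A -> exists2 u', f u = Some u' & part S u.1 u.2 u'.1 u'.2.
  rewrite inE => /l1[t' [x' h]]; rewrite /f; case: pickP => [u' hu'|no]; first by exists u'.
  by have := no (t', x'); rewrite h.
rewrite -(card_in_imset (f := f) (D := mem A)); last first.
  move=> u1 u2 u1A u2A; have [u' -> p1] := fE u1 u1A; have [u2' -> p2] := fE u2 u2A => -[e].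
  rewrite inE in u1A; rewrite inE in u2A; rewrite -e in p2.
  case: u1 u2 u1A u2A p1 p2 => [t1 x1] [t2 x2] u1A u2A p1 p2.
  by have [/= -> ->] := l2 _ _ _ _ _ _ u1A u2A p1 p2.
rewrite -(card_imset (mem A') (@Some_inj _)).
apply: subset_leq_card; apply/fintype.subsetP => _ /imsetP[u uA ->].
have [u' -> /andP[h _]] := fE u uA; apply/imsetP; exists u' => //.
by rewrite inE.
Qed.
End Counting.

(** * An additive invariant from counting points *)

Section Measure.
Variables (k : closedFieldType) (p : nat).
Hypothesis p_char : p \in [pchar k].
Variables (F : fieldType) (g : {rmorphism fix_type p_char -> F}).
Hypotheses (gs : forall y, exists x, g x = y) (g0 : forall x, eventually_zero p_char x -> g x = 0).
Variable kap : {rmorphism k -> F}.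
Hypothesis kapE : forall r, kap r = g (iota_ p_char r).
Local Notation FA := (Algebra kap).
Local Notation I := (seq k * nat)%type.
Local Notation large := (large g).
Local Notation fsol := (fsol kap).
Local Notation paste := (@paste_fun _ _ kap _ _).

Definition generates n (C : algebra k) (a : 'I_n -> C) := forall y, exists e, y = peval a e.

Lemma gen_pres n (C : algebra k) (a : 'I_n -> C) : generates a ->
  exists rels : seq (pexpr k n), presents a (fun e => pmem e rels).
Proof.
move=> ga; have [l [l0 lP]] := finite_subsystem (fun e => peval a e = 0).
exists l; split=> // B b hb.
have [f fE] := mp_eval b; have [h hE] := mp_eval a.
have hs y : exists q, h q = y.
  have [e ->] := ga y; exists (peval (mpX k : _ -> mp_alg k n) e).
  by rewrite hom_peval; apply: peval_ext => i /=.
have hf q : h q = 0 -> f q = 0.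
  have [e ->] := mp_pexpr q; rewrite !hom_peval => e0.
  rewrite (@peval_ext _ _ _ _ b) => [|i] /=; last exact: fE.
  by apply: (lP B b hb); rewrite -e0; apply: peval_ext => i /=.
split.
  have [u uE] := surj_factor hs hf.
  have ui r : u (alg_in C r) = alg_in B r by rewrite -(hom_in h) uE hom_in.
  by exists (AlgHom ui) => i; rewrite /= -hE uE.
move=> u u' e y; have [q ->] := ga y; rewrite !hom_peval; exact: peval_ext.
Qed.

(* [X(F)] is the disjoint union of the [C t (F)] *)
Definition strat (X : presheaf k) (T : finType) n (rels : T -> seq (pexpr k n)) :=
  exists (C : T -> algebra k) (a : forall t, 'I_n -> C t) (xi : forall t, X (C t)),
  [/\ forall t, presents (a t) (fun e => pmem e (rels t)),
      forall x : X FA, exists t (f : alghom (C t) FA), pmap f (xi t) = x &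
      forall t t' (f : alghom (C t) FA) (f' : alghom (C t') FA), pmap f (xi t) = pmap f' (xi t') ->
        t = t' /\ forall i, f (a t i) = f' (a t' i)].

(** The correspondence between two stratifications of [X(F)] is given by equations, because equality
    of points of the separated [X] is a closed condition; [finite_subsystem] makes them finite in
    number. *)
Lemma strat_graph (X : presheaf k) (T T' : finType) n n' (rels : T -> seq (pexpr k n)) (rels' : T' -> seq (pexpr k n')) :
  Defs.separated X -> strat X rels -> strat X rels' ->
  large (fun S => (ncount p_char rels S <= ncount p_char rels' S)%N).
Proof.
move=> Xs [C [a [xi [aP xis xii]]]] [C' [a' [xi' [aP' xis' xii']]]].
have graph t t' : exists E : seq (pexpr k (n + n')), forall (f : alghom (C t) FA) (f' : alghom (C' t') FA),
    pmap f (xi t) = pmap f' (xi' t') <-> fsol E (paste (fun i => f (a t i)) (fun i => f' (a' t' i))).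
  pose R e := (exists2 e', pmem e' (rels t) & e = pren (lshift n') e') \/
              (exists2 e', pmem e' (rels' t') & e = pren (@rshift n n') e').
  have [D [d dP]] := pres_exists R.
  have [|al alE] := pres_hom (aP t) (B := D) (b := d \o lshift n').
    by move=> e er; rewrite -peval_ren; apply: dP.1; left; exists e.
  have [|be beE] := pres_hom (aP' t') (B := D) (b := d \o @rshift n n').
    by move=> e er; rewrite -peval_ren; apply: dP.1; right; exists e.
  have [S SE] := Xs D (pmap al (xi t)) (pmap be (xi' t')).
  have [E [ES EP]] := finite_subsystem (fun e => exists2 s, S s & s = peval d e).
  exists E => f f'; pose c := paste (fun i => f (a t i)) (fun i => f' (a' t' i)).
  have cl i : c (lshift n' i) = f (a t i) by rewrite /c /paste_fun (unsplitK (inl _ : 'I_n + 'I_n')).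
  have cr i : c (rshift n i) = f' (a' t' i) by rewrite /c /paste_fun (unsplitK (inr _ : 'I_n + 'I_n')).
  have [|h hE] := pres_hom dP (B := FA) (b := c).
    move=> e [[e' er ->]|[e' er ->]]; rewrite peval_ren.
      rewrite -(rmorph0 f) -((aP t).1 e' er) hom_peval; apply: peval_ext => i; exact: cl.
    rewrite -(rmorph0 f') -((aP' t').1 e' er) hom_peval; apply: peval_ext => i; exact: cr.
  have hf y : h (al y) = f y.
    by apply: (pres_eq (aP t) (f := alg_comp h al)) => i /=; rewrite alE /= hE cl.
  have hf' y : h (be y) = f' y.
    by apply: (pres_eq (aP' t') (f := alg_comp h be)) => i /=; rewrite beE /= hE cr.
  have pe e : peval c e = h (peval d e) by rewrite hom_peval; apply: peval_ext => i /=.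
  rewrite -(pmapcE (xi t) hf) -(pmapcE (xi' t') hf') SE; split=> [hS e /ES[s Ss se]|hE' s Ss].
    by rewrite [LHS]pe -se hS.
  by have [e se] := pres_gen dP s; rewrite se -pe; apply: (EP FA c hE'); exists s.
have /choice[E0 E0P] : forall u : T * T', exists E : seq (pexpr k (n + n')),
    forall (f : alghom (C u.1) FA) (f' : alghom (C' u.2) FA),
    pmap f (xi u.1) = pmap f' (xi' u.2) <-> fsol E (paste (fun i => f (a u.1 i)) (fun i => f' (a' u.2 i))).
  by case=> t t'; apply: graph.
have homP t b : fsol (rels t) b -> exists f : alghom (C t) FA, b = fun i => f (a t i).
  by move=> hb; have [f fE] := pres_hom (aP t) (B := FA) hb; exists f; apply/funext => i.
have homP' t b : fsol (rels' t) b -> exists f : alghom (C' t) FA, b = fun i => f (a' t i).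
  by move=> hb; have [f fE] := pres_hom (aP' t) (B := FA) hb; exists f; apply/funext => i.
apply: (ncount_le gs g0 kapE (E := fun t t' => E0 (t, t'))).
  move=> t b /homP[f ->]; have [t' [f' e]] := xis' (pmap f (xi t)).
  exists t', (fun i => f' (a' t' i)); split; last exact/(E0P (t, t')).
  by move=> e0 he; apply: (pres_rel (aP' t') f' he).
move=> t1 t2 t' b1 b2 b' /homP[f1 ->] /homP[f2 ->] /homP'[f' ->] /(E0P (t1, t')) /= e1 /(E0P (t2, t')) /= e2.
have [te fe] := xii t1 t2 f1 f2 (etrans e1 (esym e2)).
by split=> //; apply/funext.
Qed.

(** The quotient by it is the ultraproduct of the integers, which receives the numbers of points. *)
Definition large_ideal : ideal (I -> int).
Proof.
exists (fun f => large (fun S => f S = 0)).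
- exact: (large_ev g0 (S0 := ([::], 0%N))).
- by move=> f h hf hh; apply: large_mono (large_and hf hh) => S [e1 e2]; rewrite [LHS]/(f S + h S) e1 e2.
- by move=> f h; apply: large_mono => S e; rewrite [LHS]/(f S * h S) e; exact: mulr0.
Defined.
Local Notation M := (quo large_ideal).

Definition cls (c : I -> nat) : M := qpi large_ideal (fun S => (c S)%:Z).

Lemma cls_eq c c' : cls c = cls c' <-> large (fun S => c S = c' S).
Proof.
rewrite /cls qpi_eq /=; split; apply: large_mono => S.
  by move=> h; apply/eqP; rewrite -eqz_nat -subr_eq0; apply/eqP.
by move=> h; rewrite [LHS]/((c S)%:Z - (c' S)%:Z) h; apply: subrr.
Qed.

Lemma strat_uniq (X : presheaf k) (T T' : finType) n n' (rels : T -> seq (pexpr k n)) (rels' : T' -> seq (pexpr k n')) :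
  Defs.separated X -> strat X rels -> strat X rels' ->
  cls (ncount p_char rels) = cls (ncount p_char rels').
Proof.
move=> Xs h h'; apply/cls_eq.
apply: large_mono (large_and (strat_graph Xs h h') (strat_graph Xs h' h)) => S [h1 h2].
by apply/eqP; rewrite eqn_leq h1.
Qed.

Definition stratified (X : presheaf k) (m : M) := exists (T : finType) n (rels : T -> seq (pexpr k n)),
  strat X rels /\ m = cls (ncount p_char rels).

(** The value 0 is a default for presheaves without stratification; for separated [X] the choice of
    the stratification does not matter, by [strat_uniq]. *)
Definition mu (X : presheaf k) : M :=
  if pselect (exists m, stratified X m) is left h then sval (cid h) else 0.

Lemma muE (X : presheaf k) (T : finType) n (rels : T -> seq (pexpr k n)) :
  Defs.separated X -> strat X rels -> mu X = cls (ncount p_char rels).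
Proof.
move=> Xs h; rewrite /mu; case: pselect => [h'|[]]; last by exists (cls (ncount p_char rels)), T, n, rels.
case: cid => _ /= [T' [n' [rels' [h'' ->]]]]; exact: strat_uniq Xs h'' h.
Qed.

Lemma strat_iso (X Y : presheaf k) (T : finType) n (rels : T -> seq (pexpr k n)) :
  isomorphic X Y -> strat X rels -> strat Y rels.
Proof.
move=> [u ub] [C [a [xi [aP xis xii]]]]; exists C, a, (fun t => u _ (xi t)); split=> //.
  move=> y; have [v _ uv] := ub FA; have [t [f e]] := xis (v y); exists t, f.
  by rewrite -mor_map e uv.
move=> t t' f f'; rewrite -!mor_map => /(bij_inj (ub FA)); exact: xii.
Qed.

Lemma generates_pad n n' (C : algebra k) (a : 'I_n -> C) : (n <= n')%N -> generates a ->
  generates (fun i : 'I_n' => if insub (val i) is Some j then a j else 0).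
Proof.
move=> nn ga y; have [e ->] := ga y; exists (pren (widen_ord nn) e).
by rewrite peval_ren; apply: peval_ext => i /=; rewrite insubT //= => h; congr a; apply: val_inj.
Qed.

Lemma strat_of (X : presheaf k) (T : finType) n (C : T -> algebra k) (a : forall t, 'I_n -> C t) (xi : forall t, X (C t)) :
  (forall t, generates (a t)) ->
  (forall x : X FA, exists t (f : alghom (C t) FA), pmap f (xi t) = x) ->
  (forall t t' (f : alghom (C t) FA) (f' : alghom (C t') FA), pmap f (xi t) = pmap f' (xi t') ->
        t = t' /\ forall i, f (a t i) = f' (a t' i)) ->
  exists rels : T -> seq (pexpr k n), strat X rels.
Proof.
move=> ga h1 h2; have /choice[rels rP] := fun t => gen_pres (ga t).
by exists rels, C, a, xi.
Qed.

Lemma quo_gen n (A : algebra k) (a : 'I_n -> A) (J : ideal A) : generates a ->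
  generates (fun i => quo_hom J (a i)).
Proof.
move=> ga y; have [x <-] := quo_surj y; have [e ->] := ga x; exists e.
by rewrite hom_peval; apply: peval_ext.
Qed.

Lemma finite_type_gen (A : algebra k) : finite_type A -> exists n (a : 'I_n -> A), generates a.
Proof. by move=> [n [a [r aP]]]; exists n, a => y; apply: (pres_gen aP). Qed.

Lemma open_field (X : presheaf k) (U : subfunctor X) (A : algebra k) (x : X A) (S : A -> Prop) (f : alghom A FA) :
  (forall (B : algebra k) (f : alghom A B), U B (pmap f x) <-> gen_unit_ideal f S) ->
  U _ (pmap f x) <-> exists2 s, S s & f s != 0.
Proof.
move=> SE; rewrite SE; split=> [/gen_unit_pt//|[s Ss fs]].
have [y ye] := field_unit fs; exact: (gen_unitW (f := f) Ss ye).
Qed.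

(** The [i]-th stratum is the closed part of the [i]-th affine open set outside the earlier ones: a
    point belongs to the first open set that contains it. *)
Lemma strat_exists (X : presheaf k) : variety X -> exists (T : finType) n (rels : T -> seq (pexpr k n)), strat X rels.
Proof.
move=> [Xsh Xsep [N [U [Uc cov]]]].
have h0 i : exists A : algebra k, exists n, exists a : 'I_n -> A, exists2 u : X A, generates a &
    forall B : algebra k, (forall y : X B, U i B y <-> exists f : alghom A B, pmap f u = y) /\
      (forall f g : alghom A B, pmap f u = pmap g u -> f =1 g).
  have [_ [A /finite_type_gen[n [a ga]] [u uP]]] := Uc i; by exists A, n, a, u.
have /choice[A /choice[n0 nP]] := h0.
(* All strata must have the same number of generators; shorter lists are padded with 0. *)
pose n := (\max_i n0 i)%N.
have h1 i : exists ua : X (A i) * ('I_n -> A i), generates ua.2 /\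
    forall B : algebra k, (forall y : X B, U i B y <-> exists f : alghom (A i) B, pmap f ua.1 = y) /\
      (forall f g : alghom (A i) B, pmap f ua.1 = pmap g ua.1 -> f =1 g).
  have [a [u ga uP]] := nP i; have nn : (n0 i <= n)%N by apply: (leq_bigmax i).
  by exists (u, fun j : 'I_n => if insub (val j) is Some j' then a j' else 0); split=> //; apply: generates_pad.
pose ua i := sval (cid (h1 i)).
have ga i : generates (ua i).2 by have [] := svalP (cid (h1 i)).
have uP i : forall B : algebra k, (forall y : X B, U i B y <-> exists f : alghom (A i) B, pmap f (ua i).1 = y) /\
      (forall f g : alghom (A i) B, pmap f (ua i).1 = pmap g (ua i).1 -> f =1 g).
  by have [] := svalP (cid (h1 i)).
have h2 i j : exists S : A i -> Prop, forall (B : algebra k) (f : alghom (A i) B),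
    U j B (pmap f (ua i).1) <-> gen_unit_ideal f S by have [Uo _] := Uc j; apply: Uo.
pose S i j := sval (cid (h2 i j)).
have SE i j : forall (B : algebra k) (f : alghom (A i) B),
    U j B (pmap f (ua i).1) <-> gen_unit_ideal f (S i j) := svalP (cid (h2 i j)).
pose J (i : 'I_N) := idgen (fun s => exists2 j : 'I_N, (j < i)%N & S i j s).
pose C i : algebra k := quo_alg (J i).
exists 'I_N, n.
have inU i (f : alghom (C i) FA) : U i _ (pmap f (pmap (quo_hom (J i)) (ua i).1)).
  have [h _] := uP i FA; apply/h; exists (alg_comp f (quo_hom (J i))); exact: pmapc.
have notU i (f : alghom (C i) FA) (j : 'I_N) : (j < i)%N -> ~ U j _ (pmap f (pmap (quo_hom (J i)) (ua i).1)).
  move=> ji; rewrite -pmapc => /(open_field _ (SE i j))[s Ss /eqP]; apply => /=.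
  have -> : quo_hom (J i) s = 0 by apply/quo_homK/idgen_mem; exists j.
  exact: rmorph0.
apply: (@strat_of X 'I_N n C (fun i l => quo_hom (J i) ((ua i).2 l)) (fun i => pmap (quo_hom (J i)) (ua i).1)).
- by move=> i; apply: quo_gen.
- move=> x; have [i0 Ui0] := cov F kap x.
  pose P i := `[< U i FA x >].
  have [i /asboolP Ui imin] := @arg_minnP _ i0 P (fun i : 'I_N => nat_of_ord i) (asboolT Ui0).
  have [h _] := uP i FA; have [f fx] := (h x).1 Ui.
  have fJ y : J i y -> f y = 0.
    apply: (@idgen_min _ _ (preim_ideal f (zero_ideal _))) => s [j ji Ss] /=.
    apply/eqP; apply: contrapT => /negP fs.
    have : U j FA x by rewrite -fx; apply/(open_field _ (SE i j)); exists s.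
    by move=> Uj; have := imin j (asboolT Uj); rewrite leqNgt ji.
  have [f' f'E] := quo_lift fJ; exists i, f'.
  by rewrite -fx; apply: pmapcE.
move=> i i' f f' e; have ii : i = i'.
  apply: val_inj; case: (ltngtP i i') => // [lt|lt].
    by have := @notU i' f' i lt; rewrite -e; case; apply: inU.
  by have := @notU i f i' lt; rewrite e; case; apply: inU.
case: i' / ii f' e => f' e; split=> // l.
have [_ h] := uP i FA; apply: (h (alg_comp f (quo_hom (J i))) (alg_comp f' (quo_hom (J i)))).
by rewrite !pmapc.
Qed.

Lemma mu_iso (X Y : presheaf k) : variety X -> variety Y -> isomorphic X Y -> mu X = mu Y.
Proof.
move=> vX [_ Ys _] XY; have [_ Xs _] := vX.
have [T [n [rels h]]] := strat_exists vX.
by rewrite (muE Xs h) (muE Ys (strat_iso XY h)).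
Qed.

Lemma sub_separated (X : presheaf k) (U : subfunctor X) : Defs.separated X -> Defs.separated (sub_presheaf U).
Proof.
move=> Xs A [x hx] [y hy]; have [S SE] := Xs A x y; exists S => B f; rewrite -SE.
split=> [e|e]; last exact: eq_exist.
exact: (congr1 sval e).
Qed.

Lemma ncount_sum (T T' : finType) n (r : T -> seq (pexpr k n)) (r' : T' -> seq (pexpr k n)) S :
  ncount p_char (fun u : T + T' => match u with inl t => r t | inr t => r' t end) S =
  (ncount p_char r S + ncount p_char r' S)%N.
Proof. by rewrite /ncount big_sumType. Qed.

(** For points over [F], finitely many functions [l t] define [Z] within a stratum. The complement
    is cut into the pieces where the [j]-th function is invertible and the earlier ones vanish.
    These pieces stratify [Z] and [U] and, taken together, [X]. *)
Lemma mu_scissor (X : presheaf k) (Z U : subfunctor X) : variety X -> complementary Z U ->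
  mu X = mu (sub_presheaf Z) + mu (sub_presheaf U).
Proof.
move=> vX ZU; have [_ Xs _] := vX.
have [T [n [rels [C [a [xi [aP xis xii]]]]]]] := strat_exists vX.
have ga t : generates (a t) by move=> y; apply: (pres_gen (aP t)).
have h0 t : exists S : C t -> Prop, forall (B : algebra k) (f : alghom (C t) B),
    (Z B (pmap f (xi t)) <-> forall s, S s -> f s = 0) /\ (U B (pmap f (xi t)) <-> gen_unit_ideal f S).
  exact: ZU.
have h1 t : exists l : seq (C t), exists S : C t -> Prop, [/\ forall s, pmem s l -> S s,
    forall f : alghom (C t) FA, (forall s, pmem s l -> f s = 0) -> forall s, S s -> f s = 0 &
    forall (B : algebra k) (f : alghom (C t) B),
    (Z B (pmap f (xi t)) <-> forall s, S s -> f s = 0) /\ (U B (pmap f (xi t)) <-> gen_unit_ideal f S)].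
  have [S SE] := h0 t; have [E [ES EP]] := finite_subsystem (fun e => S (peval (a t) e)).
  exists (map (fun e => peval (a t) e) E), S; split=> // [s /pmem_map[e eE <-]|f hf s Ss]; first exact: ES.
  have [e se] := ga t s; rewrite se hom_peval; apply: (EP FA) => [e' e'E|]; last by rewrite -se.
  by rewrite -hom_peval; apply: hf; apply/pmem_map; exists e'.
pose l t := sval (cid (h1 t)); pose S t := sval (cid (svalP (cid (h1 t)))).
have [lS lZ SE] : [/\ forall t s, pmem s (l t) -> S t s,
    forall t (f : alghom (C t) FA), (forall s, pmem s (l t) -> f s = 0) -> forall s, S t s -> f s = 0 &
    forall t (B : algebra k) (f : alghom (C t) B),
    (Z B (pmap f (xi t)) <-> forall s, S t s -> f s = 0) /\ (U B (pmap f (xi t)) <-> gen_unit_ideal f (S t))].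
  by split=> t; have [] := svalP (cid (svalP (cid (h1 t)))).
pose m := (\max_t size (l t))%N.
pose ln t j := nth 0 (l t) j.
have pn t s : pmem s (l t) <-> exists2 j : 'I_m, (j < size (l t))%N & ln t j = s.
  have lm : (size (l t) <= m)%N by apply: (leq_bigmax t).
  have -> : pmem s (l t) <-> exists2 j, (j < size (l t))%N & ln t j = s.
    rewrite /ln; elim: (l t) => [|x r IH] /=; first by split=> [//|[]].
    rewrite IH; split=> [[<-|[j js e]]|[[|j] js e]]; [by exists 0%N|by exists j.+1|by left|].
    by right; exists j.
  split=> [[j js e]|[j js e]]; last by exists j.
  by exists (Ordinal (leq_trans js lm)).
pose JZ t := idgen (S t).
pose JU t (j : 'I_m) := idgen (fun s => exists2 i : 'I_m, (i < j)%N & s = ln t i).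
have h2 t j : exists B : algebra k, exists q : alghom (quo_alg (JU t j)) B, is_localization q (quo_hom (JU t j) (ln t j)).
  exact: loc_exists.
pose B u := sval (cid (h2 u.1 u.2)).
pose q u : alghom (quo_alg (JU u.1 u.2)) (B u) := sval (cid (svalP (cid (h2 u.1 u.2)))).
have qP u : is_localization (q u) (quo_hom (JU u.1 u.2) (ln u.1 u.2)) := svalP (cid (svalP (cid (h2 u.1 u.2)))).
pose r u : alghom (C u.1) (B u) := alg_comp (q u) (quo_hom (JU u.1 u.2)).
have zZ t : Z _ (pmap (quo_hom (JZ t)) (xi t)).
  by have [h _] := SE t _ (quo_hom (JZ t)); apply/h => s Ss; apply/quo_homK/idgen_mem.
have rl u : exists y, r u (ln u.1 u.2) * y = 1 by have [] := qP u.
have small (u : T * 'I_m) (i : 'I_m) : (i < u.2)%N -> r u (ln u.1 i) = 0.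
  move=> iu; rewrite /r /=; have -> : quo_hom (JU u.1 u.2) (ln u.1 i) = 0; last exact: rmorph0.
  by apply/quo_homK/idgen_mem; exists i.
have uU u : U _ (pmap (r u) (xi u.1)).
  have [_ h] := SE u.1 _ (r u); apply/h; have [y ye] := rl u.
  (* Past the end of the list the function is 0 and the piece is empty: its ring is the zero ring,
     over which [U] holds trivially. *)
  case: (ltnP u.2 (size (l u.1))) => ul.
    by apply: (gen_unitW (f := r u) _ ye); apply: lS; apply/pn; exists u.2.
  move: ye; rewrite /ln nth_default // rmorph0 mul0r => e0.
  exists 0%N, (fun=> 0), (fun=> 0); split=> [[]//|]; by rewrite big_ord0.
pose xZ t : sub_presheaf Z (quo_alg (JZ t)) := exist _ _ (zZ t).
pose xU u : sub_presheaf U (B u) := exist _ _ (uU u).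
have gB u : exists b : 'I_n.+1 -> B u, generates b /\
    forall (f f' : alghom (B u) FA), (forall y, f (r u y) = f' (r u y)) -> forall i, f (b i) = f' (b i).
  have [b bg] := loc_gen (quo_gen (J := JU u.1 u.2) (ga u.1)) (qP u).
  exists b; split; first exact: bg.
  move=> f f' e i; apply: (loc_hom_eq (qP u)) => y.
  by have [x <-] := quo_surj y; apply: e.
pose aZ t (i : 'I_n.+1) : quo_alg (JZ t) := if insub (val i) is Some j then quo_hom (JZ t) (a t j) else 0.
have gZ t : generates (aZ t) by apply: (generates_pad (leqnSn n)); apply: quo_gen.
pose aU u := sval (cid (gB u)).
have [gU aUE] : (forall u, generates (aU u)) /\ forall u (f f' : alghom (B u) FA),
    (forall y, f (r u y) = f' (r u y)) -> forall i, f (aU u i) = f' (aU u i).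
  by split=> u; have [] := svalP (cid (gB u)).
have ptZ (x : X FA) : Z _ x -> exists t (f : alghom (quo_alg (JZ t)) FA), pmap f (pmap (quo_hom (JZ t)) (xi t)) = x.
  have [t [f <-]] := xis x; have [h _] := SE t _ f => /h fS.
  have [|f' f'E] := quo_lift (g := f) (I := JZ t).
    by apply: (@idgen_min _ _ (preim_ideal f (zero_ideal _))).
  by exists t, f'; apply: pmapcE.
have ptU (x : X FA) : U _ x -> exists u (f : alghom (B u) FA), pmap f (pmap (r u) (xi u.1)) = x.
  have [t [f <-]] := xis x; have [_ h] := SE t _ f => /h/gen_unit_pt[s Ss fs].
  have [i0 fi0] : exists i : 'I_m, f (ln t i) != 0.
    apply: contrapT => no; move/eqP: fs; apply; apply: lZ Ss => s' /pn[j _ <-].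
    by apply/eqP; apply: contrapT => /negP nj; apply: no; exists j.
  have [i fi imin] := @arg_minnP _ i0 (fun i : 'I_m => f (ln t i) != 0) (fun i : 'I_m => nat_of_ord i) fi0.
  have [|f' f'E] := quo_lift (g := f) (I := JU t i).
    apply: (@idgen_min _ _ (preim_ideal f (zero_ideal _))) => _ [j ji ->] /=.
    by apply/eqP; apply: contraTT ji => nj; rewrite -leqNgt; apply: imin.
  have [|f2 f2E] := loc_lift (f := f') (qP (t, i)); first by rewrite f'E; exact: field_unit.
  by exists (t, i), f2; apply: pmapcE => y; rewrite /= f2E f'E.
have injZ t t' (f : alghom (quo_alg (JZ t)) FA) (f' : alghom (quo_alg (JZ t')) FA) :
    pmap f (pmap (quo_hom (JZ t)) (xi t)) = pmap f' (pmap (quo_hom (JZ t')) (xi t')) ->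
    t = t' /\ forall i, f (aZ t i) = f' (aZ t' i).
  rewrite -!pmapc => /xii[tt e]; split=> // i; rewrite /aZ.
  by case: insub => [j|]; [apply: e|rewrite !rmorph0].
have injU u u' (f : alghom (B u) FA) (f' : alghom (B u') FA) :
    pmap f (pmap (r u) (xi u.1)) = pmap f' (pmap (r u') (xi u'.1)) ->
    u = u' /\ forall i, f (aU u i) = f' (aU u' i).
  rewrite -!pmapc => /xii[tt e].
  case: u u' f f' tt e => [t j] [t' j'] f f' /= tt; case: t' / tt f' => f' e.
  have e2 y : f (r (t, j) y) = f' (r (t, j') y).
    apply: (pres_eq (aP t) (f := alg_comp f (r (t, j))) (g := alg_comp f' (r (t, j')))).
    exact: e.
  have nz u (h : alghom (B u) FA) : h (r u (ln u.1 u.2)) != 0.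
    have [y ye] := rl u; apply: (@unit_field F _ (h y)); by rewrite -rmorphM ye rmorph1.
  have jj : j = j'.
    apply: val_inj; case: (ltngtP j j') => // [lt|lt].
      have := nz (t, j) f; rewrite e2.
      have -> : r (t, j') (ln (t, j).1 (t, j).2) = 0 by exact: (@small (t, j') j lt).
      by rewrite rmorph0 eqxx.
    have := nz (t, j') f'; rewrite -e2.
    have -> : r (t, j) (ln (t, j').1 (t, j').2) = 0 by exact: (@small (t, j) j' lt).
    by rewrite rmorph0 eqxx.
  by case: j' / jj f' e e2 => f' e e2; split=> // i; apply: aUE.
have disj (x : X FA) : Z _ x -> U _ x -> False.
  have [t [f <-]] := xis x; have [h h'] := SE t _ f => /h fS /h'/gen_unit_pt[s Ss].
  by rewrite fS // eqxx.
have ptZ' t (f : alghom (quo_alg (JZ t)) FA) : Z _ (pmap f (pmap (quo_hom (JZ t)) (xi t))).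
  exact: (sf_map f (zZ t)).
have ptU' u (f : alghom (B u) FA) : U _ (pmap f (pmap (r u) (xi u.1))).
  exact: (sf_map f (uU u)).
have ZorU (x : X FA) : Z _ x \/ U _ x.
  have [t [f <-]] := xis x; have [h h'] := SE t _ f.
  case: (pselect (forall s, S t s -> f s = 0)) => [/h|no]; [by left|right].
  apply/h'; have [s [Ss fs]] : exists s, S t s /\ f s <> 0.
    by apply: contrapT => no'; apply: no => s Ss; apply: contrapT => fs; apply: no'; exists s.
  have [y ye] := @field_unit _ F kap (f s) (introN eqP fs); exact: (gen_unitW (f := f) Ss ye).
have [||rZ sZ] := @strat_of (sub_presheaf Z) T n.+1 (fun t => quo_alg (JZ t)) aZ xZ gZ.
- by move=> [x Zx]; have [t [f fx]] := ptZ x Zx; exists t, f; exact: eq_exist.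
- by move=> t t' f f' /(congr1 sval) /= /injZ.
have [||rU sU] := @strat_of (sub_presheaf U) (T * 'I_m)%type n.+1 B aU xU gU.
- by move=> [x Ux]; have [u [f fx]] := ptU x Ux; exists u, f; exact: eq_exist.
- by move=> u u' f f' /(congr1 sval) /= /injU.
have [CZ [bZ [yZ [bP yZs yZi]]]] := sZ; have [CU [bU [yU [bP' yUs yUi]]]] := sU.
have sX : strat X (fun u : T + T * 'I_m => match u with inl t => rZ t | inr u => rU u end).
  exists (fun u => match u with inl t => CZ t | inr u => CU u end).
  exists (fun u => match u return 'I_n.+1 -> match u with inl t => CZ t | inr u => CU u end with
    inl t => bZ t | inr u => bU u end).
  exists (fun u => match u return X (match u with inl t => CZ t | inr u => CU u end) with
    inl t => sval (yZ t) | inr u => sval (yU u) end).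
  have zc t (f : alghom (CZ t) FA) : Z _ (pmap f (sval (yZ t))) by apply: sf_map; apply: svalP.
  have uc u (f : alghom (CU u) FA) : U _ (pmap f (sval (yU u))) by apply: sf_map; apply: svalP.
  split=> [[t|u]||]; [exact: bP|exact: bP'| |].
    move=> x; case: (ZorU x) => hx.
      by have [t [f /(congr1 sval) e]] := yZs (exist _ x hx); exists (inl t), f.
    by have [t [f /(congr1 sval) e]] := yUs (exist _ x hx); exists (inr t), f.
  move=> [t|u] [t'|u'] f f' e.
  - have [|e1 h] := yZi t t' f f'; first exact: eq_exist.
    by split; [rewrite e1|exact: h].
  - by case: (disj _ (zc t f)); rewrite e; apply: uc.
  - by case: (disj _ (zc t' f')); rewrite -e; apply: uc.
  - have [|e1 h] := yUi u u' f f'; first exact: eq_exist.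
    by split; [rewrite e1|exact: h].
rewrite (muE Xs sX) (muE (sub_separated Xs) sZ) (muE (sub_separated Xs) sU).
rewrite /cls -rmorphD; apply: (congr1 (qpi large_ideal)); apply/funext => S0.
by rewrite ncount_sum PoszD.
Qed.
End Measure.

(** * Transcendence of the class of the line *)

Section Transcendence.
Variables (k : closedFieldType) (p : nat).
Hypothesis p_char : p \in [pchar k].
Variables (K0 : comPzRingType) (cl : presheaf k -> K0).
Hypothesis clP : grothendieck_ring cl.
Local Notation LL := (cl (affine_line k)).

(** Counting points turns a relation into a polynomial identity in [q], valid on a large set of
    indices. For some of them [q] exceeds the sum of the absolute values of the coefficients, and
    the leading term dominates. *)
Lemma line_relation (N : nat) (c : 'I_N.+1 -> int) :
  \sum_i (c i)%:~R * LL ^+ i = 0 -> forall i, c i = 0.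
Proof.
move=> rel.
have [F [g [gs g0]]] := pseudo_finite_field p_char.
have [kap kapE] := kappa_exists g0.
have inv : additive_invariant (mu (g := g) g0 kap).
  by split=> [X Y|X Z U]; [apply: (mu_iso gs g0 kapE)|apply: (mu_scissor gs g0 kapE)].
have [[phi phiE] _] := gr_univ clP inv.
pose q S := (p ^ fexp p_char S)%N.
have vA m : variety (asp k m) := coords_variety (asp_coords k m).
have mu_asp m : mu (g := g) g0 kap (asp k m) = cls g0 (fun S => (q S ^ m)%N).
  have sm : strat kap (asp k m) (fun _ : unit => [::] : seq (pexpr k m)).
    pose C := mp_alg k m.
    have univ (B : algebra k) (x : 'rV[B]_m) : exists f : alghom C B, forall i, f (mpX k i) = x 0 i.
      exact: mp_eval.
    exists (fun=> C), (fun=> (mpX k : _ -> C)), (fun=> (\row_i mpX k i : 'rV[C]_m)); split.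
    - move=> _; split=> // B b _; split; first exact: mp_eval.
      by move=> f f' e; apply: mp_hom_eq.
    - move=> x; have [f fE] := univ _ x; exists tt, f.
      by apply/rowP => i; rewrite !mxE fE.
    - move=> [] [] f f' /rowP e; split=> // i; by have := e i; rewrite !mxE.
  have [_ As _] := vA m.
  rewrite (muE gs g0 kapE As sm); apply/cls_eq; apply: (large_ev g0 (S0 := ([::], 0%N))) => S _.
  rewrite /ncount big_const card_unit /= addn0.
  have -> : sols p_char ([::] : seq (pexpr k m)) S = [set: pts p_char m S].
    by apply/setP => t; rewrite !inE.
  have [us ss _] := frootsP p_char S.
  by rewrite cardsT card_ffun card_ord card_seq_sub // ss.
have cl_phi m : phi (LL ^+ m) = cls g0 (fun S => (q S ^ m)%N).
  by rewrite -(cl_asp clP) phiE.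
have : phi (\sum_i (c i)%:~R * LL ^+ i) = 0 by rewrite rel raddf0.
rewrite raddf_sum.
have fctz (z : int) (h : seq k * nat -> int) S : (h *~ z) S = h S *~ z.
  have fctn (m : nat) : (h *+ m) S = h S *+ m.
    by elim: m => [|m IH]; rewrite ?mulr0n // !mulrS -IH.
  by case: z => m; rewrite ?NegzE ?mulrNz -?pmulrn -?fctn.
have -> : \sum_i phi ((c i)%:~R * LL ^+ i) =
    qpi (large_ideal g0) (\sum_(i < N.+1) (fun S => c i * (q S)%:Z ^+ i)).
  rewrite rmorph_sum; apply: eq_bigr => i _.
  rewrite mulrzl raddfMz cl_phi /cls -rmorphMz; apply: (congr1 (qpi _)); apply/funext => S.
  by rewrite fctz mulrzz mulrC -natz natrX natz.
move=> /qpi0 /= large0 i; apply: contrapT => ci.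
have [i1 ci1 imax] : exists2 i1, c i1 != 0 & forall j, c j != 0 -> (j <= i1)%N.
  have [i1 h1 h2] := @arg_maxnP _ i (fun i => c i != 0) (fun i : 'I_N.+1 => nat_of_ord i) (introN eqP ci).
  by exists i1.
(* The second component of an index bounds the exponent of [q] from below, hence [q] itself. *)
pose b := (\sum_i absz (c i)).+1%N.
have [S [e0 bS]] := large_ex (large_and large0 (large_ev g0 (S0 := ([::], b)) (J := fun S => (b <= S.2)%N) (fun S h => h.2))).
have [h1 h2 _ _ _] := phiP p_char S.
have pp := pcharf_prime p_char.
have bq : (b < q S)%N.
  by rewrite (leq_ltn_trans (leq_trans bS h1)) // ltn_expl // prime_gt1.
move: e0; rewrite fct_sumE.
move: (q S) bq => Q bQ e0.
have Q0 : (0 < Q)%N by apply: leq_ltn_trans bQ.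
have e1 : c i1 * Q%:Z ^+ i1 = - \sum_(j < N.+1 | j != i1) c j * Q%:Z ^+ j.
  by apply/eqP; rewrite -addr_eq0 -(bigD1 (P := xpredT) i1) //=; apply/eqP.
have le1 : `|\sum_(j < N.+1 | j != i1) c j * Q%:Z ^+ j| * Q%:Z <= (\sum_j `|c j|) * Q%:Z ^+ i1.
  apply: le_trans (ler_wpM2r _ (ler_norm_sum _ _ _)) _ => //.
  rewrite mulr_suml [in leRHS](bigD1 i1) //= mulrDl mulr_suml.
  apply: ler_wpDl; first by rewrite mulr_ge0 // exprn_ge0.
  apply: ler_sum => j ji; rewrite normrM.
  case: (eqVneq (c j) 0) => [->|cj]; first by rewrite normr0 !mul0r.
  rewrite -mulrA ler_wpM2l // ger0_norm ?exprn_ge0 // -exprSr.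
  have ji1 : (j < i1)%N by rewrite ltn_neqAle imax // andbT; apply: contraNneq ji => /val_inj ->.
  by rewrite ler_weXn2l // lez_nat.
have := le1; rewrite -[X in X * _]normrN -e1 normrM [`|_ ^+ _|]ger0_norm ?exprn_ge0 // mulrAC.
rewrite ler_pM2r ?exprn_gt0 ?ltz_nat // leNgt => /negP; apply.
apply: lt_le_trans (_ : Q%:Z <= _); last first.
  by rewrite -[leLHS]mul1r ler_wpM2r // -gtz0_ge1 normr_gt0.
apply: lt_trans (_ : b%:Z < Q%:Z); last by rewrite ltz_nat.
have -> : \sum_j `|c j| = (\sum_j absz (c j))%N%:Z :> int.
  by rewrite -natz natr_sum; apply: eq_bigr => j _; rewrite natz abszE.
by rewrite ltz_nat ltnS.
Qed.

End Transcendence.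

(** * The tame base change conductor *)

Section TameConductor.
Variable R : realType.

(** The error is the remainder divided by [n] and by [dn m], hence less than [1 / dn m]. *)
Lemma floor_jump_cvg (dn : nat -> nat) (n i : nat) : (0 < n)%N ->
  (forall B, exists N, forall m, (N <= m)%N -> (B < dn m)%N) ->
  limn (fun m => ((dn m * i) %/ n)%:R / (dn m)%:R : R) = i%:R / n%:R.
Proof.
move=> n0 dninf; apply: cvg_lim => //; apply/cvgrPdist_lt => e e0.
have [N NP] := dninf (Num.truncn e^-1).+1; exists N => // m /NP dm.
have d0 : (0 : R) < (dn m)%:R by rewrite ltr0n; apply: leq_ltn_trans dm.
have n0' : (0 : R) < n%:R by rewrite ltr0n.
have de : e^-1 < (dn m)%:R :> R.
  apply: lt_le_trans (truncnS_gt _) _; by rewrite ler_nat; exact: ltnW.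
have de' : (dn m)%:R^-1 < e by rewrite -[e]invrK ltf_pV2 // posrE ?invr_gt0.
have := divn_eq (dn m * i) n; have := ltn_pmod (dn m * i) n0.
move: ((dn m * i) %/ n)%N ((dn m * i) %% n)%N => x y yn /(congr1 (fun z : nat => z%:R : R)).
rewrite natrD !natrM => h.
have -> : i%:R / n%:R - x%:R / (dn m)%:R = y%:R / n%:R / (dn m)%:R :> R.
  by apply/eqP; rewrite eq_sym -subr_eq0; apply/eqP; field: h; rewrite ?gt_eqF //.
rewrite ger0_norm ?divr_ge0 ?ler0n // ?mulr_ge0 ?invr_ge0 ?ler0n //.
apply: le_lt_trans de'; rewrite -[leRHS]mul1r; apply: ler_wpM2r; first by rewrite invr_ge0 ltW.
by rewrite ler_pdivrMr // mul1r ler_nat ltnW.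
Qed.

Lemma sum_fraction n : (0 < n)%N -> \sum_(i < n) (i%:R / n%:R : R) = n.-1%:R / 2%:R.
Proof.
move=> n0; rewrite -mulr_suml.
have n0' : n%:R != 0 :> R by rewrite pnatr_eq0 -lt0n.
have -> : \sum_(i < n) i%:R = n%:R * n.-1%:R / 2%:R :> R.
  case: n n0 {n0'} => // n _ /=; elim: n => [|n IH].
    by rewrite big_ord1 mulr0 mul0r.
  by rewrite big_ord_recr /= IH -!natr1; field.
by field.
Qed.
End TameConductor.

(** * The zeta function as a geometric series *)

Section Series.
Variable A : comPzRingType.
Implicit Types f g : powser A.

Lemma ps_mulE f g d : (f * g) d = \sum_(i < d.+1) f i * g (d - i)%N.
Proof. by []. Qed.
Lemma ps_addE f g d : (f + g) d = f d + g d. Proof. by []. Qed.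
Lemma ps_oppE f d : (- f) d = - f d. Proof. by []. Qed.
Lemma ps_oneE d : (1 : powser A) d = (d == 0%N)%:R. Proof. by []. Qed.
Lemma ps_sumE (T : Type) (r : seq T) (P : pred T) (F : T -> powser A) d :
  (\sum_(t <- r | P t) F t) d = \sum_(t <- r | P t) F t d.
Proof. by elim/big_rec2: _ => // i x y _ <-. Qed.

Lemma ps_monomM c b f d : (ps_monom c b * f) d = if (b <= d)%N then c * f (d - b)%N else 0.
Proof.
rewrite ps_mulE; case: leqP => bd.
  rewrite (bigD1 (Ordinal (bd : b < d.+1)%N)) //= /ps_monom eqxx big1 ?addr0 // => i ib.
  by rewrite ifN ?mul0r //; apply: contraNneq ib => ib; apply/eqP/val_inj.
rewrite big1 // => i _; rewrite /ps_monom ifN ?mul0r //.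
by rewrite neq_ltn (leq_trans (ltn_ord i) bd).
Qed.

Lemma ps_factorM c b f d :
  ((1 - ps_monom c b) * f) d = f d - (if (b <= d)%N then c * f (d - b)%N else 0).
Proof. by rewrite mulrBl mul1r ps_addE ps_oppE ps_monomM. Qed.

Lemma is_polynomial_add f g : is_polynomial f -> is_polynomial g -> is_polynomial (f + g).
Proof.
move=> [n hn] [m hm]; exists (maxn n m) => d; rewrite geq_max => /andP[h1 h2].
by rewrite ps_addE hn // hm // addr0.
Qed.
Lemma is_polynomial_mul f g : is_polynomial f -> is_polynomial g -> is_polynomial (f * g).
Proof.
move=> [n hn] [m hm]; exists (n + m)%N => d nm; rewrite ps_mulE big1 // => i _.
case: (leqP n i) => ni; first by rewrite hn // mul0r.
by rewrite hm ?mulr0 //; lia.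
Qed.
Lemma is_polynomial_monom c b : is_polynomial (ps_monom c b : powser A).
Proof. by exists b.+1 => d bd; rewrite /ps_monom gtn_eqF. Qed.
Lemma is_polynomial_opp f : is_polynomial f -> is_polynomial (- f).
Proof. by move=> [n hn]; exists n => d /hn e; rewrite ps_oppE e oppr0. Qed.
Lemma is_polynomial1 : is_polynomial (1 : powser A).
Proof. by exists 1%N => -[|d]. Qed.

Lemma polynomial_sum f n : (forall d, (n <= d)%N -> f d = 0) -> f = \sum_(i < n) ps_monom (f i) i.
Proof.
move=> hn; apply/funext => d; rewrite ps_sumE; case: (ltnP d n) => dn.
  rewrite (bigD1 (Ordinal dn)) //= /ps_monom eqxx big1 ?addr0 // => i id_.
  by rewrite ifN //; apply: contraNneq id_ => e; apply/eqP/val_inj.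
rewrite hn // big1 // => i _; rewrite /ps_monom ifN //.
by rewrite neq_ltn orbC (leq_trans (ltn_ord i) dn).
Qed.

Lemma in_subring_polynomial q J f : is_polynomial f -> in_subring q J f.
Proof.
move=> [n /polynomial_sum ->].
have h0 : in_subring q J (0 : powser A).
  have -> : (0 : powser A) = ps_monom 0 0 by apply/funext => d; rewrite /ps_monom; case: ifP.
  exact: SrConst.
apply: (big_ind (in_subring q J)) => // [x y|i _]; first exact: SrAdd.
have mono m : in_subring q J (ps_monom 1 m).
  elim: m => [|m IH]; first exact: SrConst.
  have -> : ps_monom 1 m.+1 = ps_monom 1 1 * ps_monom 1 m :> powser A.
    apply/funext => -[|d]; rewrite ps_monomM //= mul1r subn1 /= /ps_monom eqSS //.
  by apply: SrMul => //; apply: SrVar.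
have -> : ps_monom (f i) i = ps_monom (f i) 0 * ps_monom 1 i.
  by apply/funext => d; rewrite ps_monomM subn0 /= /ps_monom; case: ifP; rewrite ?mulr1 ?mulr0.
by apply: SrMul => //; apply: SrConst.
Qed.

Variables (q : A) (p n : nat).
Hypotheses (p1 : (1 < p)%N) (pn : forall d, ~~ (p %| d)%N -> ~~ odd (d.-1 * n.-1)) (pe : ~~ odd (p * n.-1)).
Definition zexp d := ((d.-1 * n.-1)./2)%N.
Definition zper := ((p * n.-1)./2)%N.
Definition zseries : powser A := fun d => if (p %| d)%N then 0 else (q - 1) * q ^+ n.-1 * q ^+ zexp d.
Definition zgeom : powser A := fun d => if (p %| d)%N then q ^+ (zper * (d %/ p)) else 0.

Lemma zgeomP : (1 - ps_monom (q ^+ zper) p) * zgeom = 1.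
Proof.
have p0 : (0 < p)%N by apply: ltnW.
apply/funext => d; rewrite ps_factorM ps_oneE /zgeom; case: leqP => pd; last first.
  rewrite subr0; case: eqVneq => [->|d0]; first by rewrite dvdn0 div0n muln0 expr0.
  by rewrite gtnNdvd // lt0n.
rewrite -{1 2}(subnK pd) dvdn_addl // gtn_eqF ?(leq_trans p0) //.
case: ifP => _; last by rewrite mulr0 subrr.
by rewrite divnDr // divnn p0 addn1 mulnS exprD subrr.
Qed.

Definition zpoly := (1 - ps_monom (q ^+ zper) p) * zseries.

Lemma zexp_add d : ~~ (p %| d)%N -> zexp (d + p) = (zper + zexp d)%N.
Proof.
move=> pd; have d0 : (0 < d)%N by rewrite lt0n; apply: contraNneq pd => ->; rewrite dvdn0.
rewrite /zexp /zper -[(d + p).-1](_ : d.-1 + p = _)%N; last by case: d d0 {pd}.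
by rewrite mulnDl addnC halfD (negPf pe).
Qed.

Lemma zpolyE d : zpoly d = if (d < p)%N then zseries d else 0.
Proof.
rewrite /zpoly ps_factorM ltnNge; case: leqP => pd /=; last by rewrite subr0.
rewrite /zseries -{1 2}(subnK pd) dvdn_addl //; case: ifP => [_|/negbT h]; first by rewrite mulr0 subrr.
by rewrite zexp_add // exprD mulrCA mulrA -mulrA subrr.
Qed.

Lemma zpoly_poly : is_polynomial zpoly.
Proof. by exists p => d pd; rewrite zpolyE ltnNge pd. Qed.

Lemma zseriesE : zseries = zpoly * zgeom.
Proof. by rewrite /zpoly mulrAC zgeomP mul1r. Qed.
End Series.

(** * Change of coefficients *)

Section SeriesMap.
Variables (A B : comPzRingType) (f : {rmorphism A -> B}).
Definition psmap (s : powser A) : powser B := fun d => f (s d).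
Lemma psmapM s t : psmap (s * t) = psmap s * psmap t.
Proof.
apply/funext => d; rewrite /psmap ps_mulE rmorph_sum ps_mulE.
by apply: eq_bigr => i _; rewrite rmorphM.
Qed.
Lemma psmap_factor c b : psmap (1 - ps_monom c b) = 1 - ps_monom (f c) b.
Proof.
apply/funext => d; rewrite /psmap !ps_addE !ps_oppE !ps_oneE rmorphB rmorph_nat.
by rewrite /ps_monom; case: ifP; rewrite ?rmorph0.
Qed.
Lemma psmap1 : psmap 1 = 1.
Proof. by apply/funext => d; rewrite /psmap !ps_oneE rmorph_nat. Qed.
End SeriesMap.

Definition den (A : comPzRingType) (q : A) (M : seq (nat * nat)) : powser A :=
  \prod_(ab <- M) (1 - ps_monom (q ^+ ab.1) ab.2).

Lemma psmap_den (A B : comPzRingType) (f : {rmorphism A -> B}) q M :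
  psmap f (den q M) = den (f q) M.
Proof.
rewrite /den; elim: M => [|ab M IH]; first by rewrite !big_nil psmap1.
by rewrite !big_cons psmapM IH psmap_factor rmorphXn.
Qed.

Lemma psmap_zseries (A B : comPzRingType) (f : {rmorphism A -> B}) q p n :
  psmap f (zseries q p n) = zseries (f q) p n.
Proof.
apply/funext => d; rewrite /psmap /zseries; case: ifP => _; first exact: rmorph0.
by rewrite !rmorphM rmorphB rmorph1 !rmorphXn.
Qed.

Definition coef_series (R : comNzRingType) (r : {poly R}) : powser R := fun d => r`_d.
Lemma coef_seriesM (R : comNzRingType) (r s : {poly R}) :
  coef_series (r * s) = coef_series r * coef_series s.
Proof. by apply/funext => d; rewrite /coef_series coefM. Qed.
Lemma coef_series_factor (R : comNzRingType) (c : R) b :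
  coef_series (1 - c%:P * 'X^b) = 1 - ps_monom c b.
Proof.
apply/funext => d; rewrite /coef_series coefB coef1 coefCM coefXn ps_addE ps_oppE ps_oneE /ps_monom.
by case: (d == b); rewrite ?mulr1 ?mulr0.
Qed.
Lemma coef_series_inj (R : comNzRingType) : injective (@coef_series R).
Proof. by move=> r s e; apply/polyP => i; exact: (congr1 (fun h : powser R => h i) e). Qed.
Lemma coef_series_den (R : comNzRingType) (q : R) M :
  coef_series (\prod_(ab <- M) (1 - (q ^+ ab.1)%:P * 'X^(ab.2))) = den q M.
Proof.
rewrite /den; elim: M => [|ab M IH].
  by rewrite !big_nil; apply/funext => d; rewrite /coef_series coef1 ps_oneE.
by rewrite !big_cons coef_seriesM IH coef_series_factor.
Qed.
Lemma is_polynomial_coef (R : comNzRingType) (f : powser R) : is_polynomial f ->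
  exists r, f = coef_series r.
Proof.
move=> [N hN]; exists (\poly_(i < N) f i); apply/funext => d; rewrite /coef_series coef_poly.
by case: ltnP => // /hN.
Qed.

(** * The order of the pole *)

Section NotPole.
Variables (K0 : comPzRingType) (LL : K0) (p n : nat).
Hypothesis rel0 : forall N (c : 'I_N.+1 -> int), \sum_i (c i)%:~R * LL ^+ i = 0 -> forall i, c i = 0.
Hypotheses (p1 : (1 < p)%N) (pn : forall d, ~~ (p %| d)%N -> ~~ odd (d.-1 * n.-1)) (pe : ~~ odd (p * n.-1)).

(** Absence of relations is the injectivity of evaluation at [LL], which allows identities to be
    pulled back to integer polynomials. *)
Lemma generic_evaluation : exists f : {rmorphism {poly int} -> K0}, f 'X = LL /\
  forall r, f r = 0 -> r = 0.
Proof.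
pose KA : algebra int := @Algebra int K0 (intr : {rmorphism int -> K0}).
have [f fE] := @mp_eval int 1 KA (fun=> LL).
have fX : f ('X : {poly int}) = LL by rewrite -(fE ord0) /= unlift_none.
have fC c : f (c%:P : {poly int}) = c%:~R by exact: (hom_in f c).
exists f; split=> // r fr; apply/polyP => i; rewrite coef0.
case: (ltnP i (size r)) => [ir|]; last exact: nth_default.
have sz : (size r).-1.+1 = size r by rewrite prednK // (leq_ltn_trans (leq0n i)).
have h := @rel0 (size r).-1 (fun i => r`_i); rewrite sz in h.
apply: (h _ (Ordinal ir)).
transitivity (f (\sum_(i0 < size r) r`_i0 *: 'X^i0)); last by rewrite -poly_def coefK.
rewrite (rmorph_sum f); apply: eq_bigr => j _.
by rewrite -mul_polyC (rmorphM f) (rmorphXn f) fX fC.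
Qed.

(** With [q = 4] and [z = 2 ^ (1 - n)] a factor [1 - q ^ a z ^ b] vanishes exactly when
    [2 a = (n - 1) b], that is when [a / b] is the excluded value. A square is chosen for [q]
    because [q ^ ((n - 1) / 2)] has to be rational also for even [n]. *)
Lemma den_eval (M : seq (nat * nat)) :
  (forall ab, ab \in M -> (0 < ab.2)%N /\ ab.1%:R / ab.2%:R != n.-1%:R / 2%:R :> rat) ->
  (\prod_(ab <- M) (1 - ((4 : rat) ^+ ab.1)%:P * 'X^(ab.2))).[(2 ^+ n.-1)^-1] != 0.
Proof.
move=> hM; rewrite horner_prod; elim: M hM => [|[a b] M IH] hM; first by rewrite big_nil oner_neq0.
rewrite big_cons mulf_neq0 //; last by apply: IH => ab abM; apply: hM; rewrite inE abM orbT.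
have [/= b0] := hM (a, b) (mem_head _ _); apply: contraNneq.
rewrite !hornerE /= exprVn -exprM => /eqP; rewrite subr_eq0 => /eqP e.
have p20 : (2 : rat) ^+ (n.-1 * b) != 0 by rewrite expf_neq0.
have e1 : (2 : rat) ^+ (2 * a) = 2 ^+ (n.-1 * b).
  rewrite exprM (_ : 2 ^+ 2 = 4) //; apply: (divIf p20); by rewrite divff.
have e2 : (2 ^ (2 * a) = 2 ^ (n.-1 * b))%N.
  by apply/eqP; rewrite -(eqr_nat rat) !natrX e1.
have e3 : (2 * a = n.-1 * b)%N by apply/eqP; rewrite -(eqn_exp2l (m := 2)) // e2.
have b0' : b%:R != 0 :> rat by rewrite pnatr_eq0 -lt0n.
rewrite eqr_div ?pnatr_eq0 -?lt0n //; apply/eqP.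
by rewrite -!natrM mulnC e3.
Qed.

(** Multiplied by a product of factors away from the pole, the series would become a polynomial.
    This survives the lift to integer polynomials and the specialization at 4, and gives
    [rD * rZ = rG * rQ]: at [2 ^ (1 - n)] the factor [rQ] vanishes, while [rD] and [rZ] do not. *)
Lemma not_pole : ~ pole_order_le LL (zseries LL p n) (n.-1%:R / 2%:R) 0.
Proof.
move=> [m [P [u [mu [H Ze]]]]].
pose M := flatten [seq mu i | i <- enum 'I_m].
have MP ab : ab \in M -> (0 < ab.2)%N /\ ab.1%:R / ab.2%:R != n.-1%:R / 2%:R :> rat.
  move=> /flattenP[_ /mapP[i _ ->] abi]; have [_ [/allP h1 h2 _]] := H i.
  split; first exact: h1.
  move: h2; rewrite leqn0 -leqn0 leqNgt -has_count => /hasPn/(_ ab abi); exact.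
have denM (A : comPzRingType) (q : A) : den q M = \prod_i den q (mu i).
  by rewrite /den /M big_flatten big_map big_enum.
have denp (A : comPzRingType) (q : A) M' : is_polynomial (den q M').
  rewrite /den; apply: (big_ind (@is_polynomial A)) => [|x y|ab _]; first exact: is_polynomial1.
    exact: is_polynomial_mul.
  by apply: is_polynomial_add; [exact: is_polynomial1|apply/is_polynomial_opp/is_polynomial_monom].
have Wp : is_polynomial (den LL M * zseries LL p n).
  rewrite Ze mulr_sumr; apply: (big_ind (@is_polynomial K0)) => [|x y|i _].
  - by exists 0%N.
  - exact: is_polynomial_add.
  have [Pp [_ _ du]] := H i.
  have -> : den LL M * (P i * u i) = P i * \prod_(j | j != i) den LL (mu j).
    rewrite denM (bigD1 i) //=; rewrite /den in du *.
    set D1 := (X in X * _ * _ = _) in du *; set D2 := (X in D1 * X * _ = _).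
    transitivity (P i * D2 * (D1 * u i)); last by rewrite du mulr1.
    by rewrite mulrACA [D1 * P i]mulrC mulrACA.
  apply: is_polynomial_mul => //; apply: (big_ind (@is_polynomial K0)) => [|x y|j _].
  - exact: is_polynomial1.
  - exact: is_polynomial_mul.
  - exact: denp.
have [f [fX finj]] := generic_evaluation.
have Wt : is_polynomial (den 'X M * zseries 'X p n : powser {poly int}).
  have [N hN] := Wp; exists N => d /hN e; apply: finj.
  by rewrite -[LHS]/(psmap f _ d) psmapM psmap_den psmap_zseries fX.
pose sp : {rmorphism {poly int} -> rat} := horner_eval (4 : rat) \o map_poly intr.
have spX : sp 'X = 4 by rewrite /sp /= map_polyX /horner_eval hornerX.
have : is_polynomial (den (4 : rat) M * zseries 4 p n).
  have [N hN] := Wt; exists N => d /hN e.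
  by rewrite -spX -psmap_den -psmap_zseries -psmapM /psmap e rmorph0.
move=> /is_polynomial_coef[rG GE].
pose rD : {poly rat} := \prod_(ab <- M) (1 - ((4 : rat) ^+ ab.1)%:P * 'X^(ab.2)).
pose rQ : {poly rat} := 1 - ((4 : rat) ^+ zper p n)%:P * 'X^p.
pose rZ : {poly rat} := \poly_(d < p) zseries 4 p n d.
have ZE : coef_series rZ = zpoly 4 p n.
  by apply/funext => d; rewrite /coef_series coef_poly zpolyE.
have E : rD * rZ = rG * rQ.
  apply: coef_series_inj; rewrite !coef_seriesM ZE -GE coef_series_den coef_series_factor.
  by rewrite /zpoly mulrA mulrAC.
have := congr1 (fun r : {poly rat} => r.[(2 ^+ n.-1)^-1]) E.
rewrite !hornerM.
have -> : rQ.[(2 ^+ n.-1)^-1] = 0.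
  rewrite /rQ !hornerE /= exprVn -exprM (_ : (4 : rat) = 2 ^+ 2) // -exprM mul2n.
  rewrite /zper halfK (negPf pe) subn0 mulnC divff ?subrr // expf_neq0 //.
rewrite mulr0 => /eqP; rewrite mulf_eq0 (negPf (den_eval MP)) /= => /eqP Z0.
(* All coefficients are nonnegative, and that of [z] is positive since [p > 1]. *)
have : 0 < rZ.[(2 ^+ n.-1)^-1].
  rewrite horner_poly (bigD1 (Ordinal p1)) //=.
  have z0 : (0 : rat) < (2 ^+ n.-1)^-1 by rewrite invr_gt0 exprn_gt0.
  have zs d : 0 <= zseries (4 : rat) p n d.
    by rewrite /zseries; case: ifP => // _; rewrite !mulr_ge0 ?exprn_ge0.
  apply: ltr_wpDr; first by apply: sumr_ge0 => i _; rewrite mulr_ge0 // exprn_ge0 // ltW.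
  rewrite mulr_gt0 ?exprn_gt0 // /zseries ifF; first by rewrite !mulr_gt0 ?exprn_gt0.
  by rewrite dvdn1 gtn_eqF.
by rewrite Z0 ltxx.
Qed.
End NotPole.

(** * Tame extensions and the proof of the theorem *)

Section Extensions.
Variables (K : fieldType) (v : valuation K) (k : closedFieldType) (red : {rmorphism integers v -> k}).
Hypotheses (redP : residue_map red) (Kc : complete_field v).

Lemma totally_ramified (L : fieldExtType K) : exists w : valuation L,
  (forall c, c != 0 -> w c%:A = (\dim {:L})%:Z * v c) /\
  forall x, exists c, x = @comb _ L w (\dim {:L}) c.
Proof.
have [w [e [e0 we]]] := valuation_extends v L.
have [e' eE] : exists e' : nat, e = e'%:Z by exists (absz e); lia.
rewrite eE in e0 we; have e0' : (0 < e')%N by [].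
have res := residue_full e0' we redP.
by rewrite -(ramification_dim e0' we res Kc); exists w; split; last exact: (comb_surj e0' we res Kc).
Qed.

Variable E : val_ext red.
Local Notation vE := (ve_val E).

(** [ve_inc] sends integers to integers and units to units, so the valuation of [E] restricts to a
    multiple of that of [K]; the factor is the value of the uniformizer, positive because its
    reduction is 0. *)
Lemma ext_index : exists2 e : nat, (0 < e)%N & forall c, c != 0 -> vE c%:A = e%:Z * v c.
Proof.
pose ph c : E := c%:A.
have ph0 c : c != 0 -> ph c != 0 by move=> c0; rewrite /ph scaler_eq0 negb_or c0 oner_eq0.
have phM c c' : ph (c * c') = ph c * ph c' by exact: (rmorphM (GRing.in_alg E)).
have int0 c : vge v 0 c -> vge vE 0 (ph c).
  by move=> hc; rewrite /ph -[c]/(int_val (mkint hc)) -ve_incE; apply: int_valP.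
have unit0 c : c != 0 -> v c = 0 -> vE (ph c) = 0.
  move=> c0 vc; have i0 : c^-1 != 0 by rewrite invr_eq0.
  have h1 : 0 <= vE (ph c) by have := int0 c; rewrite /vge vc lexx orbT (negPf (ph0 c c0)); apply.
  have h2 : 0 <= vE (ph c^-1).
    by have := int0 c^-1; rewrite /vge vmapV // vc oppr0 lexx orbT (negPf (ph0 _ i0)); apply.
  have : vE (ph 1) = 0 by rewrite /ph scale1r vmap1.
  by rewrite -(divff c0) phM vmapM ?ph0 //; lia.
have e1 : 1 <= vE (ph (unif v)).
  have [_ h] := ve_redP E.
  have : vge vE 1 (int_val (ve_inc E (opi v))).
    by apply/h; rewrite ve_red_inc; apply/redP.2; rewrite opi_val /vge unifE lexx orbT.
  by rewrite ve_incE opi_val /vge (negPf (ph0 _ (unif_neq0 v))).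
exists (absz (vE (ph (unif v)))); first by rewrite absz_gt0 gt_eqF // (lt_le_trans _ e1).
move=> c c0; rewrite gez0_abs; last exact: le_trans e1.
have u0 : c / unif v ^ v c != 0 by rewrite mulf_neq0 // invr_eq0 unifXz_neq0.
have vu : v (c / unif v ^ v c) = 0.
  by rewrite vmapM ?invr_eq0 ?unifXz_neq0 // vmapV ?unifXz_neq0 // unifXz subrr.
rewrite -[c in LHS](divfK (unifXz_neq0 v (v c))) -[LHS]/(vE (ph _)) phM vmapM ?ph0 ?unifXz_neq0 //.
rewrite (unit0 _ u0 vu) add0r.
have -> : ph (unif v ^ v c) = ph (unif v) ^ v c by exact: (fmorphXz (GRing.in_alg E)).
by rewrite vmapXz ?ph0 ?unif_neq0 // -mulrzr intz.
Qed.

Lemma ext_residue a : vge vE 0 a -> exists2 c, vge v 0 c & vge vE 1 (a - c%:A).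
Proof.
move=> ha; have [x xE] := redP.1 (ve_red E (mkint ha)); exists (int_val x); first exact: int_valP.
have [_ h] := ve_redP E; rewrite -ve_incE.
have hx : vge vE 1 (int_val (mkint ha - ve_inc E x)).
  by apply/h; rewrite rmorphB ve_red_inc xE subrr.
exact: hx.
Qed.

Lemma ext_dim c : c != 0 -> vE (GRing.in_alg E c) = (\dim {:E})%:Z * v c.
Proof.
by have [e e0 Ee] := ext_index; rewrite -(ramification_dim e0 Ee ext_residue Kc); apply: Ee.
Qed.

Lemma ext_complete_field : complete_field vE.
Proof. by have [e e0 Ee] := ext_index; apply: (ext_complete e0 Ee ext_residue Kc). Qed.

Lemma res_Gm_tame (p : nat) (p_char : p \in [pchar k]) (L : fieldExtType K) (n0 : (0 < \dim {:L})%N)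
    (d0 : (0 < \dim {:E})%N) (nd : coprime (\dim {:L}) (\dim {:E}))
    (N : neron_lft v (res_Gm L)) (NE : neron_lft vE (gbase_change (GRing.in_alg E) (res_Gm L)))
    (h : bc_morphism N NE) (g : 'I_(\dim {:L}) -> nat) (hg : coker_exponents h g)
    (Q : subfunctor NE) (QP : max_qc_subgroup Q)
    (K0 : comPzRingType) (cl : presheaf k -> K0) (clP : grothendieck_ring cl) :
  (forall i, g i = ((\dim {:E} * i) %/ \dim {:L})%N) /\
  cl (base_change (ve_red E) (sub_presheaf Q)) =
    (cl (affine_line k) - 1) * cl (affine_line k) ^+ (\dim {:L}).-1.
Proof.
have [w [we combS]] := totally_ramified L.
pose i0 := Ordinal n0; have i00 : i0 = 0%N :> nat by [].
have am1 (j : 'I_(\dim {:L})) : 1%:Z * j%:Z + (\dim {:L})%:Z * 0 = j%:Z by rewrite mulr0 addr0 mul1r.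
have vphi1 c : c != 0 -> v (idfun c) = 1%:Z * v c by rewrite mul1r.
have [a [m am]] := exponents_exist n0 nd d0.
have [al1 [al1E al1M al1I al1L]] := weil_neron_base n0 we combS i00 p_char am1 vphi1 redP Kc N.
have [al [alE alM alI alL alQ]] :=
  weil_neron n0 we combS i00 p_char ext_dim nd am (ve_redP E) ext_complete_field NE.
split; first exact: (coker_floor al1E alE al1M al1I al1L alM alI alL hg).
have [_ [f fB]] := alQ Q QP.
have [f' f'B] := special_fibre (lat_law n0 we combS ext_dim nd am i00) i00
  (fun i j l => @lat_special _ _ _ _ n0 we combS _ _ _ _ ext_dim _ _ am _ (ve_red E) i j l (ve_redP E)).
apply: (cl_Gm_asp clP (f := mor_comp (mor_base_change (ve_red E) f) f')) => A.
by apply: (bij_comp (f'B A)); apply: fB.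
Qed.
End Extensions.

(** The fractions [d a / n] and [d (n - a) / n] sum to [d] and are not integers, [n] being prime to
    [d]. *)
Lemma floor_pair (d n a : nat) : coprime n d -> (0 < a < n)%N ->
  ((d * a) %/ n + (d * (n - a)) %/ n = d.-1)%N.
Proof.
move=> nd /andP[a0 an]; have n0 : (0 < n)%N by apply: leq_trans an.
have s0 : (0 < (d * a) %% n)%N.
  rewrite lt0n; apply/negP; rewrite -/(n %| d * a)%N (Gauss_dvdr _ nd) => /(dvdn_leq a0).
  by rewrite leqNgt an.
have sn : ((d * a) %% n < n)%N by rewrite ltn_mod.
have E := divn_eq (d * a) n; move: ((d * a) %/ n)%N ((d * a) %% n)%N s0 sn E => q s s0 sn E.
have qd : (q < d)%N.
  rewrite -(ltn_pmul2r n0) -(ltn_add2r s) -E; apply: (@leq_ltn_trans (d * n)); first by rewrite leq_mul2l ltnW ?orbT.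
  by rewrite -addn1 leq_add2l.
have -> : (d * (n - a) = (d.-1 - q) * n + (n - s))%N.
  rewrite mulnBr E -(subnKC qd) /= addSn /=; move: (d - q.+1)%N => u.
  by rewrite addKn -addSn mulnDl mulSn; lia.
by rewrite divnMDl // divn_small ?addn0; lia.
Qed.

(** The terms of index [i] and [n - i] are paired, which doubles the sum. *)
Lemma floor_sum (d n : nat) : coprime n d -> (0 < n)%N ->
  ((\sum_(i < n) (d * i) %/ n).*2 = d.-1 * n.-1)%N.
Proof.
case: n => // n nd _; rewrite big_ord_recl muln0 div0n add0n -addnn.
rewrite [X in (_ + X)%N](reindex_inj rev_ord_inj) -big_split /= (eq_bigr (fun=> d.-1)).
  by rewrite sum_nat_const card_ord mulnC.
move=> i _; rewrite -(@floor_pair d n.+1 i.+1) ?ltnS ?ltn_ord //.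
by rewrite /bump !add1n subSS -subSn.
Qed.

Lemma ahom_dim_leq (K : fieldType) (E F : fieldExtType K) : 'AHom(E, F) -> (\dim {:E} <= \dim {:F})%N.
Proof.
move=> f; rewrite -(limg_dim_eq (f := f) (U := fullv)); first exact: dimvS (subvf _).
by rewrite (eqP (AHom_lker0 f)) capv0.
Qed.

Lemma tower_unbounded (K : fieldType) (v : valuation K) (k : fieldType)
    (red : {rmorphism integers v -> k}) (p : nat) (Kd : nat -> val_ext red) (dn : nat -> nat) :
  (1 < p)%N -> (forall d, ~~ (p %| d)%N -> \dim {:Kd d} = d) -> cofinal_tower p Kd dn ->
  forall B, exists N, forall m, (N <= m)%N -> (B < dn m)%N.
Proof.
move=> p1 KdP [dnp step cof] B.
have mono m : (dn m <= dn m.+1)%N.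
  by have [f] := step m; have := ahom_dim_leq f; rewrite !KdP.
(* Cofinality is tested against the tame extension of degree [B p + 1], prime to [p] and larger than
   [B]. *)
have pB : ~~ (p %| (B * p).+1)%N by rewrite -addn1 dvdn_addr ?dvdn_mull // dvdn1 gtn_eqF.
have [|N [f]] := cof (Kd (B * p).+1); first by rewrite KdP.
have := ahom_dim_leq f; rewrite !KdP // => BN; exists N => m /subnKC <-.
have B1 : (B < (B * p).+1)%N by rewrite ltnS leq_pmulr // ltnW.
elim: (m - N)%N => [|i IH]; first by rewrite addn0; apply: leq_trans BN.
by rewrite addnS (leq_trans IH).
Qed.

Lemma zper_ratio (F : numFieldType) (p n : nat) : (0 < p)%N -> ~~ odd (p * n.-1) ->
  (zper p n)%:R / p%:R = n.-1%:R / 2%:R :> F.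
Proof.
move=> p0 pe; apply/eqP; rewrite eqr_div ?pnatr_eq0 -?lt0n // -!natrM eqr_nat /zper muln2.
by rewrite halfK (negPf pe) subn0 mulnC.
Qed.

(** A single term with the single pair [(zper, p)], of ratio [(n - 1) / 2]: it counts once at that
    value and not at all elsewhere. This bounds the order at the pole and excludes all other
    poles. *)
Lemma zseries_pole_order_le (A : comPzRingType) (q : A) (p n : nat) (s : rat) (m : nat) :
  (1 < p)%N -> ~~ odd (p * n.-1) -> ((n.-1%:R / 2%:R == s) <= m)%N ->
  pole_order_le q (zseries q p n) s m.
Proof.
move=> p1 pe sm; have p0 := ltnW p1.
exists 1%N, (fun=> zpoly q p n), (fun=> zgeom q p n), (fun=> [:: (zper p n, p)]).
split=> [i|]; last by rewrite big_ord_recl big_ord0 addr0 zseriesE.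
split; first exact: zpoly_poly.
by split; rewrite /= ?p0 ?addn0 ?zper_ratio ?big_seq1 ?zgeomP.
Qed.

Theorem theorem2p11 (R : realType) (p : nat)
  (k : closedFieldType) (p_char : p \in [pchar k])
  (K : fieldType) (v : valuation K)
  (K_complete : complete_field v) (OK_henselian : henselian v)
  (red : {rmorphism integers v -> k}) (redP : residue_map red)
  (L : fieldExtType K) (L_sep : separable 1 {:L})
  (r : nat) (L_wild : \dim {:L} = (p ^ r)%N)
  (Kd : nat -> val_ext red)
  (KdP : forall d, ~~ (p %| d)%N -> \dim {:Kd d} = d)
  (dn : nat -> nat) (dnP : cofinal_tower p Kd dn)
  (N : neron_lft v (res_Gm L))
  (Nd : forall d, neron_lft (ve_val (Kd d))
     (gbase_change (GRing.in_alg (Kd d) : {rmorphism K -> Kd d}) (res_Gm L)))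
  (psi : forall d, bc_morphism N (Nd d))
  (j : nat -> 'I_(\dim {:L}) -> nat)
  (jP : forall d, ~~ (p %| d)%N -> coker_exponents (psi d) (j d))
  (Q : forall d, subfunctor (Nd d))
  (QP : forall d, ~~ (p %| d)%N -> max_qc_subgroup (Q d))
  (K0 : comPzRingType) (cl : presheaf k -> K0) (clP : grothendieck_ring cl) :
  let LL := cl (affine_line k) in
  let Z := motivic_zeta p j Q cl in
  let c : R := c_tame R j dn in
  [/\ ps_rational Z,
      in_subring LL (fun a b => (0 < b)%N /\ a%:R / b%:R = c) Z &
      exists s0 : rat, [/\ ratr s0 = c, pole_order LL Z s0 1 &
        forall s : rat, is_pole LL Z s -> s = s0]].
Proof.
move=> LL Z c.
have pp := pcharf_prime p_char; have p1 := prime_gt1 pp.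
have n0 : (0 < \dim {:L})%N by rewrite L_wild expn_gt0 prime_gt0.
have nd d : ~~ (p %| d)%N -> coprime (\dim {:L}) d.
  by move=> pd; rewrite L_wild; apply/coprimeXl; rewrite prime_coprime.
have tame d : ~~ (p %| d)%N -> (forall i, j d i = ((d * i) %/ \dim {:L})%N) /\
    cl (base_change (ve_red (Kd d)) (sub_presheaf (Q d))) = (LL - 1) * LL ^+ (\dim {:L}).-1.
  move=> pd; have dE := KdP d pd.
  have d0 : (0 < d)%N by rewrite lt0n; apply: contraNneq pd => ->.
  have [||jE clE] := res_Gm_tame redP K_complete p_char n0 _ _ (jP d pd) (QP d pd) clP.
  - by rewrite dE.
  - by rewrite dE; apply: nd.
  by split=> // i; rewrite jE dE.
have pn d : ~~ (p %| d)%N -> ~~ odd (d.-1 * (\dim {:L}).-1).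
  by move=> pd; rewrite -(floor_sum (nd d pd) n0) odd_double.
(* If [p] is odd, so is its power [\dim {:L}]. *)
have pe : ~~ odd (p * (\dim {:L}).-1).
  rewrite oddM negb_and -implybE; apply/implyP => po.
  have : odd (\dim {:L}) by rewrite L_wild oddX po orbT.
  by rewrite -{1}(prednK n0) oddS.
have ZE : Z = zseries LL p (\dim {:L}).
  apply/funext => d; rewrite /Z /motivic_zeta /zseries; case: ifP => // /negbT pd.
  have [jE ->] := tame d pd; congr (_ * _ ^+ _).
  by rewrite /ord_of /zexp -(floor_sum (nd d pd) n0) doubleK; apply: eq_bigr => i _; rewrite jE.
have cE : c = (\dim {:L}).-1%:R / 2%:R.
  rewrite /c /c_tame -(sum_fraction R n0); apply: eq_bigr => i _.
  rewrite -(@floor_jump_cvg R dn _ i n0 (tower_unbounded p1 KdP dnP)) /jump; congr (limn _).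
  have [dnp _ _] := dnP.
  by apply/funext => m; rewrite (tame (dn m) (dnp m)).1.
have p0 := ltnW p1; split.
- exists (zpoly LL p (\dim {:L})), (1 - ps_monom (LL ^+ zper p (\dim {:L})) p), (zgeom LL p (\dim {:L})).
  split; [exact: zpoly_poly | | exact: zgeomP | by rewrite ZE zseriesE].
  apply: is_polynomial_add; first exact: is_polynomial1.
  exact/is_polynomial_opp/is_polynomial_monom.
- rewrite ZE zseriesE //; apply: SrMul; first exact/in_subring_polynomial/zpoly_poly.
  by apply: (SrGeom (a := zper p (\dim {:L})) (b := p)); [rewrite cE zper_ratio | apply: zgeomP].
exists ((\dim {:L}).-1%:R / 2%:R); split.
- by rewrite cE fmorph_div !rmorph_nat.
- split=> //; first by rewrite ZE; apply: zseries_pole_order_le => //; case: (_ == _).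
  by rewrite ZE /=; apply: not_pole => // M cM; apply: (line_relation p_char clP).
move=> s sP; apply/eqP; rewrite eq_sym; apply/negPn/negP => ns; apply: sP.
by rewrite ZE; apply: zseries_pole_order_le => //; rewrite (negPf ns).
Qed.
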